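(* Let $X$ be a compact connected nonpositively curved $\mathcal{VH}$-complex. Then the fundamental group $\pi_1(X)$ is systolic.
   Context: Square complexes: a (generalised) square complex is obtained from a set of vertices, edges and squares by gluing along affine embeddings of cells onto faces of cells (closed under composition), with precisely one attaching map onto each proper face of each cell; cells need not be embedded (e.g. an edge may be a loop, or two sides of a square may be glued together). The link at a vertex $v$ is the graph with one vertex for each end of an edge at $v$ (each attaching map of $v$ to an edge) and one edge for each corner of a square at $v$ (each attaching map of $v$ to a square), joining the two edge-ends forming that corner. A square complex is a $\mathcal{VH}$-complex if its edges are partitioned into two classes, vertical and horizontal, such that going around the boundary of each square the sides alternate between vertical and horizontal. A square complex is nonpositively curved if the link at every vertex contains no embedded combinatorial cycle of length less than $4$ (for a $\mathcal{VH}$-complex: no double edges in vertex links). Simplicial complexes: a generalised simplicial complex (called ''simplicial complex'' here) is a set of affine simplices together with a set, closed under composition, of affine embeddings (attaching maps) of simplices onto faces of simplices, such that for each proper face of each simplex there is precisely one attaching map onto it; the geometric realisation is the quotient (simplices need not be embedded). The link of a simplex $\sigma$ has one simplex for each attaching map of $\sigma$ onto a proper face of a simplex $\tau$, namely the face of $\tau$ spanned by the vertices not in the image of $\sigma$, with the restricted attaching maps. A simplicial complex is simple if it has no edge joining a vertex to itself and no two distinct simplices of positive dimension with the same boundary. A simple complex is flag if every finite clique of its $1$-skeleton spans a simplex. A cycle without diagonals is an embedded simplicial loop such that no edge of the complex connects two nonconsecutive vertices of it. A simplicial complex is locally $6$-large if all its vertex links are (simple and) flag and contain no cycles of length $4$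 or $5$ without diagonals. A systolic complex is a (nonempty) connected, simply connected locally $6$-large simplicial complex. A group is systolic if it acts geometrically (properly and cocompactly, by simplicial automorphisms) on a systolic complex. *)

(* Defs.v *)
From HB Require Import structures.
From Stdlib Require Import Relations.
From mathcomp Require Import all_boot all_order all_algebra generic_quotient.
From mathcomp Require Import all_classical all_reals topology normedtype homotopy.
From mathcomp Require Import lra.

Set Implicit Arguments.
Unset Strict Implicit.
Unset Printing Implicit Defensive.

Import Order.TTheory GRing.Theory Num.Theory numFieldNormedType.Exports.
Local Open Scope classical_set_scope.
Local Open Scope ring_scope.
Local Open Scope quotient_scope.

Definition unit_interval (R : realType) : Type :=
  set_type (`[0, 1]%classic : set R).

Section UnitInterval.
Variable R : realType.
Local Notation I := (unit_interval R).

HB.instance Definition _ :=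
  Topological.copy I (set_type (`[0, 1]%classic : set R)).

Lemma clamp_subproof (r : R) :
  Num.max 0 (Num.min 1 r) \in (`[0, 1]%classic : set R).
Proof. by rewrite inE /= in_itv /= le_max lexx ge_max ler01 ge_min lexx. Qed.

Definition clamp (r : R) : I :=
  exist (fun x => x \in (`[0, 1]%classic : set R)) _ (clamp_subproof r).

Arguments clamp : simpl never.

Lemma clamp_neq : clamp 0 != clamp 1.
Proof.
apply/eqP => /(congr1 val); rewrite /clamp /= minxx.
rewrite (max_r (@ler01 R)) (min_r (@ler01 R)) maxxx => /esym/eqP.
by rewrite oner_eq0.
Qed.

HB.instance Definition _ := isBiPointed.Build I clamp_neq.

Lemma unit_intervalP (t : I) : 0 <= val t <= 1.
Proof. by case: t => t /=; rewrite inE /= in_itv. Qed.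

Lemma val_clamp (r : R) : 0 <= r <= 1 -> val (clamp r) = r.
Proof. by move=> /andP[r0 r1]; rewrite /clamp /= (min_r r1) (max_r r0). Qed.

Lemma clampK (t : I) : clamp (val t) = t.
Proof. by apply: val_inj; rewrite val_clamp ?unit_intervalP. Qed.

Lemma val_zero : val (zero : I) = 0.
Proof. by rewrite val_clamp // lexx ler01. Qed.

Lemma val_one : val (one : I) = 1.
Proof. by rewrite val_clamp // lexx ler01. Qed.

Lemma clamp0 (r : R) : r <= 0 -> clamp r = zero.
Proof.
move=> r0; apply: val_inj; rewrite val_zero /clamp /=.
by rewrite (min_r (le_trans r0 ler01)) (max_l r0).
Qed.

Lemma clamp1 (r : R) : 1 <= r -> clamp r = one.
Proof.
by move=> r1; apply: val_inj; rewrite val_one /clamp /= (min_l r1) (max_r ler01).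
Qed.

Lemma val_continuous : continuous (val : I -> R).
Proof. exact: (@initial_continuous _ _ (val : I -> R)). Qed.

Lemma clamp_continuous : continuous clamp.
Proof.
apply: (@continuous_comp_initial _ _ _ (val : I -> R)) => r.
have h : {for r, continuous (Num.min 1 : R^o -> R^o)}.
  apply: (@continuous_min R R (cst 1) id r); [exact: cvg_cst|exact: cvg_id].
by apply: (@continuous_max R R (cst 0) (Num.min 1) r) => //; exact: cvg_cst.
Qed.

Lemma continuous_compose (S T U : topologicalType) (f : S -> T) (g : T -> U) :
  continuous f -> continuous g -> continuous (fun x => g (f x)).
Proof. by move=> cf cg x; apply: (continuous_comp (cf x)); exact: cg. Qed.

Lemma continuous_pair (S T U : topologicalType) (f : S -> T) (g : S -> U) :
  continuous f -> continuous g -> continuous (fun x => (f x, g x)).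
Proof. by move=> cf cg x; apply: cvg_pair; [exact: cf|exact: cg]. Qed.

Lemma fst_continuous (S T : topologicalType) : continuous (@fst S T).
Proof. by move=> x; exact: cvg_fst. Qed.

Lemma snd_continuous (S T : topologicalType) : continuous (@snd S T).
Proof. by move=> x; exact: cvg_snd. Qed.

Lemma affine_continuous (S : topologicalType) (u : S -> I) (a b : R) :
  continuous u -> continuous (fun p => a * val (u p) + b).
Proof.
move=> cu p; apply: cvgD; last exact: cvg_cst.
apply: cvgM; first exact: cvg_cst.
exact: (continuous_compose cu val_continuous).
Qed.

Lemma clamp_affine_continuous (S : topologicalType) (u : S -> I) (a b : R) :
  continuous u -> continuous (fun p => clamp (a * val (u p) + b)).
Proof.
by move=> cu; apply: (continuous_compose _ clamp_continuous); exact: affine_continuous.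
Qed.

Lemma continuous_glue (S T : topologicalType) (u : S -> R) (c : R)
    (f g : S -> T) :
  continuous u -> continuous f -> continuous g ->
  (forall x, u x = c -> f x = g x) ->
  continuous (fun x => if u x <= c then f x else g x).
Proof.
move=> cu cf cg fg.
pose A := u @^-1` [set r | r <= c]; pose B := u @^-1` [set r | c <= r].
have AB : A `|` B = setT.
  by apply/seteqP; split=> x _ //; case: (leP (u x) c) => [?|/ltW ?]; [left|right].
suff: {within A `|` B, continuous (fun x => if u x <= c then f x else g x)}.
  by rewrite AB => ?; apply/continuous_subspace_setT.
apply: withinU_continuous.
- by apply: closed_comp => [x _|]; [exact: cu|exact: closed_le].
- by apply: closed_comp => [x _|]; [exact: cu|exact: closed_ge].
- apply: (@subspace_eq_continuous _ _ _ f).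
    by move=> x; rewrite inE /A /= => uxc /=; rewrite /from_subspace /= uxc.
  exact: continuous_subspaceT.
- apply: (@subspace_eq_continuous _ _ _ g).
    move=> x; rewrite inE /B /= => ucx; rewrite /from_subspace /=; case: ifP => // uxc.
    by rewrite fg //; apply/eqP; rewrite eq_le uxc.
  exact: continuous_subspaceT.
Qed.

End UnitInterval.

Local Ltac pairE := cbn beta iota delta [fst snd].

Section PathHomotopy.
Variables (R : realType) (T : topologicalType).
Local Notation I := (unit_interval R).
Local Notation path := (fun x y : T => {path I from x to y}).
Implicit Types x y z w : T.

(* Homotopy relative to the endpoints; the first coordinate of [I * I] is the
   homotopy parameter. *)
Definition path_homotopic x y (f g : path x y) : Prop :=
  exists H : I * I -> T,
    [/\ continuous H,
        forall t, H (zero, t) = f t,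
        forall t, H (one, t) = g t &
        forall s, H (s, zero) = x /\ H (s, one) = y].

Lemma path_homotopic_refl x y (f : path x y) : path_homotopic f f.
Proof.
exists (f \o snd); split=> // [|s]; last by rewrite /= path_zero path_one.
by apply: (continuous_compose (@snd_continuous _ _)); exact: cts_fun.
Qed.

Lemma path_homotopic_sym x y (f g : path x y) :
  path_homotopic f g -> path_homotopic g f.
Proof.
move=> [H [cH H0 H1 He]].
pose K (p : I * I) := H (clamp (- 1 * val p.1 + 1), p.2).
exists K; split=> [|t|t|s]; rewrite ?/K; pairE; last exact: He.
- apply: (continuous_compose _ cH); apply: continuous_pair.
    by apply: clamp_affine_continuous; exact: fst_continuous.
  exact: snd_continuous.
- by rewrite val_zero clamp1 //; lra.
- by rewrite val_one clamp0 //; lra.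
Qed.

Lemma path_homotopic_trans x y (f g h : path x y) :
  path_homotopic f g -> path_homotopic g h -> path_homotopic f h.
Proof.
move=> [H [cH H0 H1 He]] [K [cK K0 K1 Ke]].
have cl (a b : R) : continuous (fun p : I * I => (clamp (a * val p.1 + b), p.2)).
  apply: continuous_pair; last exact: snd_continuous.
  by apply: clamp_affine_continuous; exact: fst_continuous.
exists (fun p => if val p.1 <= 2^-1 then H (clamp (2 * val p.1 + 0), p.2)
                 else K (clamp (2 * val p.1 + -1), p.2)); split=> [|t|t|s].
- apply: (@continuous_glue R _ _ (fun p : I * I => val p.1) 2^-1) => [|||p /= ->].
  + exact: (continuous_compose (@fst_continuous _ _) (@val_continuous R)).
  + exact: (continuous_compose (cl _ _) cH).
  + exact: (continuous_compose (cl _ _) cK).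
  + by rewrite clamp1 ?H1 ?clamp0 ?K0 //; lra.
- by pairE; rewrite val_zero ifT ?clamp0 //; lra.
- by pairE; rewrite val_one ifF ?clamp1 //; lra.
- by case: ifP => _; [exact: He|exact: Ke].
Qed.

Lemma clamp_path_continuous x y (f : path x y) (S : topologicalType)
  (u : S -> R) : continuous u -> continuous (fun p => f (clamp (u p))).
Proof.
move=> cu; apply: (@continuous_compose _ _ _ (fun p => clamp (u p)) f).
  exact: (continuous_compose cu (@clamp_continuous R)).
exact: cts_fun.
Qed.

Lemma path_homotopic_reparam x y z w (F : path z w) (f g : path x y)
    (u v : I -> R) : continuous u -> continuous v ->
    u zero = v zero -> u one = v one ->
    (forall t, f t = F (clamp (u t))) -> (forall t, g t = F (clamp (v t))) ->
  path_homotopic f g.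
Proof.
move=> cu cv uv0 uv1 fE gE.
exists (fun p => F (clamp ((1 - val p.1) * u p.2 + val p.1 * v p.2))).
have cp1 : continuous (fun p : I * I => val p.1 : R).
  exact: (continuous_compose (@fst_continuous _ _) (@val_continuous R)).
split=> [|t|t|s].
- have cu2 := continuous_compose (@snd_continuous I I) cu.
  have cv2 := continuous_compose (@snd_continuous I I) cv.
  apply: clamp_path_continuous => p; apply: cvgD.
    apply: cvgM; last exact: cu2.
    by apply: cvgB; [exact: cvg_cst|exact: cp1].
  by apply: cvgM; [exact: cp1|exact: cv2].
- by pairE; rewrite val_zero fE subr0 mul1r mul0r addr0.
- by pairE; rewrite val_one gE subrr mul0r mul1r add0r.
- rewrite /= -uv0 -uv1 -!mulrDl subrK !mul1r -!fE.
  by rewrite path_zero path_one.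
Qed.

Definition path_concat_fun x y z (f : path x y) (g : path y z) (t : I) : T :=
  if val t <= 2^-1 then f (clamp (2 * val t)) else g (clamp (2 * val t - 1)).

Lemma unit_affine_continuous (a b : R) :
  continuous (fun t : I => a * val t + b).
Proof. by apply: affine_continuous => t. Qed.

Lemma scale_continuous (a : R) : continuous (fun t : I => a * val t).
Proof.
exact: (continuous_compose (@val_continuous R) (@mulrl_continuous R a)).
Qed.

Lemma path_concat_continuous x y z (f : path x y) (g : path y z) :
  continuous (path_concat_fun f g).
Proof.
apply: (@continuous_glue R I T (fun t => val t) 2^-1
  (fun t => f (clamp (2 * val t))) (fun t => g (clamp (2 * val t - 1))))
  => [||| t ->].
- exact: (@val_continuous R).
- by apply: clamp_path_continuous; exact: scale_continuous.
- by apply: clamp_path_continuous; exact: unit_affine_continuous.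
- by rewrite clamp1 ?path_one ?clamp0 ?path_zero //; lra.
Qed.

Lemma path_concat_zero x y z (f : path x y) (g : path y z) :
  path_concat_fun f g zero = x.
Proof.
by rewrite /path_concat_fun val_zero ifT ?clamp0 ?path_zero //; lra.
Qed.

Lemma path_concat_one x y z (f : path x y) (g : path y z) :
  path_concat_fun f g one = z.
Proof.
by rewrite /path_concat_fun val_one ifF ?clamp1 ?path_one //; lra.
Qed.

Definition path_concat x y z (f : path x y) (g : path y z) : path x z :=
  mk_path (@path_concat_continuous x y z f g) (path_concat_zero f g)
          (path_concat_one f g).

Lemma path_concatE x y z (f : path x y) (g : path y z) (t : I) :
  path_concat f g t = if val t <= 2^-1
    then f (clamp (2 * val t)) else g (clamp (2 * val t - 1)).
Proof. by []. Qed.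

Definition path_rev_fun x y (f : path x y) (t : I) : T :=
  f (clamp (-1 * val t + 1)).

Lemma path_rev_continuous x y (f : path x y) : continuous (path_rev_fun f).
Proof. by apply: clamp_path_continuous; exact: unit_affine_continuous. Qed.

Lemma path_rev_zero x y (f : path x y) : path_rev_fun f zero = y.
Proof. by rewrite /path_rev_fun val_zero clamp1 ?path_one //; lra. Qed.

Lemma path_rev_one x y (f : path x y) : path_rev_fun f one = x.
Proof. by rewrite /path_rev_fun val_one clamp0 ?path_zero //; lra. Qed.

Definition path_rev x y (f : path x y) : path y x :=
  mk_path (@path_rev_continuous x y f) (path_rev_zero f) (path_rev_one f).

Lemma path_revE x y (f : path x y) (t : I) :
  path_rev f t = f (clamp (-1 * val t + 1)).
Proof. by []. Qed.

Definition path_cst x : path x x := cst x.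

Lemma path_concat_homotopic x y z (f f' : path x y) (g g' : path y z) :
  path_homotopic f f' -> path_homotopic g g' ->
  path_homotopic (path_concat f g) (path_concat f' g').
Proof.
move=> [H [cH H0 H1 He]] [K [cK K0 K1 Ke]].
have cl (a b : R) : continuous (fun p : I * I => (p.1, clamp (a * val p.2 + b))).
  apply: continuous_pair; first exact: fst_continuous.
  by apply: clamp_affine_continuous; exact: snd_continuous.
exists (fun p => if val p.2 <= 2^-1 then H (p.1, clamp (2 * val p.2 + 0))
                 else K (p.1, clamp (2 * val p.2 + -1))); split=> [|t|t|s].
- apply: (@continuous_glue R _ _ (fun p : I * I => val p.2) 2^-1) => [|||p /= ->].
  + exact: (continuous_compose (@snd_continuous _ _) (@val_continuous R)).
  + exact: (continuous_compose (cl _ _) cH).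
  + exact: (continuous_compose (cl _ _) cK).
  + by rewrite clamp1 ?(He _).2 ?clamp0 ?(Ke _).1 //; lra.
- by rewrite /= H0 K0 addr0.
- by rewrite /= H1 K1 addr0.
- pairE; rewrite val_zero val_one ifT; last lra.
  rewrite ifF; last lra.
  by rewrite clamp0 ?(He _).1 ?clamp1 ?(Ke _).2 //; lra.
Qed.

Lemma path_rev_homotopic x y (f g : path x y) :
  path_homotopic f g -> path_homotopic (path_rev f) (path_rev g).
Proof.
move=> [H [cH H0 H1 He]].
exists (fun p => H (p.1, clamp (-1 * val p.2 + 1))); split=> [|t|t|s].
- apply: (continuous_compose _ cH); apply: continuous_pair.
    exact: fst_continuous.
  by apply: clamp_affine_continuous; exact: snd_continuous.
- by rewrite /= H0.
- by rewrite /= H1.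
- pairE; rewrite val_zero val_one clamp1 ?(He _).2 ?clamp0 ?(He _).1 //; lra.
Qed.

Lemma path_concat_clamp x y z (f : path x y) (g : path y z) (r : R) :
  0 <= r <= 1 -> path_concat f g (clamp r) =
    if r <= 2^-1 then f (clamp (2 * r)) else g (clamp (2 * r - 1)).
Proof.
by move=> r01; rewrite path_concatE val_clamp.
Qed.

Lemma path_concatA x y z w (f : path x y) (g : path y z) (h : path z w) :
  path_homotopic (path_concat f (path_concat g h))
                 (path_concat (path_concat f g) h).
Proof.
pose u (t : I) : R := if val t <= 2^-1 then
  (if val t <= 4^-1 then 2 * val t else 1 * val t + 4^-1)
  else 2^-1 * val t + 2^-1.
apply: path_homotopic_sym.
apply: (@path_homotopic_reparam _ _ _ _ (path_concat f (path_concat g h))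
  _ _ u (fun t => val t)).
- apply: continuous_glue; first exact: (@val_continuous R).
  + apply: continuous_glue; first exact: (@val_continuous R).
    * exact: scale_continuous.
    * exact: unit_affine_continuous.
    * by move=> t ->; lra.
  + exact: unit_affine_continuous.
  + move=> t ->; rewrite ifF; lra.
- exact: (@val_continuous R).
- by rewrite /u val_zero !ifT; lra.
- by rewrite /u val_one !ifF; lra.
- move=> t; rewrite -[t in LHS]clampK.
  have /andP[t0 t1] := unit_intervalP t.
  rewrite path_concat_clamp; last lra.
  rewrite /u; case: (leP (val t) 2^-1) => t2; last first.
    rewrite path_concat_clamp; last lra.
    rewrite ifF; last lra.
    rewrite path_concat_clamp; last lra.
    rewrite ifF; last lra.
    by congr (h (clamp _)); lra.
  rewrite path_concat_clamp; last lra.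
  case: (leP (val t) 4^-1) => t4.
    rewrite ifT; last lra.
    rewrite path_concat_clamp; last lra.
    by rewrite ifT //; lra.
  rewrite ifF; last lra.
  rewrite path_concat_clamp; last lra.
  rewrite ifF; last lra.
  rewrite path_concat_clamp; last lra.
  rewrite ifT; last lra.
  by congr (g (clamp _)); lra.
- by move=> t; rewrite clampK.
Qed.

Lemma path_concat1p x y (f : path x y) :
  path_homotopic (path_concat (path_cst x) f) f.
Proof.
apply: (@path_homotopic_reparam _ _ _ _ f _ _
  (fun t => if val t <= 2^-1 then 0 else 2 * val t + -1) (fun t => val t)).
- apply: continuous_glue; first exact: (@val_continuous R).
  + exact: cst_continuous.
  + exact: unit_affine_continuous.
  + by move=> t ->; lra.
- exact: (@val_continuous R).
- by rewrite val_zero ifT; lra.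
- by rewrite val_one ifF; lra.
- move=> t; rewrite path_concatE.
  by case: ifP => // _; rewrite (@clamp0 R 0) // path_zero.
- by move=> t; rewrite clampK.
Qed.

Lemma path_concatp1 x y (f : path x y) :
  path_homotopic (path_concat f (path_cst y)) f.
Proof.
apply: (@path_homotopic_reparam _ _ _ _ f _ _
  (fun t => if val t <= 2^-1 then 2 * val t else 1) (fun t => val t)).
- apply: continuous_glue; first exact: (@val_continuous R).
  + exact: scale_continuous.
  + exact: cst_continuous.
  + by move=> t ->; lra.
- exact: (@val_continuous R).
- by rewrite val_zero ifT; lra.
- by rewrite val_one ifF; lra.
- move=> t; rewrite path_concatE.
  by case: ifP => // _; rewrite (@clamp1 R 1) // path_one.
- by move=> t; rewrite clampK.
Qed.

Lemma path_concatpV x y (f : path x y) :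
  path_homotopic (path_concat f (path_rev f)) (path_cst x).
Proof.
apply: (@path_homotopic_reparam _ _ _ _ f _ _
  (fun t => if val t <= 2^-1 then 2 * val t else - 2 * val t + 2) (fun=> 0)).
- apply: continuous_glue; first exact: (@val_continuous R).
  + exact: scale_continuous.
  + exact: unit_affine_continuous.
  + by move=> t ->; lra.
- exact: cst_continuous.
- by rewrite val_zero ifT; lra.
- by rewrite val_one ifF; lra.
- move=> t; rewrite path_concatE.
  case: (leP (val t) 2^-1) => // t2; rewrite path_revE.
  have /andP[t0 t1] := unit_intervalP t.
  by rewrite val_clamp; [congr (f (clamp _)); lra|lra].
- by move=> t; rewrite /= clamp0 // path_zero.
Qed.

Lemma path_concatVp x y (f : path x y) :
  path_homotopic (path_concat (path_rev f) f) (path_cst y).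
Proof.
apply: (@path_homotopic_reparam _ _ _ _ f _ _
  (fun t => if val t <= 2^-1 then - 2 * val t + 1 else 2 * val t + -1) (fun=> 1)).
- apply: continuous_glue; first exact: (@val_continuous R).
  + exact: unit_affine_continuous.
  + exact: unit_affine_continuous.
  + by move=> t ->; lra.
- exact: cst_continuous.
- by rewrite val_zero ifT; lra.
- by rewrite val_one ifF; lra.
- move=> t; rewrite path_concatE.
  case: (leP (val t) 2^-1) => // t2; rewrite path_revE.
  have /andP[t0 t1] := unit_intervalP t.
  by rewrite val_clamp; [congr (f (clamp _)); lra|lra].
- by move=> t; rewrite /= clamp1 // path_one.
Qed.

End PathHomotopy.

Section FundamentalGroup.
Variables (R : realType) (T : topologicalType) (x : T).
Local Notation loop := {path (unit_interval R) from x to x}.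

Definition loop_eq (f g : loop) : bool := `[< path_homotopic f g >].

Lemma loop_eq_refl : reflexive loop_eq.
Proof. by move=> f; apply/asboolP; exact: path_homotopic_refl. Qed.

Lemma loop_eq_sym : symmetric loop_eq.
Proof.
by move=> f g; apply: asbool_equiv_eq; split; exact: path_homotopic_sym.
Qed.

Lemma loop_eq_trans : transitive loop_eq.
Proof.
move=> g f h /asboolP fg /asboolP gh; apply/asboolP.
exact: path_homotopic_trans fg gh.
Qed.

Definition loop_equiv := EquivRel loop_eq loop_eq_refl loop_eq_sym loop_eq_trans.

Definition pi1 : Type := {eq_quot loop_equiv}.

HB.instance Definition _ := Choice.on pi1.
HB.instance Definition _ := Quotient.on pi1.

Definition loop_class (f : loop) : pi1 := \pi_pi1 f.

Definition pi1_one : pi1 := loop_class (path_cst R x).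
Definition pi1_inv (a : pi1) : pi1 := loop_class (path_rev (repr a)).
Definition pi1_mul (a b : pi1) : pi1 :=
  loop_class (path_concat (repr a) (repr b)).

Lemma loop_classP (f g : loop) :
  loop_class f = loop_class g <-> path_homotopic f g.
Proof.
split=> [/eqmodP/asboolP//|fg].
by apply/eqmodP/asboolP.
Qed.

Lemma loop_class_repr (a : pi1) : loop_class (repr a) = a.
Proof. exact: reprK. Qed.

Lemma repr_loop_class (f : loop) : path_homotopic (repr (loop_class f)) f.
Proof. by apply/loop_classP; exact: loop_class_repr. Qed.

Lemma pi1_mulE (f g : loop) :
  pi1_mul (loop_class f) (loop_class g) = loop_class (path_concat f g).
Proof. by apply/loop_classP; apply: path_concat_homotopic; exact: repr_loop_class. Qed.

Lemma pi1_invE (f : loop) : pi1_inv (loop_class f) = loop_class (path_rev f).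
Proof. by apply/loop_classP; apply: path_rev_homotopic; exact: repr_loop_class. Qed.

Lemma pi1_mulA : associative pi1_mul.
Proof.
move=> a b c; rewrite -[a]loop_class_repr -[b]loop_class_repr -[c]loop_class_repr !pi1_mulE.
by apply/loop_classP; exact: path_concatA.
Qed.

Lemma pi1_mul1 : left_id pi1_one pi1_mul.
Proof.
by move=> a; rewrite -[a]loop_class_repr pi1_mulE; apply/loop_classP; exact: path_concat1p.
Qed.

Lemma pi1_mulr1 : right_id pi1_one pi1_mul.
Proof.
by move=> a; rewrite -[a]loop_class_repr pi1_mulE; apply/loop_classP; exact: path_concatp1.
Qed.

Lemma pi1_mulV : left_inverse pi1_one pi1_inv pi1_mul.
Proof.
move=> a; rewrite -[a]loop_class_repr pi1_invE pi1_mulE.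
by apply/loop_classP; exact: path_concatVp.
Qed.

Lemma pi1_mulrV : right_inverse pi1_one pi1_inv pi1_mul.
Proof.
move=> a; rewrite -[a]loop_class_repr pi1_invE pi1_mulE.
by apply/loop_classP; exact: path_concatpV.
Qed.

HB.instance Definition _ := isGroup.Build pi1
  pi1_mulA pi1_mul1 pi1_mulr1 pi1_mulV pi1_mulrV.

End FundamentalGroup.

Definition simply_connected (R : realType) (T : topologicalType) : Prop :=
  (forall x y : T, inhabited {path (unit_interval R) from x to y}) /\
  (forall (x : T) (g : pi1 R x), g = 1%g).

(* The quotient of [D] by the equivalence relation generated by [glue]. *)
Section Gluing.
Variables (D : topologicalType) (glue : D -> D -> Prop).

Definition glued (a b : D) : bool := `[< clos_refl_sym_trans D glue a b >].

Lemma glued_refl : reflexive glued.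
Proof. by move=> a; apply/asboolP; exact: rst_refl. Qed.

Lemma glued_sym : symmetric glued.
Proof. by move=> a b; apply: asbool_equiv_eq; split; exact: rst_sym. Qed.

Lemma glued_trans : transitive glued.
Proof.
by move=> b a c /asboolP ab /asboolP bc; apply/asboolP; exact: rst_trans bc.
Qed.

Definition glued_equiv := EquivRel glued glued_refl glued_sym glued_trans.

Definition glued_space : Type := {eq_quot glued_equiv}.

HB.instance Definition _ :=
  Topological.copy glued_space (quotient_topology glued_space).
HB.instance Definition _ := Quotient.on glued_space.

Definition glued_class (a : D) : glued_space := \pi_glued_space a.

Lemma glued_classP (a b : D) :
  glued_class a = glued_class b <-> clos_refl_sym_trans D glue a b.
Proof. by split=> [/eqmodP/asboolP//|ab]; apply/eqmodP/asboolP. Qed.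

End Gluing.

(* The gluing data of a generalised square complex. Each edge is a copy of
   [0, 1] and each square a copy of [0, 1]^2. As there is precisely one
   attaching map onto each proper face of each cell, the attaching maps are
   given as functions of the face:
   - [endpoint e b] is the vertex attached to the point b of the edge e;
   - [side s true a] is the edge attached to the side {a} x [0, 1] of the
     square s, and [side s false b] the one attached to [0, 1] x {b}; the
     boolean component tells whether the affine embedding reverses the
     direction of increasing coordinate;
   - [corner s a b] is the vertex attached to the corner (a, b) of s.
   The last two fields say that the attaching maps are closed under
   composition: the two maps to (a, b) through the two sides containing it are
   the attaching map of [corner s a b]. *)
Record square_complex := SquareComplex {
  vertex : choiceType;
  edge : choiceType;
  square : choiceType;
  endpoint : edge -> bool -> vertex;
  side : square -> bool -> bool -> edge * bool;
  corner : square -> bool -> bool -> vertex;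
  endpoint_side1 : forall s a b,
    endpoint (side s true a).1 (b (+) (side s true a).2) = corner s a b;
  endpoint_side2 : forall s a b,
    endpoint (side s false b).1 (a (+) (side s false b).2) = corner s a b
}.

Section SquareRealization.
Variables (R : realType) (X : square_complex).
Local Notation I := (unit_interval R).

Definition cell : choiceType := (vertex X + edge X + square X)%type.

Definition cell_space (c : cell) : topologicalType :=
  match c with
  | inl (inl _) => set_type [set 0 : R]
  | inl (inr _) => I
  | inr _ => (I * I)%type
  end.

Definition vertex_point (v : vertex X) : {c & cell_space c} :=
  existT cell_space (inl (inl v)) (exist (fun x => x \in [set 0 : R]) 0 (mem_set erefl)).

Definition edge_point (e : edge X) (t : I) : {c & cell_space c} :=
  existT cell_space (inl (inr e)) t.

Definition square_point (s : square X) (p : I * I) : {c & cell_space c} :=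
  existT cell_space (inr s) p.

Definition unit_end (b : bool) : I := if b then one else zero.

Definition unit_flip (o : bool) (t : I) : I :=
  if o then clamp (1 - val t) else t.

Definition side_point (d b : bool) (t : I) : I * I :=
  if d then (unit_end b, t) else (t, unit_end b).

Inductive square_attach : {c & cell_space c} -> {c & cell_space c} -> Prop :=
| EndpointAttach e b :
    square_attach (vertex_point (endpoint e b)) (edge_point e (unit_end b))
| SideAttach s d b t :
    square_attach (edge_point (side s d b).1 t)
      (square_point s (side_point d b (unit_flip (side s d b).2 t)))
| CornerAttach s a b :
    square_attach (vertex_point (corner s a b))
      (square_point s (unit_end a, unit_end b)).

Definition square_realization : topologicalType := glued_space square_attach.

End SquareRealization.

(* Loops and multiple arcs are allowed; the order of the two ends is irrelevant
   (see [joins]). *)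
Record multigraph := Multigraph {
  node : Type;
  arc : Type;
  arc_ends : arc -> node * node
}.

Definition joins (G : multigraph) (a : arc G) (x y : node G) : Prop :=
  arc_ends a = (x, y) \/ arc_ends a = (y, x).

(* A cycle of length 1 is a loop, one of length 2 a pair of distinct arcs with
   the same two distinct ends. *)
Definition has_embedded_cycle (G : multigraph) (n : nat) : Prop :=
  exists (x : 'I_n -> node G) (a : 'I_n -> arc G),
    [/\ injective x, injective a & forall i, joins (a i) (x i) (x (ordS i))].

(* A node of the link of v is an end (e, b) of an edge at v, that is, an
   attaching map of v to an edge; an arc is a corner of a square at v, that is,
   an attaching map of v to a square. At the corner (a, b) of s the edge on the
   side {a} x [0, 1] is at its end b, up to reversal, and the edge on the side
   [0, 1] x {b} is at its end a, up to reversal. *)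
Section SquareLink.
Variables (X : square_complex) (v : vertex X).

Definition link_node := {p : edge X * bool | endpoint p.1 p.2 = v}.
Definition link_arc := {c : square X * (bool * bool) | corner c.1 c.2.1 c.2.2 = v}.

Definition corner_end1 (s : square X) (a b : bool) : edge X * bool :=
  ((side s true a).1, b (+) (side s true a).2).
Definition corner_end2 (s : square X) (a b : bool) : edge X * bool :=
  ((side s false b).1, a (+) (side s false b).2).

Definition link_arc_ends (c : link_arc) : link_node * link_node :=
  let: exist (s, (a, b)) cv := c in
  (exist (fun p => endpoint p.1 p.2 = v) (corner_end1 s a b)
     (etrans (endpoint_side1 s a b) cv),
   exist (fun p => endpoint p.1 p.2 = v) (corner_end2 s a b)
     (etrans (endpoint_side2 s a b) cv)).

Definition vertex_link : multigraph := Multigraph link_arc_ends.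

End SquareLink.

Definition nonpositively_curved (X : square_complex) : Prop :=
  forall (v : vertex X) (n : nat),
    (0 < n < 4)%N -> ~ has_embedded_cycle (vertex_link v) n.

Record VH_complex := VHComplex {
  VH_square_complex :> square_complex;
  vertical : pred (edge VH_square_complex);
  VH_alternating : forall (s : square VH_square_complex) (a b : bool),
    vertical (side s true a).1 = ~~ vertical (side s false b).1
}.


(* A simplex s is the affine simplex spanned by the nonempty finite set
   [verts s] (its dimension is #|verts s| - 1), so an affine embedding onto a
   face is an injection between vertex sets. [attach s t] is the set of
   attaching maps of s onto proper faces of t. A proper (nonempty) face of t is
   a nonempty proper subset F of [verts t]. *)
Record simplicial_complex := SimplicialComplex {
  simplex : choiceType;
  verts : simplex -> finType;
  attach : forall s t : simplex, set {ffun verts s -> verts t};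
  verts_gt0 : forall s, (0 < #|verts s|)%N;
  attach_inj : forall s t (f : {ffun verts s -> verts t}),
    attach f -> injective f;
  attach_proper : forall s t (f : {ffun verts s -> verts t}),
    attach f -> exists y, y \notin codom f;
  attach_comp : forall s t u (f : {ffun verts s -> verts t})
      (g : {ffun verts t -> verts u}),
    attach f -> attach g -> attach [ffun x => g (f x)];
  attach_face : forall t (F : {set verts t}),
    (0 < #|F| < #|verts t|)%N ->
    exists! p : {s & {ffun verts s -> verts t}},
      attach (projT2 p) /\ F =i codom (projT2 p)
}.

Section SimplicialRealization.
Variables (R : realType) (Y : simplicial_complex).

(* Barycentric coordinates. *)
Definition std_simplex (A : finType) : set {ptws A -> R} :=
  [set w : {ptws A -> R} | (forall x, 0 <= w x) /\ \sum_x w x = 1].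

Definition simplex_space (s : simplex Y) : topologicalType :=
  set_type (@std_simplex (verts s)).

Definition affine_ext (A B : finType) (f : A -> B) (w : {ptws A -> R}) :
  {ptws B -> R} := fun y => \sum_(x | f x == y) w x.

Lemma affine_ext_subproof (A B : finType) (f : A -> B)
  (w : set_type (@std_simplex A)) : affine_ext f (val w) \in @std_simplex B.
Proof.
case: w => w /= /set_mem [w0 w1]; apply/mem_set; split=> [y|].
  exact: sumr_ge0.
by rewrite -w1 /affine_ext (exchange_big_dep xpredT) //=; apply: eq_bigr => x _;
  rewrite (bigD1 (f x)) //= big1 ?addr0 // => y /andP[/eqP->]; rewrite eqxx.
Qed.

Definition affine_map (A B : finType) (f : A -> B)
    (w : set_type (@std_simplex A)) : set_type (@std_simplex B) :=
  exist (fun w => w \in @std_simplex B) _ (affine_ext_subproof f w).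

Definition simplex_point (s : simplex Y) (w : simplex_space s) :
  {s & simplex_space s} := existT simplex_space s w.

Inductive simplicial_attach :
    {s & simplex_space s} -> {s & simplex_space s} -> Prop :=
| FaceAttach s t (f : {ffun verts s -> verts t}) (w : simplex_space s) :
    attach f -> simplicial_attach (simplex_point w)
                  (simplex_point (affine_map f w : simplex_space t)).

Definition simplicial_realization : topologicalType :=
  glued_space simplicial_attach.

End SimplicialRealization.

(* The link of s: one simplex for each attaching map of s onto a proper face of
   a simplex t, spanned by the vertices of t outside the image of s; the
   attaching maps are the restrictions of those attaching maps h that are
   compatible with the maps from s. *)
Section SimplicialLink.
Variables (Y : simplicial_complex) (s : simplex Y).

Definition star_set : set {t & {ffun verts s -> verts t}} :=
  [set p | attach (projT2 p)].

Definition slink_simplex : choiceType := set_type star_set.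

Definition slink_pair t (k : {ffun verts s -> verts t})
    (kP : existT (fun t => {ffun verts s -> verts t}) t k \in star_set) :
  slink_simplex := exist (fun p => p \in star_set) _ kP.

Implicit Types p q r : slink_simplex.

Definition slink_carrier p : simplex Y := projT1 (val p).
Definition slink_map p : {ffun verts s -> verts (slink_carrier p)} :=
  projT2 (val p).
Definition slink_verts p : finType := {x | x \notin codom (slink_map p)}.

Definition slink_attach p q : set {ffun slink_verts p -> slink_verts q} :=
  [set g | exists h : {ffun verts (slink_carrier p) -> verts (slink_carrier q)},
    [/\ attach h, forall x, h (slink_map p x) = slink_map q x &
        forall y : slink_verts p, h (val y) = val (g y)]].

Lemma slink_mapP p : attach (slink_map p).
Proof. exact: (set_mem (valP p)). Qed.

Lemma slink_verts_gt0 p : (0 < #|slink_verts p|)%N.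
Proof.
have [y yP] := attach_proper (slink_mapP p).
by apply/card_gt0P; exists (exist _ y yP).
Qed.

Lemma slink_attach_inj p q (g : {ffun slink_verts p -> slink_verts q}) :
  slink_attach g -> injective g.
Proof.
move=> [h [/attach_inj hI _ hg]] x y gxy; apply/val_inj/hI.
by rewrite !hg gxy.
Qed.

Lemma slink_attach_proper p q (g : {ffun slink_verts p -> slink_verts q}) :
  slink_attach g -> exists y, y \notin codom g.
Proof.
move=> [h [hP hpq hg]]; have [y yP] := attach_proper hP.
have yq : y \notin codom (slink_map q).
  apply: contraNN yP => /codomP[x ->].
  by rewrite -hpq codom_f.
exists (exist _ y yq); apply: contraNN yP => /codomP[x /(congr1 val)/= ->].
by rewrite -hg codom_f.
Qed.

Lemma slink_attach_comp p q r (f : {ffun slink_verts p -> slink_verts q})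
    (g : {ffun slink_verts q -> slink_verts r}) :
  slink_attach f -> slink_attach g -> slink_attach [ffun x => g (f x)].
Proof.
move=> [h [hP hpq hf]] [k [kP kqr kg]].
exists [ffun x => k (h x)]; split=> [|x|y].
- exact: attach_comp.
- by rewrite ffunE hpq kqr.
- by rewrite !ffunE hf kg.
Qed.

(* If the face f of u lies strictly inside the face h, then f factors through h. *)
Lemma attach_factor t u (h : {ffun verts t -> verts u})
    (f : {ffun verts s -> verts u}) :
  attach h -> attach f -> {subset codom f <= codom h} ->
  (exists2 x, x \in codom h & x \notin codom f) ->
  exists2 k : {ffun verts s -> verts t}, attach k & forall x, h (k x) = f x.
Proof.
move=> hP fP fh [_ /codomP[x0 ->] x0f].
have hI := attach_inj hP.
pose F := [set x | h x \in codom f]%SET.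
have F1 : (0 < #|F| < #|verts t|)%N.
  apply/andP; split.
    have /card_gt0P[x _] := verts_gt0 s.
    have /codomP[y fxy] := fh _ (codom_f f x).
    by apply/card_gt0P; exists y; rewrite inE -fxy codom_f.
  rewrite -cardsT proper_card //; apply/properP; split; first exact: finset.subsetT.
  by exists x0; rewrite ?inE.
have [[s' k] /= [[kP Fk] _]] := attach_face F1.
have G1 : (0 < #|[set y in codom f]%SET| < #|verts u|)%N.
  apply/andP; split.
    have /card_gt0P[x _] := verts_gt0 s.
    by apply/card_gt0P; exists (f x); rewrite inE codom_f.
  rewrite -cardsT proper_card //; apply/properP; split; first exact: finset.subsetT.
  by exists (h x0); rewrite ?inE.
have [p [_ pU]] := attach_face G1.
have Ef : p = existT _ s f by apply: pU; split=> //= y; rewrite inE.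
have Ek : p = existT _ s' [ffun x => h (k x)].
  apply: pU; split=> /= [|y]; first exact: attach_comp.
  rewrite inE; apply/idP/codomP => [yf|[x ->]]; last first.
    by rewrite ffunE; have := codom_f k x; rewrite -Fk inE.
  have /codomP[z yz] := fh _ yf.
  have : z \in F by rewrite inE -yz.
  by rewrite Fk => /codomP[x zx]; exists x; rewrite ffunE -zx.
pose P (p : {s : simplex Y & {ffun verts s -> verts u}}) :=
  exists2 k : {ffun verts (projT1 p) -> verts t}, attach k &
    forall x, h (k x) = projT2 p x.
have : P p by rewrite Ek; exists k => // x; rewrite /= ffunE.
by rewrite Ef.
Qed.

Lemma slink_attach_face q (F : {set slink_verts q}) :
  (0 < #|F| < #|slink_verts q|)%N ->
  exists! a : {p & {ffun slink_verts p -> slink_verts q}},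
    slink_attach (projT2 a) /\ F =i codom (projT2 a).
Proof.
move=> /andP[F0 FT].
pose C := [set y in codom (slink_map q)]%SET.
pose G := ([set val y | y in F] :|: C)%SET.
have /card_gt0P[y0 y0F] := F0.
have [y1 y1F] : exists y, y \notin F.
  have /subsetPn[y _ yF] : ~~ ([set: slink_verts q]%SET \subset F).
    by apply: contraTN FT => /subset_leq_card; rewrite cardsT -leqNgt.
  by exists y.
have memG y : val y \in G = (y \in F).
  rewrite !inE (negPf (valP y)) orbF.
  by rewrite (mem_imset _ _ val_inj).
have CG y : y \in codom (slink_map q) -> y \in G by rewrite !inE orbC => ->.
have GE y : y \in G -> y \notin codom (slink_map q) ->
    exists2 z, z \in F & y = val z.
  rewrite !inE => /orP[/imsetP[z zF ->] _|->//]; by exists z.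
have G1 : (0 < #|G| < #|verts (slink_carrier q)|)%N.
  apply/andP; split; first by apply/card_gt0P; exists (val y0); rewrite memG.
  rewrite -cardsT proper_card //; apply/properP; split; first exact: finset.subsetT.
  by exists (val y1); [rewrite finset.in_setT|rewrite memG].
have [[t h] /= [[hP Gh] hU]] := attach_face G1.
have [k kP hk] : exists2 k : {ffun verts s -> verts t}, attach k &
    forall x, h (k x) = slink_map q x.
  apply: attach_factor => //; first exact: slink_mapP.
    by move=> y /CG; rewrite Gh.
  by exists (val y0); [rewrite -Gh memG|exact: (valP y0)].
pose p : slink_simplex := @slink_pair t k (mem_set kP).
have hI := attach_inj hP.
have gP (y : slink_verts p) : h (val y) \notin codom (slink_map q).
  apply: contraNN (valP y) => /codomP[x]; rewrite -hk => /hI ->.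
  exact: codom_f.
pose g : {ffun slink_verts p -> slink_verts q} :=
  [ffun y => exist (fun x => x \notin codom (slink_map q)) (h (val y)) (gP y)].
exists (existT _ p g); split.
  split=> /= [|y]; first by exists h; split=> // y; rewrite ffunE.
  apply/idP/codomP => [yF|[x ->]].
    have : val y \in codom h by rewrite -Gh memG.
    move=> /codomP[x yx].
    have xp : x \notin codom (slink_map p).
      apply: contraNN (valP y) => /codomP[z xz].
      by rewrite yx xz hk codom_f.
    by exists (exist _ x xp); apply: val_inj; rewrite ffunE.
  by rewrite -memG ffunE /= Gh codom_f.
move=> [[[t' k'] k'P] g'] /= [[h' [h'P hk' hg']] Fg'].
rewrite /slink_carrier /slink_map /= in h' h'P hk' hg'.
have Gh' : G =i codom h'.
  move=> y; apply/idP/codomP => [yG|[x ->]].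
    have [/codomP[x ->]|yq] := boolP (y \in codom (slink_map q)).
      by exists (k' x); rewrite hk'.
    have [z zF ->] := GE _ yG yq.
    move: zF; rewrite Fg' => /codomP[x ->].
    by exists (val x); rewrite hg'.
  have [/codomP[z ->]|xk] := boolP (x \in codom k').
    by apply: CG; rewrite hk' codom_f.
  by rewrite (hg' (exist _ x xk)) memG Fg' codom_f.
have E := hU (existT _ t' h') (conj h'P Gh').
pose Q (a : {t & {ffun verts t -> verts (slink_carrier q)}}) :=
  forall (k' : {ffun verts s -> verts (projT1 a)})
    (k'P : existT (fun t => {ffun verts s -> verts t}) (projT1 a) k' \in star_set)
    (g' : {ffun {x | x \notin codom k'} -> slink_verts q}),
    (forall x, projT2 a (k' x) = slink_map q x) ->
    (forall y : {x | x \notin codom k'}, projT2 a (val y) = val (g' y)) ->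
  existT (fun p => {ffun slink_verts p -> slink_verts q}) p g =
  existT (fun p => {ffun slink_verts p -> slink_verts q})
    (slink_pair k'P) g'.
suff : Q (existT _ t' h') by apply.
rewrite -E => {k' k'P g' hk' hg' Fg' h' h'P Gh' E t'} k' k'P g' /= hk' hg'.
have kk' : k' = k by apply/ffunP => x; apply: hI; rewrite hk hk'.
subst k'; rewrite (bool_irrelevance k'P (mem_set kP)) in g' hg' *.
congr existT; apply/ffunP => y; apply: val_inj.
by rewrite ffunE /= -hg'.
Qed.

Definition simplex_link : simplicial_complex := SimplicialComplex
  slink_verts_gt0 slink_attach_inj slink_attach_proper slink_attach_comp
  slink_attach_face.

End SimplicialLink.

Section SimplicialNotions.
Variable Y : simplicial_complex.
Implicit Types s t u v e : simplex Y.

Definition is_vertex v : Prop := #|verts v| = 1%N.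
Definition is_edge e : Prop := #|verts e| = 2%N.

(* v is (the image of) a vertex of s; an attaching map onto a proper face does
   not cover the case where s is the vertex v itself. *)
Definition vertex_of v s : Prop :=
  is_vertex v /\ (v = s \/ exists f : {ffun verts v -> verts s}, attach f).

(* There is an edge with u and v attached to its two different ends; for u = v
   this is a loop. *)
Definition adjacent u v : Prop :=
  [/\ is_vertex u, is_vertex v &
    exists e (f : {ffun verts u -> verts e}) (g : {ffun verts v -> verts e}),
      [/\ is_edge e, attach f, attach g & forall x y, f x != g y]].

(* The boundary of s is the union of the simplices attached to its proper
   faces. *)
Definition same_boundary s t : Prop :=
  forall r, (exists f : {ffun verts r -> verts s}, attach f) <->
            (exists f : {ffun verts r -> verts t}, attach f).

Definition simple_complex : Prop :=
  (forall v, ~ adjacent v v) /\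
  (forall s t, (1 < #|verts s|)%N -> (1 < #|verts t|)%N ->
     same_boundary s t -> s = t).

Definition clique (K : set (simplex Y)) : Prop :=
  (forall v, K v -> is_vertex v) /\
  (forall u v, K u -> K v -> u <> v -> adjacent u v).

Definition flag : Prop :=
  simple_complex /\
  (forall K : set (simplex Y), finite_set K -> K !=set0 -> clique K ->
     exists s, forall v, K v <-> vertex_of v s).

(* A cycle of length n without diagonals; a closed edge path through n >= 3
   distinct vertices is embedded. *)
Definition has_full_cycle (n : nat) : Prop :=
  exists c : 'I_n -> simplex Y,
    [/\ injective c, forall i, adjacent (c i) (c (ordS i)) &
        forall i j, adjacent (c i) (c j) -> j = ordS i \/ i = ordS j].

End SimplicialNotions.

Definition locally_6_large (Y : simplicial_complex) : Prop :=
  forall v : simplex Y, is_vertex v ->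
    [/\ flag (simplex_link v), ~ has_full_cycle (simplex_link v) 4 &
        ~ has_full_cycle (simplex_link v) 5].

Definition systolic_complex (R : realType) (Y : simplicial_complex) : Prop :=
  [/\ [set: simplicial_realization R Y] !=set0,
      connected [set: simplicial_realization R Y],
      simply_connected R (simplicial_realization R Y) &
      locally_6_large Y].

(* As simplices need not be determined by their vertices, nor embedded, an
   automorphism consists of a permutation of the simplices and of bijections
   between their vertex sets. *)
Record simplicial_aut (Y : simplicial_complex) := SimplicialAut {
  aut_simplex : simplex Y -> simplex Y;
  aut_verts : forall s, verts s -> verts (aut_simplex s);
  aut_simplex_bij : bijective aut_simplex;
  aut_verts_bij : forall s, bijective (@aut_verts s);
  aut_attach : forall s t (f : {ffun verts s -> verts t})
      (g : {ffun verts (aut_simplex s) -> verts (aut_simplex t)}),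
    (forall x, g (aut_verts x) = aut_verts (f x)) -> (attach f <-> attach g)
}.

Definition aut_vertex_map (Y : simplicial_complex) (phi : simplicial_aut Y)
    (p : {s : simplex Y & verts s}) : {s : simplex Y & verts s} :=
  existT (fun s => verts s : Type) (aut_simplex phi (projT1 p))
    (aut_verts phi (projT2 p)).

Section AutRealization.
Variables (R : realType) (Y : simplicial_complex) (phi : simplicial_aut Y).

Definition aut_point (p : {s : simplex Y & simplex_space R s}) :
    {s : simplex Y & simplex_space R s} :=
  simplex_point (affine_map (@aut_verts _ phi (projT1 p)) (projT2 p) :
                 simplex_space R (aut_simplex phi (projT1 p))).

Definition aut_realization (p : simplicial_realization R Y) :
    simplicial_realization R Y :=
  glued_class (@simplicial_attach R Y) (aut_point (repr p)).

Lemma affine_map_comp (A B C : finType) (f : A -> B) (g : B -> C)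
    (w : set_type (@std_simplex R A)) :
  affine_map g (affine_map f w) = affine_map (g \o f) w.
Proof.
apply: val_inj; apply: funext => z /=.
rewrite /affine_ext (exchange_big_dep (fun x => g (f x) == z)) //=.
  apply: eq_bigr => x /eqP gfz; rewrite (bigD1 (f x)) ?gfz ?eqxx //=.
  by rewrite big1 ?addr0 // => y /andP[/andP[_ /eqP->]]; rewrite eqxx.
by move=> y x gy /eqP ->.
Qed.

Lemma eq_affine_map (A B : finType) (f g : A -> B)
    (w : set_type (@std_simplex R A)) :
  f =1 g -> affine_map f w = affine_map g w.
Proof. by move=> /funext ->. Qed.

Lemma aut_realizationE (p : {s : simplex Y & simplex_space R s}) :
  aut_realization (glued_class (@simplicial_attach R Y) p) =
  glued_class (@simplicial_attach R Y) (aut_point p).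
Proof.
apply/glued_classP.
have : clos_refl_sym_trans _ (@simplicial_attach R Y)
    (repr (glued_class (@simplicial_attach R Y) p)) p.
  by apply/glued_classP; exact: reprK.
move: (repr _) => q; elim=> {p q} [a b [s t f w fP]|a|a b _|a b c _ ab _].
- have [inv invK Kinv] := @aut_verts_bij _ phi s.
  apply: rst_step; rewrite /aut_point /=.
  pose g : {ffun verts (aut_simplex phi s) -> verts (aut_simplex phi t)} :=
    [ffun x => aut_verts phi (f (inv x))].
  have gP x : g (aut_verts phi x) = aut_verts phi (f x) by rewrite ffunE invK.
  have := FaceAttach (affine_map (@aut_verts _ phi s) w : simplex_space R _)
    ((aut_attach gP).1 fP).
  rewrite !affine_map_comp.
  by rewrite (@eq_affine_map _ _ (g \o @aut_verts _ phi s)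
    (@aut_verts _ phi t \o f) w gP).
- exact: rst_refl.
- exact: rst_sym.
- exact: rst_trans ab.
Qed.

End AutRealization.

Record simplicial_action (G : groupType) (Y : simplicial_complex) :=
  SimplicialAction {
    act_aut : G -> simplicial_aut Y;
    act1 : forall p, aut_vertex_map (act_aut 1%g) p = p;
    actM : forall g h p,
      aut_vertex_map (act_aut (g * h)%g) p = aut_vertex_map (act_aut g)
        (aut_vertex_map (act_aut h) p)
  }.

Section GeometricAction.
Variables (R : realType) (G : groupType) (Y : simplicial_complex).
Variable rho : simplicial_action G Y.
Local Notation act_on g := (@aut_realization R Y (act_aut rho g)).

Definition proper_action : Prop :=
  forall K : set (simplicial_realization R Y), compact K ->
    finite_set [set g : G | (act_on g @` K) `&` K !=set0].

Definition cocompact_action : Prop :=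
  exists2 K : set (simplicial_realization R Y), compact K &
    \bigcup_(g in [set: G]) (act_on g @` K) = [set: simplicial_realization R Y].

Definition geometric_action : Prop := proper_action /\ cocompact_action.

End GeometricAction.

Definition systolic_group (R : realType) (G : groupType) : Prop :=
  exists2 Y : simplicial_complex, systolic_complex R Y &
    exists rho : simplicial_action G Y, geometric_action R rho.

(* Main.v *)
(* The complex Y on which the fundamental group acts has as vertices the vertices
   and the edges of the universal cover of X. Its maximal simplices are spanned by
   a vertex and edges issuing from it, at most one of them vertical, or by the two
   vertical sides of a square and one of its horizontal sides. As the links of X
   have no double edges, the links of Y are flag and have no full cycles of length
   4 or 5.

   The universal cover itself is not constructed: a simplex of Y carries a homotopy
   class of paths from x0 to an anchor point of X, and a loop acts by composition.
   This action is free and transitive on the classes with a given anchor, and there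
   are finitely many cells, whence properness and cocompactness.

   Y is simply connected because it is dominated by the universal cover: there are a
   map xi from |Y| to X with a lift khat to classes of paths, and a map Theta from
   the universal cover to |Y|, such that Theta (xi z) (khat z) is homotopic to z. A
   loop in |Y| is lifted by khat to a loop of the universal cover; this loop is
   contractible, and Theta maps a contraction to |Y|. *)

Require Import Defs.
From Stdlib Require Import Relations.
From mathcomp Require Import all_boot all_order all_algebra finmap generic_quotient.
From mathcomp Require Import all_classical all_reals topology normedtype homotopy.
From mathcomp Require Import lra.

Set Implicit Arguments.
Unset Strict Implicit.
Unset Printing Implicit Defensive.

Import Order.TTheory GRing.Theory Num.Theory numFieldNormedType.Exports.
Local Open Scope classical_set_scope.
Local Open Scope ring_scope.

(** * Homotopy classes of paths *)

(** The asymmetry between the two classes of edges is what controls the links. The four sides of a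
    square form a 4-cycle, which receives only the diagonal joining the vertical sides. The link of
    a vertical edge then consists of two cliques, one for each end, bridged by one extra node for
    each square along the edge. In the link of a horizontal edge, each end contributes the join of a
    clique (the vertex and the horizontal directions) and an independent set (the vertical
    directions), and squares match vertical directions at the two ends. Nonpositive curvature makes
    these bridges disjoint, so a full cycle that crosses between the two ends has length at least 6.

    The obstacle is that cells of X need not be embedded: a simplex cannot be described by the cells
    that it touches. Hence the local names at an anchor. Passing to a face may move the anchor,
    which renames the vertices and prolongs the path class, and the coherence of these renamings
    must be checked.

    Only one composite of the two maps between |Y| and the universal cover has to be homotopic to
    the identity: a domination already transfers simple connectedness. *)

Section PathClasses.
Variables (R : realType) (T : topologicalType).
Local Notation I := (unit_interval R).
Implicit Types f g h : I -> T.

Definition pconc f g (t : I) : T :=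
  if val t <= 2^-1 then f (clamp (2 * val t)) else g (clamp (2 * val t - 1)).

Definition revp f (t : I) : T := f (clamp (-1 * val t + 1)).

(** Ends are read off [f] and do not occur in types, so classes of paths with different ends live in
    one type. The relation forces [f] and [g] to be continuous; [pcls] of a discontinuous map is
    empty. *)
Definition phmt f g := exists H : I * I -> T,
  [/\ continuous H, forall t, H (zero, t) = f t, forall t, H (one, t) = g t &
      forall s, H (s, zero) = f zero /\ H (s, one) = f one].

Lemma phmt_of_path x y (f g : {path I from x to y}) :
  path_homotopic f g -> phmt f g.
Proof.
move=> [H [cH H0 H1 He]]; exists H; split=> // s.
by have [-> ->] := He s; rewrite !path_zero !path_one.
Qed.

Lemma path_of_phmt x y (f g : {path I from x to y}) :
  phmt f g -> path_homotopic f g.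
Proof.
move=> [H [cH H0 H1 He]]; exists H; split=> // s.
by have [-> ->] := He s; rewrite !path_zero !path_one.
Qed.

Lemma phmt_cont f g : phmt f g -> continuous f.
Proof.
move=> [H [cH H0 _ _]].
have -> : f = H \o (fun t => (zero, t)) by apply/funext => t /=; rewrite H0.
by apply: (continuous_compose _ cH); apply: continuous_pair; [exact: cst_continuous|by move=> t; exact: cvg_id].
Qed.

Lemma phmt_ends f g : phmt f g -> f zero = g zero /\ f one = g one.
Proof. by move=> [H [_ _ H1 He]]; have [] := He one; rewrite !H1. Qed.

Lemma phmt_refl f : continuous f -> phmt f f.
Proof.
move=> cf.
exact: (phmt_of_path (path_homotopic_refl (mk_path cf erefl erefl))).
Qed.

Lemma phmt_cont2 f g : phmt f g -> continuous g.
Proof.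
move=> [H [cH _ H0 _]].
have -> : g = H \o (fun t => (one, t)) by apply/funext => t /=; rewrite H0.
by apply: (continuous_compose _ cH); apply: continuous_pair; [exact: cst_continuous|by move=> t; exact: cvg_id].
Qed.

Lemma phmt_sym f g : phmt f g -> phmt g f.
Proof.
move=> fg; have [e0 e1] := phmt_ends fg.
have cf := phmt_cont fg; have cg := phmt_cont2 fg.
apply: (phmt_of_path (f := mk_path cg (esym e0) (esym e1))
  (g := mk_path cf erefl erefl)).
apply: path_homotopic_sym.
exact: (path_of_phmt (f := mk_path cf erefl erefl)
  (g := mk_path cg (esym e0) (esym e1))).
Qed.

Lemma phmt_trans f g h : phmt f g -> phmt g h -> phmt f h.
Proof.
move=> fg gh; have [e0 e1] := phmt_ends fg; have [e2 e3] := phmt_ends gh.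
have cf := phmt_cont fg; have cg := phmt_cont gh; have ch := phmt_cont2 gh.
pose F := mk_path cf e0 e1; pose G := mk_path cg erefl erefl.
pose H := mk_path ch (esym e2) (esym e3).
apply: (phmt_of_path (f := F) (g := H)).
apply: (@path_homotopic_trans _ _ _ _ F G H); exact: path_of_phmt.
Qed.

Lemma phmt_conc f f' g g' : f one = g zero -> phmt f f' -> phmt g g' ->
  phmt (pconc f g) (pconc f' g').
Proof.
move=> fg ff gg; have [e0 e1] := phmt_ends ff; have [e2 e3] := phmt_ends gg.
have cf := phmt_cont ff; have cf' := phmt_cont2 ff.
have cg := phmt_cont gg; have cg' := phmt_cont2 gg.
pose F := mk_path cf erefl fg; pose F' := mk_path cf' (esym e0) (etrans (esym e1) fg).
pose G := mk_path cg erefl erefl; pose G' := mk_path cg' (esym e2) (esym e3).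
apply: (phmt_of_path (f := path_concat F G) (g := path_concat F' G')).
apply: path_concat_homotopic; exact: path_of_phmt.
Qed.

Lemma pconc_cont f g : continuous f -> continuous g -> f one = g zero ->
  continuous (pconc f g).
Proof.
move=> cf cg fg.
have h := @path_concat_continuous R T _ _ _ (mk_path cf erefl fg) (mk_path cg erefl erefl).
exact: h.
Qed.

Lemma pconc0 f g : pconc f g zero = f zero.
Proof. by rewrite /pconc val_zero ifT ?clamp0 //; lra. Qed.

Lemma pconc1 f g : pconc f g one = g one.
Proof. by rewrite /pconc val_one ifF ?clamp1 //; lra. Qed.

Lemma revp_cont f : continuous f -> continuous (revp f).
Proof. move=> cf; have h := @path_rev_continuous R T _ _ (mk_path cf erefl erefl).
exact: h. Qed.

Lemma revp0 f : revp f zero = f one.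
Proof. by rewrite /revp val_zero clamp1 //; lra. Qed.

Lemma revp1 f : revp f one = f zero.
Proof. by rewrite /revp val_one clamp0 //; lra. Qed.

Lemma phmt_concA f g h : continuous f -> continuous g -> continuous h ->
  f one = g zero -> g one = h zero ->
  phmt (pconc f (pconc g h)) (pconc (pconc f g) h).
Proof.
move=> cf cg ch fg gh.
pose F := mk_path cf erefl fg; pose G := mk_path cg erefl gh.
pose H := mk_path ch erefl erefl.
exact: (phmt_of_path (path_concatA F G H)).
Qed.

Lemma phmt_conc1p f : continuous f -> phmt (pconc (fun=> f zero) f) f.
Proof.
move=> cf.
exact: (phmt_of_path (path_concat1p (mk_path cf erefl erefl))).
Qed.

Lemma phmt_concp1 f : continuous f -> phmt (pconc f (fun=> f one)) f.
Proof.
move=> cf.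
exact: (phmt_of_path (path_concatp1 (mk_path cf erefl erefl))).
Qed.

Lemma phmt_concpV f : continuous f -> phmt (pconc f (revp f)) (fun=> f zero).
Proof.
move=> cf.
exact: (phmt_of_path (path_concatpV (mk_path cf erefl erefl))).
Qed.

Lemma phmt_concVp f : continuous f -> phmt (pconc (revp f) f) (fun=> f one).
Proof.
move=> cf.
exact: (phmt_of_path (path_concatVp (mk_path cf erefl erefl))).
Qed.

Definition pcls f : set (I -> T) := [set g | phmt f g].

Lemma pclsE f g : phmt f g -> pcls f = pcls g.
Proof.
move=> fg; apply/seteqP; split=> h /= H.
  exact: phmt_trans (phmt_sym fg) H.
exact: phmt_trans fg H.
Qed.

Lemma pcls_inj f g : continuous g -> pcls f = pcls g -> phmt f g.
Proof. by move=> cg E; have : pcls f g by rewrite E /pcls /=; exact: phmt_refl. Qed.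

Implicit Types A B C : set (I -> T).

(** Taken on arbitrary sets of maps, so that [pmulA] has no side condition on ends or continuity; a
    product of classes that do not compose is empty. *)
Definition pmul A B : set (I -> T) := [set k | exists f g,
  [/\ A f, B g, continuous f, continuous g & f one = g zero /\ phmt (pconc f g) k]].

Lemma pmulA A B C : pmul A (pmul B C) = pmul (pmul A B) C.
Proof.
apply/seteqP; split=> k /=.
  move=> [a [h [Aa [b [c [Bb Cc cb cc [bc bch]]] ca ch [ah ahk]]]]].
  have [bch0 bch1] := phmt_ends bch; rewrite pconc0 in bch0.
  have ab : a one = b zero by rewrite ah -bch0.
  exists (pconc a b), c; split=> //.
  - by exists a, b; split=> //; split=> //; apply: phmt_refl; exact: pconc_cont.
  - exact: pconc_cont.
  - split; first by rewrite pconc1.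
    apply: phmt_trans ahk; apply: phmt_trans (phmt_conc _ (phmt_refl ca) bch).
      by apply: phmt_sym; exact: phmt_concA.
    by rewrite pconc0.
move=> [h [c [[a [b [Aa Bb ca cb [ab abh]]]] Cc ch cc [hc hck]]]].
have [abh0 abh1] := phmt_ends abh; rewrite pconc1 in abh1.
have bc : b one = c zero by rewrite -hc -abh1.
exists a, (pconc b c); split=> //.
- by exists b, c; split=> //; split=> //; apply: phmt_refl; exact: pconc_cont.
- exact: pconc_cont.
- split; first by rewrite pconc0.
  apply: phmt_trans hck; apply: phmt_trans (phmt_conc _ abh (phmt_refl cc)).
    exact: phmt_concA.
  by rewrite pconc1.
Qed.

Lemma pmul_cls f g : continuous f -> continuous g -> f one = g zero ->
  pmul (pcls f) (pcls g) = pcls (pconc f g).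
Proof.
move=> cf cg fg; apply/seteqP; split=> k /=.
  move=> [f' [g' [ff gg _ _ [fg' H]]]].
  by apply: phmt_trans H; apply: phmt_conc.
by move=> H; exists f, g; split=> //; exact: phmt_refl.
Qed.

Lemma pmulp1 f : continuous f -> pmul (pcls f) (pcls (fun=> f one)) = pcls f.
Proof.
move=> cf; rewrite pmul_cls //; last exact: cst_continuous.
by apply: pclsE; exact: phmt_concp1.
Qed.

Lemma pmul1p f : continuous f -> pmul (pcls (fun=> f zero)) (pcls f) = pcls f.
Proof.
move=> cf; rewrite pmul_cls //; last exact: cst_continuous.
by apply: pclsE; exact: phmt_conc1p.
Qed.

Lemma pmulpV f : continuous f -> pmul (pcls f) (pcls (revp f)) = pcls (fun=> f zero).
Proof.
move=> cf; rewrite pmul_cls ?revp0 //; last exact: revp_cont.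
by apply: pclsE; exact: phmt_concpV.
Qed.

Lemma pmulVp f : continuous f -> pmul (pcls (revp f)) (pcls f) = pcls (fun=> f one).
Proof.
move=> cf; rewrite pmul_cls ?revp1 //; last exact: revp_cont.
by apply: pclsE; exact: phmt_concVp.
Qed.

(** For fixed [x], the classes [A] form the fibre over [y] of the universal cover based at [x]. *)
Definition pfib (x y : T) A :=
  exists f, [/\ continuous f, f zero = x, f one = y & A = pcls f].

Lemma pfib_mul x y z A B : pfib x y A -> pfib y z B -> pfib x z (pmul A B).
Proof.
move=> [f [cf f0 f1 ->]] [g [cg g0 g1 ->]].
have fg : f one = g zero by rewrite f1.
by exists (pconc f g); rewrite pconc0 pconc1 pmul_cls //; split=> //; exact: pconc_cont.
Qed.

(** Cancellation by [revp f]. It makes the label of a simplex recoverable from the label of a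
    face. *)
Lemma pfib_mulK x y A B f : pfib x y A -> pfib x y B -> continuous f ->
  f zero = y -> pmul A (pcls f) = pmul B (pcls f) -> A = B.
Proof.
move=> [a [ca a0 a1 ->]] [b [cb b0 b1 ->]] cf fy.
move=> /(congr1 (fun C => pmul C (pcls (revp f)))); rewrite -!pmulA pmulpV //.
by rewrite fy -{1}a1 -b1 !pmulp1.
Qed.

End PathClasses.

(** * Compactness, connectedness and separation of the unit interval *)

Section UnitIntervalTopology.
Variable R : realType.
Local Notation I := (unit_interval R).

Lemma clamp_image : clamp (R := R) @` `[0, 1] = setT.
Proof.
apply/seteqP; split=> // t _ /=; exists (val t); last exact: clampK.
by rewrite /= in_itv /= unit_intervalP.
Qed.

Lemma unit_compact : compact [set: I].
Proof.
rewrite -clamp_image; apply: continuous_compact; last exact: segment_compact.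
exact: continuous_subspaceT (@clamp_continuous R).
Qed.

Lemma unit_connected : connected [set: I].
Proof.
rewrite -clamp_image; apply: connected_continuous_connected; first exact: segment_connected.
exact: continuous_subspaceT (@clamp_continuous R).
Qed.

Lemma unit_hausdorff : hausdorff_space I.
Proof.
move=> p q pq; apply: val_inj; apply: Rhausdorff => A B nA nB.
have [t [/= tA tB]] := pq _ _ (val_continuous nA) (val_continuous nB).
by exists (val t).
Qed.

Lemma unit_locally_compact : locally_compact [set: I].
Proof.
move=> x _; exists setT; rewrite ?withinET; first exact: filterT.
by split; [exact: unit_compact|exact: closedT].
Qed.

End UnitIntervalTopology.

(** * Maps out of glued spaces *)

Section GluedContinuity.
Variables (D : topologicalType) (glue : D -> D -> Prop).
Local Notation Q := (glued_space glue).
Local Notation cl := (glued_class glue).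

Lemma glued_class_repr (x : Q) : cl (repr x) = x.
Proof. exact: reprK. Qed.

Lemma glued_class_continuous : continuous cl.
Proof. exact: pi_continuous. Qed.

Lemma glued_open (U : set Q) : open U <-> open (cl @^-1` U).
Proof. by []. Qed.

(** The maps to be descended may be compatible with the gluing only over a subset, such as the star
    of a cell. A chain of gluings never leaves its class, so it stays over [U]. *)
Lemma glued_compat (Z : Type) (g : D -> Z) (U : set Q) :
  (forall a b, glue a b -> U (cl a) -> g a = g b) ->
  forall a b, cl a = cl b -> U (cl a) -> g a = g b.
Proof.
move=> gU a b /glued_classP; elim=> {a b} [a b ab|a|a b ab IH|a b c ab IH1 bc IH2] Ua //.
- exact: gU.
- by rewrite IH //; have /glued_classP -> := ab.
- by rewrite IH1 // IH2 //; have /glued_classP <- := ab.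
Qed.

Lemma glued_lift (Z : Type) (g : D -> Z) (U : set Q) :
  (forall a b, glue a b -> U (cl a) -> g a = g b) ->
  forall a, U (cl a) -> g (repr (cl a)) = g a.
Proof.
move=> gU a Ua; apply/esym/(glued_compat gU) => //.
by rewrite glued_class_repr.
Qed.

Lemma glued_lift_continuous (Z : topologicalType) (g : D -> Z) (U : set Q) :
  open U -> (forall a, U (cl a) -> {for a, continuous g}) ->
  (forall a b, glue a b -> U (cl a) -> g a = g b) ->
  forall x, U x -> {for x, continuous (fun y : Q => g (repr y))}.
Proof.
move=> oU cg gU x Ux O; rewrite /= nbhsE => -[V [oV Vx] VO].
suff oW : open [set y | U y /\ V (g (repr y))].
  apply: (@filterS _ _ _ [set y | U y /\ V (g (repr y))]) => [y [_ /VO]//|].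
  by apply: open_nbhs_nbhs; split.
apply/glued_open; rewrite openE => a [/= Ua Va]; rewrite /interior /=.
rewrite (glued_lift gU) // in Va.
have nU : \forall b \near a, U (cl b).
  by apply: glued_class_continuous; apply: open_nbhs_nbhs.
have nV : \forall b \near a, V (g b).
  by apply: (cg a Ua); apply: open_nbhs_nbhs.
near=> b; split; first by near: b.
by rewrite (glued_lift gU); near: b.
Unshelve. all: by end_near. Qed.

(** This is the tube lemma along the compact set [K], which needs continuity only at the points
    [(a, v)]. *)
Lemma curry_continuous_at (V W : topologicalType) (f : D -> V -> W) (a : D) :
  (forall v, {for (a, v), continuous (fun p => f p.1 p.2)}) ->
  {for a, continuous (f : D -> {compact-open, V -> W})}.
Proof.
move=> cf; apply/compact_open_cvgP => K O /= cptK oO fKO.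
suff : \forall b \near a, forall v, K v -> O (f b v).
  by apply: filterS => b h w [v Kv <-]; exact: h.
have /compact_near_coveringP nK := cptK.
apply: (nK _ _ (fun b v => O (f b v))) => v Kv.
have := cf v O; rewrite /= => /(_ (open_nbhs_nbhs (conj oO _))) h.
have {h} : nbhs (a, v) (fun p : D * V => O (f p.1 p.2)) by apply: h; apply: fKO; exists v.
by move=> [[A B] /= [nA nB] AB]; exists (B, A) => //= -[v' b] /= [Bv Ab]; apply: (AB (b, v')).
Qed.

(* The exponential law stands in for the fact that [glued_space] commutes with
   products by the unit interval. *)
Lemma glued_homotopy (R : realType) (Z S : topologicalType)
    (C : D -> unit_interval R -> Z) (U : set Q) (u : S -> Q) :
  open U ->
  (forall a r, U (cl a) -> {for (a, r), continuous (fun p => C p.1 p.2)}) ->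
  (forall a b, glue a b -> U (cl a) -> C a = C b) ->
  continuous u -> (forall s, U (u s)) ->
  continuous (fun p : S * unit_interval R => C (repr (u p.1)) p.2).
Proof.
move=> oU cC gC cu uU.
(* As a map into a function space, the homotopy descends to the quotient without any product by the
   interval; it is uncurried afterwards. *)
have c1 : continuous (fun s => C (repr (u s)) : {compact-open, unit_interval R -> Z}).
  move=> s; apply: (@continuous_comp S Q {compact-open, unit_interval R -> Z} u
    (fun x => C (repr x)) s (cu s)).
  apply: (@glued_lift_continuous {compact-open, unit_interval R -> Z} C U) => //.
  by move=> a Ua; apply: curry_continuous_at => v; exact: cC.
have c2 : forall s, continuous (C (repr (u s))).
  move=> s r; have Ur : U (cl (repr (u s))) by rewrite glued_class_repr.
  apply: (@continuous_comp _ _ _ (fun r => (repr (u s), r)) (fun p => C p.1 p.2)).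
    apply: (@continuous_pair _ _ _ (fun=> repr (u s)) id); last by move=> t; exact: cvg_id.
    exact: cst_continuous.
  exact: cC.
have := continuous_uncurry (@unit_locally_compact R) (@unit_hausdorff R) c1 c2.
have -> // : uncurry (fun s => C (repr (u s))) =
  (fun p : S * unit_interval R => C (repr (u p.1)) p.2) by apply/funext => -[].
Qed.

End GluedContinuity.

(** * Spaces dominated by a universal cover *)

(** What the interval, the square and the simplices have in common as convex sets. Its purpose is
    that two paths with the same ends in [Q] are homotopic, by [segments_phmt]. *)
Record segments (R : realType) (Q : topologicalType) := Segments {
  lerp : Q -> Q -> unit_interval R -> Q;
  lerp_cont : continuous (fun p : Q * Q * unit_interval R => lerp p.1.1 p.1.2 p.2);
  lerp0 : forall a b, lerp a b zero = a;
  lerp1 : forall a b, lerp a b one = b;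
  lerpp : forall a t, lerp a a t = a
}.

Section Segments.
Variables (R : realType) (T Q : topologicalType) (c : segments R Q).
Local Notation I := (unit_interval R).

Lemma lerp_comp_cont (S : topologicalType) (a b : S -> Q) (t : S -> I) :
  continuous a -> continuous b -> continuous t ->
  continuous (fun s => lerp c (a s) (b s) (t s)).
Proof.
move=> ca cb ct.
apply: (continuous_compose (f := fun s => (a s, b s, t s)) _ (@lerp_cont R Q c)).
by apply: continuous_pair => //; exact: continuous_pair.
Qed.

Lemma seg_cont a b : continuous (lerp c a b).
Proof.
by apply: lerp_comp_cont; [exact: cst_continuous|exact: cst_continuous|move=> t; exact: cvg_id].
Qed.

Lemma segments_phmt (f : Q -> T) (u v : I -> Q) : continuous f ->
  continuous u -> continuous v -> u zero = v zero -> u one = v one ->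
  phmt (fun t => f (u t)) (fun t => f (v t)).
Proof.
move=> cf cu cv uv0 uv1.
exists (fun p => f (lerp c (u p.2) (v p.2) p.1)); split=> [|t|t|s] /=.
- apply: (continuous_compose _ cf); apply: lerp_comp_cont.
  + exact: (continuous_compose (@snd_continuous _ _)).
  + exact: (continuous_compose (@snd_continuous _ _)).
  + exact: fst_continuous.
- by rewrite lerp0.
- by rewrite lerp1.
- by rewrite uv0 uv1 !lerpp.
Qed.

(** By [sgE] every path in [Q] from [a] to [b] has this image class, so path computations inside a
    cell reduce to bookkeeping of end points. *)
Definition sg (f : Q -> T) a b := pcls (fun t => f (lerp c a b t)).

Lemma sgE (f : Q -> T) (u : I -> Q) : continuous f -> continuous u ->
  pcls (fun t => f (u t)) = sg f (u zero) (u one).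
Proof.
move=> cf cu; apply: pclsE.
by apply: segments_phmt; rewrite ?lerp0 ?lerp1 //; exact: seg_cont.
Qed.

Lemma f_seg_cont (f : Q -> T) a b : continuous f -> continuous (fun t => f (lerp c a b t)).
Proof. by move=> cf; apply: (continuous_compose _ cf); exact: seg_cont. Qed.

Lemma sg_mul (f : Q -> T) x y z : continuous f ->
  pmul (sg f x y) (sg f y z) = sg f x z.
Proof.
move=> cf; rewrite pmul_cls; [|exact: f_seg_cont|exact: f_seg_cont|by rewrite lerp0 lerp1].
pose u := pconc (lerp c x y) (lerp c y z).
have -> : pconc (fun t => f (lerp c x y t)) (fun t => f (lerp c y z t)) =
          fun t => f (u t).
  by apply/funext => t; rewrite /u /pconc; case: ifP.
rewrite sgE //; first by rewrite /u pconc0 pconc1 lerp0 lerp1.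
by apply: pconc_cont; rewrite ?lerp0 ?lerp1 //; exact: seg_cont.
Qed.

Lemma sg_id (f : Q -> T) x : sg f x x = pcls (fun=> f x).
Proof. by rewrite /sg; congr pcls; apply/funext => t; rewrite lerpp. Qed.

Lemma pfib_sg (f : Q -> T) x y : continuous f -> pfib (f x) (f y) (sg f x y).
Proof.
move=> cf; exists (fun t => f (lerp c x y t)); rewrite lerp0 lerp1; split=> //.
exact: f_seg_cont.
Qed.

(** The constant segment at [q] lies over [U], and compactness of the interval extends this to all
    sufficiently short segments. *)
Lemma near_seg (f : Q -> T) (U : set T) q : continuous f -> open U -> U (f q) ->
  \forall q' \near q, forall t, U (f (lerp c q q' t)).
Proof.
move=> cf oU Uq.
have /compact_near_coveringP nK := @unit_compact R.
suff : \forall q' \near q, [set: I] `<=` (fun t => U (f (lerp c q q' t))).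
  by apply: filterS => q' h t; exact: h.
apply: (nK _ _ (fun q' t => U (f (lerp c q q' t)))) => t _.
have cF : continuous (fun p : Q * I => f (lerp c q p.1 p.2)).
  apply: (continuous_compose _ cf); apply: lerp_comp_cont.
  - exact: cst_continuous.
  - exact: fst_continuous.
  - exact: snd_continuous.
have nU : nbhs (q, t) (fun p : Q * I => U (f (lerp c q p.1 p.2))).
  by apply: (cF (q, t) U); apply: open_nbhs_nbhs; split=> //=; rewrite lerpp.
move: nU => [[A B] /= [nA nB] AB]; exists (B, A) => //= -[t' q'] /= [Bt Aq].
exact: (AB (q', t')).
Qed.

End Segments.

Lemma sg_comp (R : realType) (T Q Q' : topologicalType) (c : segments R Q)
    (c' : segments R Q') (f : Q -> T) (g : Q' -> Q) x y :
  continuous f -> continuous g -> sg c' (fun z => f (g z)) x y = sg c f (g x) (g y).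
Proof.
move=> cf cg; rewrite {1}/sg (sgE c (u := fun t => g (lerp c' x y t))) //.
  by rewrite lerp0 lerp1.
by apply: (continuous_compose _ cg); exact: seg_cont.
Qed.

(** * Segments in the interval, in products and in the square *)

Section StandardSegments.
Variable R : realType.
Local Notation I := (unit_interval R).

Definition unit_lerp (a b t : I) : I := clamp ((1 - val t) * val a + val t * val b).

Lemma val_unit_lerp a b t : val (unit_lerp a b t) = (1 - val t) * val a + val t * val b.
Proof.
rewrite val_clamp //.
have := unit_intervalP a; have := unit_intervalP b; have := unit_intervalP t.
nra.
Qed.

Lemma unit_lerp_cont : continuous (fun p : I * I * I => unit_lerp p.1.1 p.1.2 p.2).
Proof.
apply: (continuous_compose _ (@clamp_continuous R)).
have c1 : continuous (fun p : I * I * I => val p.1.1 : R).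
  apply: (continuous_compose _ (@val_continuous R)).
  exact: (continuous_compose (@fst_continuous _ _) (@fst_continuous _ _)).
have c2 : continuous (fun p : I * I * I => val p.1.2 : R).
  apply: (continuous_compose _ (@val_continuous R)).
  exact: (continuous_compose (@fst_continuous _ _) (@snd_continuous _ _)).
have c3 : continuous (fun p : I * I * I => val p.2 : R).
  exact: (continuous_compose (@snd_continuous _ _) (@val_continuous R)).
move=> p; apply: cvgD; apply: cvgM; [|exact: c1|exact: c3|exact: c2].
by apply: cvgB; [exact: cvg_cst|exact: c3].
Qed.

Lemma unit_lerp0 a b : unit_lerp a b zero = a.
Proof. by apply: val_inj; rewrite val_unit_lerp val_zero subr0 mul1r mul0r addr0. Qed.
Lemma unit_lerp1 a b : unit_lerp a b one = b.
Proof. by apply: val_inj; rewrite val_unit_lerp val_one subrr mul1r mul0r add0r. Qed.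
Lemma unit_lerpp a t : unit_lerp a a t = a.
Proof. by apply: val_inj; rewrite val_unit_lerp -mulrDl subrK mul1r. Qed.

Definition unit_segments : segments R I :=
  Segments unit_lerp_cont unit_lerp0 unit_lerp1 unit_lerpp.

Section Product.
Variables (Q Q' : topologicalType) (c : segments R Q) (c' : segments R Q').

Definition prod_lerp (a b : (Q * Q')%type) (t : I) : (Q * Q')%type :=
  (lerp c a.1 b.1 t, lerp c' a.2 b.2 t).

Lemma prod_lerp_cont :
  continuous (fun p : ((Q * Q') * (Q * Q') * I)%type => prod_lerp p.1.1 p.1.2 p.2).
Proof.
apply: continuous_pair; apply: lerp_comp_cont; [| |exact: snd_continuous| | |exact: snd_continuous].
- exact: (continuous_compose (@fst_continuous _ _) (continuous_compose (@fst_continuous _ _) (@fst_continuous _ _))).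
- exact: (continuous_compose (@fst_continuous _ _) (continuous_compose (@snd_continuous _ _) (@fst_continuous _ _))).
- exact: (continuous_compose (@fst_continuous _ _) (continuous_compose (@fst_continuous _ _) (@snd_continuous _ _))).
- exact: (continuous_compose (@fst_continuous _ _) (continuous_compose (@snd_continuous _ _) (@snd_continuous _ _))).
Qed.

Lemma prod_lerp0 a b : prod_lerp a b zero = a.
Proof. by case: a b => [a a'] [b b']; rewrite /prod_lerp !lerp0. Qed.
Lemma prod_lerp1 a b : prod_lerp a b one = b.
Proof. by case: a b => [a a'] [b b']; rewrite /prod_lerp !lerp1. Qed.
Lemma prod_lerpp a t : prod_lerp a a t = a.
Proof. by case: a => [a a']; rewrite /prod_lerp !lerpp. Qed.

Definition prod_segments : segments R (Q * Q')%type :=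
  Segments prod_lerp_cont prod_lerp0 prod_lerp1 prod_lerpp.

End Product.

Definition square_segments := prod_segments unit_segments unit_segments.

End StandardSegments.

(** Both composites are images of paths from one corner of the convex square to the opposite one. *)
Lemma square_pmul (R : realType) (T : topologicalType)
    (F : unit_interval R * unit_interval R -> T) : continuous F ->
  pmul (pcls (fun t => F (t, zero))) (pcls (fun t => F (one, t))) =
  pmul (pcls (fun t => F (zero, t))) (pcls (fun t => F (t, one))).
Proof.
move=> cF.
have cl (x : unit_interval R) : continuous (fun t : unit_interval R => (x, t)).
  by apply: continuous_pair; [exact: cst_continuous|move=> t; exact: cvg_id].
have cr (x : unit_interval R) : continuous (fun t : unit_interval R => (t, x)).
  by apply: continuous_pair; [move=> t; exact: cvg_id|exact: cst_continuous].
rewrite (sgE (square_segments R) cF (cl zero)) (sgE (square_segments R) cF (cl one)).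
rewrite (sgE (square_segments R) cF (cr zero)) (sgE (square_segments R) cF (cr one)).
by rewrite !sg_mul.
Qed.

(** Stands in for an evenly covered neighbourhood. By [ch_coh], a path inside the domain does not
    affect the continuation to the centre, so over the domain a class of paths is the same as a
    class at the centre. *)
Record chart (R : realType) (T : topologicalType) := Chart {
  ch_dom : set T;
  ch_ctr : T;
  ch_path : T -> unit_interval R -> T;
  ch_open : open ch_dom;
  ch_path_cont : forall x, ch_dom x -> continuous (ch_path x);
  ch_path0 : forall x, ch_dom x -> ch_path x zero = x;
  ch_path1 : forall x, ch_dom x -> ch_path x one = ch_ctr;
  ch_coh : forall g : unit_interval R -> T, continuous g -> (forall t, ch_dom (g t)) ->
    pmul (pcls g) (pcls (ch_path (g one))) = pcls (ch_path (g zero))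
}.

Section Charts.
Variables (R : realType) (T : topologicalType) (ch : chart R T).
Local Notation I := (unit_interval R).

(** [near_seg] keeps short segments inside the domain, where [ch_coh] applies to them. *)
Lemma chart_near (Q : topologicalType) (c : segments R Q) (f : Q -> T) q :
  continuous f -> ch_dom ch (f q) -> \forall q' \near q, ch_dom ch (f q') /\
    pmul (sg c f q q') (pcls (ch_path ch (f q'))) = pcls (ch_path ch (f q)).
Proof.
move=> cf fq; have := near_seg c cf (ch_open ch) fq.
apply: filterS => q' h; split; first by have := h one; rewrite lerp1.
have cu : continuous (fun t => f (lerp c q q' t)) by exact: f_seg_cont.
by have := ch_coh cu h; rewrite lerp0 lerp1.
Qed.

Lemma chart_mulK x y A : ch_dom ch y -> pfib x y A ->
  A = pmul (pmul A (pcls (ch_path ch y))) (pcls (revp (ch_path ch y))).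
Proof.
move=> dy [f [cf f0 f1 ->]].
rewrite -pmulA pmulpV; last exact: ch_path_cont.
by rewrite ch_path0 // -f1 pmulp1.
Qed.

Lemma pfib_chart x : ch_dom ch x -> pfib x (ch_ctr ch) (pcls (ch_path ch x)).
Proof.
by move=> dx; exists (ch_path ch x); rewrite ch_path0 ?ch_path1 //; split=> //; exact: ch_path_cont.
Qed.

End Charts.

(* [Z] is simply connected if it is dominated, through homotopy, by the set of
   pairs (point x of T, homotopy class of paths from x0 to x), that is, by the
   universal cover of T. *)
Section UniversalCoverDomination.
Variables (R : realType) (T Z : topologicalType) (x0 : T).
Local Notation I := (unit_interval R).
Variables (A : Type) (ch : A -> chart R T).
Hypothesis ch_cover : forall x, exists a, ch_dom (ch a) x.
Variable Theta : T -> set (I -> T) -> Z.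
(** The classes [pmul k (pcls (revp (ch_path (ch a) y)))] form the local section of the universal
    cover through [k] over the chart. The topology of the universal cover enters only through these
    sections. *)
Hypothesis Theta_cont : forall a k x, pfib x0 (ch_ctr (ch a)) k -> ch_dom (ch a) x ->
  {for x, continuous (fun y => Theta y (pmul k (pcls (revp (ch_path (ch a) y)))))}.

(** Near [q], the lift of [f] agrees with the section of a chart at [f q], whose class [k0] at the
    centre is the continuation of the class at [q]. *)
Lemma Theta_lift (Q : topologicalType) (c : segments R Q) (f : Q -> T) q0 k :
  continuous f -> pfib x0 (f q0) k ->
  continuous (fun q => Theta (f q) (pmul k (sg c f q0 q))).
Proof.
move=> cf kf q.
have [a aq] := ch_cover (f q).
pose k0 := pmul (pmul k (sg c f q0 q)) (pcls (ch_path (ch a) (f q))).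
have fk' q' : pfib x0 (f q') (pmul k (sg c f q0 q')).
  by apply: pfib_mul kf _; exact: pfib_sg.
have fk0 : pfib x0 (ch_ctr (ch a)) k0 by apply: pfib_mul (fk' q) _; exact: pfib_chart.
have E : \forall q' \near q, Theta (f q') (pmul k0 (pcls (revp (ch_path (ch a) (f q')))))
     = Theta (f q') (pmul k (sg c f q0 q')).
  have := chart_near c cf aq; apply: filterS => q' [dq' hq']; congr Theta.
  rewrite [RHS](chart_mulK dq' (fk' q')); congr pmul; rewrite /k0 -hq'.
  by rewrite -!pmulA [pmul (sg c f q0 q) _]pmulA sg_mul.
have := Theta_cont fk0 aq => /(continuous_comp (cf q)) h.
have {h} h2 := cvg_trans (near_eq_cvg E) h.
have e := nbhs_singleton E; move: h2; rewrite /= e; apply.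
Qed.

Variables (xi : Z -> T) (khat : Z -> set (I -> T)).
Hypothesis xi_cont : continuous xi.
Hypothesis khat_fib : forall z, pfib x0 (xi z) (khat z).
(** Continued to the centre of a chart, [khat] is locally constant. This is the continuity of the
    lift of [xi] to the universal cover. *)
Hypothesis khat_near : forall a z, ch_dom (ch a) (xi z) -> \forall z' \near z,
  pmul (khat z') (pcls (ch_path (ch a) (xi z'))) =
  pmul (khat z) (pcls (ch_path (ch a) (xi z))).
Variable K : Z -> I -> Z.
Hypothesis K_cont : forall g : I -> Z, continuous g ->
  continuous (fun p : I * I => K (g p.1) p.2).
Hypothesis K0 : forall z, K z zero = z.
Hypothesis K1 : forall z, K z one = Theta (xi z) (khat z).

Local Notation c1 := (unit_segments R).
Local Notation c2 := (square_segments R).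

Lemma K_path z : continuous (K z).
Proof.
have := @K_cont (fun=> z) (@cst_continuous _ _ _).
move=> /(continuous_compose (f := fun t : I => (zero, t))); apply.
by apply: continuous_pair; [exact: cst_continuous|move=> t; exact: cvg_id].
Qed.

(** Uniqueness of lifts: the parameters at which the two lifts of [b] agree form a nonempty, open
    and closed subset of the interval. *)
Lemma khat_lift (g : I -> Z) : continuous g -> forall t,
  khat (g t) = pmul (khat (g zero)) (sg c1 (fun t => xi (g t)) zero t).
Proof.
move=> cg; pose b t := xi (g t).
have cb : continuous b := continuous_compose cg xi_cont.
pose P t := khat (g t) = pmul (khat (g zero)) (sg c1 b zero t).
have fk t : pfib x0 (b t) (pmul (khat (g zero)) (sg c1 b zero t)).
  by apply: pfib_mul (khat_fib _) _; exact: pfib_sg.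
(* Both lifts have the same continuations to the centre of one chart at [t] and at [t'], so they
   agree at both parameters or at neither. *)
have loc t : \forall t' \near t, P t <-> P t'.
  have [a at_] := ch_cover (b t).
  have n1 := cg t _ (khat_near at_).
  have n2 := chart_near c1 cb at_.
  near=> t'.
  have h1 : pmul (khat (g t')) (pcls (ch_path (ch a) (b t'))) =
            pmul (khat (g t)) (pcls (ch_path (ch a) (b t))) by near: t'.
  have [d2 h2] : ch_dom (ch a) (b t') /\
     pmul (sg c1 b t t') (pcls (ch_path (ch a) (b t'))) = pcls (ch_path (ch a) (b t)).
    by near: t'.
  have h3 : pmul (pmul (khat (g zero)) (sg c1 b zero t')) (pcls (ch_path (ch a) (b t'))) =
     pmul (pmul (khat (g zero)) (sg c1 b zero t)) (pcls (ch_path (ch a) (b t))).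
    by rewrite -h2 -(sg_mul c1 zero t t' cb) !pmulA.
  have q t1 B : ch_dom (ch a) (b t1) -> pfib x0 (b t1) B ->
     khat (g t1) = B <-> pmul (khat (g t1)) (pcls (ch_path (ch a) (b t1))) =
     pmul B (pcls (ch_path (ch a) (b t1))).
    move=> dt1 fB; split=> [->//|E].
    by rewrite (chart_mulK dt1 (khat_fib (g t1))) E -(chart_mulK dt1 fB).
  by rewrite /P q // q // h1 h3.
suff : [set t | P t] = setT by move=> PT t; have : [set t | P t] t by rewrite PT.
apply: (@unit_connected R); rewrite ?setTI.
- exists zero; rewrite /= /P sg_id.
  have [f [cf _ f1 ->]] := khat_fib (g zero).
  by rewrite -[b zero]f1 pmulp1.
- exists [set t | P t]; rewrite ?setTI // openE => t /= Pt.
  by have := loc t; apply: filterS => t' [h _]; exact: h.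
- exists [set t | P t]; rewrite ?setTI //; rewrite -openC openE => t /= Pt.
  by have := loc t; apply: filterS => t' [_ h] /h.
Unshelve. all: by end_near. Qed.

(** Follow the track of [K] from [z], then [Theta] along a lift of a path that represents the
    difference of [khat z] and [khat z'], then the track of [z'] backwards. *)
Lemma dominated_path (z z' : Z) : inhabited {path I from z to z'}.
Proof.
have [f [cf f0 f1 fE]] := khat_fib z; have [g [cg g0 g1 gE]] := khat_fib z'.
pose b := pconc (revp f) g.
have fg : revp f one = g zero by rewrite revp1 f0 g0.
have cb : continuous b by apply: pconc_cont => //; exact: revp_cont.
have b0 : b zero = xi z by rewrite /b pconc0 revp0.
have b1 : b one = xi z' by rewrite /b pconc1.
have bE : pmul (khat z) (pcls b) = khat z'.
  rewrite fE gE /b -pmul_cls //; last exact: revp_cont.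
  by rewrite pmulA pmulpV // f0 -g0 pmul1p.
have kb : pfib x0 (b zero) (khat z) by rewrite b0; exact: khat_fib.
pose th t := Theta (b t) (pmul (khat z) (sg c1 b zero t)).
have cth : continuous th := @Theta_lift _ c1 b zero _ cb kb.
have th0 : th zero = K z one.
  by rewrite /th sg_id K1 b0 fE -f1 pmulp1.
have th1 : th one = K z' one.
  rewrite /th K1 b1; congr Theta; rewrite -bE; congr pmul.
  (* The segment from [zero] to [one] is the identity of the interval, so [sg] along it is the class
     of [b] itself. *)
  rewrite -[X in sg _ _ X one](unit_lerp0 zero one) -[X in sg _ _ _ X](unit_lerp1 zero one).
  rewrite -(sgE c1 cb (@seg_cont _ _ c1 zero one)); congr pcls; apply/funext => t.
  congr b; apply: val_inj; rewrite val_unit_lerp val_zero val_one; lra.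
have cK := K_path.
have c1' : continuous (pconc (K z) th) by exact: pconc_cont.
have c2' : continuous (pconc (pconc (K z) th) (revp (K z'))).
  by apply: pconc_cont => //; [exact: revp_cont|rewrite pconc1 revp0 th1].
by constructor; apply: (mk_path c2'); rewrite ?pconc0 ?pconc1 ?revp1 ?K0.
Qed.

(** The homotopy [K] conjugates the loop [al] to the loop of its images under [Theta]; the latter
    factors through the lift of a contractible loop of [T]. *)
Lemma dominated_simply_connected : simply_connected R Z.
Proof.
split; first exact: dominated_path.
move=> z l; rewrite -[l]loop_class_repr; apply/loop_classP; apply: path_of_phmt.
set al := repr l; have cal : continuous al by exact: cts_fun.
have al0 : al zero = z by exact: path_zero.
have al1 : al one = z by exact: path_one.
pose b t := xi (al t); have cb : continuous b := continuous_compose cal xi_cont.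
have bloop : b one = b zero by rewrite /b al0 al1.
pose F (p : I * I) := K (al p.1) p.2.
have cF : continuous F by exact: K_cont.
have id_c : continuous (id : I -> I) by move=> t; exact: cvg_id.
have cst_c (x : I) : continuous (fun _ : I => x) by exact: cst_continuous.
pose bot (t : I) : I * I := (t, zero); pose top (t : I) : I * I := (t, one).
pose lft (t : I) : I * I := (zero, t); pose rgt (t : I) : I * I := (one, t).
have cbot : continuous bot by apply: continuous_pair.
have ctop : continuous top by apply: continuous_pair.
have clft : continuous lft by apply: continuous_pair.
have crgt : continuous rgt by apply: continuous_pair.
have cFf (u : I -> I * I) : continuous u -> continuous (fun t => F (u t)).
  by move=> cu; exact: (continuous_compose cu cF).
(* The boundary of the square [F]: its bottom is [al], and its left and right sides are both the
   track of [z]. *)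
have E1 : pcls al = pmul (pcls (fun t => F (lft t)))
    (pmul (pcls (fun t => F (top t))) (pcls (revp (fun t => F (rgt t))))).
  have -> : (al : I -> Z) = fun t => F (bot t) by apply/funext => t; rewrite /F K0.
  have cp : continuous (revp (fun t => F (rgt t))) by apply: revp_cont; exact: cFf.
  have E := square_pmul cF.
  rewrite pmulA -[X in pmul X _]E -pmulA pmulpV; last exact: cFf.
  rewrite (_ : F (rgt zero) = F (bot one)) //.
  by rewrite (@pmulp1 _ _ (fun t => F (bot t))) //; exact: cFf.
have E2 : pcls (fun t => F (top t)) = pcls (fun=> K z one).
  (* As [al] is a loop, its lift returns to [khat z]; cancelling [khat z] shows that [b] is
     null-homotopic. *)
  have kz : khat z = pmul (khat z) (pcls b).
    have := khat_lift cal one; rewrite al1 al0 => {1}->; congr pmul.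
    rewrite -[X in sg _ _ X one](unit_lerp0 zero one) -[X in sg _ _ _ X](unit_lerp1 zero one).
    rewrite -(sgE c1 cb (@seg_cont _ _ c1 zero one)); congr pcls; apply/funext => t.
    rewrite /b; congr (xi (al _)); apply: val_inj; rewrite val_unit_lerp val_zero val_one; lra.
  have [f [cf f0 f1 fE]] := khat_fib z.
  have bn : phmt b (fun=> b zero).
    apply: pcls_inj; first exact: cst_continuous.
    have fb : f one = b zero by rewrite f1 /b al0.
    have := congr1 (pmul (pcls (revp f))) kz; rewrite fE pmulA pmulVp //.
    by rewrite fb pmul1p.
  have [H [cH H0 H1 He]] := bn.
  have kH : pfib x0 (H (zero, zero)) (khat z) by rewrite H0 /b al0; exact: khat_fib.
  (* The null-homotopy [H] of [b] is lifted from its corner [(zero, zero)] with initial class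
     [khat z], and [Theta] is applied to the lift. *)
  pose G q := Theta (H q) (pmul (khat z) (sg c2 H (zero, zero) q)).
  have cG : continuous G := @Theta_lift _ c2 _ _ _ cH kH.
  have sgc (u v : I * I) (g : I -> I * I) x : continuous g -> g zero = u -> g one = v ->
      (forall t, H (g t) = x) -> sg c2 H u v = pcls (fun=> x).
    move=> cg <- <- gx; rewrite -(sgE c2 cH cg); congr pcls.
    by apply/funext => t; exact: gx.
  have kc : pmul (khat z) (pcls (fun=> b zero)) = khat z.
    by rewrite fE /b al0 -f1 pmulp1.
  have side s : sg c2 H (zero, zero) (s, zero) = pcls (fun=> b zero).
    apply: (sgc _ _ (fun t => (unit_lerp zero s t, zero))).
    - by apply: continuous_pair; [exact: (@seg_cont _ _ c1)|exact: cst_continuous].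
    - by rewrite unit_lerp0.
    - by rewrite unit_lerp1.
    - by move=> t; have [] := He (unit_lerp zero s t).
  have topE t : sg c2 H (zero, zero) (one, t) = pcls (fun=> b zero).
    rewrite -(sg_mul c2 (zero, zero) (one, zero) (one, t) cH) side.
    rewrite (@sgc (one, zero) (one, t) (fun r => (one, unit_lerp zero t r)) (b zero)).
    - have cc : continuous (fun _ : I => b zero) by exact: cst_continuous.
      exact: (@pmulp1 _ _ (fun=> b zero)).
    - by apply: continuous_pair; [exact: cst_continuous|exact: (@seg_cont _ _ c1)].
    - by rewrite unit_lerp0.
    - by rewrite unit_lerp1.
    - by move=> r; rewrite H1.
  apply: pclsE; exists G; split=> [//|t|t|s].
  - rewrite /G /F /top /= K1 H0; congr Theta; rewrite khat_lift // al0; congr pmul.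
    rewrite -(@sg_comp R T _ _ c2 c1 H lft zero t cH clft); congr (sg c1 _ _ _).
    by apply/funext => r; rewrite /lft H0.
  - by rewrite /G H1 topE kc K1 /b al0.
  - rewrite /G /F /top /= side kc al0 al1 !K1; have [-> _] := He s.
    rewrite /b al0; split=> //.
    have -> : H (s, one) = xi z by have [_ ->] := He s; rewrite /b al1.
    (* The far end is reached along the side [(zero, t)], which is [b], and then along a side on
       which [H] is constant. *)
    congr Theta; rewrite -(sg_mul c2 (zero, zero) (zero, one) (s, one) cH).
    rewrite (@sgc (zero, one) (s, one) (fun r => (unit_lerp zero s r, one)) (b one)).
    + rewrite -(@sg_comp R T _ _ c2 c1 H lft zero one cH clft) pmulA.
      have -> : sg c1 (fun x => H (lft x)) zero one = sg c1 b zero one.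
        by congr (sg c1 _ _ _); apply/funext => r; rewrite /lft H0.
      have := khat_lift cal one; rewrite al0 al1 => <-.
      by rewrite bloop kc.
    + by apply: continuous_pair; [exact: (@seg_cont _ _ c1)|exact: cst_continuous].
    + by rewrite unit_lerp0.
    + by rewrite unit_lerp1.
    + by move=> r; have [] := He (unit_lerp zero s r).
apply: pcls_inj; first exact: cst_continuous.
rewrite E1 E2; have cp : continuous (revp (fun t => F (rgt t))) by apply: revp_cont; exact: cFf.
have -> : (fun=> K z one) = (fun _ : I => revp (fun t => F (rgt t)) zero).
  by apply/funext => _; rewrite revp0 /F /rgt /= al1.
rewrite pmul1p // (_ : (fun t => F (rgt t)) = (fun t => F (lft t))).
  by rewrite pmulpV; [rewrite /F /lft /= K0 al0|exact: cFf].
by apply/funext => t; rewrite /F /= al0 al1.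
Qed.

End UniversalCoverDomination.

(** * Disjoint unions and finite subcovers *)

Lemma sigT_cont_at (J : choiceType) (E : J -> topologicalType) (V Z : topologicalType)
    (F : {j & E j} -> V -> Z) (j : J) (p : E j) (r : V) :
  {for (p, r), continuous (fun q : E j * V => F (existT E j q.1) q.2)} ->
  {for (existT E j p, r), continuous (fun q : {j & E j} * V => F q.1 q.2)}.
Proof.
move=> cF O /= nO; have := cF O nO; rewrite /= => -[[A B] /= [nA nB] AB].
exists (existT E j @` A, B) => /=.
  split=> //; apply: (@filterS _ _ _ (existT E j @` A)) => //.
  rewrite /nbhs /= sigT_nbhsE /=; apply: filterS nA => a Aa; by exists a.
by move=> [[j' a] v] /= [[b Ab <-] Bv]; exact: (AB (b, v)).
Qed.

(** Near-covering compactness is applied to the filter of finite index sets that contain a given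
    one. *)
Lemma compact_fin_cover (T : topologicalType) (A : set T) (J : choiceType)
    (f : J -> set T) : compact A -> (forall j, open (f j)) ->
  (forall x, A x -> exists j, f j x) ->
  exists D : {fset J}, forall x, A x -> exists2 j, j \in D & f j x.
Proof.
move=> /compact_near_coveringP cA of_ cov.
pose F : set_system {fset J} := [set P | exists D0, forall D, (D0 `<=` D)%fset -> P D].
have FF : Filter F.
  split=> [|P Q [D1 h1] [D2 h2]|P Q PQ [D0 h]].
  - by exists fset0.
  - exists (D1 `|` D2)%fset => D; rewrite fsubUset => /andP[/h1 ? /h2 ?].
    by split.
  - by exists D0 => D /h; exact: PQ.
have [D0 h] : \forall D \near F, A `<=` [set x | exists2 j, j \in D & f j x].
  apply: (cA _ F (fun D => [set x | exists2 j, j \in D & f j x])) => x /cov [j fjx].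
  exists (f j, [set D | j \in D]) => /=.
    split; first exact: open_nbhs_nbhs.
    by exists [fset j]%fset => D; rewrite fsub1set.
  by move=> [x' D] /= [fjx' jD]; exists j.
by exists D0 => x; exact: h.
Qed.

(** * Charts of a square complex *)

Section DyadicPositions.
Variable R : realType.
Local Notation I := (unit_interval R).

(** [Some b] stands for an end and [None] for the midpoint: these are the vertices of the
    barycentric subdivision of the interval, and pairs of them those of the square. *)
Definition pos_pt (i : option bool) : I := if i is Some b then unit_end R b else clamp 2^-1.

Definition pos_flip (o : bool) (i : option bool) := omap (addb^~ o) i.

(* The part of the unit interval that is pushed to [pos_pt i]. *)
Definition pos_near (i : option bool) (t : I) : bool :=
  match i with
  | None => 0 < val t < 1
  | Some false => val t < 2^-1
  | Some true => 2^-1 < val t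
  end.

(** The first argument is the coordinate transverse to a side: [mkdir d (unit_end R b) t] runs along
    [side s d b] for both values of [d]. *)
Definition mkdir (U : Type) (d : bool) (x y : U) : U * U := if d then (x, y) else (y, x).

Definition pos2_pt (ij : option bool * option bool) : I * I := (pos_pt ij.1, pos_pt ij.2).
Definition pos2_near (ij : option bool * option bool) (p : I * I) : bool :=
  pos_near ij.1 p.1 && pos_near ij.2 p.2.

Lemma val_half : val (clamp 2^-1 : I) = 2^-1.
Proof. by rewrite val_clamp //; lra. Qed.

Lemma val_end b : val (unit_end R b) = b%:R.
Proof. by case: b; rewrite /unit_end ?val_one ?val_zero. Qed.

Lemma val_flip o (t : I) : val (unit_flip o t) = if o then 1 - val t else val t.
Proof.
case: o; rewrite /unit_flip // val_clamp //; have := unit_intervalP t; lra.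
Qed.

Lemma pos_near_end i b : pos_near i (unit_end R b) = (i == Some b).
Proof.
case: i => [[]|]; case: b; rewrite /pos_near val_end /= ?mulr1n ?mulr0n;
  try (by case: ltP => h //; exfalso; lra).
all: by rewrite /= ?ltxx ?andbF.
Qed.

Lemma pos_near_half i : pos_near i (clamp 2^-1) = (i == None).
Proof.
case: i => [[]|]; rewrite /pos_near val_half ?ltxx //=.
by rewrite invr_gt0 ltr0n invf_lt1 ?ltr0n ?ltr1n.
Qed.

Lemma pos_near_flip o i (t : I) : pos_near (pos_flip o i) (unit_flip o t) = pos_near i t.
Proof.
rewrite /pos_near !val_flip; case: o i => [] [[]|] //=; apply/idP/idP; lra.
Qed.

Lemma pos_flipK o i : pos_flip o (pos_flip o i) = i.
Proof. by case: o i => [] [[]|]. Qed.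

Lemma val_pos_pt i : val (pos_pt i) = if i is Some b then b%:R else 2^-1.
Proof. by case: i => [b|]; [exact: val_end|exact: val_half]. Qed.

Lemma pos_pt_flip o i : pos_pt (pos_flip o i) = unit_flip o (pos_pt i).
Proof.
apply: val_inj; rewrite val_flip !val_pos_pt; case: o i => [] [[]|] //=; lra.
Qed.

Lemma unit_flipK o : involutive (@unit_flip R o).
Proof. by move=> t; apply: val_inj; rewrite !val_flip; case: o => //; lra. Qed.

Lemma unit_flip_lerp o (a b t : I) :
  unit_flip o (unit_lerp a b t) = unit_lerp (unit_flip o a) (unit_flip o b) t.
Proof.
by apply: val_inj; rewrite val_flip !val_unit_lerp !val_flip; case: o => //; lra.
Qed.

Lemma unit_flip_cont o : continuous (@unit_flip R o).
Proof.
case: o => [|t]; last exact: cvg_id.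
have -> : @unit_flip R true = fun t => clamp (-1 * val t + 1).
  by apply/funext => t; rewrite /unit_flip; congr clamp; lra.
by apply: clamp_affine_continuous => t; exact: cvg_id.
Qed.

Lemma pos_near_exists (t : I) : exists i, pos_near i t.
Proof.
have [h|h|h] := ltgtP (val t) 2^-1; first by exists (Some false).
  by exists (Some true).
by exists None; rewrite /pos_near h; lra.
Qed.

Lemma pos_near_open i : open [set t : I | pos_near i t].
Proof.
have o1 (c : R) : open [set t : I | val t < c].
  by have /continuousP h := @val_continuous R; exact: (h _ (@open_lt R c)).
have o2 (c : R) : open [set t : I | c < val t].
  by have /continuousP h := @val_continuous R; exact: (h _ (@open_gt R c)).
case: i => [[]|]; [exact: o2|exact: o1|].
have -> : [set t : I | pos_near None t] = [set t : I | 0 < val t] `&` [set t | val t < 1].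
  by apply/seteqP; split=> t /= => [/andP|[-> ->]].
exact: openI.
Qed.

Lemma pos2_near_open ij : open [set p : I * I | pos2_near ij p].
Proof.
have -> : [set p : I * I | pos2_near ij p] = [set t | pos_near ij.1 t] `*` [set t | pos_near ij.2 t].
  by apply/seteqP; split=> -[a b] /= => [/andP|[h1 h2]] //; apply/andP.
rewrite openE => -[a b] /= [h1 h2].
by exists ([set t | pos_near ij.1 t], [set t | pos_near ij.2 t]) => //=; split;
  apply: open_nbhs_nbhs; split=> //; exact: pos_near_open.
Qed.

End DyadicPositions.

Section SquareCharts.
Variables (R : realType) (X : VH_complex).
Local Notation I := (unit_interval R).
Local Notation T := (square_realization R X).
Local Notation pr := (glued_class (@square_attach R X)).
Local Notation half := (clamp 2^-1 : I).

Definition vp (v : vertex X) : T := pr (vertex_point R v).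
Definition em (e : edge X) (t : I) : T := pr (edge_point e t).
Definition sm (s : square X) (p : I * I) : T := pr (square_point s p).

Lemma em_cont e : continuous (em e).
Proof.
apply: (continuous_compose _ (@glued_class_continuous _ _)).
exact: (@existT_continuous _ (@cell_space R X) (inl (inr e))).
Qed.

Lemma sm_cont s : continuous (sm s).
Proof.
apply: (continuous_compose _ (@glued_class_continuous _ _)).
exact: (@existT_continuous _ (@cell_space R X) (inr s)).
Qed.

Lemma em_end e b : em e (unit_end R b) = vp (endpoint e b).
Proof. by apply/esym/glued_classP/rst_step/EndpointAttach. Qed.

Lemma sm_side s d b t :
  sm s (mkdir d (unit_end R b) t) = em (side s d b).1 (unit_flip (side s d b).2 t).
Proof.
apply/esym/glued_classP/rst_step.
have := @SideAttach R X s d b (unit_flip (side s d b).2 t).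
by rewrite unit_flipK; rewrite /side_point /mkdir.
Qed.

Lemma sm_corner s a b : sm s (unit_end R a, unit_end R b) = vp (corner s a b).
Proof. by apply/esym/glued_classP/rst_step/CornerAttach. Qed.

Lemma cell_pointP (a : {c & @cell_space R X c}) :
  [\/ exists v, a = vertex_point R v, exists e t, a = edge_point e t |
      exists s p, a = square_point s p].
Proof.
case: a => -[[v|e]|s] p; last by constructor 3; exists s, p.
- constructor 1; exists v; rewrite /vertex_point; congr existT.
  by apply: val_inj => /=; case: p => r /= /set_mem.
- by constructor 2; exists e, p.
Qed.

Definition edge_face (e : edge X) (i : option bool) : cell X :=
  if i is Some b then inl (inl (endpoint e b)) else inl (inr e).

Definition square_face (s : square X) (ij : option bool * option bool) : cell X :=
  match ij with
  | (Some a, Some b) => inl (inl (corner s a b))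
  | (Some a, None) => inl (inr (side s true a).1)
  | (None, Some b) => inl (inr (side s false b).1)
  | (None, None) => inr s
  end.

Lemma square_face_side s d b j :
  square_face s (mkdir d (Some b) j) = edge_face (side s d b).1 (pos_flip (side s d b).2 j).
Proof.
by case: d j => -[a|] //=; [rewrite endpoint_side1|rewrite endpoint_side2].
Qed.

Definition cell_ctr (c : cell X) : T :=
  match c with
  | inl (inl v) => vp v
  | inl (inr e) => em e half
  | inr s => sm s (half, half)
  end.

Lemma em_pos e i : em e (pos_pt R i) = cell_ctr (edge_face e i).
Proof. by case: i => [b|//]; rewrite /= em_end. Qed.

Lemma sm_pos s ij : sm s (pos2_pt R ij) = cell_ctr (square_face s ij).
Proof.
have sp d b j : sm s (mkdir d (unit_end R b) (pos_pt R j)) =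
    cell_ctr (square_face s (mkdir d (Some b) j)).
  by rewrite square_face_side sm_side -em_pos pos_pt_flip.
case: ij => -[a|] [b|] //; first exact: (sp true).
  exact: (sp true).
exact: (sp false).
Qed.

(** A closed cell may be attached to [c] at several positions, so its part of the star can have
    several components, one for each position. *)
Definition in_star (c : cell X) (a : {c & @cell_space R X c}) : Prop :=
  match a with
  | existT (inl (inl v)) _ => c = inl (inl v)
  | existT (inl (inr e)) t => exists i, edge_face e i = c /\ pos_near i (t : I)
  | existT (inr s) p => exists ij, square_face s ij = c /\ pos2_near ij (p : I * I)
  end.

(** The straight line to the position near the point. The choice made by [pick] does not matter,
    since over the star this position is unique; away from the star the path is constant. *)
Definition star_path (c : cell X) (a : {c & @cell_space R X c}) (r : I) : T :=
  match a with
  | existT (inl (inl v)) _ => vp v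
  | existT (inl (inr e)) t =>
      if [pick i | (edge_face e i == c) && pos_near i (t : I)] is Some i
      then em e (unit_lerp (t : I) (pos_pt R i) r) else em e t
  | existT (inr s) p =>
      if [pick ij | (square_face s ij == c) && pos2_near ij (p : I * I)] is Some ij
      then sm s (lerp (square_segments R) (p : I * I) (pos2_pt R ij) r) else sm s p
  end.

(** The ends of a loop are one vertex, but the regions [t < 1/2] and [1/2 < t] are disjoint; the
    middle position has the edge itself as its face. *)
Lemma edge_pos_uniq e i j (t : I) : edge_face e i = edge_face e j ->
  pos_near i t -> pos_near j t -> i = j.
Proof.
case: i j => [[]|] [[]|] //= _; rewrite /pos_near => h1 h2; exfalso; lra.
Qed.

(* Two sides of [s] in different directions are never glued together, since one
   is vertical and the other horizontal. *)
Lemma square_pos_uniq s ij kl (p : I * I) : square_face s ij = square_face s kl ->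
  pos2_near ij p -> pos2_near kl p -> ij = kl.
Proof.
have nb a b : pos_near (Some a) (p.1) -> pos_near (Some b) p.1 -> a = b.
  by case: a b => [] [] //=; rewrite /pos_near => h1 h2; exfalso; lra.
have nb2 a b : pos_near (Some a) (p.2) -> pos_near (Some b) p.2 -> a = b.
  by case: a b => [] [] //=; rewrite /pos_near => h1 h2; exfalso; lra.
have vh a b : (side s true a).1 <> (side s false b).1.
  by move=> E; have := VH_alternating s a b; rewrite E; case: vertical.
case: ij kl => -[a|] [b|] [[a'|] [b'|]] //= E; rewrite /pos2_near => /andP[h1 h2] /andP[h3 h4].
- by rewrite (nb _ _ h1 h3) (nb2 _ _ h2 h4).
- by rewrite (nb _ _ h1 h3).
- by case: E => /vh.
- by case: E => /esym/vh.
- by rewrite (nb2 _ _ h2 h4).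
Qed.

Lemma star_path_edge c e (t : I) i : edge_face e i = c -> pos_near i t ->
  star_path c (edge_point e t) = fun r => em e (unit_lerp t (pos_pt R i) r).
Proof.
move=> ec it; rewrite /star_path /=; apply/funext => r.
case: pickP => [j /andP[/eqP je jt]|/(_ i)]; last by rewrite ec eqxx it.
by rewrite (@edge_pos_uniq e i j t) // ec.
Qed.

Lemma star_path_square c s (p : I * I) ij : square_face s ij = c -> pos2_near ij p ->
  star_path c (square_point s p) = fun r => sm s (lerp (square_segments R) p (pos2_pt R ij) r).
Proof.
move=> ec it; rewrite /star_path /=; apply/funext => r.
case: pickP => [j /andP[/eqP je jt]|/(_ ij)]; last by rewrite ec eqxx it.
by rewrite (@square_pos_uniq s ij j p) // ec.
Qed.

Lemma pos2_near_end ij a b : pos2_near ij (unit_end R a, unit_end R b) = (ij == (Some a, Some b)).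
Proof. by rewrite /pos2_near /= !pos_near_end; case: ij. Qed.

Lemma pos2_near_side ij d b (t : I) : pos2_near ij (mkdir d (unit_end R b) t) ->
  exists2 j, ij = mkdir d (Some b) j & pos_near j t.
Proof.
case: ij => i j; case: d; rewrite /pos2_near /= pos_near_end.
  by move=> /andP[/eqP-> jt]; exists j.
by move=> /andP[it /eqP->]; exists i.
Qed.

Lemma pos2_near_mkdir d i j (t u : I) :
  pos2_near (mkdir d i j) (mkdir d t u) = pos_near i t && pos_near j u.
Proof. by case: d => //; rewrite /pos2_near andbC. Qed.

Lemma in_star_attach c a b : square_attach a b -> in_star c a <-> in_star c b.
Proof.
case=> {a b} [e b|s d b t|s a b].
- split=> [->|[i [<-]]] /=; first by exists (Some b); rewrite pos_near_end eqxx.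
  by rewrite pos_near_end => /eqP ->.
- rewrite (_ : side_point d b _ = mkdir d (unit_end R b) (unit_flip (side s d b).2 t)) //.
  split=> /= [[i [ec it]]|[ij [ec]]].
    exists (mkdir d (Some b) (pos_flip (side s d b).2 i)).
    rewrite square_face_side pos_flipK; split=> //.
    by rewrite pos2_near_mkdir pos_near_end eqxx pos_near_flip it.
  move=> /pos2_near_side [j jE jt]; move: ec; rewrite jE square_face_side => ec.
  exists (pos_flip (side s d b).2 j); split=> //.
  by rewrite -(pos_near_flip (side s d b).2) pos_flipK.
- split=> /= [->|[ij [<-]]]; first by exists (Some a, Some b); rewrite pos2_near_end eqxx.
  by rewrite pos2_near_end => /eqP ->.
Qed.

Lemma star_path_attach c a b : square_attach a b -> in_star c a ->
  star_path c a = star_path c b.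
Proof.
case=> {a b} [e b|s d b t|s a b] /=.
- move=> ->; rewrite (@star_path_edge _ e (unit_end R b) (Some b)) // ?pos_near_end //.
  by apply/funext => r /=; rewrite unit_lerpp em_end.
- rewrite (_ : side_point d b _ = mkdir d (unit_end R b) (unit_flip (side s d b).2 t)) //.
  move=> [i [ec it]]; rewrite (star_path_edge ec it).
  rewrite (@star_path_square c s _ (mkdir d (Some b) (pos_flip (side s d b).2 i))).
  + apply/funext => r; set o := (side s d b).2.
    have -> : lerp (square_segments R) (mkdir d (unit_end R b) (unit_flip o t))
       (pos2_pt R (mkdir d (Some b) (pos_flip o i))) r =
       mkdir d (unit_end R b) (unit_flip o (unit_lerp t (pos_pt R i) r)).
      rewrite unit_flip_lerp -pos_pt_flip.
      by case: (d); rewrite /= /prod_lerp /= unit_lerpp.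
    by rewrite sm_side unit_flipK.
  + by rewrite square_face_side pos_flipK.
  + by rewrite pos2_near_mkdir pos_near_end eqxx pos_near_flip it.
- move=> ->; rewrite (@star_path_square _ s _ (Some a, Some b)) // ?pos2_near_end //.
  by apply/funext => r; rewrite lerpp sm_corner.
Qed.

Definition star (c : cell X) : set T := [set x | in_star c (repr x)].

Lemma starP c a : star c (pr a) <-> in_star c a.
Proof.
rewrite /star /=.
rewrite (@glued_lift _ _ _ (in_star c) setT) // => {}a b ab _.
by apply/propext; exact: in_star_attach.
Qed.

Lemma star_open c : open (star c).
Proof.
have -> : star c = [set x | star c x] by [].
apply/glued_open; rewrite openE => a; rewrite /= => /starP; rewrite /interior.
have [[v ->]|[e [t ->]]|[s [p ->]]] := cell_pointP a.
- move=> h; rewrite /nbhs /= sigT_nbhsE /=.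
  by apply: filterE => -[r r0]; apply/starP.
- move=> [i [ec it]]; rewrite /nbhs /= sigT_nbhsE /=.
  have : nbhs t [set t : I | pos_near i t] by apply: open_nbhs_nbhs; split=> //; exact: pos_near_open.
  by apply: filterS => t' it'; apply/starP; exists i.
- move=> [ij [ec it]]; rewrite /nbhs /= sigT_nbhsE /=.
  have : nbhs p [set p : I * I | pos2_near ij p] by apply: open_nbhs_nbhs; split=> //; exact: pos2_near_open.
  by apply: filterS => t' it'; apply/starP; exists ij.
Qed.

Lemma star_path_cont c a r : star c (pr a) ->
  {for (a, r), continuous (fun p => star_path c p.1 p.2)}.
Proof.
move=> /starP; have [[v ->]|[e [t ->]]|[s [p ->]]] := cell_pointP a.
- by move=> _; apply: sigT_cont_at => /=; exact: cst_continuous.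
- move=> [i [ec it]]; apply: sigT_cont_at => /=.
  have : nbhs t [set t : I | pos_near i t] by apply: open_nbhs_nbhs; split=> //; exact: pos_near_open.
  move=> nt.
  have E : \forall q \near (t, r), em e (unit_lerp q.1 (pos_pt R i) q.2) =
       star_path c (edge_point e q.1) q.2.
    exists ([set t : I | pos_near i t], setT) => /=; first by split=> //; exact: filterT.
    by move=> [t' r'] [/= it' _]; have := congr1 (@^~ r') (star_path_edge ec it') => /= ->.
  have cc : continuous (fun q : I * I => em e (unit_lerp q.1 (pos_pt R i) q.2)).
    apply: (continuous_compose _ (@em_cont e)).
    apply: (lerp_comp_cont (c := unit_segments R)).
    + exact: fst_continuous.
    + exact: cst_continuous.
    + exact: snd_continuous.
  have h := cvg_trans (near_eq_cvg E) (cc (t, r)).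
  by move: h; rewrite /= (nbhs_singleton E); apply.
- move=> [i [ec it]]; apply: sigT_cont_at => /=.
  have : nbhs p [set p : I * I | pos2_near i p] by apply: open_nbhs_nbhs; split=> //; exact: pos2_near_open.
  move=> nt.
  have E : \forall q \near (p, r), sm s (lerp (square_segments R) q.1 (pos2_pt R i) q.2) =
       star_path c (square_point s q.1) q.2.
    exists ([set p : I * I | pos2_near i p], setT) => /=; first by split=> //; exact: filterT.
    by move=> [t' r'] [/= it' _]; have := congr1 (@^~ r') (star_path_square ec it') => /= ->.
  have cc : continuous (fun q : (I * I) * I => sm s (lerp (square_segments R) q.1 (pos2_pt R i) q.2)).
    apply: (continuous_compose _ (@sm_cont s)).
    apply: (lerp_comp_cont (c := square_segments R)).
    + exact: fst_continuous.
    + exact: cst_continuous.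
    + exact: snd_continuous.
  have h := cvg_trans (near_eq_cvg E) (cc (p, r)).
  by move: h; rewrite /= (nbhs_singleton E); apply.
Qed.

Lemma star_path0 c a : star_path c a zero = pr a.
Proof.
have [[v ->]|[e [t ->]]|[s [p ->]]] := cell_pointP a; rewrite /star_path //=.
  by case: pickP => [i _|_] //; rewrite unit_lerp0.
by case: pickP => [i _|_] //; have /= -> := lerp0 (square_segments R) p (pos2_pt R i).
Qed.

Lemma star_path1 c a : in_star c a -> star_path c a one = cell_ctr c.
Proof.
have [[v ->]|[e [t ->]]|[s [p ->]]] := cell_pointP a.
- by move=> ->.
- by move=> [i [ec it]]; rewrite (star_path_edge ec it) unit_lerp1 em_pos ec.
- by move=> [i [ec it]]; rewrite (star_path_square ec it) lerp1 sm_pos ec.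
Qed.

Definition chart_path c (x : T) : I -> T := star_path c (repr x).

Lemma chart_pathE c a : in_star c a -> chart_path c (pr a) = star_path c a.
Proof.
move=> /starP h; apply: (@glued_lift _ _ _ (star_path c) (star c)) => // {h}a b ab /starP.
exact: star_path_attach.
Qed.

Lemma chart_path2_cont c (S : topologicalType) (u : S -> T) : continuous u ->
  (forall s, star c (u s)) -> continuous (fun p : S * I => chart_path c (u p.1) p.2).
Proof.
move=> cu su; apply: (@glued_homotopy _ _ R T S (star_path c) (star c)) => //.
- exact: star_open.
- by move=> a r; exact: star_path_cont.
- by move=> a b ab /starP; exact: star_path_attach.
Qed.

Lemma chart_path_cont c x : star c x -> continuous (chart_path c x).
Proof.
move=> cx; have := @chart_path2_cont c T (fun=> x) (@cst_continuous _ _ _) (fun=> cx).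
move=> /(continuous_compose (f := fun r : I => (x, r))); apply.
by apply: continuous_pair; [exact: cst_continuous|move=> t; exact: cvg_id].
Qed.

Lemma chart_path0 c x : star c x -> chart_path c x zero = x.
Proof. by move=> _; rewrite /chart_path star_path0 glued_class_repr. Qed.

Lemma chart_path1 c x : star c x -> chart_path c x one = cell_ctr c.
Proof. exact: star_path1. Qed.

(** Contracting the path [g] to the centre sweeps out a square whose top is constant; [square_pmul]
    reads off its boundary. *)
Lemma chart_coh c (g : I -> T) : continuous g -> (forall t, star c (g t)) ->
  pmul (pcls g) (pcls (chart_path c (g one))) = pcls (chart_path c (g zero)).
Proof.
move=> cg sg; have := square_pmul (chart_path2_cont cg sg) => /=.
have -> : (fun t => chart_path c (g t) zero) = g by apply/funext => t; rewrite chart_path0.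
have -> : (fun t => chart_path c (g t) one) = fun=> chart_path c (g zero) one.
  by apply/funext => t; rewrite !chart_path1.
by rewrite pmulp1 //; exact: chart_path_cont.
Qed.

Definition cell_chart (c : cell X) : chart R T :=
  Chart (@star_open c) (@chart_path_cont c) (@chart_path0 c) (@chart_path1 c) (@chart_coh c).

Lemma cell_chart_cover x : exists c, ch_dom (cell_chart c) x.
Proof.
rewrite -[x]glued_class_repr; have [[v ->]|[e [t ->]]|[s [p ->]]] := cell_pointP (repr x).
- by exists (inl (inl v)); apply/starP.
- have [i it] := pos_near_exists t.
  by exists (edge_face e i); apply/starP; exists i.
- have [i it] := pos_near_exists p.1; have [j jt] := pos_near_exists p.2.
  by exists (square_face s (i, j)); apply/starP; exists (i, j); rewrite /pos2_near it jt.
Qed.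

Lemma star_ctr c c' : star c (cell_ctr c') -> c = c'.
Proof.
case: c' => [[v|e]|s] /starP //= => -[].
  by move=> i [<-]; rewrite pos_near_half => /eqP ->.
by move=> [i j] [<-]; rewrite /pos2_near /= !pos_near_half => /andP[/eqP-> /eqP->].
Qed.

(** The centre of a cell lies in the star of that cell only, so a finite subcover by stars involves
    every cell. *)
Lemma cells_finite : compact [set: T] -> finite_set [set: cell X].
Proof.
move=> cT; have [|x _|D cov] := @compact_fin_cover T _ _ (@star) cT.
- exact: star_open.
- exact: cell_chart_cover.
apply: (sub_finite_set _ (finite_fset D)) => c _.
by have [c' + /star_ctr <-] := cov (cell_ctr c) Logic.I.
Qed.

End SquareCharts.

Local Open Scope fset_scope.

(** * Complexes of tokens *)

(* The simplices are determined by the names of their vertices, so flagness and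
   full cycles, in particular those of links, can be checked on names. *)
Section NamedComplex.
Variables (Z : simplicial_complex) (N : choiceType).
Variable nm : forall s : simplex Z, verts s -> N.
Hypothesis nm_inj : forall s, injective (@nm s).
Hypothesis nm_attach : forall s t (f : {ffun verts s -> verts t}) x,
  attach f -> nm (f x) = nm x.
Hypothesis nm_det : forall s t : simplex Z,
  (forall n, (exists x : verts s, nm x = n) <-> (exists x : verts t, nm x = n)) -> s = t.

Definition nm_adj (a b : N) : Prop :=
  a <> b /\ exists s (x y : verts s), nm x = a /\ nm y = b.

Hypothesis nm_flag : forall K : set N, finite_set K -> K !=set0 ->
  (forall a, K a -> exists s (x : verts s), nm x = a) ->
  (forall a b, K a -> K b -> a <> b -> nm_adj a b) ->
  exists s, forall a, K a <-> exists x : verts s, nm x = a.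

Lemma vertex_elt (u : simplex Z) : is_vertex u -> exists x : verts u, forall y, y = x.
Proof.
by move=> /eqP /fintype1P [x xP]; exists x => y; rewrite xP.
Qed.

Lemma vertex_name_inj (u v : simplex Z) (x : verts u) (y : verts v) :
  is_vertex u -> is_vertex v -> nm x = nm y -> u = v.
Proof.
move=> /vertex_elt[x0 ux] /vertex_elt[y0 vy] xy; apply: nm_det => n.
split=> -[z <-]; first by exists y; rewrite -xy (ux x) (ux z).
by exists x; rewrite xy (vy y) (vy z).
Qed.

Lemma face_vertex (s : simplex Z) (x : verts s) : (1 < #|verts s|)%N ->
  exists (u : simplex Z) (f : {ffun verts u -> verts s}),
    [/\ is_vertex u, attach f & forall z, f z = x].
Proof.
move=> s1; have [|[u f] /= [[fa fE] _]] := @attach_face Z s [set x]%SET.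
  by rewrite cards1 s1.
have fx z : f z = x by apply/eqP; have := codom_f f z; rewrite -fE inE.
exists u, f; split=> //; rewrite /is_vertex.
have /card_gt0P[z0 _] := verts_gt0 u.
by apply/eqP/fintype1P; exists z0 => z; apply: (attach_inj fa); rewrite !fx.
Qed.

Lemma vertex_of_name (u s : simplex Z) (x : verts u) : is_vertex u ->
  (exists y : verts s, nm y = nm x) -> vertex_of u s.
Proof.
move=> uv [y yx]; split=> //.
have [s1|s1] := leqP #|verts s| 1; last first.
  have [u' [f [u'v fa fy]]] := face_vertex y s1.
  have /card_gt0P[z _] := verts_gt0 u'.
  have uu : u' = u by apply: (vertex_name_inj u'v uv (x := z) (y := x)); rewrite -(nm_attach z fa) fy.
  by subst u'; right; exists f.
left; apply: (vertex_name_inj (x := x) (y := y)) => //.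
by apply/eqP; rewrite eqn_leq s1 verts_gt0.
Qed.

Lemma vertex_ofE (u s : simplex Z) (x : verts u) : vertex_of u s ->
  exists y : verts s, nm y = nm x.
Proof.
move=> [uv [us|[f fa]]]; last by exists (f x); rewrite nm_attach.
by subst s; exists x.
Qed.

Lemma adjacent_nm (u v : simplex Z) (x : verts u) (y : verts v) :
  adjacent u v -> nm_adj (nm x) (nm y).
Proof.
move=> [uv vv [e [f [g [_ fa ga fg]]]]].
rewrite -(nm_attach x fa) -(nm_attach y ga); split; last by exists e, (f x), (g y).
by move=> /nm_inj E; have := fg x y; rewrite E eqxx.
Qed.

(** The names share a simplex of unknown dimension; [nm_flag] applied to the pair produces a simplex
    with exactly these two names. *)
Lemma nm_adj_adjacent (u v : simplex Z) (x : verts u) (y : verts v) :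
  is_vertex u -> is_vertex v -> nm_adj (nm x) (nm y) -> adjacent u v.
Proof.
move=> uv vv xy; split=> //.
have sym a b : nm_adj a b -> nm_adj b a.
  by move=> [ab [s [z [z' [h h']]]]]; split; [exact/nesym|exists s, z', z].
have [||||e eP] := @nm_flag [set nm x; nm y].
- by rewrite finite_setU; split; exact: finite_set1.
- by exists (nm x); left.
- by move=> a [->|->]; [exists u, x|exists v, y].
- by move=> a b [->|->] [->|->] ab; [case: ab|exact: xy|exact: sym|case: ab].
have [x' x'x] := (eP (nm x)).1 (or_introl erefl).
have [y' y'y] := (eP (nm y)).1 (or_intror erefl).
have xy' : x' != y' by apply/eqP => E; apply: xy.1; rewrite -x'x -y'y E.
have all2 z : z = x' \/ z = y'.
  have [] := (eP (nm z)).2 (ex_intro _ z erefl) => E; [left|right]; apply: nm_inj; by rewrite E.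
have e2 : #|verts e| = 2%N.
  have <- : #|[set x'; y']%SET| = 2%N by rewrite cards2 xy'.
  rewrite -cardsT; apply: eq_card => z; rewrite !inE.
  by case: (all2 z) => ->; rewrite eqxx ?orbT.
have [_ [ue|[f fa]]] : vertex_of u e by apply: (@vertex_of_name _ _ x) => //; exists x'.
  by move: uv; rewrite /is_vertex ue e2.
have [_ [ve|[g ga]]] : vertex_of v e by apply: (@vertex_of_name _ _ y) => //; exists y'.
  by move: vv; rewrite /is_vertex ve e2.
exists e, f, g; split=> // a b.
have [x0 ux] := vertex_elt uv; have [y0 vy] := vertex_elt vv.
apply/eqP => fg; apply: xy.1.
rewrite (ux x) -(ux a) (vy y) -(vy b) -(nm_attach a fa) -(nm_attach b ga) fg //.
Qed.

(** In positive dimension every vertex of a simplex is a proper face, so the boundary determines the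
    names and hence the simplex. *)
Lemma named_simple : simple_complex Z.
Proof.
split=> [v vv|s t s1 t1 st].
  have /card_gt0P[x _] := verts_gt0 v.
  by have [] := adjacent_nm x x vv.
apply: nm_det => n; split=> -[x <-].
  have [u [f [uv fa fx]]] := face_vertex x s1.
  have [g ga] := (st u).1 (ex_intro _ f fa).
  have /card_gt0P[z _] := verts_gt0 u.
  by exists (g z); rewrite nm_attach // -(fx z) nm_attach.
have [u [f [uv fa fx]]] := face_vertex x t1.
have [g ga] := (st u).2 (ex_intro _ f fa).
have /card_gt0P[z _] := verts_gt0 u.
by exists (g z); rewrite nm_attach // -(fx z) nm_attach.
Qed.

Lemma named_flag : flag Z.
Proof.
split; first exact: named_simple.
move=> K fK [v0 Kv0] [Kv Kadj].
pose L : set N := [set n | exists v (x : verts v), K v /\ nm x = n].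
have ne (v : simplex Z) : exists x : verts v, True by have /card_gt0P[x _] := verts_gt0 v; exists x.
pose vn v := nm (projT1 (cid (ne v))).
have LE : L = (vn @` K)%classic.
  apply/seteqP; split=> n.
    move=> [v [x [Kv' <-]]]; exists v => //; rewrite /vn.
    by have [x0 h] := vertex_elt (Kv _ Kv'); congr nm; rewrite (h x) (h (projT1 _)).
  by move=> [v Kv' <-]; exists v, (projT1 (cid (ne v))).
have [||||s sP] := @nm_flag L.
- by rewrite LE; exact: finite_image.
- by have [x _] := ne v0; exists (nm x), v0, x.
- by move=> a [v [x [_ <-]]]; exists v, x.
- move=> a b [v [x [Kv1 <-]]] [v' [x' [Kv2 <-]]] xx'.
  apply: adjacent_nm; apply: Kadj => // vv; apply: xx'; subst v'.
  by have [x0 h] := vertex_elt (Kv _ Kv1); rewrite (h x) (h x').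
exists s => v; split=> [Kv1|vs].
  have [x _] := ne v.
  by apply: (@vertex_of_name _ _ x); [exact: Kv|apply/sP; exists v, x].
have [x _] := ne v.
have /sP [v' [x' [Kv' E]]] := vertex_ofE x vs.
by rewrite -(vertex_name_inj (Kv _ Kv') vs.1 E).
Qed.

Lemma named_full_cycle n : has_full_cycle Z n -> exists c : 'I_n -> N,
  [/\ injective c, forall i, exists s (x : verts s), nm x = c i,
      forall i, nm_adj (c i) (c (ordS i)) &
      forall i j, nm_adj (c i) (c j) -> j = ordS i \/ i = ordS j].
Proof.
move=> [c [cI cA cD]].
have ne (v : simplex Z) : exists x : verts v, True by have /card_gt0P[x _] := verts_gt0 v; exists x.
have cv i : is_vertex (c i) by have [] := cA i.
exists (fun i => nm (projT1 (cid (ne (c i))))); split.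
- by move=> i j /(vertex_name_inj (cv i) (cv j)) /cI.
- by move=> i; exists (c i), (projT1 (cid (ne (c i)))).
- by move=> i; exact: adjacent_nm.
- by move=> i j /(nm_adj_adjacent (cv i) (cv j)) /cD.
Qed.

End NamedComplex.

(* A simplicial complex whose simplices are pairs (finite set of tokens, label).
   The face of (L, k) spanned by F has token set [cv F @` F] and label [tr F k]. *)
Record token_data := TokenData {
  Tok : choiceType;
  Lab : choiceType;
  good : {fset Tok} -> Prop;
  fib : {fset Tok} -> Lab -> Prop;
  cv : {fset Tok} -> Tok -> Tok;
  tr : {fset Tok} -> Lab -> Lab;
  good_neq0 : forall L, good L -> L != fset0;
  cv_inj : forall L F, good L -> F `<` L -> F != fset0 -> {in F &, injective (cv F)};
  good_face : forall L F, good L -> F `<` L -> F != fset0 -> good (cv F @` F);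
  fib_face : forall L F k, good L -> F `<` L -> F != fset0 -> fib L k ->
    fib (cv F @` F) (tr F k);
  cv_cv : forall L F G x, good L -> F `<` L -> G `<=` F -> G != fset0 -> x \in G ->
    cv (cv F @` G) (cv F x) = cv G x;
  tr_tr : forall L F G k, good L -> F `<` L -> G `<=` F -> G != fset0 -> fib L k ->
    tr (cv F @` G) (tr F k) = tr G k;
  fib_lift : forall L x k, good L -> [fset x] `<` L -> fib [fset cv [fset x] x] k ->
    exists k', fib L k' /\ tr [fset x] k' = k;
  tr_inj : forall L x k k', good L -> [fset x] `<` L -> fib L k -> fib L k' ->
    tr [fset x] k = tr [fset x] k' -> k = k'
}.

Section TokenComplex.
Variable D : token_data.
Local Notation Tok := (Tok D).
Local Notation cv := (@cv D).
Local Notation tr := (@tr D).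

Definition tsimplex : choiceType :=
  {p : {fset Tok} * Lab D | `[< good p.1 /\ fib p.1 p.2 >]}.
Definition toks (s : tsimplex) : {fset Tok} := (val s).1.
Definition lab (s : tsimplex) : Lab D := (val s).2.
Definition tverts (s : tsimplex) : finType := toks s.

Definition mksim L k (h : good L /\ fib L k) : tsimplex :=
  exist (fun p : {fset Tok} * Lab D => `[< good p.1 /\ fib p.1 p.2 >]) (L, k) (introT (asboolP _) h).

Lemma tsimplexP s : good (toks s) /\ fib (toks s) (lab s).
Proof. by have /asboolP := valP s. Qed.

Lemma tsimplex_eq s t : toks s = toks t -> lab s = lab t -> s = t.
Proof.
case: s t => [[L k] p] [[L' k'] p']; rewrite /toks /lab /= => E E'; subst L' k'.
by congr exist; exact: bool_irrelevance.
Qed.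

Definition face_of (s t : tsimplex) (F : {fset Tok}) (f : tverts s -> tverts t) : Prop :=
  [/\ F != fset0, F `<` toks t, toks s = cv F @` F, lab s = tr F (lab t) &
      forall x, val (f x) \in F /\ cv F (val (f x)) = val x].

Definition tattach (s t : tsimplex) : set {ffun tverts s -> tverts t} :=
  [set f | exists F, face_of F f].

Lemma tverts_gt0 s : (0 < #|tverts s|)%N.
Proof.
have /fset0Pn[x xs] := good_neq0 (tsimplexP s).1.
by apply/card_gt0P; exists ([` xs] : tverts s).
Qed.

Lemma face_of_codom (s t : tsimplex) F (f : tverts s -> tverts t) y :
  face_of F f -> (y \in codom f) = (val y \in F).
Proof.
move=> [F0 Ft sF _ fP]; apply/codomP/idP => [[x ->]|yF]; first by have [] := fP x.
have ys : cv F (val y) \in toks s by rewrite sF in_imfset.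
exists [` ys]; apply: val_inj.
have [h1 h2] := fP [` ys].
by apply: (cv_inj (tsimplexP t).1 Ft F0); rewrite ?h2.
Qed.

Lemma tattach_inj s t (f : {ffun tverts s -> tverts t}) : tattach f -> injective f.
Proof.
move=> [F [_ _ _ _ fP]] x y fxy; apply: val_inj.
by rewrite -(fP x).2 -(fP y).2 fxy.
Qed.

Lemma tattach_proper s t (f : {ffun tverts s -> tverts t}) : tattach f ->
  exists y, y \notin codom f.
Proof.
move=> [F fF]; have [_ + _ _ _] := fF.
rewrite fproperE => /andP[_ /fsubsetPn[y yt yF]].
by exists [` yt]; rewrite (face_of_codom _ fF).
Qed.

Lemma tattach_comp s t u (f : {ffun tverts s -> tverts t}) (g : {ffun tverts t -> tverts u}) :
  tattach f -> tattach g -> tattach [ffun x => g (f x)].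
Proof.
move=> [F [F0 Ft sF lF fP]] [G [G0 Gu tG lG gP]].
have [gu fu] := tsimplexP u.
(* The composite is the face spanned by the tokens of [G] that are renamed into [F]; [cv_cv] and
   [tr_tr] identify renaming in two steps with renaming at once. *)
pose H := [fset y in G | cv G y \in F].
have HG : H `<=` G by apply/fsubsetP => y; rewrite !inE => /andP[].
have HF : cv G @` H = F.
  apply/fsetP => z; apply/imfsetP/idP => [[y /= + ->]|zF].
    by rewrite !inE => /andP[].
  have : z \in cv G @` G by rewrite -tG; exact: (fsubsetP (fproper_sub Ft)).
  by move=> /imfsetP[y /= yG zy]; exists y => //=; rewrite !inE yG -zy.
have H0 : H != fset0.
  by apply: contraNneq F0 => H0; rewrite -HF H0 imfset0.
have HP x : val (g (f x)) \in H /\ cv H (val (g (f x))) = val x.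
  have [h1 h2] := fP x; have [h3 h4] := gP (f x).
  have h5 : val (g (f x)) \in H by rewrite !inE h3 h4.
  split=> //; rewrite -(cv_cv gu Gu HG H0 h5) HF h4 //.
exists H; split=> //.
- exact: fsub_proper_trans HG Gu.
- rewrite sF; apply/fsetP => z; apply/imfsetP/imfsetP => -[y /= yH ->].
    have : y \in cv G @` H by rewrite HF.
    move=> /imfsetP[w /= wH ->].
    by exists w => //; rewrite -(cv_cv gu Gu HG H0 wH) HF.
  exists (cv G y); last by rewrite -(cv_cv gu Gu HG H0 yH) HF.
  by rewrite -HF in_imfset.
- by rewrite lF lG -{1}HF (tr_tr gu Gu HG H0 fu).
- by move=> x; rewrite ffunE.
Qed.

Lemma face_of_exists (t : tsimplex) (G : {fset Tok}) : G != fset0 -> G `<` toks t ->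
  exists (s : tsimplex) (f : {ffun tverts s -> tverts t}), face_of G f.
Proof.
move=> G0 Gt; have [gt ft] := tsimplexP t.
pose s := mksim (conj (good_face gt Gt G0) (fib_face gt Gt G0 ft)).
have ex (x : tverts s) : exists y : tverts t, val y \in G /\ cv G (val y) = val x.
  have /imfsetP[y /= yG xy] := valP x.
  have yt : y \in toks t := fsubsetP (fproper_sub Gt) _ yG.
  by exists [` yt].
exists s, [ffun x => projT1 (cid (ex x))]; split=> // x.
by rewrite ffunE; exact: (projT2 (cid (ex x))).
Qed.

Lemma tattach_face t (F : {set tverts t}) : (0 < #|F| < #|tverts t|)%N ->
  exists! p : {s & {ffun tverts s -> tverts t}}, tattach (projT2 p) /\ F =i codom (projT2 p).
Proof.
move=> /andP[F0 FT]; have [gt ft] := tsimplexP t.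
pose G : {fset Tok} := [fset val x | x in F].
have memG y : (val y \in G) = (y \in F).
  by apply/imfsetP/idP => [[x /= xF /val_inj ->]|yF] //; exists y.
have Gt : G `<=` toks t.
  by apply/fsubsetP => z /imfsetP[x /= _ ->]; exact: valP.
have G0 : G != fset0.
  have /card_gt0P[x xF] := F0; apply/fset0Pn; exists (val x); by rewrite memG.
have Gpr : G `<` toks t.
  rewrite fproperEneq Gt andbT; apply: contraTneq FT => GE; rewrite -leqNgt.
  by apply/subset_leq_card/fintype.subsetP => x _; rewrite -memG GE; exact: valP.
have [s [f fG]] := face_of_exists G0 Gpr.
exists (existT _ s f); split=> /=.
  by split; [exists G|move=> y; rewrite (face_of_codom _ fG) memG].
move=> [s' f'] /= [[F' fF'] FE].
have F'G : F' = G.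
  apply/fsetP => z; apply/idP/idP => zF.
    have [_ /fproper_sub/fsubsetP/(_ _ zF) zt _ _ _] := fF'.
    by rewrite -[z]/(val [` zt]) memG FE (face_of_codom _ fF').
  have zt := fsubsetP Gt _ zF.
  by rewrite -[z]/(val [` zt]) -(face_of_codom _ fF') -FE -memG.
subst F'; have [_ _ sG lG fP] := fG; have [_ _ sG' lG' fP'] := fF'.
have ss : s = s' by apply: tsimplex_eq; rewrite ?sG ?sG' ?lG ?lG'.
subst s'; congr existT; apply/ffunP => x; apply: val_inj.
by apply: (cv_inj gt Gpr G0); rewrite ?(fP x).1 ?(fP' x).1 // (fP x).2 (fP' x).2.
Qed.

Definition token_complex : simplicial_complex := SimplicialComplex
  tverts_gt0 tattach_inj tattach_proper tattach_comp tattach_face.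

End TokenComplex.

(** * Links in a complex of tokens *)

Section TokenLinks.
Variable D : token_data.
Local Notation Tok := (Tok D).
Local Notation cv := (@cv D).
Local Notation tr := (@tr D).

(* [t0] is the vertex of the token set [M] given by its token [y]. *)
Definition lk (t0 : Tok) (M : {fset Tok}) (y : Tok) : Prop :=
  [/\ good M, [fset y] `<` M & cv [fset y] y = t0].

(* The edge joining [y] to [z], seen as a vertex of the link of [y]. *)
Definition ename (y z : Tok) : Tok * Tok := (cv [fset y; z] y, cv [fset y; z] z).

Definition isname (M : {fset Tok}) (y : Tok) (n : Tok * Tok) : Prop :=
  exists z, [/\ z \in M, z != y & ename y z = n].

Definition lnode (t0 : Tok) n := exists M y, lk t0 M y /\ isname M y n.

Definition ladj (t0 : Tok) n n' :=
  n <> n' /\ exists M y, [/\ lk t0 M y, isname M y n & isname M y n'].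

Variable s0 : simplex (token_complex D).
Hypothesis s0v : is_vertex s0.
Variable t0 : Tok.
Hypothesis s0t : toks s0 = [fset t0].

(** From here on links are studied on token sets alone: a label in the link is determined by that of
    [s0] through [tr_inj], and exists by [fib_lift]. *)
Hypothesis lk_inj : forall M y z z', lk t0 M y -> z \in M -> z' \in M ->
  z != y -> z' != y -> ename y z = ename y z' -> z = z'.
Hypothesis lk_det : forall M y M' y', lk t0 M y -> lk t0 M' y' ->
  (forall n, isname M y n <-> isname M' y' n) -> M = M' /\ y = y'.
Hypothesis lk_flag : forall K : set (Tok * Tok), finite_set K -> (K !=set0)%classic ->
  (forall n, K n -> lnode t0 n) ->
  (forall n n', K n -> K n' -> n <> n' -> ladj t0 n n') ->
  exists M y, lk t0 M y /\ forall n, K n <-> isname M y n.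

Lemma s0_elt_subproof : t0 \in toks s0.
Proof. by rewrite s0t inE. Qed.
Definition s0_elt : tverts s0 := [` s0_elt_subproof].

Lemma s0_eltP (x : tverts s0) : x = s0_elt.
Proof.
apply: val_inj; have : val x \in [fset t0] by rewrite -s0t; exact: (valP x).
by rewrite inE => /eqP.
Qed.

Local Notation Z := (simplex_link s0).

Definition lbase (p : slink_simplex s0) : Tok :=
  val (slink_map p s0_elt : tverts (slink_carrier p)).

Lemma lbase_face (p : slink_simplex s0) :
  face_of [fset lbase p] (slink_map p : tverts s0 -> tverts (slink_carrier p)).
Proof.
have [F fF] := slink_mapP p.
suff -> : [fset lbase p] = F by [].
have [F0 Ft _ _ fP] := fF.
apply/fsetP => z; rewrite inE; apply/eqP/idP => [->|zF]; first by have [] := fP s0_elt.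
have zt := fsubsetP (fproper_sub Ft) _ zF.
have : [` zt] \in codom (slink_map p : tverts s0 -> _) by rewrite (face_of_codom _ fF).
by move=> /codomP[x]; rewrite (s0_eltP x) => /(congr1 val).
Qed.

Lemma lbaseP (p : slink_simplex s0) : [/\ lk t0 (toks (slink_carrier p)) (lbase p) &
  tr [fset lbase p] (lab (slink_carrier p)) = lab s0].
Proof.
have [_ Ft _ -> fP] := lbase_face p.
by split=> //; split=> //; [exact: (tsimplexP _).1|have [_ ->] := fP s0_elt].
Qed.

Lemma lbase_codom (p : slink_simplex s0) (x : tverts (slink_carrier p)) :
  (x \in codom (slink_map p)) = (val x == lbase p).
Proof. by rewrite (face_of_codom x (lbase_face p)) inE. Qed.

Definition lname (p : simplex Z) (x : verts p) : Tok * Tok :=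
  ename (lbase p) (val (val x : tverts (slink_carrier p))).

Lemma lname_vert (p : slink_simplex s0) z : z \in toks (slink_carrier p) -> z != lbase p ->
  exists x : slink_verts p, val (val x : tverts (slink_carrier p)) = z.
Proof.
move=> zt zb.
have xc : ([` zt] : tverts (slink_carrier p)) \notin codom (slink_map p) by rewrite lbase_codom.
by exists (exist (fun x : verts (slink_carrier p) => x \notin codom (slink_map p)) _ xc).
Qed.

Lemma lvert_neq (p : slink_simplex s0) (x : slink_verts p) :
  val (val x : tverts (slink_carrier p)) != lbase p.
Proof. by rewrite -lbase_codom; exact: (valP x). Qed.

Lemma isnameE (p : slink_simplex s0) n : isname (toks (slink_carrier p)) (lbase p) n <->
  exists x : verts (p : simplex Z), lname x = n.
Proof.
split=> [[z [zt zb <-]]|[x <-]].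
  by have [x xz] := lname_vert zt zb; exists x; rewrite /lname xz.
exists (val (val x : tverts (slink_carrier p))); split=> //; first exact: (valP (val x)).
exact: lvert_neq.
Qed.

Lemma lname_inj (p : simplex Z) : injective (@lname p).
Proof.
move=> x y E; apply/val_inj/val_inj.
by apply: (lk_inj (lbaseP p).1) E; rewrite ?lvert_neq //; [exact: (valP (val x))|exact: (valP (val y))].
Qed.

(** The name is formed in the edge joining the base to the vertex, and by [cv_cv] this edge has the
    same tokens in both simplices. *)
Lemma lname_attach (p q : simplex Z) (g : {ffun verts p -> verts q}) x : attach g ->
  lname (g x) = lname x.
Proof.
move=> [h [[F fF] hpq hg]]; have [F0 Ft sF _ fP] := fF.
have [gq _] := tsimplexP (slink_carrier q).
have yP := fP (slink_map p s0_elt); rewrite hpq in yP.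
have xP := fP (val x); rewrite hg in xP.
have [yF yE] := yP; have [xF xE] := xP.
have sub : [fset lbase q; val (val (g x) : tverts (slink_carrier q))] `<=` F.
  by rewrite fsubUset !fsub1set yF xF.
have ne : [fset lbase q; val (val (g x) : tverts (slink_carrier q))] != fset0.
  by apply/fset0Pn; exists (lbase q); rewrite !inE eqxx.
have im : cv F @` [fset lbase q; val (val (g x) : tverts (slink_carrier q))] =
   [fset lbase p; val (val x : tverts (slink_carrier p))].
  rewrite -[lbase p]yE -[val (val x)]xE; apply/fsetP => z; rewrite !inE.
  apply/imfsetP/orP => [[w /=]|].
    by rewrite !inE => /orP[] /eqP -> ->; rewrite eqxx; [left|right].
  case=> /eqP ->; [exists (lbase q)|exists (val (val (g x)))]; rewrite //= !inE eqxx ?orbT //.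
rewrite /lname /ename.
have -> : lbase p = cv F (lbase q) by rewrite yE.
have e2 : val (val x : tverts (slink_carrier p)) = cv F (val (val (g x) : tverts (slink_carrier q))) by rewrite xE.
rewrite e2; have im2 := im; rewrite e2 -[lbase p]yE in im2.
by rewrite -im2; congr pair; rewrite (cv_cv gq Ft sub ne) // !inE eqxx ?orbT.
Qed.

(** [lk_det] recovers the tokens and the base. Both labels restrict to the label of [s0], so they
    agree by [tr_inj]. *)
Lemma lname_det (p q : simplex Z) :
  (forall n, (exists x : verts p, lname x = n) <-> (exists x : verts q, lname x = n)) -> p = q.
Proof.
move=> E; have [pl pt] := lbaseP p; have [ql qt] := lbaseP q.
have [Mpq ypq] : toks (slink_carrier p) = toks (slink_carrier q) /\ lbase p = lbase q.
  by apply: lk_det => // n; split=> /isnameE/E/isnameE.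
have cpq : slink_carrier p = slink_carrier q.
  apply: tsimplex_eq => //.
  have [gp fp] := tsimplexP (slink_carrier p); have [_ fq] := tsimplexP (slink_carrier q).
  have [_ py _] := pl; rewrite -Mpq in fq.
  by apply: (tr_inj gp py fp fq); rewrite pt ypq qt.
apply: val_inj; move: ypq cpq; rewrite /lbase /slink_map /slink_carrier.
case: (val p) => u f; case: (val q) => u' f' /= fE cE; subst u'; congr existT.
by apply/ffunP => x; rewrite (s0_eltP x); apply: val_inj.
Qed.

(** [fib_lift] extends the label of [s0] over the whole token set. *)
Lemma lk_simplex M y : lk t0 M y ->
  exists p : slink_simplex s0, toks (slink_carrier p) = M /\ lbase p = y.
Proof.
move=> [gM yM yt].
have fs : fib [fset cv [fset y] y] (lab s0) by rewrite yt -s0t; exact: (tsimplexP s0).2.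
have [k [fk kE]] := fib_lift gM yM fs.
pose t := mksim (conj gM fk).
have yt' : y \in toks t by have /fproper_sub := yM; rewrite fsub1set.
pose f : {ffun tverts s0 -> tverts t} := [ffun=> [` yt']].
have fa : attach (f : {ffun verts s0 -> verts (t : simplex (token_complex D))}).
  exists [fset y]; split=> //.
  - by apply/fset0Pn; exists y; rewrite inE.
  - by rewrite s0t imfset_fset1 yt.
  - by move=> x; rewrite ffunE /= inE eqxx (s0_eltP x) yt.
exists (slink_pair (mem_set fa)); split=> //.
by rewrite /lbase /slink_map /= ffunE.
Qed.

Lemma lname_adj n n' : nm_adj lname n n' <-> ladj t0 n n'.
Proof.
split=> [[nn [p [x [y [xn yn]]]]]|[nn [M [y [ly ny n'y]]]]]; split; [exact: nn| |exact: nn| ].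
  subst n n'.  exists (toks (slink_carrier p)), (lbase p); split; first exact: (lbaseP p).1.
    by apply/isnameE; exists x.
    by apply/isnameE; exists y.
have [p [pM py]] := lk_simplex ly; subst M y.
have [x xn] := (isnameE _ _).1 ny; have [y yn] := (isnameE _ _).1 n'y.
by exists p, x, y.
Qed.

Lemma lname_flag (K : set (Tok * Tok)) : finite_set K -> (K !=set0)%classic ->
  (forall a, K a -> exists (s : simplex Z) (x : verts s), lname x = a) ->
  (forall a b, K a -> K b -> a <> b -> nm_adj lname a b) ->
  exists s : simplex Z, forall a, K a <-> exists x : verts s, lname x = a.
Proof.
move=> fK K0 Kn Ka.
have [|a b aK bK ab|M [y [ly My]]] := lk_flag fK K0.
- move=> n /Kn[p [x <-]]; exists (toks (slink_carrier p)), (lbase p).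
  by split; [exact: (lbaseP p).1|apply/isnameE; exists x].
- by apply/lname_adj; exact: Ka.
have [p [pM py]] := lk_simplex ly; subst M y; exists p => a.
by split=> [/My/isnameE|/isnameE/My].
Qed.

Lemma token_link_flag : flag Z.
Proof. exact: named_flag lname_inj lname_attach lname_det lname_flag. Qed.

Lemma token_link_cycle n : has_full_cycle Z n -> exists c : 'I_n -> Tok * Tok,
  [/\ injective c, forall i, lnode t0 (c i),
      forall i, ladj t0 (c i) (c (ordS i)) &
      forall i j, ladj t0 (c i) (c j) -> j = ordS i \/ i = ordS j].
Proof.
move=> /(named_full_cycle lname_inj lname_attach lname_det lname_flag) [c [cI cn ca cd]].
exists c; split=> //.
- move=> i; have [p [x <-]] := cn i; exists (toks (slink_carrier p)), (lbase p).
  by split; [exact: (lbaseP p).1|apply/isnameE; exists x].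
- by move=> i; apply/lname_adj.
- by move=> i j /lname_adj/cd.
Qed.

End TokenLinks.

(** * Finite sets by size *)

(** The case distinction behind [tcv] and [ttr]: only faces with one or two tokens can change their
    anchor. *)
Lemma fset_cases (K : choiceType) (F : {fset K}) : F != fset0 ->
  [\/ exists t, F = [fset t], exists t t', t != t' /\ F = [fset t; t'] |
      exists t1 t2 t3, [/\ [&& t1 \in F, t2 \in F & t3 \in F], t1 != t2, t1 != t3 & t2 != t3]].
Proof.
move=> /fset0Pn[t tF].
have [E1|/fset0Pn[t']] := eqVneq (F `\ t) fset0.
  constructor 1; exists t; apply/fsetP => z; rewrite inE; apply/idP/eqP => [zF|->//].
  apply/eqP; apply: contraT => zt; have : z \in F `\ t by rewrite !inE zt.
  by rewrite E1 inE.
rewrite !inE => /andP[t't t'F].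
have [E2|/fset0Pn[t'']] := eqVneq (F `\ t `\ t') fset0.
  constructor 2; exists t, t'; split; first by rewrite eq_sym.
  apply/fsetP => z; rewrite !inE; apply/idP/orP => [zF|[]/eqP->//].
  have [zt|zt] := eqVneq z t; first by left.
  have [zt'|zt'] := eqVneq z t'; first by right.
  have : z \in F `\ t `\ t' by rewrite !inE zt zt'.
  by rewrite E2 inE.
rewrite !inE => /and3P[a b c]; constructor 3; exists t, t', t''.
by rewrite tF t'F c eq_sym t't eq_sym b eq_sym a.
Qed.

Lemma enum_fset_nil (K : choiceType) : enum_fset (fset0 : {fset K}) = [::].
Proof. by apply/size0nil; exact: cardfs0. Qed.

Lemma enum_fset_single (K : choiceType) (t : K) : enum_fset [fset t] = [:: t].
Proof.
case E : (enum_fset [fset t]) (cardfs1 t) => [|u []] //= _.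
have : t \in enum_fset [fset t] by exact: fset11.
by rewrite E inE => /eqP ->.
Qed.

(** * The complex of a VH-complex *)

Section Tokens.
Variable X : VH_complex.

(* A simplex of the complex is anchored at a vertex, an edge midpoint or a square
   centre of X, and its vertices are named as seen from the anchor: the anchor
   vertex, the anchor edge, an end of an edge at the anchor vertex, or the side
   {b} in direction d of the anchor square. The last two stand for an edge. *)
Definition token : choiceType :=
  (vertex X + edge X + (edge X * bool) + (square X * (bool * bool)))%type.

Notation TV v := (inl (inl (inl v)) : token).
Notation TE e := (inl (inl (inr e)) : token).
Notation TN p := (inl (inr p) : token).
Notation TS s d b := (inr (s, (d, b)) : token).

Lemma TN_inj (p q : edge X * bool) : TN p = TN q -> p = q.
Proof. by case. Qed.

(* The direction of the vertical sides of s. *)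
Definition vdir (s : square X) : bool := vertical (side s true false).1.

Lemma vertical_side s d b : vertical (side s d b).1 = (d == vdir s).
Proof.
have h1 := VH_alternating s; rewrite /vdir.
have h2 := h1 false false; case: d.
  rewrite eq_sym eqb_id; have := h1 b false; rewrite h2.
  by case: vertical; case: vertical => //; case: vertical.
by have := h1 false b; case: vertical => [|] /=; case: vertical => //=.
Qed.

(* The end at the corner with coordinate b' of the side {b} in direction d. *)
Definition side_end (s : square X) (d b b' : bool) : edge X * bool :=
  ((side s d b).1, b' (+) (side s d b).2).

Lemma side_end_endpoint s d b b' :
  endpoint (side_end s d b b').1 (side_end s d b b').2 =
  endpoint (side_end s (~~ d) b' b).1 (side_end s (~~ d) b' b).2.
Proof. by case: d; rewrite /side_end /= endpoint_side1 endpoint_side2. Qed.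

(** The name of the vertex when it is a simplex of its own: a vertex or an edge of X. *)
Definition cv1 (t : token) : token :=
  match t with
  | inl (inr p) => TE p.1
  | inr (s, (d, b)) => TE (side s d b).1
  | _ => t
  end.

Definition cv2 (t t' : token) : token :=
  match t, t' with
  | inr (s, (d, b)), inr (_, (d', b')) => if d != d' then TN (side_end s d b b') else t
  | _, _ => t
  end.

(* How the vertices of a face are named by its own anchor: a single end or side
   becomes an edge, and the two sides at a corner of a square become two edge
   ends at the vertex of that corner. *)
Definition tcv (F : {fset token}) (t : token) : token :=
  match enum_fset (F `\ t) with
  | [::] => cv1 t
  | [:: t'] => cv2 t t'
  | _ => t
  end.

Definition at_vertex (v : vertex X) (t : token) : Prop :=
  match t with
  | inl (inl (inl v')) => v' = v
  | inl (inr p) => endpoint p.1 p.2 = v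
  | _ => False
  end.

(** For [None] this is the diagonal joining the vertical sides. Two sides in different directions
    are not listed here, because the edge that they span is anchored at their common corner. *)
Definition square_toks (s : square X) (o : option bool) : {fset token} :=
  [fset TS s (vdir s) false; TS s (vdir s) true] `|`
  (if o is Some b then [fset TS s (~~ vdir s) b] else fset0).

(* Up to faces, the simplices are a vertex with some edge ends at it, at most one
   of them vertical, and the two vertical sides of a square with one horizontal
   side. *)
Inductive tgood : {fset token} -> Prop :=
| GoodEdge e : tgood [fset TE e]
| GoodVertex v L : L != fset0 -> (forall t, t \in L -> at_vertex v t) ->
    (forall p p', TN p \in L -> TN p' \in L -> vertical p.1 -> vertical p'.1 -> p = p') ->
    (forall p, L <> [fset TN p]) -> tgood L
| GoodSquare s o : tgood (square_toks s o).

Lemma square_toksP s o t : reflect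
  (exists d b, t = TS s d b /\ ((d == vdir s) || (o == Some b))) (t \in square_toks s o).
Proof.
apply: (iffP idP).
  rewrite !inE => /orP[/orP[]/eqP->|]; first by exists (vdir s), false; rewrite eqxx.
    by exists (vdir s), true; rewrite eqxx.
  by case: o => [b|] //; rewrite inE => /eqP ->; exists (~~ vdir s), b; rewrite eqxx orbT.
move=> [d [b [->]]]; rewrite !inE; case: eqP => [->|/eqP dv] /=.
  by move=> _; case: b; rewrite eqxx ?orbT.
move=> /eqP ->; rewrite inE; have -> : d = ~~ vdir s by move: dv; case: d; case: vdir.
by rewrite eqxx orbT.
Qed.

Lemma tgood_neq0 L : tgood L -> L != fset0.
Proof.
case=> [e|v {}L //|s o]; apply/fset0Pn; first by exists (TE e); rewrite inE.
by exists (TS s (vdir s) true); apply/square_toksP; exists (vdir s), true; rewrite eqxx.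
Qed.

Lemma tcv1 t : tcv [fset t] t = cv1 t.
Proof. by rewrite /tcv fsetDv enum_fset_nil. Qed.

Lemma tcv2 t t' : t != t' -> tcv [fset t; t'] t = cv2 t t'.
Proof.
move=> tt; rewrite /tcv (_ : [fset t; t'] `\ t = [fset t']) ?enum_fset_single //.
apply/fsetP => z; rewrite !inE; case: (eqVneq z t) => // ->.
by rewrite (negbTE tt).
Qed.

Lemma tcv2r t t' : t != t' -> tcv [fset t; t'] t' = cv2 t' t.
Proof. by rewrite eq_sym fsetUC => /tcv2. Qed.

Lemma tcv3 F t t1 t2 t3 : [&& t1 \in F, t2 \in F & t3 \in F] ->
  t1 != t2 -> t1 != t3 -> t2 != t3 -> tcv F t = t.
Proof.
move=> /and3P[h1 h2 h3] n12 n13 n23; rewrite /tcv.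
case E : (enum_fset (F `\ t)) => [|u [|u' l]] //; exfalso.
  have inF z : z \in F -> z = t.
    move=> zF; apply/eqP; apply: contraT => zt.
    have : z \in F `\ t by rewrite !inE zt.
    by rewrite -[z \in _]/(z \in enum_fset _) E.
  by move: n12; rewrite (inF t1) // (inF t2) // eqxx.
have inF z : z \in F -> z = t \/ z = u.
  move=> zF; have [->|zt] := eqVneq z t; first by left.
  have : z \in F `\ t by rewrite !inE zt.
  by rewrite -[z \in _]/(z \in enum_fset _) E inE => /eqP; right.
move: n12 n13 n23; have [->|->] := inF t1 h1; have [->|->] := inF t2 h2;
  have [->|->] := inF t3 h3; rewrite ?eqxx //.
Qed.

Lemma cv1_cv1 t : cv1 (cv1 t) = cv1 t.
Proof. by case: t => [[[v|e]|p]|[s [d b]]]. Qed.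

Lemma cv1_cv2 t t' : cv1 (cv2 t t') = cv1 t.
Proof.
by case: t => [[[v|e]|p]|[s [d b]]] //=; case: t' => [|[s' [d' b']]] //=; case: ifP.
Qed.

(** All that renaming of pairs needs to know about a good set: its square tokens belong to one
    square. *)
Definition squarish (L : {fset token}) := forall t t', t \in L -> t' \in L ->
  match t, t' with inr (s, _), inr (s', _) => s = s' | _, _ => True end.

Lemma tgood_squarish L : tgood L -> squarish L.
Proof.
case=> [e|v {}L L0 Lv _ _|s o] t t'.
- by rewrite inE => /eqP ->.
- by case: t => // -[s [d b]] /Lv.
- by move=> /square_toksP[d [b [-> _]]] /square_toksP[d' [b' [-> _]]].
Qed.

(* The two-element faces that are converted are the corners of a square. *)
Definition corner_pair (t t' : token) s d b b' := t = TS s d b /\ t' = TS s (~~ d) b'.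

Lemma pair_cases L t t' : squarish L -> t \in L -> t' \in L ->
  (exists s d b b', corner_pair t t' s d b b') \/ (cv2 t t' = t /\ cv2 t' t = t').
Proof.
move=> sL tL t'L; have := sL _ _ tL t'L.
case: t {tL} => [[[v|e]|p]|[s [d b]]]; case: t' {t'L} => [[[v'|e']|p']|[s' [d' b']]] //=;
  try by right.
move=> <-; have [->|dd] := eqVneq d d'; first by right.
by left; exists s, d, b, b'; split=> //; move: dd; case: d; case: d'.
Qed.

Lemma cv2_corner t t' s d b b' : corner_pair t t' s d b b' ->
  [/\ cv2 t t' = TN (side_end s d b b'), cv2 t' t = TN (side_end s (~~ d) b' b) & t != t'].
Proof.
by move=> [-> ->] /=; split; case: d => //; rewrite -?(inj_eq inr_inj) //;
  apply/eqP => -[].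
Qed.

(** One of the two edges is vertical and the other horizontal. *)
Lemma side_end_neq s d b b' : side_end s d b b' <> side_end s (~~ d) b' b.
Proof.
move=> [E _]; have := vertical_side s d b; rewrite E vertical_side.
by case: d {E}; case: vdir.
Qed.

Lemma cv2_neq L t t' : squarish L -> t \in L -> t' \in L -> t != t' ->
  cv2 t t' != cv2 t' t.
Proof.
move=> sL tL t'L tt; have [[s [d [b [b' /cv2_corner[-> -> _]]]]]|[-> ->] //] := pair_cases sL tL t'L.
by apply/eqP => /TN_inj/(@side_end_neq s d b b').
Qed.

Lemma tcv_inj L F : tgood L -> F `<` L -> F != fset0 -> {in F &, injective (tcv F)}.
Proof.
move=> /tgood_squarish sL /fproper_sub/fsubsetP FL F0 x y.
case: (fset_cases F0) FL => [[t ->] _|[t [t' [tt ->]]] FL|[t1 [t2 [t3 [h n12 n13 n23]]]] _ _ _].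
- by rewrite !inE => /eqP -> /eqP ->.
- have tL : t \in L by apply: FL; rewrite !inE eqxx.
  have t'L : t' \in L by apply: FL; rewrite !inE eqxx orbT.
  have := cv2_neq sL tL t'L tt.
  rewrite !inE => nn /orP[]/eqP -> /orP[]/eqP -> //; rewrite tcv2 // tcv2r // => E.
    by rewrite E eqxx in nn.
  by rewrite E eqxx in nn.
- by rewrite !(tcv3 _ h).
Qed.

Lemma at_vertex_pair v t t' L : at_vertex v t -> at_vertex v t' -> t != t' ->
  (forall p p', TN p \in L -> TN p' \in L -> vertical p.1 -> vertical p'.1 -> p = p') ->
  [fset t; t'] `<=` L -> tgood [fset t; t'].
Proof.
move=> tv t'v tt Lu /fsubsetP sub; apply: (@GoodVertex v).
- by apply/fset0Pn; exists t; rewrite !inE eqxx.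
- by move=> z; rewrite !inE => /orP[]/eqP ->.
- by move=> p p' /sub pL /sub; exact: Lu.
- move=> p E; have := fset21 t t'; have := fset22 t t'; rewrite E !inE => /eqP t1 /eqP t2.
  by rewrite t1 t2 eqxx in tt.
Qed.

Lemma tgood_corner s d b b' :
  tgood [fset TN (side_end s d b b'); TN (side_end s (~~ d) b' b)].
Proof.
have ne : side_end s d b b' <> side_end s (~~ d) b' b by exact: side_end_neq.
apply: (@GoodVertex (endpoint (side_end s d b b').1 (side_end s d b b').2)).
- by apply/fset0Pn; exists (TN (side_end s d b b')); rewrite !inE eqxx.
- by move=> z; rewrite !inE => /orP[]/eqP -> //=; rewrite -side_end_endpoint.
- move=> p p'; rewrite !inE => /orP[]/eqP/TN_inj-> /orP[]/eqP/TN_inj-> //;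
  rewrite !vertical_side; by case: (d); case: vdir.
- move=> p /fsetP E; apply: ne.
  have := E (TN (side_end s d b b')); rewrite !inE eqxx => /esym/eqP/TN_inj->.
  by have := E (TN (side_end s (~~ d) b' b)); rewrite !inE eqxx orbT => /esym/eqP/TN_inj->.
Qed.

(** A single token becomes a vertex or an edge, and a corner pair becomes two edge ends at that
    corner; every other face keeps its tokens. *)
Lemma tgood_face L F : tgood L -> F `<` L -> F != fset0 -> tgood (tcv F @` F).
Proof.
move=> gL FL F0; have sL := tgood_squarish gL.
have /fsubsetP sub := fproper_sub FL.
have im2 t t' : t != t' -> tcv [fset t; t'] @` [fset t; t'] = [fset cv2 t t'; cv2 t' t].
  by move=> tt; rewrite imfset_fset2 tcv2 // tcv2r.
case: (fset_cases F0) => [[t FE]|[t [t' [tt FE]]]|[t1 [t2 [t3 [h n12 n13 n23]]]]].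
- subst F; rewrite imfset_fset1 tcv1.
  have tL : t \in L by apply: sub; rewrite inE.
  case: gL tL FL {sub sL} => [e|v {}L L0 Lv Lu Ln|s o] tL FL.
  + by move: tL; rewrite inE => /eqP ->; constructor.
  + have := Lv _ tL; case: t tL FL F0 => [[[v'|e]|p]|[s [d b]]] //= tL FL F0 vE.
      apply: (@GoodVertex v) => //.
      * by move=> z; rewrite inE => /eqP ->.
      * by move=> p p'; rewrite inE.
      * by move=> p /fsetP/(_ (TN p)); rewrite !inE eqxx.
    by constructor.
  + by move: tL => /square_toksP[d [b [-> _]]] /=; constructor.
- subst F; rewrite im2 //.
  have tL : t \in L by apply: sub; rewrite !inE eqxx.
  have t'L : t' \in L by apply: sub; rewrite !inE eqxx orbT.
  have [[s [d [b [b' cp]]]]|[c1 c2]] := pair_cases sL tL t'L.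
    have [-> -> _] := cv2_corner cp; exact: tgood_corner.
  rewrite c1 c2; case: gL tL t'L FL {sub sL} => [e|v {}L L0 Lv Lu Ln|s o] tL t'L FL.
  + by move: tt tL t'L; rewrite !inE => nn /eqP te /eqP t'e; rewrite te t'e eqxx in nn.
  + apply: (at_vertex_pair (v := v) (L := L)) => //; [exact: Lv|exact: Lv|exact: fproper_sub].
  + move: tL t'L c1 tt => /square_toksP[d [b [-> h]]] /square_toksP[d' [b' [-> h']]] /=.
    case: eqVneq => //= dd _; subst d'; have [dv|dv] := eqVneq d (vdir s); last first.
      move: h h'; rewrite (negbTE dv) /= => /eqP -> /eqP[->].
      by rewrite eqxx.
    move=> bb; suff -> : [fset TS s d b; TS s d b'] = square_toks s None by constructor.
    rewrite dv /square_toks fsetU0; move: bb; case: b {h}; case: b' {h'}; rewrite ?eqxx //.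
    by rewrite fsetUC.
- have -> : tcv F @` F = F.
    rewrite -[RHS]imfset_id; apply: eq_in_imfset => z _; exact: (tcv3 _ h).
  case: gL FL sub {sL} => [e|v {}L L0 Lv Lu Ln|s o] FL sub.
  + move: h n12 => /and3P[/sub + /sub + _]; rewrite !inE => /eqP -> /eqP ->.
    by rewrite eqxx.
  + apply: (@GoodVertex v) => //.
    * by move=> z /sub/Lv.
    * by move=> p p' /sub pL /sub; exact: Lu.
    * move=> p FE; move: h n12; rewrite FE => /and3P[]; rewrite !inE => /eqP -> /eqP ->.
      by rewrite eqxx.
  (* A set of square tokens has at most three members, so a face with three tokens cannot be
     proper. *)
  + exfalso; have := fproper_ltn_card FL.
    have c3 : (3 <= #|` F|)%N.
      have <- : #|` [fset t1; t2; t3]| = 3%N.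
        rewrite -fsetUA cardfsU1 cardfs2 !inE negb_or n12 n13 n23 //.
      apply: fsubset_leq_card; apply/fsubsetP => z; rewrite !inE.
      by move: h => /and3P[? ? ?] /orP[/orP[]|]/eqP ->.
    have : (#|` square_toks s o| <= 3)%N.
      rewrite cardfsU; apply: (leq_trans (leq_subr _ _)); rewrite cardfs2.
      case: o {FL sub} => [b|]; last by rewrite cardfs0; case: (_ != _).
      by rewrite cardfs1; case: (_ != _).
    by move=> c4 lt; move: (leq_trans (leq_ltn_trans c3 lt) c4); rewrite ltnn.
Qed.

(** Renaming a side first as an edge end at a corner and then as an edge gives the edge of the side,
    by [cv1_cv2]; otherwise at most one of the two steps renames anything new. *)
Lemma tcv_tcv L F G x : tgood L -> F `<` L -> G `<=` F -> G != fset0 -> x \in G ->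
  tcv (tcv F @` G) (tcv F x) = tcv G x.
Proof.
move=> gL FL GF G0 xG; have sL := tgood_squarish gL.
have F0 : F != fset0 by apply: contraTneq G0 => F0; rewrite negbK -fsubset0 -F0.
have /fsubsetP sub := fproper_sub FL.
case: (fset_cases F0) => [[t FE]|[t [t' [tt FE]]]|[t1 [t2 [t3 [h n12 n13 n23]]]]].
- subst F; have xt : x = t by have := fsubsetP GF _ xG; rewrite inE => /eqP.
  have -> : G = [fset t].
    by apply/eqP; rewrite eqEfsubset GF /= fsub1set -xt.
  by rewrite xt imfset_fset1 !tcv1 cv1_cv1.
- subst F; have tL : t \in L by apply: sub; rewrite !inE eqxx.
  have t'L : t' \in L by apply: sub; rewrite !inE eqxx orbT.
  have neq := cv2_neq sL tL t'L tt.
  have single u : u \in [fset t; t'] -> G = [fset u] ->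
      tcv (tcv [fset t; t'] @` G) (tcv [fset t; t'] x) = tcv G x.
    move=> uF GE; move: xG; rewrite GE inE => /eqP ->.
    rewrite imfset_fset1 !tcv1; move: uF; rewrite !inE => /orP[]/eqP ->.
      by rewrite tcv2 // cv1_cv2.
    by rewrite tcv2r // cv1_cv2.
  have [GE|] := eqVneq G [fset t; t'].
    rewrite GE imfset_fset2 tcv2 // tcv2r //; move: xG; rewrite GE !inE.
    have [[s [d [b [b' cp]]]]|[c1 c2]] := pair_cases sL tL t'L; last first.
      by rewrite c1 c2 => /orP[]/eqP ->; [rewrite tcv2 // c1 tcv2|rewrite tcv2r // c2 tcv2r].
    have [E1 E2 _] := cv2_corner cp.
    move: neq; rewrite E1 E2 => neq.
    by move=> /orP[]/eqP ->; [rewrite tcv2 // E1 tcv2|rewrite tcv2r // E2 tcv2r].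
  case: (fset_cases G0) => [[u GE] _|[u [u' [uu GE]]]|[u1 [u2 [u3 [h n12 n13 n23]]]]].
  + by apply: (single u) => //; apply: (fsubsetP GF); rewrite GE inE.
  + case/eqP; apply/eqP; rewrite GE eqEfcard.
    by rewrite -GE GF /= GE !cardfs2 tt uu.
  + have inF z : z \in G -> z = t \/ z = t'.
      by move=> /(fsubsetP GF); rewrite !inE => /orP[]/eqP ->; [left|right].
    exfalso; move: h n12 n13 n23 => /and3P[/inF[]-> /inF[]-> /inF[]->]; rewrite ?eqxx //.
- have FE z : tcv F z = z by exact: (tcv3 _ h).
  rewrite FE; congr tcv; rewrite -[RHS]imfset_id; apply: eq_in_imfset => z _; exact: FE.
Qed.

End Tokens.

Notation TV v := (inl (inl (inl v))) (only parsing).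
Notation TE e := (inl (inl (inr e))) (only parsing).
Notation TN p := (inl (inr p)) (only parsing).
Notation TS s d b := (inr (s, (d, b))) (only parsing).

(** * Labels: homotopy classes of paths to the anchor *)

Section TokenLabels.
Variables (R : realType) (X : VH_complex).
Local Notation I := (unit_interval R).
Local Notation T := (square_realization R X).
Local Notation token := (token X).
Local Notation half := (clamp 2^-1 : I).
Local Notation ctr := (half, half).
Local Notation c1 := (unit_segments R).
Local Notation c2 := (square_segments R).
Local Notation ue := (unit_end R).
Local Notation em := (@em R X).
Local Notation sm := (@sm R X).
Variable x0 : T.

Definition anchor (t : token) : T :=
  match t with
  | inl (inl (inl v)) => vp R v
  | inl (inl (inr e)) => em e half
  | inl (inr p) => vp R (endpoint p.1 p.2)
  | inr (s, _) => sm s ctr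
  end.

Definition tr1 (t : token) (k : set (I -> T)) : set (I -> T) :=
  match t with
  | inl (inr p) => pmul k (sg c1 (em p.1) (ue p.2) half)
  | inr (s, (d, b)) => pmul k (sg c2 (sm s) ctr (mkdir d (ue b) half))
  | _ => k
  end.

Definition tr2 (t t' : token) (k : set (I -> T)) : set (I -> T) :=
  match t, t' with
  | inr (s, (d, b)), inr (_, (d', b')) =>
      if d != d' then pmul k (sg c2 (sm s) ctr (mkdir d (ue b) (ue b'))) else k
  | _, _ => k
  end.

(* Transport of a class of paths from the anchor of a simplex to the anchor of its
   face F. *)
Definition ttr (F : {fset token}) (k : set (I -> T)) : set (I -> T) :=
  match enum_fset F with
  | [:: t] => tr1 t k
  | [:: t; t'] => tr2 t t' k
  | _ => k
  end.

Definition tfib (L : {fset token}) (k : set (I -> T)) : Prop :=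
  forall t, t \in L -> pfib x0 (anchor t) k.

Lemma ttr1 t k : ttr [fset t] k = tr1 t k.
Proof. by rewrite /ttr enum_fset_single. Qed.

(** [enum_fset] may list the pair in either order, but [tr2] is symmetric because square tokens of
    [L] belong to one square. *)
Lemma ttr2 L t t' k : squarish L -> t \in L -> t' \in L -> t != t' ->
  ttr [fset t; t'] k = tr2 t t' k.
Proof.
move=> sL tL t'L tt; rewrite /ttr.
have sym : tr2 t t' k = tr2 t' t k.
  have := sL _ _ tL t'L.
  case: t {tL tt} => [[[v|e]|p]|[s [d b]]]; case: t' {t'L} => [[[v'|e']|p']|[s' [d' b']]] //=.
  by move=> <-; rewrite eq_sym; case: eqVneq => // dd; case: d dd => [] []; case: d'.
have : #|` [fset t; t']| = 2%N by rewrite cardfs2 tt.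
have inE' z : z \in enum_fset [fset t; t'] -> z = t \/ z = t'.
  by rewrite -[_ \in _]/(z \in [fset t; t']) !inE => /orP[]/eqP ->; [left|right].
have := fset_uniq [fset t; t'].
case E : (enum_fset _) inE' => [|u [|u' []]] //= h; rewrite andbT inE => uu _.
have [ue|ue] := h u (mem_head _ _); have [u'e|u'e] : u' = t \/ u' = t'
  by [apply: h; rewrite !inE eqxx orbT|apply: h; rewrite !inE eqxx orbT].
- by rewrite ue u'e eqxx in uu.
- by rewrite ue u'e.
- by rewrite ue u'e sym.
- by rewrite ue u'e eqxx in uu.
Qed.

Lemma ttr3 F k t1 t2 t3 : [&& t1 \in F, t2 \in F & t3 \in F] ->
  t1 != t2 -> t1 != t3 -> t2 != t3 -> ttr F k = k.
Proof.
move=> /and3P[h1 h2 h3] n12 n13 n23; rewrite /ttr.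
case E : (enum_fset F) => [|u [|u' []]] //; exfalso.
  have inF z : z \in F -> z = u.
    by rewrite -[z \in _]/(z \in enum_fset _) E inE => /eqP.
  by move: n12; rewrite (inF t1) // (inF t2) // eqxx.
have inF z : z \in F -> z = u \/ z = u'.
  by rewrite -[z \in _]/(z \in enum_fset _) E !inE => /orP[]/eqP; [left|right].
by move: n12 n13 n23; have [->|->] := inF t1 h1; have [->|->] := inF t2 h2;
  have [->|->] := inF t3 h3; rewrite ?eqxx.
Qed.

Lemma tgood_anchor L t t' : tgood L -> t \in L -> t' \in L -> anchor t = anchor t'.
Proof.
case=> [e|v {}L L0 Lv _ _|s o].
- by rewrite !inE => /eqP -> /eqP ->.
- move=> /Lv tv /Lv t'v; have av u : at_vertex v u -> anchor u = vp R v.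
    by case: u => [[[v'|e]|p]|[s [d b]]] //= ->.
  by rewrite !av.
- by move=> /square_toksP[d [b [-> _]]] /square_toksP[d' [b' [-> _]]].
Qed.

(** The attaching map of the side is affine, so a segment of the edge and the corresponding segment
    on the boundary of the square have one image. *)
Lemma sg_side s d b t t' :
  sg c1 (em (side s d b).1) (unit_flip (side s d b).2 t) (unit_flip (side s d b).2 t') =
  sg c2 (sm s) (mkdir d (ue b) t) (mkdir d (ue b) t').
Proof.
have cm : continuous (fun t : I => mkdir d (ue b) t).
  by case: (d); apply: continuous_pair; (try exact: cst_continuous) => r; exact: cvg_id.
rewrite -(@sg_comp R T _ _ c2 c1 (sm s) _ t t' (@sm_cont R X s) cm).
rewrite -(@sg_comp R T _ _ c1 c1 (em (side s d b).1) _ t t' (@em_cont R X _) (@unit_flip_cont R _)).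
by congr (sg c1 _ _ _); apply/funext => r; rewrite sm_side.
Qed.

Lemma unit_flip_end o b : unit_flip o (ue b) = ue (b (+) o).
Proof. by rewrite -[ue b]/(pos_pt R (Some b)) -pos_pt_flip. Qed.

Lemma unit_flip_half o : unit_flip o half = half.
Proof. by rewrite -[half]/(pos_pt R None) -pos_pt_flip. Qed.

Lemma sg_side_end s d b b' :
  sg c1 (em (side_end s d b b').1) (ue (side_end s d b b').2) half =
  sg c2 (sm s) (mkdir d (ue b) (ue b')) (mkdir d (ue b) half).
Proof. by rewrite -sg_side unit_flip_end unit_flip_half. Qed.

Lemma sm_side_end s d b b' :
  sm s (mkdir d (ue b) (ue b')) = vp R (endpoint (side_end s d b b').1 (side_end s d b b').2).
Proof. by rewrite sm_side unit_flip_end em_end. Qed.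

Lemma sm_side_half s d b : sm s (mkdir d (ue b) half) = em (side s d b).1 half.
Proof. by rewrite sm_side unit_flip_half. Qed.

Lemma mkdirC (U : Type) d (x y : U) : mkdir (~~ d) y x = mkdir d x y.
Proof. by case: d. Qed.

(** Transport to a vertex is right multiplication by a path that does not depend on the class, so it
    can be cancelled. *)
Lemma tr1_path t (k : set (I -> T)) : pfib x0 (anchor t) k -> exists f : I -> T,
  [/\ continuous f, f zero = anchor t, f one = anchor (cv1 t) &
      forall k : set (I -> T), pfib x0 (anchor t) k -> tr1 t k = pmul k (pcls f)].
Proof.
move=> fk; case: t fk => [[[v|e]|p]|[s [d b]]] /= fk.
- exists (fun=> vp R v); split=> //; first exact: cst_continuous.
  by move=> k' [f [cf _ f1 ->]]; rewrite -f1 pmulp1.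
- exists (fun=> em e half); split=> //; first exact: cst_continuous.
  by move=> k' [f [cf _ f1 ->]]; rewrite -f1 pmulp1.
- exists (fun t => em p.1 (lerp c1 (ue p.2) half t)); split=> //.
  + by apply: f_seg_cont; exact: em_cont.
  + by rewrite lerp0 em_end.
  + by rewrite lerp1.
- exists (fun t => sm s (lerp c2 ctr (mkdir d (ue b) half) t)); split=> //.
  + by apply: f_seg_cont; exact: sm_cont.
  + by rewrite lerp0.
  + by rewrite lerp1 sm_side_half.
Qed.

Lemma tfib_face L F k : tgood L -> F `<` L -> F != fset0 -> tfib L k ->
  tfib (tcv F @` F) (ttr F k).
Proof.
move=> gL FL F0 fk; have sL := tgood_squarish gL.
have /fsubsetP sub := fproper_sub FL.
case: (fset_cases F0) => [[t FE]|[t [t' [tt FE]]]|[t1 [t2 [t3 [h n12 n13 n23]]]]].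
- subst F; rewrite imfset_fset1 tcv1 ttr1 => u; rewrite inE => /eqP ->.
  have ft : pfib x0 (anchor t) k by apply: fk; apply: sub; rewrite inE.
  have [f [cf f0 f1 ->//]] := tr1_path ft.
  by apply: pfib_mul ft _; exists f.
- subst F; have tL : t \in L by apply: sub; rewrite !inE eqxx.
  have t'L : t' \in L by apply: sub; rewrite !inE eqxx orbT.
  rewrite imfset_fset2 tcv2 // tcv2r // (ttr2 _ sL) //.
  have [[s [d [b [b' cp]]]]|[e1 e2]] := pair_cases sL tL t'L; last first.
    have -> : tr2 t t' k = k.
      case: t t' e1 {tt sub FL F0 tL t'L e2} => [[[v|e]|p]|[s [d b]]] [[[v'|e']|p']|[s' [d' b']]] //=.
      by case: ifP.
    by rewrite e1 e2 => u; rewrite !inE => /orP[]/eqP ->; apply: fk.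
  have [E1 E2 _] := cv2_corner cp; rewrite E1 E2; have := fk _ tL.
  move: cp => [-> ->] /=; rewrite (_ : d != ~~ d); last by case: d {E1 E2}.
  move=> fc; have fm : pfib x0 (sm s (mkdir d (ue b) (ue b')))
      (pmul k (sg c2 (sm s) ctr (mkdir d (ue b) (ue b')))).
    by apply: pfib_mul fc _; apply: pfib_sg; exact: sm_cont.
  move=> u; rewrite !inE => /orP[]/eqP -> /=; first by rewrite -sm_side_end.
  by rewrite -side_end_endpoint -sm_side_end.
- rewrite (ttr3 _ h) // => u /imfsetP[z /= zF ->]; rewrite (tcv3 _ h) //.
  by apply: fk; apply: sub.
Qed.

(** The route from the centre of a square to a corner and on to the midpoint of a side is homotopic
    in the square to the direct segment, by [sg_mul]. In all other cases one of the two transports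
    is trivial. *)
Lemma ttr_ttr L F G k : tgood L -> F `<` L -> G `<=` F -> G != fset0 -> tfib L k ->
  ttr (tcv F @` G) (ttr F k) = ttr G k.
Proof.
move=> gL FL GF G0 fk; have sL := tgood_squarish gL.
have F0 : F != fset0 by apply: contraTneq G0 => F0; rewrite negbK -fsubset0 -F0.
have /fsubsetP sub := fproper_sub FL.
case: (fset_cases F0) => [[t FE]|[t [t' [tt FE]]]|[t1 [t2 [t3 [h n12 n13 n23]]]]].
- subst F; have -> : G = [fset t].
    have /fset0Pn[z zG] := G0; have := fsubsetP GF _ zG; rewrite inE => /eqP zt.
    by apply/eqP; rewrite eqEfsubset GF /= fsub1set -zt.
  by rewrite imfset_fset1 tcv1 !ttr1; case: (t) => [[[v|e]|p]|[s [d b]]].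
- subst F; have tL : t \in L by apply: sub; rewrite !inE eqxx.
  have t'L : t' \in L by apply: sub; rewrite !inE eqxx orbT.
  have neq := cv2_neq sL tL t'L tt.
  have gF := tgood_face gL FL F0; have sF := tgood_squarish gF.
  rewrite imfset_fset2 tcv2 // tcv2r // in gF sF.
  rewrite (ttr2 _ sL tL t'L tt).
  have tr12 : tr1 (cv2 t t') (tr2 t t' k) = tr1 t k /\ tr1 (cv2 t' t) (tr2 t t' k) = tr1 t' k.
    have [[s [d [b [b' cp]]]]|[e1 e2]] := pair_cases sL tL t'L; last first.
      have -> : tr2 t t' k = k.
        case: t t' e1 {tt sub FL F0 tL t'L e2 GF gF sF neq} => [[[v|e]|p]|[s [d b]]] [[[v'|e']|p']|[s' [d' b']]] //=.
        by case: ifP.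
      by rewrite e1 e2.
    have [-> -> _] := cv2_corner cp; move: cp => [-> ->].
    rewrite /tr2 (_ : d != ~~ d); last by case: (d).
    split; rewrite /tr1 sg_side_end -pmulA; congr pmul.
      by rewrite sg_mul //; exact: sm_cont.
    by rewrite !mkdirC sg_mul ?mkdirC //; exact: sm_cont.
  have [GE|Gne] := eqVneq G [fset t; t'].
    rewrite GE imfset_fset2 tcv2 // tcv2r // (ttr2 _ sL tL t'L tt).
    rewrite (ttr2 _ sF) ?fset21 ?fset22 //.
    have [[s [d [b [b' cp]]]]|[e1 e2]] := pair_cases sL tL t'L.
      by have [-> -> _] := cv2_corner cp.
    have e3 : tr2 t t' k = k.
      case: t t' e1 {tt sub FL F0 tL t'L e2 GF gF sF neq tr12 GE} => [[[v|e]|p]|[s [d b]]] [[[v'|e']|p']|[s' [d' b']]] //=.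
      by case: ifP.
    by rewrite e1 e2 !e3.
  case: (fset_cases G0) => [[u GE]|[u [u' [uu GE]]]|[u1 [u2 [u3 [h n12 n13 n23]]]]].
  + have : u \in [fset t; t'] by apply: (fsubsetP GF); rewrite GE inE.
    rewrite GE imfset_fset1 !ttr1 !inE => /orP[]/eqP ->.
      by rewrite tcv2 // tr12.1.
    by rewrite tcv2r // tr12.2.
  + case/eqP: Gne; apply/eqP; rewrite eqEfcard GF /=.
    by rewrite GE !cardfs2 tt uu.
  + have inF z : z \in G -> z = t \/ z = t'.
      by move=> /(fsubsetP GF); rewrite !inE => /orP[]/eqP ->; [left|right].
    by exfalso; move: h n12 n13 n23 => /and3P[/inF[]-> /inF[]-> /inF[]->]; rewrite ?eqxx.
- rewrite (ttr3 _ h) //; congr ttr; rewrite -[RHS]imfset_id; apply: eq_in_imfset => z _.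
  exact: (tcv3 _ h).
Qed.

(** The label is carried back from the vertex to the anchor along the reversed path. *)
Lemma tfib_lift L x k : tgood L -> [fset x] `<` L -> tfib [fset tcv [fset x] x] k ->
  exists k', tfib L k' /\ ttr [fset x] k' = k.
Proof.
move=> gL xL; rewrite tcv1 => /(_ (cv1 x)); rewrite inE eqxx => /(_ isT) fk.
pose f t := match x with
  | inl (inr p) => em p.1 (lerp c1 (ue p.2) half t)
  | inr (s, (d, b)) => sm s (lerp c2 ctr (mkdir d (ue b) half) t)
  | _ => anchor x
  end.
have [cf f0 f1] : [/\ continuous f, f zero = anchor x & f one = anchor (cv1 x)].
  rewrite /f; case: (x) => [[[v|e]|p]|[s [d b]]]; split=> //; rewrite ?lerp0 ?lerp1 ?sm_side_half //.
  - exact: cst_continuous.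
  - exact: cst_continuous.
  - by apply: f_seg_cont; exact: em_cont.
  - by rewrite em_end.
  - by apply: f_seg_cont; exact: sm_cont.
have fk' : pfib x0 (anchor x) (pmul k (pcls (revp f))).
  apply: pfib_mul fk _; exists (revp f); rewrite revp0 revp1 f0 f1; split=> //.
  exact: revp_cont.
exists (pmul k (pcls (revp f))); split.
  by move=> t tL; rewrite (tgood_anchor gL tL (fproper1set xL)).
have E : tr1 x (pmul k (pcls (revp f))) = pmul (pmul k (pcls (revp f))) (pcls f).
  rewrite /f; move: fk'; rewrite /f; case: (x) => [[[v|e]|p]|[s [d b]]] //=.
    by move=> [g [cg _ g1 ->]]; rewrite -g1 pmulp1.
  by move=> [g [cg _ g1 ->]]; rewrite -g1 pmulp1.
rewrite ttr1 E -pmulA pmulVp //; have [g [cg _ g1 ->]] := fk.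
by rewrite f1 -g1 pmulp1.
Qed.

Lemma ttr_inj L x k k' : tgood L -> [fset x] `<` L -> tfib L k -> tfib L k' ->
  ttr [fset x] k = ttr [fset x] k' -> k = k'.
Proof.
move=> gL /fproper1set xL /(_ _ xL) fk /(_ _ xL) fk'; rewrite !ttr1.
have [f [cf f0 f1 fE]] := tr1_path fk; rewrite !fE //.
exact: pfib_mulK fk fk' cf f0.
Qed.

Definition tdata : token_data := @TokenData token (set (I -> T)) (@tgood X) tfib
  (@tcv X) ttr (@tgood_neq0 X) (@tcv_inj X) (@tgood_face X) tfib_face (@tcv_tcv X)
  ttr_ttr tfib_lift ttr_inj.

End TokenLabels.

(** * Links *)

Section ShortCycles.
Variables (N : Type) (adj : N -> N -> Prop) (d : nat -> N) (n : nat).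
Hypothesis n45 : n = 4%N \/ n = 5%N.
Hypothesis d_per : forall k, d (k + n)%N = d k.
Hypothesis d_adj : forall k, adj (d k) (d k.+1).
Hypothesis adj_sym : forall x y, adj x y -> adj y x.
Hypothesis d_nadj : forall k, ~ adj (d k) (d k.+2).
Hypothesis d_neq : forall k, d k <> d k.+2.

(** Models the link of a vertical edge: the nodes outside [isB] form a clique for each colour (an
    end of the edge), and the nodes in [isB] are bridges (squares), with at most one neighbour of
    each colour and at most one bridge at each other node. *)
Lemma no_short_cycle_AB (isB : N -> bool) (S : Type) (col : N -> S) :
  (forall x y, adj x y -> ~~ isB x -> ~~ isB y -> col x = col y) ->
  (forall k l, ~~ isB (d k) -> ~~ isB (d l) -> d k <> d l -> col (d k) = col (d l) -> adj (d k) (d l)) ->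
  (forall x y, isB x -> isB y -> ~ adj x y) ->
  (forall x y y', isB x -> ~~ isB y -> ~~ isB y' -> adj x y -> adj x y' -> col y = col y' -> y = y') ->
  (forall x x' y, isB x -> isB x' -> ~~ isB y -> adj x y -> adj x' y -> x = x') -> False.
Proof.
move=> cAA AA BB Bc Bu.
(* On either side of a bridge there are two consecutive non-bridges of equal colour, and the colours
   on the two sides differ; this does not close up in length 4 or 5. *)
have key k : isB (d k.+2) -> False.
  move=> B2.
  have A1 : ~~ isB (d k.+1) by apply/negP => B1; exact: BB (d_adj k.+1).
  have A3 : ~~ isB (d k.+3) by apply/negP => B3; exact: BB (d_adj k.+2).
  have A0 : ~~ isB (d k).
    apply/negP => B0; apply: (@d_neq k); apply: (Bu _ _ (d k.+1)) => //.
    by apply: adj_sym; exact: d_adj.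
  have A4 : ~~ isB (d k.+4).
    apply/negP => B4; apply: (@d_neq k.+2); apply: (Bu _ _ (d k.+3)) => //.
    by apply: adj_sym; exact: d_adj.
  have c01 := cAA _ _ (d_adj k) A0 A1; have c34 := cAA _ _ (d_adj k.+3) A3 A4.
  have c13 : col (d k.+1) <> col (d k.+3).
    move=> E; apply: (@d_neq k.+1); apply: (Bc (d k.+2)) => //.
    by apply: adj_sym; exact: d_adj.
  have dk := d_per k; case: n45 dk => -> dk.
    by apply: c13; rewrite -c01 c34 -dk !addnS addn0.
  have E : d k.+4.+1 = d k by rewrite -dk !addnS addn0.
  by have := cAA _ _ (d_adj k.+4) A4; rewrite E => /(_ A0) e; apply: c13; rewrite -c01 c34 e.
(* Modulo the period every index has the form [m.+2], to which [key] applies. *)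
have nB k : ~~ isB (d k).
  apply/negP => B; have [m E] : exists m, (k + n = m.+2)%N.
    by case: n45 => ->; [exists k.+2|exists k.+3]; rewrite !addnS addn0.
  by apply: (@key m); rewrite -E d_per.
by apply: (@d_nadj 0); apply: AA => //; rewrite (cAA _ _ (d_adj 0)) // (cAA _ _ (d_adj 1)).
Qed.

(** Models the other links: on each side the nodes in [isK] are adjacent to everything, the rest are
    pairwise nonadjacent, and only the latter have neighbours across, at most one each. *)
Lemma no_short_cycle_KW (isK : N -> bool) (S : eqType) (side : N -> S) :
  (forall k l, d k <> d l -> side (d k) = side (d l) -> isK (d k) -> adj (d k) (d l)) ->
  (forall x y, adj x y -> side x = side y -> isK x || isK y) ->
  (forall x y, adj x y -> side x <> side y -> ~~ isK x && ~~ isK y) ->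
  (forall x y z, adj x y -> adj x z -> side x <> side y -> side x <> side z -> y = z) -> False.
Proof.
move=> Kadj WW cross cu.
(* The neighbours before and after a crossing are in [isK], on opposite sides. They are then too
   close in the cycle for a second crossing, which could not involve [isK]. *)
have key k : side (d k.+1) <> side (d k.+2) -> False.
  move=> s12; have /andP[W1 W2] := cross _ _ (d_adj k.+1) s12.
  have s01 : side (d k.+1) = side (d k).
    apply/eqP; apply: contraT => /eqP s01; exfalso; apply: (@d_neq k).
    by apply: (cu (d k.+1)) => //; exact: adj_sym.
  have s23 : side (d k.+2) = side (d k.+3).
    apply/eqP; apply: contraT => /eqP s23; exfalso; apply: (@d_neq k.+1).
    by apply: (cu (d k.+2)) => //; [exact: adj_sym|exact/nesym].
  have K0 : isK (d k) by have := WW _ _ (d_adj k) (esym s01); rewrite (negbTE W1) orbF.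
  have K3 : isK (d k.+3) by have := WW _ _ (d_adj k.+2) s23; rewrite (negbTE W2).
  have dk := d_per k; case: n45 dk => -> dk.
    have E : d k.+4 = d k by rewrite -dk !addnS addn0.
    have := cross _ _ (d_adj k.+3); rewrite K3 E => h; apply: s12.
    have [|ne] := eqVneq (side (d k.+3)) (side (d k)); last by have := h (elimN eqP ne).
    by rewrite s01 s23 => ->.
  have E : d k.+4.+1 = d k by rewrite -dk !addnS addn0.
  have s34 : side (d k.+3) = side (d k.+4).
    apply/eqP; apply: contraT => /eqP ne.
    by have := cross _ _ (d_adj k.+3) ne; rewrite K3.
  have s40 : side (d k.+4) = side (d k).
    apply/eqP; apply: contraT => /eqP ne.
    by have := cross _ _ (d_adj k.+4); rewrite E K0 andbF => /(_ ne).
  by apply: s12; rewrite s01 s23 s34 s40.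
have same k : side (d k) = side (d k.+1).
  have [m E] : exists m, (k + n = m.+1)%N.
    by case: n45 => ->; [exists k.+3|exists k.+4]; rewrite !addnS addn0.
  rewrite -(d_per k) -(d_per k.+1) addSn E; apply/eqP; apply: contraT => /eqP.
  by move=> h; exfalso; exact: key h.
have /orP[K0|K1] := WW _ _ (d_adj 0) (same 0).
  by apply: (@d_nadj 0); apply: Kadj => //; rewrite (same 0) (same 1).
by apply: (@d_nadj 1); apply: Kadj => //; rewrite (same 1) (same 2).
Qed.

End ShortCycles.

Lemma iter_ordS n (i : 'I_n) k : val (iter k (@ordS n) i) = ((i + k) %% n)%N.
Proof.
elim: k => [|k IH] /=; first by rewrite addn0 modn_small.
by rewrite IH -addn1 modnDml addn1 addnS.
Qed.

Section CycleSequence.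
Variables (N : Type) (adj : N -> N -> Prop) (n : nat) (c : 'I_n -> N).
Hypothesis n45 : n = 4%N \/ n = 5%N.
Hypothesis cI : injective c.
Hypothesis ca : forall i, adj (c i) (c (ordS i)).
Hypothesis cd : forall i j, adj (c i) (c j) -> j = ordS i \/ i = ordS j.

(** Unrolling the cycle into a periodic sequence replaces indices modulo [n] by successors. Since
    [n] is 4 or 5, terms at distance two are distinct and nonadjacent. *)
Lemma cycle_sequence : exists d : nat -> N,
  [/\ forall k, exists i, d k = c i, forall k, d (k + n)%N = d k,
      forall k, adj (d k) (d k.+1), forall k, ~ adj (d k) (d k.+2) &
      forall k, d k <> d k.+2].
Proof.
have n0 : (0 < n)%N by case: n45 => ->.
pose i0 := Ordinal n0; pose e k := iter k (@ordS n) i0.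
have ev k : val (e k) = (k %% n)%N by rewrite /e iter_ordS add0n.
have neq k m : (0 < m < n)%N -> e k <> e (k + m)%N.
  move=> /andP[m0 mn] /(congr1 val); rewrite !ev => /eqP.
  by rewrite -{1}[k]addn0 eqn_modDl mod0n modn_small // => /eqP m0'; rewrite -m0' in m0.
have per k : e (k + n)%N = e k by apply: val_inj; rewrite !ev modnDr.
exists (fun k => c (e k)); split.
- by move=> k; exists (e k).
- by move=> k; rewrite per.
- by move=> k; exact: ca.
(* Adjacency of the terms [k] and [k + 2] would identify position [k + 2] with [k + 1], or [k] with
   [k + 3], modulo [n]. *)
- move=> k /cd[] E.
    by apply: (@neq k.+1 1%N); [case: n45 => ->|rewrite addn1].
  apply: (@neq k 3%N); first by case: n45 => ->.
  by rewrite !addnS addn0.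
- move=> k /cI; rewrite -addn2; apply: neq; by case: n45 => ->.
Qed.

End CycleSequence.

Lemma neq_negb (d : bool) : (d != ~~ d) * (~~ d != d).
Proof. by case: d. Qed.

(** * Links in the complex of X *)

Section TokenLinksOfX.
Variables (R : realType) (X : VH_complex) (x0 : square_realization R X).
Hypothesis npc : nonpositively_curved X.
Local Notation token := (token X).
Local Notation D := (tdata x0).

Definition corner_name (s : square X) (a b : bool) : token * token :=
  (TN (side_end s (vdir s) a b), TN (side_end s (~~ vdir s) b a)).
Definition side_name (s : square X) (a : bool) : token * token :=
  (TS s (vdir s) a, TS s (vdir s) (~~ a)).
Definition swapn (n : token * token) := (n.2, n.1).

Definition vtok (t : token) : bool := if t is inl (inr p) then vertical p.1 else false.

(** The only place where nonpositive curvature enters: two corners with the same pair of edge ends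
    would form a cycle of length 2 in the link of their vertex. *)
Lemma npc_corner s a b s' a' b' : corner_name s a b = corner_name s' a' b' ->
  [/\ s = s', a = a' & b = b'].
Proof.
move=> E; have hV : side_end s (vdir s) a b = side_end s' (vdir s') a' b'.
  by apply: TN_inj; exact: (congr1 fst E).
have hH : side_end s (~~ vdir s) b a = side_end s' (~~ vdir s') b' a'.
  by apply: TN_inj; exact: (congr1 snd E).
(* Converts the coordinates (transverse to vertical sides, transverse to horizontal sides) into the
   order of the coordinates of the square. *)
pose cc (s : square X) (a b : bool) := if vdir s then (a, b) else (b, a).
pose V := side_end s (vdir s) a b; pose H := side_end s (~~ vdir s) b a.
pose v := endpoint V.1 V.2.
have Hv : endpoint H.1 H.2 = v by rewrite /H /v -side_end_endpoint.
have cv s1 a1 b1 : side_end s1 (vdir s1) a1 b1 = V ->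
    corner s1 (cc s1 a1 b1).1 (cc s1 a1 b1).2 = v.
  rewrite /v => <-; rewrite /cc /side_end; case: (vdir s1).
    by rewrite endpoint_side1.
  by rewrite endpoint_side2.
pose A1 : link_arc v := exist (fun c : square X * (bool * bool) => corner c.1 c.2.1 c.2.2 = v)
   (s, cc s a b) (cv s a b erefl).
pose A2 : link_arc v := exist (fun c : square X * (bool * bool) => corner c.1 c.2.1 c.2.2 = v)
   (s', cc s' a' b') (cv s' a' b' (esym hV)).
pose nV : link_node v := exist (fun p : edge X * bool => endpoint p.1 p.2 = v) V erefl.
pose nH : link_node v := exist (fun p : edge X * bool => endpoint p.1 p.2 = v) H Hv.
have node_eq (p q : link_node v) : sval p = sval q -> p = q.
  by case: p q => [p hp] [q hq] /= pq; subst q; congr exist; exact: Prop_irrelevance.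
have nVH : nV <> nH.
  by move=> /(congr1 sval) /=; exact: side_end_neq.
have ends s1 a1 b1 h : side_end s1 (vdir s1) a1 b1 = V -> side_end s1 (~~ vdir s1) b1 a1 = H ->
    @joins (vertex_link v) (exist (fun c : square X * (bool * bool) => corner c.1 c.2.1 c.2.2 = v) (s1, cc s1 a1 b1) h) nV nH.
  move=> h1 h2; rewrite /joins /= /link_arc_ends.
  move: h; rewrite /cc; case E1 : (vdir s1) h1 h2 => h1 h2 h; [left|right].
    by congr pair; apply: node_eq.
  by congr pair; apply: node_eq.
have [A12|A12] := EM (A1 = A2).
  have := congr1 sval A12; rewrite /= => -[ss]; subst s'; rewrite /cc.
  by case: (vdir s) => -[-> ->].
exfalso; apply: (npc (v := v) (n := 2)) => //.
exists (fun i : 'I_2 => if val i == 0%N then nV else nH : Defs.node (vertex_link v)),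
       (fun i : 'I_2 => if val i == 0%N then A1 else A2 : Defs.arc (vertex_link v)).
split.
- move=> [[|[|//]] hi] [[|[|//]] hj] //= e; (try exact: val_inj).
  by case: (nVH (esym e)).
- move=> [[|[|//]] hi] [[|[|//]] hj] //= e; (try exact: val_inj).
  by case: (A12 (esym e)).
- move=> [[|[|//]] hi] /=; first exact: ends.
  have [e|e] := ends s' a' b' (cv s' a' b' (esym hV)) (esym hV) (esym hH); [right|left]; exact: e.
Qed.

Lemma side_flip (s : square X) d b b' b'' : side_end s d b b' = side_end s d b b'' -> b' = b''.
Proof. by rewrite /side_end => -[/addIb]. Qed.

Lemma ename_cv2 y z : y != z -> @ename D y z = (cv2 y z, cv2 z y).
Proof. by move=> yz; rewrite /ename /= tcv2 // tcv2r. Qed.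

Lemma isname_vertex v M y n : y \in M -> (forall t, t \in M -> at_vertex v t) ->
  @isname D M y n <-> [/\ n.1 = y, n.2 \in M & n.2 != y].
Proof.
move=> yM Mv.
have c2 t t' : t \in M -> cv2 t t' = t by move=> /Mv; case: t => [[[v'|e]|p]|[s [d b]]].
split=> [[z [zM zy <-]]|[e n2 n21]].
  have yz : y != z by rewrite eq_sym.
  by rewrite ename_cv2 // (c2 _ _ yM) (c2 _ _ zM).
have yz : y != n.2 by rewrite eq_sym.
exists n.2; split=> //; rewrite ename_cv2 // (c2 _ _ yM) (c2 _ _ n2) -e.
by case: (n).
Qed.

Lemma isname_vert (s : square X) o a n :
  @isname D (square_toks s o) (TS s (vdir s) a) n <->
  n = side_name s a \/ exists2 b, o = Some b & n = corner_name s a b.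
Proof.
split=> [[z [/square_toksP[d [b [-> db]]] zy <-]]|].
  have yz : (TS s (vdir s) a : token) != TS s d b by rewrite eq_sym.
  rewrite ename_cv2 //; move: db zy {yz}; have [->|dv] := eqVneq d (vdir s).
    move=> _ zy; left; rewrite /cv2 eqxx /= /side_name.
    by move: zy; case: a; case: b; rewrite ?eqxx.
  have -> : d = ~~ vdir s by move: dv; case: d; case: vdir.
  by move=> /= /eqP ob _; right; exists b => //; rewrite !neq_negb.
have ne (x y : token) : x <> y -> x != y by move=> /eqP.
move=> [->|[b ob ->]].
  exists (TS s (vdir s) (~~ a)); have n1 : (TS s (vdir s) (~~ a) : token) != TS s (vdir s) a.
    by apply: ne => -[]; case: (a).
  split=> //; first by apply/square_toksP; exists (vdir s), (~~ a); rewrite eqxx.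
  have n2 : (TS s (vdir s) a : token) != TS s (vdir s) (~~ a) by rewrite eq_sym.
  by rewrite ename_cv2 //= eqxx.
exists (TS s (~~ vdir s) b); have n1 : (TS s (~~ vdir s) b : token) != TS s (vdir s) a.
  by apply: ne => -[]; case: (vdir s).
split=> //; first by apply/square_toksP; exists (~~ vdir s), b; rewrite ob eqxx orbT.
have n2 : (TS s (vdir s) a : token) != TS s (~~ vdir s) b by rewrite eq_sym.
rewrite ename_cv2 // /cv2 !neq_negb ?negbK; reflexivity.
Qed.

Lemma isname_horiz (s : square X) b n :
  @isname D (square_toks s (Some b)) (TS s (~~ vdir s) b) n <->
  exists a, n = swapn (corner_name s a b).
Proof.
have ne (x y : token) : x <> y -> x != y by move=> /eqP.
split=> [[z [/square_toksP[d [b' [-> db]]] zy <-]]|[a ->]].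
  have yz : (TS s (~~ vdir s) b : token) != TS s d b' by rewrite eq_sym.
  rewrite ename_cv2 //; move: db zy {yz}.
  have [->|dv] := eqVneq d (vdir s).
    move=> _ _; exists b'; rewrite /swapn /= !neq_negb; reflexivity.
  have -> : d = ~~ vdir s by move: dv; case: d; case: vdir.
  by move=> /= /eqP[->]; rewrite eqxx.
exists (TS s (vdir s) a); have n1 : (TS s (vdir s) a : token) != TS s (~~ vdir s) b.
  by apply: ne => -[]; case: (vdir s).
split=> //; first by apply/square_toksP; exists (vdir s), a; rewrite eqxx.
have n2 : (TS s (~~ vdir s) b : token) != TS s (vdir s) a by rewrite eq_sym.
rewrite ename_cv2 // /cv2 !neq_negb ?negbK; reflexivity.
Qed.

(** The simplices around [t0]: those anchored at a vertex, and the squares seen from a vertical or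
    from a horizontal side. *)
Variant lk_spec (t0 : token) : {fset token} -> token -> Prop :=
| LkVertex v M y : y \in M -> (forall t, t \in M -> at_vertex v t) ->
    (forall t t', t \in M -> t' \in M -> vtok t -> vtok t' -> t = t') ->
    (exists2 z, z \in M & z != y) -> cv1 y = t0 -> lk_spec t0 M y
| LkVert s o a : t0 = TE (side s (vdir s) a).1 ->
    lk_spec t0 (square_toks s o) (TS s (vdir s) a)
| LkHoriz s b : t0 = TE (side s (~~ vdir s) b).1 ->
    lk_spec t0 (square_toks s (Some b)) (TS s (~~ vdir s) b).

Lemma lkP t0 M y : @lk D t0 M y -> lk_spec t0 M y.
Proof.
move=> [gM]; rewrite /= tcv1 => yM yt; have yM' := fproper1set yM.
case: gM yM yM' => [e|v {}M M0 Mv Mu Mn|s o] yM yM'.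
- by move: yM'; rewrite inE => /eqP yE; rewrite yE (negbTE (fproper_irrefl _)) in yM.
- apply: (LkVertex (v := v)) => //.
    move=> [[[v1|e1]|p1]|[s1 [d1 b1]]] [[[v2|e2]|p2]|[s2 [d2 b2]]] //= h1 h2 u1 u2.
    by rewrite (Mu p1 p2).
  move: yM; rewrite fproperE => /andP[_ /fsubsetPn[z zM zy]]; exists z => //.
  by move: zy; rewrite inE.
- move: yM' yt => /square_toksP[d [b [-> db]]] /= <-.
  move: db; have [->|dv] := eqVneq d (vdir s); first by move=> _; constructor.
  have -> : d = ~~ vdir s by move: dv; case: d; case: vdir.
  by move=> /= /eqP ->; constructor.
Qed.

Lemma at_vertex_inj v v' t : at_vertex v t -> at_vertex v' t -> v = v' :> vertex X.
Proof. by case: t => [[[v1|e]|p]|[s [d b]]] //= -> ->. Qed.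

Lemma side_end_vertex s d b b' :
  at_vertex (endpoint (side_end s d b b').1 (side_end s d b b').2) (TN (side_end s (~~ d) b' b) : token).
Proof. by rewrite /= -side_end_endpoint. Qed.

Lemma vtok_side_end s d b b' : vtok (TN (side_end s d b b')) = (d == vdir s).
Proof. by rewrite /= vertical_side. Qed.

Local Notation isn := (@isname D).

Lemma link_inj t0 M y z z' : @lk D t0 M y -> z \in M -> z' \in M ->
  z != y -> z' != y -> @ename D y z = ename y z' -> z = z'.
Proof.
move=> /lkP ly zM z'M zy z'y.
have yz : y != z by rewrite eq_sym.
have yz' : y != z' by rewrite eq_sym.
rewrite !ename_cv2 // => E.
have E1 : cv2 y z = cv2 y z' := congr1 fst E.
have E2 : cv2 z y = cv2 z' y := congr1 snd E.
case: ly zM z'M zy z'y yz yz' {E} E1 E2 => {t0 M y} [v M y yM Mv _ _ _|s o a _|s b _].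
- move=> zM z'M _ _ _ _ _.
  have c2 t t' : t \in M -> cv2 t t' = t by move=> /Mv; case: t => [[[v'|e]|p]|[s [d b]]].
  by rewrite !c2.
- move=> /square_toksP[d [b [-> db]]] /square_toksP[d' [b' [-> db']]] _ _ _ _ _ /=.
  have [dv|dv] := eqVneq d (vdir s); have [dv'|dv'] := eqVneq d' (vdir s) => //=.
  move: db db'; rewrite (negbTE dv) (negbTE dv') /= => /eqP -> /eqP[->] _.
  by move: dv dv'; case: d; case: d'; case: (vdir s).
- have vz d b' : (d == vdir s) || (Some b == Some b') -> (TS s d b' : token) != TS s (~~ vdir s) b ->
      d = vdir s.
    have [//|dv] := eqVneq d (vdir s); rewrite /= => /eqP[<-].
    have -> : d = ~~ vdir s by move: dv; case: d; case: vdir.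
    by rewrite eqxx.
  move=> /square_toksP[d [b1 [-> db]]] /square_toksP[d' [b1' [-> db']]] n1 n2 _ _.
  rewrite (vz _ _ db n1) (vz _ _ db' n2) /cv2 !neq_negb => /TN_inj/side_flip -> //.
Qed.

(** At a vertex, the names have the base as first component and the other tokens as second. For
    squares the side names or [npc_corner] recover the square. *)
Lemma link_det t0 M y M' y' : @lk D t0 M y -> @lk D t0 M' y' ->
  (forall n, isn M y n <-> isn M' y' n) -> M = M' /\ y = y'.
Proof.
(* Names at a vertex have a constant first component, which is not a side. A square seen from a
   vertical side has a name starting with a side, and seen from a horizontal side it has names with
   two different first components. *)
have PQ v M1 y1 (s : square X) o d b : y1 \in M1 -> (forall t, t \in M1 -> at_vertex v t) ->
    d = vdir s \/ d = ~~ vdir s /\ o = Some b ->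
    (forall n, isn M1 y1 n <-> isn (square_toks s o) (TS s d b) n) -> False.
  move=> yM Mv [->|[-> ->]] E.
    have /E/(isname_vertex _ yM Mv) [y1E _ _] : isn (square_toks s o) (TS s (vdir s) b ) (side_name s b).
      by apply/isname_vert; left.
    by have := Mv _ yM; rewrite -y1E.
  have h a : TN (side_end s (~~ vdir s) b a) = y1.
    have /E/(isname_vertex _ yM Mv) [y1E _ _] : isn (square_toks s (Some b)) (TS s (~~ vdir s) b )
        (swapn (corner_name s a b)) by apply/isname_horiz; exists a.
    exact: y1E.
  by have := h true; rewrite -(h false) => /TN_inj/side_flip.
have PP v M1 y1 v' M2 y2 : y1 \in M1 -> (forall t, t \in M1 -> at_vertex v t) ->
    (exists2 z, z \in M1 & z != y1) ->
    y2 \in M2 -> (forall t, t \in M2 -> at_vertex v' t) ->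
    (forall n, isn M1 y1 n <-> isn M2 y2 n) -> M1 = M2 /\ y1 = y2.
  move=> yM1 Mv1 [z zM zy] yM2 Mv2 E.
  have nE n : [/\ n.1 = y1, n.2 \in M1 & n.2 != y1] <-> [/\ n.1 = y2, n.2 \in M2 & n.2 != y2].
    by rewrite -(isname_vertex n yM1 Mv1) -(isname_vertex n yM2 Mv2).
  have y12 : y1 = y2 by have [] := (nE (y1, z)).1 (And3 erefl zM zy).
  subst y2; split=> //; apply/fsetP => t.
  have [->|ty] := eqVneq t y1; first by rewrite yM1 yM2.
  by apply/idP/idP => tM; [have [] := (nE (y1, t)).1 (And3 erefl tM ty)|have [] := (nE (y1, t)).2 (And3 erefl tM ty)].
move=> /lkP l1 /lkP l2.
case: l1 l2 => {M y} [v M y yM Mv _ My _|s o a _|s b _];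
  case=> {M' y'} [v' M' y' yM' Mv' _ My' _|s' o' a' _|s' b' _] E.
- exact: PP yM Mv My yM' Mv' E.
- by case: (PQ _ _ _ _ _ _ _ yM Mv _ E); left.
- by case: (PQ _ _ _ _ _ _ _ yM Mv _ E); right.
- by case: (PQ _ _ _ s o (vdir s) a yM' Mv' _ (fun n => iff_sym (E n))); left.
- have : isn (square_toks s' o') (TS s' (vdir s') a' ) (side_name s a).
    by apply/E/isname_vert; left.
  move=> /isname_vert[|[b _ //]] e; have : TS s (vdir s) a = TS s' (vdir s') a' :> token.
    exact: (congr1 fst e).
  case=> ss _ aa; subst s' a'; split=> //; congr square_toks.
  (* The presence of the horizontal side [b] shows in the corner name, which determines [b] by
     [npc_corner]. *)
  have sub o1 o2 b : (forall n, isn (square_toks s o1) (TS s (vdir s) a) n ->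
      isn (square_toks s o2) (TS s (vdir s) a ) n) -> o1 = Some b -> o2 = Some b.
    move=> E' ob; have /E'/isname_vert[//|[b2 ob2 e2]] : isn (square_toks s o1) (TS s (vdir s) a ) (corner_name s a b).
      by apply/isname_vert; right; exists b.
    by have [_ _ ->] := npc_corner e2.
  case ob : o => [b|]; first by rewrite (sub o o' b) // => n /E.
  by case ob' : o' => [b|] //; have := sub o' o b (fun n => (E n).2) ob'; rewrite ob.
- have : isn (square_toks s' (Some b')) (TS s' (~~ vdir s') b' ) (side_name s a).
    by apply/E/isname_vert; left.
  by move=> /isname_horiz[a1] // e; have := congr1 fst e.
- by case: (PQ _ _ _ s (Some b) (~~ vdir s) b yM' Mv' _ (fun n => iff_sym (E n))); right.
- have : isn (square_toks s (Some b)) (TS s (~~ vdir s) b ) (side_name s' a').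
    by apply/E/isname_vert; left.
  by move=> /isname_horiz[a1] // e; have := congr1 fst e.
- have : isn (square_toks s' (Some b')) (TS s' (~~ vdir s') b' ) (swapn (corner_name s true b)).
    by apply/E/isname_horiz; exists true.
  move=> /isname_horiz[a1 e]; have : corner_name s true b = corner_name s' a1 b'.
    exact: (congr1 swapn e).
  by move=> /npc_corner[-> _ ->].
Qed.

Definition is_side (n : token * token) : bool := if n.1 is inr _ then true else false.

(** The nodes given by edges of the complex at a vertex [v] of X; the remaining nodes are diagonals
    of squares. *)
Definition vertex_node (t0 : token) (n : token * token) := exists v,
  [/\ at_vertex v n.1, at_vertex v n.2, n.2 != n.1, ~~ (vtok n.1 && vtok n.2) & cv1 n.1 = t0].

Lemma corner_vertex_node s a b : vertex_node (TE (side s (vdir s) a).1) (corner_name s a b).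
Proof.
exists (endpoint (side_end s (vdir s) a b).1 (side_end s (vdir s) a b).2); split=> //.
- exact: side_end_vertex.
- by apply/eqP => /TN_inj/esym; exact: side_end_neq.
- by rewrite !vtok_side_end eqxx; case: (vdir s).
Qed.

Lemma swap_vertex_node s a b :
  vertex_node (TE (side s (~~ vdir s) b).1) (swapn (corner_name s a b)).
Proof.
have [v [h1 h2 h3 h4 _]] := corner_vertex_node s a b.
by exists v; split=> //; [rewrite eq_sym|rewrite andbC].
Qed.

Lemma lnodeP t0 n : @lnode D t0 n ->
  vertex_node t0 n \/ exists s a, n = side_name s a /\ t0 = TE (side s (vdir s) a).1.
Proof.
move=> [M [y [/lkP ly]]]; case: ly => {M y} [v M y yM Mv Mu _ <-|s o a ->|s b ->].
- move=> /(isname_vertex _ yM Mv) [e n2 n21]; left; exists v; rewrite e.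
  split=> //; [exact: Mv|exact: Mv|].
  apply/negP => /andP[h1 h2]; move: n21.
  by rewrite (Mu _ _ n2 yM h2 h1) eqxx.
- move=> /isname_vert[->|[b _ ->]]; first by right; exists s, a.
  by left; exact: corner_vertex_node.
- by move=> /isname_horiz[a ->]; left; exact: swap_vertex_node.
Qed.

(** The edges of the link: between nodes at one end of [t0], between a diagonal and a corner of its
    square ([t0] vertical), and between the two corners along a side ([t0] horizontal). *)
Variant ladj_spec (t0 : token) (n n' : token * token) : Prop :=
| LadjVertex of n.1 = n'.1 & ~~ (vtok n.2 && vtok n'.2) & ~~ is_side n & ~~ is_side n'
| LadjVert s a b of t0 = TE (side s (vdir s) a).1 &
    (n = side_name s a /\ n' = corner_name s a b) \/ (n = corner_name s a b /\ n' = side_name s a)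
| LadjHoriz s a b of t0 = TE (side s (~~ vdir s) b).1 &
    n = swapn (corner_name s a b) & n' = swapn (corner_name s (~~ a) b).

Lemma ladjP t0 n n' : @ladj D t0 n n' -> ladj_spec t0 n n'.
Proof.
move=> [nn [M [y [/lkP ly]]]]; case: ly => {M y} [v M y yM Mv Mu _ <-|s o a t0E|s b t0E].
- move=> /(isname_vertex _ yM Mv) [e n2 n21] /(isname_vertex _ yM Mv) [e' n2' n21'].
  have ys : forall x : token * token, x.1 = y -> ~~ is_side x.
    by move=> x; rewrite /is_side => ->; have := Mv _ yM; case: (y) => [|[s [d b]]].
  apply: LadjVertex; rewrite ?e ?e' ?ys //.
  apply/negP => /andP[h1 h2]; apply: nn.
  move: e e' (Mu _ _ n2 n2' h1 h2); case: (n) => [x1 x2]; case: (n') => [y1 y2] /=.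
  by move=> -> -> ->.
- move=> /isname_vert[nE|[b ob nE]] /isname_vert[n'E|[b' ob' n'E]].
  + by case: nn; rewrite nE n'E.
  + by apply: (LadjVert (s := s) (a := a) (b := b') t0E); left.
  + by apply: (LadjVert (s := s) (a := a) (b := b) t0E); right.
  + by move: ob'; rewrite ob => -[bb]; subst b'; case: nn; rewrite nE n'E.
- move=> /isname_horiz[a nE] /isname_horiz[a' n'E].
  apply: (LadjHoriz t0E nE); rewrite n'E; have : a <> a' by move=> aa; apply: nn; rewrite nE n'E aa.
  by case: (a); case: (a').
Qed.

Lemma ladj_sym t0 n n' : @ladj D t0 n n' -> ladj t0 n' n.
Proof. by move=> [nn [M [y [h1 h2 h3]]]]; split; [exact/nesym|exists M, y]. Qed.

Lemma lk_vertexI v y (S : {fset token}) : S != fset0 -> at_vertex v y ->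
  (forall z, z \in S -> at_vertex v z /\ z != y) ->
  (forall t t', t \in y |` S -> t' \in y |` S -> vtok t -> vtok t' -> t = t') ->
  @lk D (cv1 y) (y |` S) y /\ forall n, isn (y |` S) y n <-> n.1 = y /\ n.2 \in S.
Proof.
move=> S0 yv Sv Su.
have yM : y \in y |` S by rewrite !inE eqxx.
have Mv t : t \in y |` S -> at_vertex v t by rewrite !inE => /orP[/eqP->//|/Sv[]].
have [z zS] := fset0Pn _ S0; have [_ zy] := Sv _ zS.
have zM : z \in y |` S by rewrite !inE zS orbT.
split; last first.
  move=> n; split=> [/(isname_vertex _ yM Mv) [-> + n2]|[e n2]].
    by rewrite !inE (negbTE n2).
  apply/(isname_vertex _ yM Mv); split=> //; first by rewrite !inE n2 orbT.
  by have [] := Sv _ n2.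
split; last by rewrite /= tcv1.
  apply: (@GoodVertex X v) => //.
  - by apply/fset0Pn; exists y.
  - by move=> p p' pM p'M vp vp'; apply: TN_inj; exact: Su.
  - move=> p E; move: zy yM zM; rewrite E !inE => nn /eqP h1 /eqP h2.
    by rewrite h1 h2 eqxx in nn.
rewrite fproperE fsub1set yM /=; apply/fsubsetPn; exists z => //.
by rewrite inE.
Qed.

Lemma ladj_vertex t0 n n' : vertex_node t0 n -> vertex_node t0 n' -> n <> n' -> n.1 = n'.1 ->
  ~~ (vtok n.2 && vtok n'.2) -> @ladj D t0 n n'.
Proof.
move=> [v [v1 v2 n21 nv <-]] [v' [v1' v2' n21' nv' _]] nn E E2.
have vv : v' = v by apply: at_vertex_inj v1' _; rewrite -E.
subst v'; rewrite -E in n21' nv'.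
have [|||lM lN] := @lk_vertexI v n.1 [fset n.2; n'.2] _ v1.
- by apply/fset0Pn; exists n.2; rewrite !inE eqxx.
- by move=> z; rewrite !inE => /orP[]/eqP->.
- move=> t t'; rewrite !inE => /or3P[]/eqP-> /or3P[]/eqP-> // h1 h2; exfalso; move: nv nv' E2;
    rewrite ?h1 ?h2 //.
split=> //; exists (n.1 |` [fset n.2; n'.2]), n.1; split=> //; apply/lN.
  by rewrite !inE eqxx.
by rewrite -E !inE eqxx orbT.
Qed.

(** With a common first component, the second components together with it form one good token set,
    as no two of them are vertical. *)
Lemma flag_same_first t0 (K : set (token * token)) : finite_set K -> (K !=set0)%classic ->
  (forall n, K n -> vertex_node t0 n) -> (forall n n', K n -> K n' -> n.1 = n'.1) ->
  (forall n n', K n -> K n' -> n <> n' -> ~~ (vtok n.2 && vtok n'.2)) ->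
  exists M y, @lk D t0 M y /\ forall n, K n <-> isn M y n.
Proof.
move=> fK [n0 Kn0] Kv K1 K2.
have [v [v1 v2 n21 nv t0E]] := Kv _ Kn0.
pose S : {fset token} := [fset n.2 | n in fset_set K].
have SP z : z \in S <-> exists2 n, K n & z = n.2.
  split=> [/imfsetP[n /= + ->]|[n Kn ->]].
    by rewrite in_fset_set // inE => Kn; exists n.
  by apply/imfsetP; exists n => //=; rewrite in_fset_set // inE.
have Sn z : z \in S -> K (n0.1, z).
  by move=> /SP[n Kn ->]; rewrite -(K1 _ _ Kn Kn0); case: (n) Kn.
have [|z zS|t t'|lM lN] := @lk_vertexI v n0.1 S _ v1.
- by apply/fset0Pn; exists n0.2; apply/SP; exists n0.
- have [v' [/= w1 w2 w21 _ _]] := Kv _ (Sn _ zS).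
  by rewrite (at_vertex_inj v1 w1).
- have base u : u \in S -> ~~ (vtok n0.1 && vtok u).
    by move=> /Sn/Kv[v' []].
  rewrite !inE => /orP[/eqP->|tS] /orP[/eqP->|t'S] // h1 h2.
  + by have := base _ t'S; rewrite h1 h2.
  + by have := base _ tS; rewrite h1 h2.
  + apply/eqP; apply: contraT => /eqP tt'.
    have /= := K2 _ _ (Sn _ tS) (Sn _ t'S); rewrite h1 h2; apply.
    by move=> /(congr1 snd).
rewrite t0E in lM; exists (n0.1 |` S), n0.1; split=> // n; split=> [Kn|/lN[e /Sn]].
  by apply/lN; split; [exact: K1|apply/SP; exists n].
by rewrite -e; case: (n).
Qed.

Lemma lk_square s o d b : TS s d b \in square_toks s o ->
  @lk D (TE (side s d b).1) (square_toks s o) (TS s d b).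
Proof.
move=> tM; split; first exact: GoodSquare.
  rewrite fproperE fsub1set tM /=; apply/fsubsetPn.
  have h c : (TS s (vdir s) c : token) \in square_toks s o.
    by apply/square_toksP; exists (vdir s), c; rewrite eqxx.
  have [E|E] := eqVneq (TS s d b : token) (TS s (vdir s) true).
    by exists (TS s (vdir s) false) => //; rewrite inE E; apply/eqP => -[].
  by exists (TS s (vdir s) true) => //; rewrite inE eq_sym.
by rewrite /= tcv1.
Qed.

Definition vert_edge (t0 : token) := exists s a, t0 = TE (side s (vdir s) a).1.

Lemma vert_edge_vertical t0 e : vert_edge t0 -> t0 = TE e -> vertical e.
Proof. by move=> [s [a ->]] [<-]; rewrite vertical_side eqxx. Qed.

Lemma horiz_not_vert t0 s b : t0 = TE (side s (~~ vdir s) b).1 -> ~ vert_edge t0.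
Proof.
by move=> E /vert_edge_vertical/(_ E); rewrite vertical_side; case: (vdir s).
Qed.

Lemma vertex_node_not_side t0 n : vertex_node t0 n -> ~~ is_side n.
Proof. by move=> [v [+ _ _ _ _]]; rewrite /is_side; case: (n.1). Qed.

Lemma vert_edge_node t0 n : vert_edge t0 -> vertex_node t0 n -> ~~ vtok n.2.
Proof.
move=> ve [v [v1 _ _ + t0E]]; have [s [a E]] := ve.
rewrite E in t0E; case: n.1 v1 t0E => [[[v'|e]|p]|[s' [d b]]] //= _ [->].
by rewrite vertical_side eqxx.
Qed.

(** If [t0] is not a vertical edge, only a square along [t0] joins nodes with different first
    components, and [npc_corner] recovers that square from one of its corners. *)
Lemma ladj_cross_uniq t0 n n' n'' : @ladj D t0 n n' -> ladj t0 n n'' -> ~ vert_edge t0 ->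
  n.1 <> n'.1 -> n.1 <> n''.1 -> n' = n''.
Proof.
move=> /ladjP[//|s a b t0E _|s a b t0E nE ->] /ladjP[//|s' a' b' t0E' _|s' a' b' t0E' nE' ->] ve.
- by case: ve; exists s, a.
- by case: ve; exists s, a.
- by case: ve; exists s', a'.
- have : corner_name s a b = corner_name s' a' b'.
    by have := congr1 swapn nE'; rewrite nE.
  by move=> /npc_corner[-> -> ->].
Qed.

(** A clique either contains a diagonal, or crosses between the ends of a horizontal edge, or has a
    constant first component. In the first two cases it has at most two members, all belonging to
    one square. *)
Lemma link_flag t0 (K : set (token * token)) : finite_set K -> (K !=set0)%classic ->
  (forall n, K n -> @lnode D t0 n) ->
  (forall n n', K n -> K n' -> n <> n' -> @ladj D t0 n n') ->
  exists M y, @lk D t0 M y /\ forall n, K n <-> isn M y n.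
Proof.
move=> fK K0 Kn Ka.
(* The neighbours of a diagonal are the two corners of its square along [t0]; these lie at different
   ends of [t0] and are not adjacent. *)
have [[n0 [Kn0 sn0]]|noside] := EM (exists n, K n /\ is_side n).
  have [s [a [n0E t0E]]] : exists s a, n0 = side_name s a /\ t0 = TE (side s (vdir s) a).1.
    by have [/vertex_node_not_side|//] := lnodeP (Kn _ Kn0); rewrite sn0.
  have ve : vert_edge t0 by exists s, a.
  have other n : K n -> n <> n0 -> exists b, n = corner_name s a b.
    move=> Kn1 nn; have := ladjP (Ka _ _ Kn0 Kn1 (nesym nn)).
    case=> [_ _|s1 a1 b1 _ [[e1 e2]|[e1 _]]|s1 a1 b1 /horiz_not_vert//].
    - by rewrite sn0.
    - have := e1; rewrite n0E => -[ss _ aa _]; subst s1 a1.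
      by exists b1.
    - by move: sn0; rewrite e1.
  have [[n1 [Kn1 n10]]|only] := EM (exists n, K n /\ n <> n0).
    have [b n1E] := other _ Kn1 n10.
    exists (square_toks s (Some b)), (TS s (vdir s) a); split.
      by rewrite t0E; apply: lk_square; apply/square_toksP; exists (vdir s), a; rewrite eqxx.
    move=> n; split=> [Kn2|/isname_vert[->|[b' [<-] ->]]]; last first.
    - by rewrite -n1E.
    - by rewrite -n0E.
    apply/isname_vert; have [->|n20] := EM (n = n0); first by left.
    right; exists b => //; have [b2 n2E] := other _ Kn2 n20.
    have [->//|n21] := EM (n = n1).
    have := ladjP (Ka _ _ Kn2 Kn1 n21); rewrite n2E n1E.
    case=> [/TN_inj/side_flip -> //|s1 a1 b1 _ [[e1 e2]|[_ e2]]|s1 a1 b1 /horiz_not_vert//].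
      by have := congr1 fst e1.
    by have := congr1 fst e2.
  exists (square_toks s None), (TS s (vdir s) a); split.
    by rewrite t0E; apply: lk_square; apply/square_toksP; exists (vdir s), a; rewrite eqxx.
  move=> n; split=> [Kn2|/isname_vert[->|[b'] //]]; last by rewrite -n0E.
  apply/isname_vert; left; rewrite -n0E; apply/not_notP => nn.
  by apply: only; exists n.
have nos n s a : K n -> n = side_name s a -> False.
  by move=> Kn1 nE; apply: noside; exists n; split=> //; rewrite nE.
have Kv n : K n -> vertex_node t0 n.
  by move=> Kn1; have [//|[s [a [/(nos _ _ _ Kn1)]]]] := lnodeP (Kn _ Kn1).
have [[n [n' [Kn1 Kn2 nn]]]|same] := EM (exists n n', [/\ K n, K n' & n.1 <> n'.1]); last first.
  apply: flag_same_first => //.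
    by move=> n n' h1 h2; apply/not_notP => h3; apply: same; exists n, n'.
  move=> n n' h1 h2 h3; have h4 : n.1 = n'.1.
    by apply/not_notP => h4; apply: same; exists n, n'.
  have := ladjP (Ka _ _ h1 h2 h3); case=> [//|s a b _ [[e _]|[_ e]]|s a b _ e1 e2].
  - by case: (nos _ _ _ h1 e).
  - by case: (nos _ _ _ h2 e).
  - by move: h4; rewrite e1 e2 => /TN_inj/side_flip; case: (a).
have nn' : n <> n' by move=> e; apply: nn; rewrite e.
have := ladjP (Ka _ _ Kn1 Kn2 nn'); case=> [//|s a b _ [[e _]|[_ e]]|s a b t0E nE n'E].
- by case: (nos _ _ _ Kn1 e).
- by case: (nos _ _ _ Kn2 e).
have nve : ~ vert_edge t0 := horiz_not_vert t0E.
exists (square_toks s (Some b)), (TS s (~~ vdir s) b); split.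
  by rewrite t0E; apply: lk_square; apply/square_toksP; exists (~~ vdir s), b; rewrite eqxx orbT.
move=> m; split=> [Km|/isname_horiz[a1 ->]]; last first.
  have [->|->] : a1 = a \/ a1 = ~~ a by case: (a); case: (a1); [left|right|right|left].
    by rewrite -nE.
  by rewrite -n'E.
apply/isname_horiz; have [->|mn] := EM (m = n); first by exists a.
have [->|mn'] := EM (m = n'); first by exists (~~ a).
(* A third member lies across from [n] or from [n'], whose neighbour across is already taken. *)
exfalso; have [e|e] := EM (m.1 = n.1).
  apply: mn; apply/esym; apply: (@ladj_cross_uniq t0 n') => //.
  - by apply: Ka => //; exact: nesym.
  - by apply: Ka => //; exact: nesym.
  - exact: nesym.
  - by rewrite e; exact: nesym.
apply: mn'; apply/esym; apply: (@ladj_cross_uniq t0 n) => //.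
- by apply: Ka.
- by apply: Ka => //; exact: nesym.
- exact: nesym.
Qed.

(** For a vertical edge the bridges are the diagonals and the colour is the end of the edge.
    Otherwise a node is in the clique part when its second component is not vertical; the link of a
    vertex of X is covered too, with a single side. *)
Lemma link_no_cycle t0 n (c : 'I_n -> token * token) : n = 4%N \/ n = 5%N ->
  injective c -> (forall i, @lnode D t0 (c i)) ->
  (forall i, @ladj D t0 (c i) (c (ordS i))) ->
  (forall i j, @ladj D t0 (c i) (c j) -> j = ordS i \/ i = ordS j) -> False.
Proof.
move=> n45 cI cn ca cd.
have [d [dc dper dadj dnadj dneq]] := cycle_sequence n45 cI ca cd.
have dn k : @lnode D t0 (d k) by have [i ->] := dc k.
have [ve|nve] := EM (vert_edge t0).
  have nS k : ~~ is_side (d k) -> vertex_node t0 (d k).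
    by have [//|[s [a [-> _]]]] := lnodeP (dn k).
  apply: (@no_short_cycle_AB _ (@ladj D t0) d n n45 dper dadj (@ladj_sym t0) dnadj dneq is_side _ fst).
  - move=> x y /ladjP[//|s a b _ [[-> _]|[_ ->]]|s a b /horiz_not_vert//] //.
  - move=> k l /nS nk /nS nl kl E; apply: ladj_vertex => //.
    by rewrite (negbTE (vert_edge_node ve nk)).
  - by move=> x y h1 h2 /ladjP[_ _ |s a b _ [[_ e]|[e _]]|s a b /horiz_not_vert//]; rewrite ?h1 //;
      [move: h2; rewrite e|move: h1; rewrite e].
  - move=> x y y' sx sy sy'.
    case/ladjP=> [_ _|s a b _ [[xE ->]|[e _]]|s a b /horiz_not_vert//]; rewrite ?sx //; last first.
      by move: sx; rewrite e.
    case/ladjP=> [_ _|s1 a1 b1 _ [[xE' ->]|[e _]]|s1 a1 b1 /horiz_not_vert//]; rewrite ?sx //; last first.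
      by move: sx; rewrite e.
    have : TS s (vdir s) a = TS s1 (vdir s1) a1 :> token by have := congr1 fst xE'; rewrite xE.
    by case=> ss _ aa; subst s1 a1 => /TN_inj/side_flip ->.
  - move=> x x' y sx sx' sy.
    case/ladjP=> [_ _|s a b _ [[-> yE]|[e _]]|s a b /horiz_not_vert//]; rewrite ?sx //; last first.
      by move: sx; rewrite e.
    case/ladjP=> [_ _|s1 a1 b1 _ [[-> yE']|[e _]]|s1 a1 b1 /horiz_not_vert//]; rewrite ?sx' //; last first.
      by move: sx'; rewrite e.
    by have := yE'; rewrite yE => /npc_corner[-> -> _].
have dv k : vertex_node t0 (d k).
  have [//|[s [a [_ h]]]] := lnodeP (dn k).
  by case: nve; exists s, a.
apply: (@no_short_cycle_KW _ (@ladj D t0) d n n45 dper dadj (@ladj_sym t0) dnadj dneq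
  (fun m => ~~ vtok m.2) _ fst).
- move=> k l kl E K1; apply: ladj_vertex => //.
  by rewrite (negbTE K1).
- move=> x y /ladjP[_ h _ _ _|s a b h|s a b _ -> ->].
  + by rewrite -negb_and.
  + by case: nve; exists s, a.
  + by move=> /TN_inj/side_flip; case: (a).
- move=> x y /ladjP[-> //|s a b h|s a b _ -> ->] _.
  + by case: nve; exists s, a.
  + by rewrite /swapn /= !vertical_side eqxx.
- move=> x y z h1 h2 h3 h4; exact: ladj_cross_uniq h1 h2 nve h3 h4.
Qed.

Lemma token_complex_6_large : locally_6_large (token_complex D).
Proof.
move=> v vv; have [x0' hx] := vertex_elt vv.
pose t0 : token := val (x0' : tverts v).
have vt : toks v = [fset t0].
  apply/fsetP => t; rewrite inE; apply/idP/eqP => [tv|->]; last exact: (valP (x0' : tverts v)).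
  by have := hx [` tv] => /(congr1 (val : tverts v -> token)).
have li := @link_inj t0; have ld := @link_det t0; have lf := @link_flag t0.
split.
- exact: (@token_link_flag D v t0 vt li ld lf).
- move=> /(@token_link_cycle D v t0 vt li ld lf) [c [h1 h2 h3 h4]].
  by apply: (@link_no_cycle t0 4 c) => //; left.
- move=> /(@token_link_cycle D v t0 vt li ld lf) [c [h1 h2 h3 h4]].
  by apply: (@link_no_cycle t0 5 c) => //; right.
Qed.

End TokenLinksOfX.

(** * Points and maps of the realization *)

Section TokenPoints.
Variables (R : realType) (D : token_data).
Local Notation Y := (token_complex D).
Local Notation Z := (simplicial_realization R Y).
Local Notation cls := (glued_class (@simplicial_attach R Y)).
Variable z0 : Z.

Definition weights (L : {fset Tok D}) (w : Tok D -> R) : Prop :=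
  (forall t, t \in L -> 0 <= w t) /\ \sum_(t <- L) w t = 1.

Lemma weights_verts (s : tsimplex D) w : weights (toks s) w ->
  (fun x : tverts s => w (val x)) \in @std_simplex R (tverts s).
Proof.
move=> [w0 w1]; apply/mem_set; split=> [x|]; first exact/w0/(valP x).
by rewrite -w1 big_seq_fsetE.
Qed.

Definition spt (s : tsimplex D) w (h : weights (toks s) w) : simplex_space R (s : simplex Y) :=
  exist (fun u => u \in @std_simplex R (tverts s)) _ (weights_verts h).

(** Total in tokens, label and weights, with the default [z0], so that points of different simplices
    are compared without transport along equalities of dependent types. *)
Definition pt (L : {fset Tok D}) (k : Lab D) (w : Tok D -> R) : Z :=
  match pselect ((good L /\ fib L k) /\ weights L w) with
  | left (conj h hw) => cls (simplex_point (@spt (mksim h) w hw))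
  | right _ => z0
  end.

Lemma ptE (s : tsimplex D) (p : simplex_space R (s : simplex Y)) w :
  (forall x : tverts s, val p x = w (val x)) -> pt (toks s) (lab s) w = cls (simplex_point p).
Proof.
move=> pw; rewrite /pt; case: pselect => [[h hw]|[]].
  have gen (s' : tsimplex D) (q : simplex_space R (s' : simplex Y)) : s' = s ->
      (forall x : tverts s', val q x = w (val x)) -> cls (simplex_point q) = cls (simplex_point p).
    move=> E; subst s' => qw; congr (cls (simplex_point _)); apply: val_inj; apply/funext => x.
    by rewrite pw qw.
  by apply: gen => //; apply: tsimplex_eq.
split; first exact: tsimplexP.
have [p0 p1] := set_mem (valP p); split=> [t ts|].
  by have := p0 [` ts]; rewrite pw.
by rewrite -p1 big_seq_fsetE; apply: eq_bigr => x _; rewrite pw.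
Qed.

Definition tok_weight (s : tsimplex D) (p : simplex_space R (s : simplex Y)) (t : Tok D) : R :=
  if insub t is Some x then val p (x : tverts s) else 0.

Lemma tok_weightE (s : tsimplex D) (p : simplex_space R (s : simplex Y)) (x : tverts s) :
  tok_weight p (val x) = val p x.
Proof. by rewrite /tok_weight valK. Qed.

Lemma tok_weight_out (s : tsimplex D) (p : simplex_space R (s : simplex Y)) t :
  t \notin toks s -> tok_weight p t = 0.
Proof. by move=> ts; rewrite /tok_weight insubF //; apply/negbTE. Qed.

Lemma tok_weights (s : tsimplex D) (p : simplex_space R (s : simplex Y)) :
  weights (toks s) (tok_weight p).
Proof.
have [p0 p1] := set_mem (valP p); split=> [t ts|].
  by rewrite -[t]/(val [` ts]) tok_weightE.
by rewrite -p1 big_seq_fsetE; apply: eq_bigr => x _; rewrite tok_weightE.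
Qed.

Lemma pt_repr (s : tsimplex D) (p : simplex_space R (s : simplex Y)) :
  cls (simplex_point p) = pt (toks s) (lab s) (tok_weight p).
Proof. by rewrite (@ptE s p) // => x; rewrite tok_weightE. Qed.

Lemma eq_pt (L : {fset Tok D}) k w w' : {in L, w =1 w'} -> pt L k w = pt L k w'.
Proof.
move=> ww; have E : weights L w <-> weights L w'.
  split=> -[w0 w1]; split=> [t tL|]; rewrite -?ww ?w0 //.
    by rewrite -w1 !big_seq; apply: eq_bigr => t tL; rewrite ww.
  by rewrite ww ?w0.
  by rewrite -w1 !big_seq; apply: eq_bigr => t tL; rewrite ww.
rewrite [LHS]/pt; case: pselect => [[h hw]|h].
  have e : pt L k w' = cls (simplex_point (@spt (mksim h) w hw)).
    apply: (@ptE (mksim h)) => x; apply: ww; exact: (valP x).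
  exact: (esym e).
rewrite /pt; case: pselect => [[h1 h2]|//]; case: h; split=> //.
exact: (E.2 h2).
Qed.

Lemma affine_ext_face (s t : tsimplex D) F (f : {ffun tverts s -> tverts t})
    (p : simplex_space R (s : simplex Y)) y : face_of F f ->
  val (affine_map f p) y = if val y \in F then tok_weight p (cv F (val y)) else 0.
Proof.
move=> fF; have fI : injective f by apply: (@tattach_inj D s t); exists F.
rewrite /= /affine_ext; case: ifP => yF.
  have : y \in codom f by rewrite (face_of_codom _ fF).
  move=> /codomP[x yx]; rewrite (bigD1 x) /=; last by rewrite yx.
  rewrite big1 ?addr0; last by move=> x' /andP[/eqP]; rewrite yx => /fI ->; rewrite eqxx.
  by have [_ _ _ _ /(_ x) [_ E]] := fF; rewrite yx E tok_weightE.
rewrite big_pred0 // => x; apply/negP => /eqP fxy.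
by have := face_of_codom y fF; rewrite yF -fxy codom_f.
Qed.

(** The gluing of the realization, read on barycentric weights: coordinates outside the face vanish
    and the others follow the renaming. *)
Lemma pt_face L F k w w' : good L -> fib L k -> F != fset0 -> F `<` L -> weights L w ->
  (forall y, y \in L -> y \notin F -> w y = 0) -> {in F, forall y, w' (cv F y) = w y} ->
  pt (cv F @` F) (tr F k) w' = pt L k w.
Proof.
move=> gL fL F0 FL wL wF ww'.
pose t := mksim (conj gL fL).
have [s [f fF]] := face_of_exists (D := D) (t := t) F0 FL.
have [_ _ sF lF fP] := fF.
have [w0 w1] := wL.
have sw' : weights (toks s) w'.
  rewrite sF; split=> [u /imfsetP[y /= yF ->]|].
    by rewrite ww' // w0 //; exact: (fsubsetP (fproper_sub FL)).
  rewrite big_imfset /=; last by move=> y y'; exact: (cv_inj gL FL F0).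
  rewrite -w1 -(big_fset_incl _ (fproper_sub FL) wF).
  by rewrite !big_seq; apply: eq_bigr => y yF; rewrite ww'.
have E1 := @ptE s (spt sw') w' (fun=> erefl).
rewrite {1}sF {1}lF in E1; rewrite E1.
have step : cls (simplex_point (spt sw')) = cls (simplex_point (affine_map f (spt sw') : simplex_space R (t : simplex Y))).
  by apply/glued_classP/rst_step; apply: FaceAttach; exists F.
rewrite step; apply/esym/(@ptE t) => y; rewrite (affine_ext_face _ _ fF).
case: ifP => yF; last by rewrite wF // ?yF //; exact: (valP y).
rewrite -ww' // /tok_weight; case: insubP => [x _ <- //|/negP[]].
by rewrite sF in_imfset.
Qed.

Lemma pt_cont (S : topologicalType) L k (w : S -> Tok D -> R) : good L -> fib L k ->
  (forall p, weights L (w p)) -> (forall t, t \in L -> continuous (fun p => w p t)) ->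
  continuous (fun p => pt L k (w p)).
Proof.
move=> gL fL wL cw; have -> : (fun p => pt L k (w p)) =
    fun p => cls (simplex_point (@spt (mksim (conj gL fL)) (w p) (wL p))).
  by apply/funext => p; exact: (@ptE (mksim (conj gL fL))).
apply: (continuous_compose _ (@glued_class_continuous _ _)).
apply: (continuous_compose (g := fun q => @simplex_point R Y (mksim (conj gL fL)) q)); last first.
  exact: (@existT_continuous _ (@simplex_space R Y) (mksim (conj gL fL))).
apply: (@continuous_comp_initial _ _ _ val).
move=> p; apply/cvg_sup => x.
have h : continuous ((fun f : tverts (mksim (conj gL fL)) -> R => f x) \o
    (fun p => val (@spt (mksim (conj gL fL)) (w p) (wL p)))).
  exact: (cw (val x) (valP x)).
exact: (@continuous_comp_initial _ _ _ (fun f : tverts (mksim (conj gL fL)) -> R => f x) _ h p).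
Qed.

End TokenPoints.

Local Close Scope fset_scope.

(** * Segments in a simplex *)

Section SimplexSpaces.
Variables (R : realType) (Y : simplicial_complex) (s : simplex Y).
Local Notation I := (unit_interval R).
Local Notation Sp := (simplex_space R s).

Lemma simplex_cont (S : topologicalType) (f : S -> Sp) :
  (forall x : verts s, continuous (fun p => (val (f p) : verts s -> R) x)) -> continuous f.
Proof.
move=> cf; apply: (@continuous_comp_initial _ _ _ val) => p; apply/cvg_sup => x.
exact: (@continuous_comp_initial _ _ _ (fun f : verts s -> R => f x) (fun p => val (f p)) (cf x) p).
Qed.

Lemma coord_cont (x : verts s) : continuous (fun p : Sp => (val p : verts s -> R) x).
Proof.
apply: (@continuous_compose Sp {ptws verts s -> R} R^o (fun p => val p)
  (fun f => f x)); last exact: proj_continuous.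
exact: initial_continuous.
Qed.

Lemma simplex_lerp_subproof (p q : Sp) (t : I) :
  (fun x => (1 - val t) * (val p : verts s -> R) x + val t * (val q : verts s -> R) x)
    \in @std_simplex R (verts s).
Proof.
have [p0 p1] := set_mem (valP p); have [q0 q1] := set_mem (valP q).
have /andP[t0 t1] := unit_intervalP t.
apply/mem_set; split=> [x|].
  by rewrite addr_ge0 // mulr_ge0 // subr_ge0.
by rewrite big_split /= -!mulr_sumr p1 q1 !mulr1 subrK.
Qed.

Definition simplex_lerp (p q : Sp) (t : I) : Sp :=
  exist (fun w => w \in @std_simplex R (verts s)) _ (simplex_lerp_subproof p q t).

Lemma simplex_lerpE p q t x : (val (simplex_lerp p q t) : verts s -> R) x =
  (1 - val t) * (val p : verts s -> R) x + val t * (val q : verts s -> R) x.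
Proof. by []. Qed.

Lemma simplex_lerp_cont : continuous (fun p : Sp * Sp * I => simplex_lerp p.1.1 p.1.2 p.2).
Proof.
apply: simplex_cont => x /= p.
have c1 : continuous (fun p : Sp * Sp * I => (val p.1.1 : verts s -> R) x).
  apply: (continuous_compose (f := fun p : Sp * Sp * I => p.1.1) _ (@coord_cont x)).
  exact: (continuous_compose (@fst_continuous _ _) (@fst_continuous _ _)).
have c2 : continuous (fun p : Sp * Sp * I => (val p.1.2 : verts s -> R) x).
  apply: (continuous_compose (f := fun p : Sp * Sp * I => p.1.2) _ (@coord_cont x)).
  exact: (continuous_compose (@fst_continuous _ _) (@snd_continuous _ _)).
have c3 : continuous (fun p : Sp * Sp * I => val p.2 : R).
  exact: (continuous_compose (@snd_continuous _ _) (@val_continuous R)).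
apply: cvgD; apply: cvgM; [|exact: c1|exact: c3|exact: c2].
by apply: cvgB; [exact: cvg_cst|exact: c3].
Qed.

Lemma simplex_lerp0 p q : simplex_lerp p q zero = p.
Proof. by apply: val_inj; apply/funext => x; rewrite simplex_lerpE val_zero subr0 mul1r mul0r addr0. Qed.
Lemma simplex_lerp1 p q : simplex_lerp p q one = q.
Proof. by apply: val_inj; apply/funext => x; rewrite simplex_lerpE val_one subrr mul1r mul0r add0r. Qed.
Lemma simplex_lerpp p t : simplex_lerp p p t = p.
Proof. by apply: val_inj; apply/funext => x; rewrite simplex_lerpE -mulrDl subrK mul1r. Qed.

Definition simplex_segments : segments R Sp :=
  Segments simplex_lerp_cont simplex_lerp0 simplex_lerp1 simplex_lerpp.

End SimplexSpaces.

(** * Functions on the realization given simplex by simplex *)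

Section TokenFunctions.
Local Open Scope fset_scope.
Variables (R : realType) (D : token_data).
Local Notation Y := (token_complex D).
Local Notation Z := (simplicial_realization R Y).
Local Notation I := (unit_interval R).
Local Notation cls := (glued_class (@simplicial_attach R Y)).

Lemma tok_weight_cont (s : tsimplex D) t :
  continuous (fun p : simplex_space R (s : simplex Y) => tok_weight p t).
Proof.
have [ts|ts] := boolP (t \in toks s).
  have -> : (fun p : simplex_space R (s : simplex Y) => tok_weight p t) =
     fun p => (val p : tverts s -> R) [` ts].
    by apply/funext => p; rewrite -[t]/(val [` ts]) tok_weightE.
  exact: coord_cont.
have -> : (fun p : simplex_space R (s : simplex Y) => tok_weight p t) = cst 0.
  by apply/funext => p; rewrite tok_weight_out.
exact: cst_continuous.
Qed.

(** Invariance under the gluing. The weights are extended by zero, as [tok_weight] does, so that [G]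
    may depend on them as functions on all tokens. *)
Definition token_compat (A : Type) (G : {fset Tok D} -> Lab D -> (Tok D -> R) -> A) : Prop :=
  forall L F k w w', good L -> fib L k -> F != fset0 -> F `<` L -> weights L w ->
  weights (cv F @` F) w' ->
  (forall y, y \notin F -> w y = 0) -> {in F, forall y, w' (cv F y) = w y} ->
  (forall y, y \notin cv F @` F -> w' y = 0) ->
  G (cv F @` F) (tr F k) w' = G L k w.

Definition token_lift (A : Type) (G : {fset Tok D} -> Lab D -> (Tok D -> R) -> A)
    (a : {s : simplex Y & simplex_space R s}) : A :=
  G (toks (projT1 a : tsimplex D)) (lab (projT1 a : tsimplex D))
    (@tok_weight R D (projT1 a : tsimplex D) (projT2 a)).

Lemma token_lift_attach (A : Type) (G : {fset Tok D} -> Lab D -> (Tok D -> R) -> A) :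
  token_compat G -> forall a b, simplicial_attach a b -> token_lift G a = token_lift G b.
Proof.
move=> cG a b [s t f p [F fF]]; have [F0 Ft sF lF fP] := fF.
have [gt ft] := tsimplexP (t : tsimplex D).
have fw y : @tok_weight R D t (affine_map f p) y =
    if y \in F then @tok_weight R D s p (cv F y) else 0.
  have [yt|yt] := boolP (y \in toks (t : tsimplex D)).
    by rewrite -[y]/(val ([` yt] : tverts (t : tsimplex D))) tok_weightE (affine_ext_face _ _ fF).
  rewrite tok_weight_out //; case: ifP => // yF.
  by rewrite (fsubsetP (fproper_sub Ft) _ yF) in yt.
rewrite /token_lift /=.
have -> : @tok_weight R D t (affine_map f p) = fun y => if y \in F then @tok_weight R D s p (cv F y) else 0.
  by apply/funext => y; exact: fw.
have ws := @tok_weights R D s p.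
have wt := @tok_weights R D t (affine_map f p : simplex_space R (t : simplex Y)).
have E : @tok_weight R D t (affine_map f p) = fun y => if y \in F then @tok_weight R D s p (cv F y) else 0.
  by apply/funext => y; exact: fw.
rewrite E in wt.
have out y : y \notin toks (s : tsimplex D) -> @tok_weight R D s p y = 0 by exact: tok_weight_out.
move: ws out; rewrite sF lF => ws out.
apply: cG => // [y yF|y yF]; first by rewrite (negbTE yF).
by rewrite yF.
Qed.

Definition token_fun (A : Type) (G : {fset Tok D} -> Lab D -> (Tok D -> R) -> A) (z : Z) : A :=
  token_lift G (repr z).

Lemma token_fun_class (A : Type) (G : {fset Tok D} -> Lab D -> (Tok D -> R) -> A) a :
  token_compat G -> token_fun G (cls a) = token_lift G a.
Proof.
move=> cG; apply: (@glued_lift _ _ _ (token_lift G) setT) => // {}a b ab _.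
exact: token_lift_attach.
Qed.

Lemma token_fun_cont (A : topologicalType) (G : {fset Tok D} -> Lab D -> (Tok D -> R) -> A) :
  token_compat G ->
  (forall s : tsimplex D, continuous (fun p : simplex_space R (s : simplex Y) =>
     G (toks s) (lab s) (tok_weight p))) ->
  continuous (token_fun G).
Proof.
move=> cG ccG z.
apply: (@glued_lift_continuous _ _ _ (token_lift G) setT) => // [|[s p] _|a b ab _].
- exact: openT.
- move=> O nO; have /= := ccG s p O nO.
  by rewrite /nbhs /= sigT_nbhsE.
- exact: token_lift_attach.
Qed.

Lemma token_homotopy (G : {fset Tok D} -> Lab D -> (Tok D -> R) -> I -> Z) (g : I -> Z) :
  token_compat G ->
  (forall s : tsimplex D, continuous (fun p : simplex_space R (s : simplex Y) * I =>
     G (toks s) (lab s) (tok_weight p.1) p.2)) ->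
  continuous g -> continuous (fun p : I * I => token_fun G (g p.1) p.2).
Proof.
move=> cG ccG cg.
apply: (@glued_homotopy _ _ R Z I (token_lift G) setT g) => //.
- exact: openT.
- move=> [s p] r _.
  by apply: (@sigT_cont_at _ _ _ _ (fun a r => token_lift G a r)); exact: ccG.
- by move=> a b ab _; exact: token_lift_attach.
Qed.

(** The values need no topology: this serves for homotopy classes of paths and for carriers. *)
Lemma token_fun_open (A : Type) (G : {fset Tok D} -> Lab D -> (Tok D -> R) -> A) (P : set A) :
  token_compat G ->
  (forall (s : tsimplex D) (p : simplex_space R (s : simplex Y)),
     P (G (toks s) (lab s) (tok_weight p)) ->
     \forall q \near p, P (G (toks s) (lab s) (tok_weight q))) ->
  open [set z | P (token_fun G z)].
Proof.
move=> cG nG; apply/glued_open; rewrite openE => -[s p] /=; rewrite /interior /=.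
rewrite token_fun_class // => Pp; rewrite /nbhs /= sigT_nbhsE /=.
have := nG s p Pp; apply: filterS => q Pq; rewrite /= token_fun_class //.
Qed.

End TokenFunctions.

(** * Small sums and continuous real functions *)

Lemma big_fset2 (R : realType) (K : choiceType) (a b : K) (f : K -> R) : a != b ->
  \sum_(x <- [fset a; b]%fset) f x = f a + f b.
Proof. by move=> ab; rewrite big_fsetU1 ?inE // big_seq_fset1. Qed.

Lemma big_fset3 (R : realType) (K : choiceType) (a b c : K) (f : K -> R) :
  a != b -> a != c -> b != c -> \sum_(x <- [fset a; b; c]%fset) f x = f a + f b + f c.
Proof.
move=> ab ac bc; rewrite -fsetUA big_fsetU1 ?inE ?negb_or ?ab ?ac // big_fset2 //.
by rewrite /= addrA.
Qed.

Section RealFunctions.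
Variables (R : realType) (S : topologicalType).
Implicit Types f g : S -> R.

Lemma contD f g : continuous f -> continuous g -> continuous (fun x => f x + g x).
Proof. by move=> cf cg x; apply: cvgD; [exact: cf|exact: cg]. Qed.

Lemma contB f g : continuous f -> continuous g -> continuous (fun x => f x - g x).
Proof. by move=> cf cg x; apply: cvgB; [exact: cf|exact: cg]. Qed.

Lemma contM f g : continuous f -> continuous g -> continuous (fun x => f x * g x).
Proof. by move=> cf cg x; apply: cvgM; [exact: cf|exact: cg]. Qed.

Lemma contMax f g : continuous f -> continuous g -> continuous (fun x => Num.max (f x) (g x)).
Proof. by move=> cf cg x; apply: (@continuous_max R S); [exact: cf|exact: cg]. Qed.

Lemma contMin f g : continuous f -> continuous g -> continuous (fun x => Num.min (f x) (g x)).
Proof. by move=> cf cg x; apply: (@continuous_min R S); [exact: cf|exact: cg]. Qed.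

Lemma cont_half f : continuous f -> continuous (fun x => f x / 2).
Proof. by move=> cf; apply: contM => //; exact: cst_continuous. Qed.

End RealFunctions.

(** * From the universal cover to the complex *)

Section SquareToComplex.
Variables (R : realType) (X : VH_complex) (x0 : square_realization R X).
Local Notation I := (unit_interval R).
Local Notation T := (square_realization R X).
Local Notation token := (token X).
Local Notation D := (tdata x0).
Local Notation Z := (simplicial_realization R (token_complex D)).
Variable z0 : Z.
Local Notation half := (clamp 2^-1 : I).
Local Notation ctr := (half, half).
Local Notation c1 := (unit_segments R).
Local Notation c2 := (square_segments R).
Local Notation ue := (unit_end R).
Local Notation em := (@em R X).
Local Notation sm := (@sm R X).
Local Notation K := (set (I -> T)).
Local Notation pt := (@pt R D z0).

Lemma token_face (L F : {fset token}) (k : K) (w w' : token -> R) : tgood L -> tfib x0 L k ->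
  F != fset0 -> (F `<` L)%fset -> weights (D := D) L w ->
  (forall y, y \in L -> y \notin F -> w y = 0) -> {in F, forall y, w' (tcv F y) = w y} ->
  pt (tcv F @` F)%fset (ttr F k) w' = pt L k w.
Proof. exact: (@pt_face R D z0 L F k w w'). Qed.

(** Among the faces of a simplex anchored at [v], only a single edge end moves to another anchor. *)
Lemma vertex_subset_face v (F : {fset token}) (k : K) : (forall t, t \in F -> at_vertex v t) ->
  F != fset0 -> (forall p, F <> [fset TN p]%fset) ->
  [/\ (tcv F @` F)%fset = F, ttr F k = k & forall t, t \in F -> tcv F t = t].
Proof.
move=> Fv F0 Fn.
have cvt : forall t, t \in F -> tcv F t = t.
  case: (fset_cases F0) => [[t FE]|[t [t' [tt FE]]]|[t1 [t2 [t3 [h n12 n13 n23]]]]].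
  - move=> u; rewrite FE inE => /eqP ->; rewrite tcv1.
    have tF : t \in F by rewrite FE inE.
    have := Fv _ tF; case: t FE tF => [[[v1|e1]|p1]|[s1 [d1 b1]]] //= FE tF.
    by have := Fn p1; rewrite FE.
  - have tF : t \in F by rewrite FE !inE eqxx.
    have t'F : t' \in F by rewrite FE !inE eqxx orbT.
    have c2' u u' : u \in F -> cv2 u u' = u.
      by move=> /Fv; case: u => [[[v1|e1]|p1]|[s1 [d1 b1]]].
    by move=> u; rewrite FE !inE => /orP[]/eqP ->; rewrite ?tcv2 ?tcv2r // c2'.
  - by move=> u _; rewrite (tcv3 _ h).
split=> //.
  by rewrite -[RHS]imfset_id; apply: eq_in_imfset => z zF; exact: cvt.
case: (fset_cases F0) => [[t FE]|[t [t' [tt FE]]]|[t1 [t2 [t3 [h n12 n13 n23]]]]].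
- have tF : t \in F by rewrite FE inE.
  have := Fv _ tF; rewrite FE ttr1; case: t FE tF => [[[v1|e1]|p1]|[s1 [d1 b1]]] //= FE tF.
  by have := Fn p1; rewrite FE.
- have tF : t \in F by rewrite FE !inE eqxx.
  have t'F : t' \in F by rewrite FE !inE eqxx orbT.
  have sF : squarish F by move=> [u|[s [d b]]] u' // /Fv.
  rewrite FE (ttr2 _ sF) //.
  by have := Fv _ tF; case: (t) => [[[v1|e1]|p1]|[s1 [d1 b1]]].
- by rewrite (ttr3 _ h).
Qed.

Lemma pt_vertex_subset v (L F : {fset token}) (k : K) (w : token -> R) : tgood L -> tfib x0 L k ->
  (forall t, t \in L -> at_vertex v t) -> (F `<=` L)%fset -> F != fset0 ->
  (forall p, F <> [fset TN p]%fset) -> weights (D := D) L w ->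
  (forall y, y \in L -> y \notin F -> w y = 0) -> pt F k w = pt L k w.
Proof.
move=> gL fL Lv FL F0 Fn wL wF.
have [FE|FL'] := eqVneq F L; first by rewrite FE.
have Fpr : (F `<` L)%fset by rewrite fproperEneq FL'.
have Fv t : t \in F -> at_vertex v t by move=> /(fsubsetP FL)/Lv.
have [E1 E2 E3] := vertex_subset_face k Fv F0 Fn.
have := @token_face L F k w w gL fL F0 Fpr wL wF.
by rewrite E1 E2; apply => y yF; rewrite E3.
Qed.

Lemma not_good_end p : ~ tgood [fset TN p : token]%fset.
Proof.
move E : [fset TN p : token]%fset => L gL; case: gL E => [e|v {}L _ _ _ Ln|s o].
- by move=> /fsetP/(_ (TE e)); rewrite !inE eqxx.
- by move=> E; apply: (Ln p); rewrite E.
- move=> /fsetP/(_ (TN p)); rewrite inE eqxx => /esym/square_toksP[d [b [//]]].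
Qed.

(** All other weights vanish, so this is the vertex of the complex that stands for the edge, whose
    label lives at the midpoint of the edge. *)
Lemma pt_vertex_end (L : {fset token}) p (k : K) (w : token -> R) : tgood L -> tfib x0 L k ->
  TN p \in L -> weights (D := D) L w -> w (TN p) = 1 ->
  pt L k w = pt [fset TE p.1]%fset (pmul k (sg c1 (em p.1) (ue p.2) half)) (fun=> 1).
Proof.
move=> gL fL pL wL wp.
have Ln : L != [fset TN p]%fset.
  by apply/eqP => E; apply: (@not_good_end p); rewrite -E.
have [w0 w1] := wL.
have wF y : y \in L -> y \notin [fset TN p]%fset -> w y = 0.
  move=> yL; rewrite inE => yp; move: w1; rewrite (big_fsetD1 (TN p)) //= wp.
  move=> w1'; have s0 : \sum_(x <- (L `\ TN p)%fset) w x = 0.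
    by apply: (@addrI _ (1 : R)); rewrite addr0.
  have yD : y \in (L `\ TN p)%fset by rewrite !inE yp.
  move: s0; rewrite (big_fsetD1 y) //= => /eqP.
  rewrite paddr_eq0; first by move=> /andP[/eqP].
    exact: w0.
  by rewrite big_seq; apply: sumr_ge0 => z; rewrite !inE => /and3P[_ _ zL]; exact: w0.
have F0 : [fset TN p : token]%fset != fset0 by apply/fset0Pn; exists (TN p); rewrite inE.
have Fpr : ([fset TN p : token] `<` L)%fset by rewrite fproperEneq eq_sym Ln fsub1set.
have := @token_face L [fset TN p]%fset k w (fun=> 1) gL fL F0 Fpr wL wF.
rewrite imfset_fset1 tcv1 ttr1 /= => <- // y; rewrite inE => /eqP ->; by rewrite wp.
Qed.

Definition edge_star (p : edge X * bool) : {fset token} := [fset TV (endpoint p.1 p.2); TN p]%fset.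

Lemma edge_star_good p : tgood (edge_star p).
Proof.
apply: (@GoodVertex X (endpoint p.1 p.2)).
- by apply/fset0Pn; exists (TN p); rewrite !inE eqxx.
- by move=> t; rewrite !inE => /orP[]/eqP ->.
- by move=> q q'; rewrite !inE /= => /eqP/TN_inj -> /eqP/TN_inj ->.
- by move=> q /fsetP/(_ (TV (endpoint p.1 p.2))); rewrite !inE eqxx.
Qed.

Lemma vertex_fib v (L : {fset token}) (k : K) : (forall t, t \in L -> at_vertex v t) ->
  pfib x0 (vp R v) k -> tfib x0 L k.
Proof.
move=> Lv fk t /Lv; case: t => [[[v1|e1]|p1]|[s1 [d1 b1]]] //= ->; exact: fk.
Qed.

(** The distance from the midpoint in half sides: 0 at the midpoint and 1 at the ends. *)
Definition udist (t : I) : R := `|2 * val t - 1|.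

Definition wE (t : I) (u : token) : R :=
  match u with
  | inl (inl (inl _)) => udist t
  | _ => 1 - udist t
  end.

Lemma unit_abs (t : I) : 0 <= udist t <= 1.
Proof.
have /andP[t0 t1] := unit_intervalP t; apply/andP; split; first exact: normr_ge0.
by rewrite /udist ler_norml; lra.
Qed.

Lemma udist_half (t : I) : val t = 2^-1 -> udist t = 0.
Proof. by move=> h; apply/eqP; rewrite /udist h normr_eq0; apply/eqP; lra. Qed.

Lemma udist_end b : udist (ue b) = 1.
Proof.
rewrite /udist val_end; case: b; rewrite ?mulr1n ?mulr0n ?mulr1 ?mulr0 ?sub0r ?normrN1 //.
by rewrite -[2]/(1 + 1) addrK normr1.
Qed.

Lemma udist_cont : continuous udist.
Proof.
move=> t; apply: (@continuous_comp _ _ _ (fun t : I => 2 * val t - 1) (fun r : R => `|r|)).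
  exact: unit_affine_continuous.
exact: norm_continuous.
Qed.

Lemma wE_weights p t : weights (D := D) (edge_star p) (wE t).
Proof.
have /andP[a0 a1] := unit_abs t; split.
  by move=> u; rewrite !inE => /orP[]/eqP -> //=; lra.
by rewrite big_fset2 //= addrC subrK.
Qed.

(** Here [k] is a class at the midpoint of [e]. The half of [e] at the end [b] is mapped onto the
    edge of the complex joining the vertices for [e] and for [endpoint e b]. *)
Definition phiEb (k : K) (e : edge X) (b : bool) (t : I) : Z :=
  pt (edge_star (e, b)) (pmul k (sg c1 (em e) half (ue b))) (wE t).

Definition phiE (k : K) (e : edge X) (t : I) : Z :=
  if val t <= 2^-1 then phiEb k e false t else phiEb k e true t.

Lemma edge_fib e b (k : K) : pfib x0 (em e half) k ->
  pfib x0 (vp R (endpoint e b)) (pmul k (sg c1 (em e) half (ue b))).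
Proof.
by move=> fk; apply: pfib_mul fk _; rewrite -em_end; apply: pfib_sg; exact: em_cont.
Qed.

Lemma edge_star_fib e b (k : K) : pfib x0 (em e half) k ->
  tfib x0 (edge_star (e, b)) (pmul k (sg c1 (em e) half (ue b))).
Proof.
move=> /(@edge_fib e b); apply: vertex_fib => t.
by rewrite !inE => /orP[]/eqP ->.
Qed.

Lemma wE_cont u : continuous (fun t : I => wE t u).
Proof.
have c : continuous (fun t : I => 1 - udist t).
  by apply: contB; [exact: cst_continuous|exact: udist_cont].
by case: u => [[[v|e]|p]|s]; [exact: udist_cont|exact: c|exact: c|exact: c].
Qed.

Lemma phiEb_cont k e b : pfib x0 (em e half) k -> continuous (phiEb k e b).
Proof.
move=> fk; apply: (@pt_cont R D z0).
- exact: edge_star_good.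
- exact: edge_star_fib.
- exact: wE_weights.
- by move=> u _; exact: wE_cont.
Qed.

Lemma sg_id_mul k (Q : topologicalType) (c : segments R Q) (f : Q -> T) q q' :
  continuous f -> pfib x0 (f q) k -> pmul (pmul k (sg c f q q')) (sg c f q' q) = k.
Proof.
move=> cf [g [cg _ g1 ->]]; rewrite -pmulA sg_mul // sg_id -g1 pmulp1 //.
Qed.

Lemma phiEb_half k e b t : pfib x0 (em e half) k -> val t = 2^-1 ->
  phiEb k e b t = pt [fset TE e]%fset k (fun=> 1).
Proof.
move=> fk th; rewrite /phiEb (@pt_vertex_end (edge_star (e, b)) (e, b)) //=.
- by congr (pt _ _ _); apply: sg_id_mul => //; exact: em_cont.
- exact: edge_star_good.
- exact: edge_star_fib.
- by rewrite !inE eqxx.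
- exact: wE_weights.
- by rewrite udist_half ?subr0.
Qed.

Definition in_half (b : bool) (t : I) : bool := if b then 2^-1 <= val t else val t <= 2^-1.

Lemma phiE_half k e b t : pfib x0 (em e half) k -> in_half b t -> phiE k e t = phiEb k e b t.
Proof.
move=> fk; rewrite /phiE; case: b => /= ht; last by rewrite ht.
case: (leP (val t)) => th; last reflexivity.
have E : val t = 2^-1 by apply/eqP; rewrite eq_le th ht.
by rewrite !phiEb_half.
Qed.

Lemma phiE_cont k e : pfib x0 (em e half) k -> continuous (phiE k e).
Proof.
move=> fk; apply: (@continuous_glue R I Z (fun t => val t) 2^-1 (phiEb k e false) (phiEb k e true)).
- exact: val_continuous.
- exact: phiEb_cont.
- exact: phiEb_cont.
- by move=> t th; rewrite !phiEb_half.
Qed.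

Lemma phiE_end k e b : pfib x0 (em e half) k ->
  phiE k e (ue b) = pt [fset TV (endpoint e b)]%fset (pmul k (sg c1 (em e) half (ue b))) (fun=> 1).
Proof.
move=> fk; rewrite (@phiE_half _ _ b) //; last first.
  by rewrite /in_half val_end; case: (b) => /=; rewrite ?mulr1n ?mulr0n; lra.
have w1 : wE (ue b) (TV (endpoint e b)) = 1 by exact: udist_end.
rewrite /phiEb -(@pt_vertex_subset (endpoint e b) (edge_star (e, b)) [fset TV (endpoint e b)]%fset) //.
- by apply: eq_pt => t; rewrite inE => /eqP ->.
- exact: edge_star_good.
- exact: edge_star_fib.
- by move=> t; rewrite !inE => /orP[]/eqP ->.
- by apply/fsubsetP => t; rewrite !inE => /eqP ->; rewrite eqxx.
- by apply/fset0Pn; exists (TV (endpoint e b)); rewrite inE.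
- by move=> p /fsetP/(_ (TN p)); rewrite !inE eqxx.
- exact: wE_weights.
- move=> y; rewrite !inE => /orP[/eqP->|/eqP-> _]; first by rewrite eqxx.
  by move: w1 => /= ->; rewrite subrr.
Qed.

End SquareToComplex.

(** * The map on squares *)

Section SquareMap.
Variables (R : realType) (X : VH_complex) (x0 : square_realization R X).
Local Notation I := (unit_interval R).
Local Notation T := (square_realization R X).
Local Notation token := (token X).
Local Notation D := (tdata x0).
Local Notation Z := (simplicial_realization R (token_complex D)).
Variable z0 : Z.
Local Notation half := (clamp 2^-1 : I).
Local Notation ctr := (half, half).
Local Notation c1 := (unit_segments R).
Local Notation c2 := (square_segments R).
Local Notation ue := (unit_end R).
Local Notation em := (@em R X).
Local Notation sm := (@sm R X).
Local Notation K := (set (I -> T)).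
Local Notation pt := (@pt R D z0).
Implicit Types (s : square X) (k : K) (a b : bool) (u w : R).

Definition corner_vertex s a b : vertex X :=
  endpoint (side_end s (vdir s) a b).1 (side_end s (vdir s) a b).2.

Definition corner_toks s a b : {fset token} :=
  [fset TV (corner_vertex s a b); TN (side_end s (vdir s) a b);
        TN (side_end s (~~ vdir s) b a)]%fset.

Definition corner_class k s a b : K :=
  pmul k (sg c2 (sm s) ctr (mkdir (vdir s) (ue a) (ue b))).

Lemma corner_toks_at s a b t : t \in corner_toks s a b -> at_vertex (corner_vertex s a b) t.
Proof.
rewrite !inE => /orP[/orP[]|]/eqP -> //=.
by rewrite -side_end_endpoint.
Qed.

Lemma corner_toks_neq s a b :
  [/\ (TV (corner_vertex s a b) : token) != TN (side_end s (vdir s) a b),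
      (TV (corner_vertex s a b) : token) != TN (side_end s (~~ vdir s) b a) &
      (TN (side_end s (vdir s) a b) : token) != TN (side_end s (~~ vdir s) b a)].
Proof. by split=> //; apply/eqP => /TN_inj; exact: side_end_neq. Qed.

Lemma vertical_end s d b b' : vertical (side_end s d b b').1 = (d == vdir s).
Proof. exact: vertical_side. Qed.

Lemma corner_toks_good s a b : tgood (corner_toks s a b).
Proof.
apply: (@GoodVertex X (corner_vertex s a b)).
- by apply/fset0Pn; exists (TV (corner_vertex s a b)); rewrite !inE eqxx.
- exact: corner_toks_at.
- by move=> p p'; rewrite !inE /= => /orP[]/eqP/TN_inj -> /orP[]/eqP/TN_inj -> //;
    rewrite !vertical_end ?(neq_negb (vdir s)).1 ?eqxx; case: (vdir s).
- by move=> p /fsetP/(_ (TV (corner_vertex s a b))); rewrite !inE eqxx.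
Qed.

Lemma corner_class_fib k s a b : pfib x0 (sm s ctr) k ->
  pfib x0 (vp R (corner_vertex s a b)) (corner_class k s a b).
Proof.
by move=> fk; apply: pfib_mul fk _; rewrite -sm_side_end; apply: pfib_sg; exact: sm_cont.
Qed.

Lemma corner_fib k s a b : pfib x0 (sm s ctr) k ->
  tfib x0 (corner_toks s a b) (corner_class k s a b).
Proof. by move=> /(@corner_class_fib k s a b); apply: vertex_fib; exact: corner_toks_at. Qed.

Lemma square_fib k s o : pfib x0 (sm s ctr) k -> tfib x0 (square_toks s o) k.
Proof. by move=> fk t /square_toksP[d [b [-> _]]]. Qed.

(* A point of a square at distances u and w (in half sides) from its two midlines
   is mapped to the simplex at the corner if 1 <= u + w, with weights [wF], and to
   the simplex of the two vertical sides and a horizontal side if u + w <= 1, with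
   weights [wM]. The truncations by max and min keep the weights admissible for
   all u and w. *)
Definition wF (u w : R) (t : token) : R :=
  match t with
  | inl (inl (inl _)) => Num.max u (1 - w) + w - 1
  | inl (inr p) => if vertical p.1 then 1 - Num.max u (1 - w) else 1 - w
  | _ => 0
  end.

Definition wM (s : square X) (a : bool) (u w : R) (t : token) : R :=
  match t with
  | inr (_, (d, c)) =>
      if d == vdir s then
        if c == a then (1 - Num.min u (1 - w) + w) / 2 else (1 - Num.min u (1 - w) - w) / 2
      else Num.min u (1 - w)
  | _ => 0
  end.

Lemma wF_weights s a b u w : 0 <= u <= 1 -> 0 <= w <= 1 ->
  weights (D := D) (corner_toks s a b) (wF u w).
Proof.
move=> /andP[u0 u1] /andP[w0 w1]; have [n1 n2 n3] := corner_toks_neq s a b.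
have h : Num.max u (1 - w) <= 1 by rewrite ge_max u1 /=; lra.
have h' : 1 - w <= Num.max u (1 - w) by rewrite le_max lexx orbT.
split.
  move=> t; rewrite !inE => /orP[/orP[]|]/eqP -> /=; first lra.
    by case: ifP => _; lra.
  by case: ifP => _; lra.
rewrite big_fset3 //= 2!vertical_side eqxx (_ : (~~ vdir s == vdir s) = false); first lra.
by case: vdir.
Qed.

Lemma big_square_toks s b (f : token -> R) :
  \sum_(t <- square_toks s (Some b)) f t =
  f (TS s (vdir s) false) + f (TS s (vdir s) true) + f (TS s (~~ vdir s) b).
Proof.
rewrite /square_toks big_fset3 //.
- by apply/eqP => -[].
- by apply/eqP => -[]; case: (vdir s).
- by apply/eqP => -[]; case: (vdir s).
Qed.

Lemma wM_weights s a b u w : 0 <= u <= 1 -> 0 <= w <= 1 ->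
  weights (D := D) (square_toks s (Some b)) (wM s a u w).
Proof.
move=> /andP[u0 u1] /andP[w0 w1].
have h : Num.min u (1 - w) <= 1 - w by rewrite ge_min lexx orbT.
have h' : 0 <= Num.min u (1 - w) by rewrite le_min u0 /=; lra.
split.
  by move=> t /square_toksP[d [c [-> _]]] /=; do 2?case: ifP => _; lra.
rewrite big_square_toks /= eqxx (_ : (~~ vdir s == vdir s) = false); last by case: vdir.
by case: a => /=; lra.
Qed.

(** The square is triangulated by four corner triangles and by the diamond on the midpoints of the
    sides, cut along the line joining the vertical sides. [phiF] and [phiM] map the pieces affinely
    onto triangles of the complex. *)
Definition phiF k s a b u w : Z := pt (corner_toks s a b) (corner_class k s a b) (wF u w).
Definition phiM k s a b u w : Z := pt (square_toks s (Some b)) k (wM s a u w).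
Definition phiQ k s a b u w : Z := if u + w <= 1 then phiM k s a b u w else phiF k s a b u w.

(** The coordinates in an order for which the vertical sides are [xc = 0] and [xc = 1], whichever
    direction of the square is vertical. *)
Definition xc s (p : I * I) : I := if vdir s then p.1 else p.2.
Definition yc s (p : I * I) : I := if vdir s then p.2 else p.1.

Definition phiS k s (p : I * I) : Z :=
  let u := udist (yc s p) in let w := udist (xc s p) in
  if val (xc s p) <= 2^-1 then
    if val (yc s p) <= 2^-1 then phiQ k s false false u w else phiQ k s false true u w
  else
    if val (yc s p) <= 2^-1 then phiQ k s true false u w else phiQ k s true true u w.

(** The edge spanned by the vertical side [a] and the horizontal side [b] is anchored at their
    corner; the weight of the opposite vertical side has to vanish. *)
Lemma pt_corner k s a b (w w' : token -> R) : pfib x0 (sm s ctr) k ->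
  weights (D := D) (square_toks s (Some b)) w -> w (TS s (vdir s) (~~ a)) = 0 ->
  w' (TN (side_end s (vdir s) a b)) = w (TS s (vdir s) a) ->
  w' (TN (side_end s (~~ vdir s) b a)) = w (TS s (~~ vdir s) b) ->
  pt [fset TN (side_end s (vdir s) a b); TN (side_end s (~~ vdir s) b a)]%fset
     (corner_class k s a b) w' = pt (square_toks s (Some b)) k w.
Proof.
move=> fk ww w0 w1 w2.
pose t : token := TS s (vdir s) a; pose t' : token := TS s (~~ vdir s) b.
have cp : corner_pair t t' s (vdir s) a b by [].
have [E1 E2 tt] := cv2_corner cp.
have gL : tgood (square_toks s (Some b)) by constructor.
have sL := tgood_squarish gL.
have tL : t \in square_toks s (Some b) by apply/square_toksP; exists (vdir s), a; rewrite eqxx.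
have t'L : t' \in square_toks s (Some b).
  by apply/square_toksP; exists (~~ vdir s), b; rewrite eqxx orbT.
have nL : TS s (vdir s) (~~ a) \in square_toks s (Some b).
  by apply/square_toksP; exists (vdir s), (~~ a); rewrite eqxx.
have nF : (TS s (vdir s) (~~ a) : token) \notin [fset t; t']%fset.
  rewrite !inE negb_or; apply/andP; split; apply/eqP => -[]; first by case: (a).
  by case: (vdir s).
have := @token_face R X x0 z0 (square_toks s (Some b)) [fset t; t']%fset k w w' gL (square_fib fk).
rewrite imfset_fset2 tcv2 // tcv2r // E1 E2 (ttr2 _ sL tL t'L tt) /= neq_negb.
apply=> //.
- by apply/fset0Pn; exists t; rewrite !inE eqxx.
- rewrite fproperE fsubUset !fsub1set tL t'L /=.
  by apply/fsubsetPn; exists (TS s (vdir s) (~~ a)).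
- move=> y /square_toksP[d [c [-> h]]]; rewrite !inE negb_or => /andP[h1 h2].
  have [dv|dv] := eqVneq d (vdir s).
    rewrite dv in h1 *; have -> // : c = ~~ a.
    by move: h1; rewrite /t; case: (c); case: (a) => //; rewrite eqxx.
  have dE : d = ~~ vdir s by move: dv; case: (d); case: (vdir s).
  by move: h h2; rewrite (negbTE dv) /= dE /t' => /eqP[<-]; rewrite eqxx.
- by move=> y; rewrite !inE => /orP[]/eqP ->; rewrite ?tcv2 ?tcv2r // ?E1 ?E2.
Qed.

Lemma pt_corner_sub k s a b (w : token -> R) : pfib x0 (sm s ctr) k ->
  weights (D := D) (corner_toks s a b) w -> w (TV (corner_vertex s a b)) = 0 ->
  pt [fset TN (side_end s (vdir s) a b); TN (side_end s (~~ vdir s) b a)]%fset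
     (corner_class k s a b) w = pt (corner_toks s a b) (corner_class k s a b) w.
Proof.
move=> fk ww w0; apply: (@pt_vertex_subset _ _ _ _ (corner_vertex s a b)) => //.
- exact: corner_toks_good.
- exact: corner_fib.
- exact: corner_toks_at.
- by apply/fsubsetP => t; rewrite !inE => /orP[]/eqP ->; rewrite eqxx ?orbT.
- by apply/fset0Pn; exists (TN (side_end s (vdir s) a b)); rewrite !inE eqxx.
- move=> p E; apply: (@not_good_end X p); rewrite -E; exact: tgood_corner.
- by move=> y; rewrite !inE negb_or => /orP[/orP[]|]/eqP -> //; rewrite eqxx ?andbF.
Qed.

(** On the line [u + w = 1] both weights are carried by the edge that the corner triangle shares
    with the diamond. *)
Lemma phiMF k s a b u w : pfib x0 (sm s ctr) k -> 0 <= u -> 0 <= w -> u + w = 1 ->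
  phiM k s a b u w = phiF k s a b u w.
Proof.
move=> fk u0 w0 uw.
have e : 1 - w = u by lra.
have u01 : 0 <= u <= 1 by lra.
have w01 : 0 <= w <= 1 by lra.
rewrite /phiM /phiF -(@pt_corner k s a b _ (wF u w)) //.
- apply: pt_corner_sub => //; first exact: wF_weights.
  by rewrite /= e maxxx; lra.
- exact: wM_weights.
- rewrite /= eqxx e minxx; case: (a) => /=; lra.
- by rewrite /= vertical_side !eqxx e maxxx minxx; lra.
- rewrite /= vertical_side; have -> : (~~ vdir s == vdir s) = false by case: vdir.
  by rewrite e minxx.
Qed.

Lemma pt_square_none k s b (w : token -> R) : pfib x0 (sm s ctr) k ->
  weights (D := D) (square_toks s (Some b)) w -> w (TS s (~~ vdir s) b) = 0 ->
  pt (square_toks s None) k w = pt (square_toks s (Some b)) k w.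
Proof.
move=> fk ww w0.
pose t : token := TS s (vdir s) false; pose t' : token := TS s (vdir s) true.
have tt : t != t' by apply/eqP => -[].
have gL : tgood (square_toks s (Some b)) by constructor.
have sL := tgood_squarish gL.
have mem c : TS s (vdir s) c \in square_toks s (Some b).
  by apply/square_toksP; exists (vdir s), c; rewrite eqxx.
have nL : TS s (~~ vdir s) b \in square_toks s (Some b).
  by apply/square_toksP; exists (~~ vdir s), b; rewrite eqxx orbT.
have E : square_toks s None = [fset t; t']%fset by rewrite /square_toks fsetU0.
have := @token_face R X x0 z0 (square_toks s (Some b)) [fset t; t']%fset k w w gL (square_fib fk).
have e1 : cv2 t t' = t by rewrite /= eqxx.
have e2 : cv2 t' t = t' by rewrite /= eqxx.
rewrite imfset_fset2 tcv2 // tcv2r // e1 e2 (ttr2 _ sL (mem _) (mem _) tt) /= eqxx /= E.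
apply=> //.
- by apply/fset0Pn; exists t; rewrite !inE eqxx.
- rewrite fproperE fsubUset !fsub1set !mem /=.
  apply/fsubsetPn; exists (TS s (~~ vdir s) b) => //.
  by rewrite !inE; apply/norP; split; apply/eqP => -[]; case: (vdir s).
- move=> y /square_toksP[d [c [-> h]]]; have [->|dv] := eqVneq d (vdir s).
    by rewrite !inE; case: (c); rewrite eqxx ?orbT.
  move=> _; move: h; rewrite (negbTE dv) /= => /eqP[<-].
  by have -> : d = ~~ vdir s by move: dv; case: (d); case: (vdir s).
- by move=> y; rewrite !inE => /orP[]/eqP ->; rewrite ?tcv2 ?tcv2r // ?e1 ?e2.
Qed.

(** For [u = 0] the horizontal side has weight zero, so the point lies on the diagonal, which both
    halves of the diamond share. *)
Lemma phiM_u0 k s a b b' w : pfib x0 (sm s ctr) k -> 0 <= w <= 1 ->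
  phiM k s a b 0 w = phiM k s a b' 0 w.
Proof.
move=> fk w01; have m0 : Num.min 0 (1 - w) = 0.
  by apply: min_l; lra.
have h c : pt (square_toks s None) k (wM s a 0 w) = phiM k s a c 0 w.
  apply: pt_square_none => //; first by apply: wM_weights => //; lra.
  by rewrite /= (_ : (~~ vdir s == vdir s) = false) //; case: vdir.
by rewrite -!h.
Qed.

Lemma phiM_w0 k s a a' b u : phiM k s a b u 0 = phiM k s a' b u 0.
Proof.
apply: eq_pt => t _; case: t => [[[v|e]|p]|[s' [d c]]] //=.
by rewrite !addr0 !subr0 !if_same.
Qed.

Lemma udist_sum0 (t : I) u : u = 0 -> u + udist t <= 1.
Proof. by move=> ->; rewrite add0r; have /andP[] := unit_abs t. Qed.

Definition in_quarter s a b (p : I * I) := in_half a (xc s p) && in_half b (yc s p).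

Lemma phiQ_b k s a b b' (p : I * I) : pfib x0 (sm s ctr) k -> val (yc s p) = 2^-1 ->
  phiQ k s a b (udist (yc s p)) (udist (xc s p)) = phiQ k s a b' (udist (yc s p)) (udist (xc s p)).
Proof.
move=> fk hy; rewrite /phiQ (udist_half hy) (udist_sum0 _ erefl).
exact: phiM_u0 fk (unit_abs _).
Qed.

Lemma phiQ_a k s a a' b (p : I * I) : val (xc s p) = 2^-1 ->
  phiQ k s a b (udist (yc s p)) (udist (xc s p)) = phiQ k s a' b (udist (yc s p)) (udist (xc s p)).
Proof.
move=> hx; rewrite /phiQ (udist_half hx) addrC udist_sum0 //.
exact: phiM_w0.
Qed.

Lemma phiS_quarter k s a b p : pfib x0 (sm s ctr) k -> in_quarter s a b p ->
  phiS k s p = phiQ k s a b (udist (yc s p)) (udist (xc s p)).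
Proof.
move=> fk /andP[ha hb]; rewrite /phiS.
have hy : in_half b (yc s p) -> (val (yc s p) <= 2^-1) = false -> b = true.
  by move=> _; case: (b) hb => //= ->.
have step c : (if val (yc s p) <= 2^-1 then phiQ k s c false (udist (yc s p)) (udist (xc s p))
     else phiQ k s c true (udist (yc s p)) (udist (xc s p))) =
     phiQ k s c b (udist (yc s p)) (udist (xc s p)).
  case: ifP => h; last by rewrite (hy hb h).
  case: b hb {hy} => hb; last reflexivity.
  by apply: phiQ_b fk _; apply/eqP; rewrite eq_le h; exact: hb.
rewrite (step false) (step true) {step}; case: ifP => h; case: a ha => ha.
- by apply: phiQ_a; apply/eqP; rewrite eq_le h; exact: ha.
- reflexivity.
- reflexivity.
- by exfalso; move: ha; rewrite /in_half h.
Qed.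

Lemma xc_cont s : continuous (xc s).
Proof.
by rewrite /xc; case: vdir; [exact: fst_continuous|exact: snd_continuous].
Qed.

Lemma yc_cont s : continuous (yc s).
Proof.
by rewrite /yc; case: vdir; [exact: snd_continuous|exact: fst_continuous].
Qed.

Lemma phiQ_cont k s a b : pfib x0 (sm s ctr) k ->
  continuous (fun p => phiQ k s a b (udist (yc s p)) (udist (xc s p))).
Proof.
move=> fk.
have cu : continuous (fun p => udist (yc s p)) := continuous_compose (@yc_cont s) (@udist_cont R).
have cw : continuous (fun p => udist (xc s p)) := continuous_compose (@xc_cont s) (@udist_cont R).
have c1w : continuous (fun p => 1 - udist (xc s p)).
  by apply: contB => //; exact: cst_continuous.
have cc (r : R) : continuous (fun _ : I * I => r) by exact: cst_continuous.
apply: (@continuous_glue R (I * I)%type Z (fun p => udist (yc s p) + udist (xc s p)) 1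
  (fun p => phiM k s a b (udist (yc s p)) (udist (xc s p)))
  (fun p => phiF k s a b (udist (yc s p)) (udist (xc s p)))).
- exact: contD.
- apply: (@pt_cont R D z0).
  + by constructor.
  + exact: square_fib.
  + by move=> p; apply: wM_weights; exact: unit_abs.
  + have cm := contMin cu c1w.
    move=> t _; case: t => [[[v|e]|p]|[s' [d c]]] /=; try exact: cc.
    case: (d == vdir s) => //; case: (c == a); apply: cont_half.
      by apply: contD => //; apply: contB.
    by apply: contB => //; apply: contB.
- apply: (@pt_cont R D z0).
  + exact: corner_toks_good.
  + exact: corner_fib.
  + by move=> p; apply: wF_weights; exact: unit_abs.
  + have cm := contMax cu c1w.
    move=> t _; case: t => [[[v|e]|p]|[s' [d c]]] /=; try exact: cc.
      by apply: contB => //; apply: contD.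
    by case: (vertical p.1) => //; apply: contB.
- move=> p uw; apply: phiMF => //.
  + by have /andP[] := unit_abs (yc s p).
  + by have /andP[] := unit_abs (xc s p).
Qed.

Lemma phiS_cont k s : pfib x0 (sm s ctr) k -> continuous (phiS k s).
Proof.
move=> fk.
have cy : continuous (fun p => val (yc s p) : R) := continuous_compose (@yc_cont s) (@val_continuous R).
have cx : continuous (fun p => val (xc s p) : R) := continuous_compose (@xc_cont s) (@val_continuous R).
have ca a : continuous (fun p => if val (yc s p) <= 2^-1
    then phiQ k s a false (udist (yc s p)) (udist (xc s p))
    else phiQ k s a true (udist (yc s p)) (udist (xc s p))).
  apply: (@continuous_glue R _ Z (fun p => val (yc s p)) 2^-1); first exact: cy.
  - exact: phiQ_cont.
  - exact: phiQ_cont.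
  - by move=> p hp; apply: phiQ_b.
apply: (@continuous_glue R _ Z (fun p => val (xc s p)) 2^-1); first exact: cx.
- exact: ca.
- exact: ca.
- move=> p hp; case: ifP => _; exact: phiQ_a hp.
Qed.

Lemma in_half_exists (t : I) : exists b, in_half b t.
Proof. by case: (leP (val t) 2^-1) => h; [exists false|exists true; exact: ltW]. Qed.

Lemma in_half_flip o b (t : I) : in_half (b (+) o) (unit_flip o t) = in_half b t.
Proof.
by rewrite /in_half val_flip; case: o; case: b => //=; apply/idP/idP; lra.
Qed.

Lemma in_half_end b : in_half b (ue b).
Proof. by rewrite /in_half val_end; case: b => /=; rewrite ?mulr1n ?mulr0n; lra. Qed.

Lemma udist_flip o (t : I) : udist (unit_flip o t) = udist t.
Proof.
rewrite /udist val_flip; case: o => //.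
by rewrite -normrN; congr (`| _ |); lra.
Qed.

(** On a side of the square the weights of a corner triangle reduce to those of a half edge, and the
    label at the centre is carried to the midpoint of the side. *)
Lemma phiS_side k s d c (t : I) : pfib x0 (sm s ctr) k ->
  phiS k s (mkdir d (ue c) t) =
  phiE z0 (pmul k (sg c2 (sm s) ctr (mkdir d (ue c) half))) (side s d c).1
    (unit_flip (side s d c).2 t).
Proof.
move=> fk; set o := (side s d c).2; set e := (side s d c).1.
have [b hb] := in_half_exists t.
have fe : pfib x0 (em e half) (pmul k (sg c2 (sm s) ctr (mkdir d (ue c) half))).
  by apply: pfib_mul fk _; rewrite -sm_side_half; apply: pfib_sg; exact: sm_cont.
rewrite (@phiE_half _ _ _ _ _ _ (b (+) o)) ?in_half_flip // /phiEb.
have eE : (e, b (+) o) = side_end s d c b by [].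
have kE : pmul (pmul k (sg c2 (sm s) ctr (mkdir d (ue c) half))) (sg c1 (em e) half (ue (b (+) o))) =
     pmul k (sg c2 (sm s) ctr (mkdir d (ue c) (ue b))).
  rewrite -pmulA; congr pmul.
  have -> : sg c1 (em e) half (ue (b (+) o)) =
      sg c2 (sm s) (mkdir d (ue c) half) (mkdir d (ue c) (ue b)).
    by rewrite -sg_side unit_flip_half unit_flip_end.
  by rewrite sg_mul //; exact: sm_cont.
rewrite kE eE.
have /andP[t0 t1] := unit_abs t.
(* Handles vertical and horizontal sides at once: the one weight outside the half edge vanishes, and
   the two others are given by [wE]. *)
have main (L := edge_star (side_end s d c b)) a' b' k' :
    (L `<=` corner_toks s a' b')%fset -> k' = corner_class k s a' b' ->
    phiS k s (mkdir d (ue c) t) = phiF k s a' b' (udist (yc s (mkdir d (ue c) t))) (udist (xc s (mkdir d (ue c) t))) ->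
    (forall (u : token), u \in corner_toks s a' b' -> u \notin L -> wF (udist (yc s (mkdir d (ue c) t))) (udist (xc s (mkdir d (ue c) t))) u = 0) ->
    (forall (u : token), u \in L -> wF (udist (yc s (mkdir d (ue c) t))) (udist (xc s (mkdir d (ue c) t))) u = wE (unit_flip o t) u) ->
    phiS k s (mkdir d (ue c) t) = pt L k' (wE (unit_flip o t)).
  move=> sub -> -> w0 wl.
  have L0 : L != fset0 by apply/fset0Pn; exists (TN (side_end s d c b)); rewrite !inE eqxx.
  have Ln p : L <> [fset TN p]%fset.
    move=> /fsetP/(_ (TV (endpoint (side_end s d c b).1 (side_end s d c b).2))).
    by rewrite !inE eqxx.
  have ww := wF_weights s a' b' (unit_abs (yc s (mkdir d (ue c) t)))
    (unit_abs (xc s (mkdir d (ue c) t))).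
  rewrite /phiF -(pt_vertex_subset z0 (corner_toks_good s a' b') (corner_fib (a := a') (b := b') fk)
    (@corner_toks_at s a' b') sub L0 Ln ww w0).
  by apply: eq_pt => u uL; exact: wl.
have QF a' b' p : (udist (yc s p) = 1 \/ udist (xc s p) = 1) ->
    phiQ k s a' b' (udist (yc s p)) (udist (xc s p)) = phiF k s a' b' (udist (yc s p)) (udist (xc s p)).
  have /andP[y0 y1] := unit_abs (yc s p); have /andP[w0 w1] := unit_abs (xc s p).
  rewrite /phiQ => h; case: ifP => // uw; apply: phiMF => //.
  by case: h => h; rewrite h in uw *; lra.
have [dv|dv] := eqVneq d (vdir s).
  have xE : xc s (mkdir d (ue c) t) = ue c by rewrite /xc dv; case: (vdir s).
  have yE : yc s (mkdir d (ue c) t) = t by rewrite /yc dv; case: (vdir s).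
  have mx : Num.max (udist t) 0 = udist t by apply: max_l.
  apply: (main c b).
  - by apply/fsubsetP => u; rewrite !inE dv => /orP[]/eqP ->; rewrite eqxx ?orbT.
  - by rewrite dv.
  - rewrite (@phiS_quarter _ _ c b) //; last by rewrite /in_quarter xE yE in_half_end.
    by apply: QF; right; rewrite xE udist_end.
  - rewrite xE yE udist_end => u; rewrite !inE => /orP[/orP[]|]/eqP ->.
    + by rewrite dv eqxx.
    + by rewrite dv eqxx orbT.
    + move=> _ /=; rewrite vertical_side (_ : (~~ vdir s == vdir s) = false); last by case: vdir.
      by rewrite subrr.
  - rewrite xE yE udist_end => u; rewrite !inE dv => /orP[]/eqP -> /=; rewrite udist_flip subrr mx.
      by rewrite addrK.
    by rewrite vertical_side eqxx.
have dE : d = ~~ vdir s by move: dv; case: (d); case: (vdir s).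
have xE : xc s (mkdir d (ue c) t) = t by rewrite /xc dE; case: (vdir s).
have yE : yc s (mkdir d (ue c) t) = ue c by rewrite /yc dE; case: (vdir s).
have mx : Num.max 1 (1 - udist t) = 1 by apply: max_l; lra.
apply: (main b c).
- apply/fsubsetP => u; rewrite !inE dE => /orP[]/eqP ->; last by rewrite eqxx ?orbT.
  by rewrite /corner_vertex (side_end_endpoint s (vdir s) b c) eqxx. 
- by rewrite /corner_class dE mkdirC.
- rewrite (@phiS_quarter _ _ b c) //; last by rewrite /in_quarter xE yE in_half_end hb.
  by apply: QF; left; rewrite yE udist_end.
- rewrite xE yE udist_end => u; rewrite !inE => /orP[/orP[]|]/eqP ->.
  + by rewrite dE /corner_vertex (side_end_endpoint s (vdir s) b c) eqxx.
  + by move=> _ /=; rewrite vertical_side eqxx mx subrr.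
  + by rewrite dE eqxx orbT.
- rewrite xE yE udist_end => u; rewrite !inE dE => /orP[]/eqP -> /=; rewrite udist_flip mx.
    by rewrite addrAC subrr add0r.
  rewrite vertical_side (_ : (~~ vdir s == vdir s) = false) //; by case: vdir.
Qed.

End SquareMap.

(** * The map on the universal cover *)

Section Theta.
Variables (R : realType) (X : VH_complex) (x0 : square_realization R X).
Local Notation I := (unit_interval R).
Local Notation T := (square_realization R X).
Local Notation pr := (glued_class (@square_attach R X)).
Local Notation token := (token X).
Local Notation D := (tdata x0).
Local Notation Z := (simplicial_realization R (token_complex D)).
Variable z0 : Z.
Local Notation half := (clamp 2^-1 : I).
Local Notation ctr := (half, half).
Local Notation c1 := (unit_segments R).
Local Notation c2 := (square_segments R).
Local Notation ue := (unit_end R).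
Local Notation em := (@em R X).
Local Notation sm := (@sm R X).
Local Notation K := (set (I -> T)).
Local Notation pt := (@pt R D z0).
Local Notation phiE := (phiE z0).
Local Notation phiS := (phiS z0).

(* The pair (point a of a cell, class k of paths from x0 to a) is a point of the
   universal cover. *)
Definition theta (k : K) (a : {c & @cell_space R X c}) : Z :=
  match a with
  | existT (inl (inl v)) _ => pt [fset TV v]%fset k (fun=> 1)
  | existT (inl (inr e)) t => phiE (pmul k (sg c1 (em e) (t : I) half)) e t
  | existT (inr s) p => phiS (pmul k (sg c2 (sm s) (p : I * I) ctr)) s p
  end.

Lemma theta_end k e b : pfib x0 (em e (ue b)) k ->
  theta k (vertex_point R (endpoint e b)) = theta k (edge_point e (ue b)).
Proof.
move=> fk; rewrite /= phiE_end; last by apply: pfib_mul fk (pfib_sg _ _ _ _); exact: em_cont.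
by rewrite (sg_id_mul (x0 := x0)) //; exact: em_cont.
Qed.

Lemma theta_side k s d b (t : I) : pfib x0 (sm s (mkdir d (ue b) t)) k ->
  theta k (edge_point (side s d b).1 (unit_flip (side s d b).2 t)) =
  theta k (square_point s (mkdir d (ue b) t)).
Proof.
move=> fk; rewrite /= phiS_side; last by apply: pfib_mul fk (pfib_sg _ _ _ _); exact: sm_cont.
congr (phiE _ _ _); rewrite -pmulA; congr pmul.
rewrite sg_mul; last exact: sm_cont.
by rewrite -sg_side unit_flip_half.
Qed.

Lemma theta_attach k a b : square_attach a b -> pfib x0 (pr a) k -> theta k a = theta k b.
Proof.
case=> {a b} [e b|s d b t|s a b].
- by rewrite -[pr _]/(vp R (endpoint e b)) -em_end => /theta_end.
- rewrite (_ : side_point d b _ = mkdir d (ue b) (unit_flip (side s d b).2 t)) // => fk.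
  rewrite -theta_side ?unit_flipK // sm_side unit_flipK.
  exact: fk.
- rewrite -[pr _]/(vp R (corner s a b)) -sm_corner => fk.
  rewrite -[(ue a, ue b)]/(mkdir true (ue a) (ue b)) -theta_side //.
  rewrite unit_flip_end -theta_end.
    by rewrite endpoint_side1.
  by rewrite em_end endpoint_side1 -sm_corner.
Qed.

Definition Theta (x : T) (k : K) : Z := theta k (repr x).

(** [theta] is not invariant under the gluing for arbitrary [k]; it is for a class ending at the
    point, and this end is the same along a chain of gluings. *)
Lemma theta_class k a : pfib x0 (pr a) k -> Theta (pr a) k = theta k a.
Proof.
move=> fk; rewrite /Theta.
have /glued_classP : pr (repr (pr a)) = pr a by exact: glued_class_repr.
move: (repr _) => b h; elim: h fk => {a b} [a b ab|a|a b /glued_classP ab IH|a b c _ IH1 bc IH2] // fk.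
- apply: theta_attach => //; have /glued_classP -> // := rst_step _ _ _ _ ab.
- by rewrite IH // -ab.
- by rewrite IH1 ?IH2 //; have /glued_classP -> := bc.
Qed.

Lemma sg_rev (Q : topologicalType) (c : segments R Q) (f : Q -> T) q q' : continuous f ->
  pcls (revp (fun t => f (lerp c q q' t))) = sg c f q' q.
Proof.
move=> cf; rewrite /revp.
have cu : continuous (fun t : I => lerp c q q' (clamp (-1 * val t + 1))).
  apply: (continuous_compose _ (@seg_cont _ _ c q q')).
  by apply: clamp_affine_continuous => t; exact: cvg_id.
have := sgE c cf cu; rewrite /= => ->.
have := revp0 (lerp c q q'); have := revp1 (lerp c q q'); rewrite /revp => -> ->.
by rewrite lerp0 lerp1.
Qed.

(** Within one cell, near a position of [c], the chart section continues to a fixed class [k'] at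
    the centre of the cell, so [Theta] is [phiE k'] or [phiS k'] there. *)
Lemma Theta_cont c k x : pfib x0 (ch_ctr (cell_chart R c)) k -> ch_dom (cell_chart R c) x ->
  {for x, continuous (fun y => Theta y (pmul k (pcls (revp (ch_path (cell_chart R c) y)))))}.
Proof.
move=> /= fk cx.
pose g a := theta (pmul k (pcls (revp (star_path c a)))) a.
apply: (@glued_lift_continuous _ _ _ g (star c)) => //; first exact: star_open.
  move=> a /starP; have [[v ->]|[e [t ->]]|[s [p ->]]] := cell_pointP a.
  (* A vertex cell has only one point. *)
  - move=> _ O nO; have nO' := nbhs_singleton nO; rewrite /nbhs /= sigT_nbhsE /=.
    apply: filterE => r; suff -> : r = projT2 (vertex_point R v) by [].
    apply: val_inj => /=; case: r => r r0 /=; have := set_mem r0 => /= ->.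
    by [].
  - move=> [i [ec it]].
    have nt : nbhs t [set t : I | pos_near i t].
      by apply: open_nbhs_nbhs; split=> //; exact: pos_near_open.
    (* The class at the midpoint of [e]: the segments to and from the moving point [t'] compose to
       one fixed segment. *)
    pose k' := pmul k (sg c1 (em e) (pos_pt R i) half).
    have fk' : pfib x0 (em e half) k'.
      by apply: pfib_mul fk _; rewrite -ec -em_pos; apply: pfib_sg; exact: em_cont.
    have E : \forall t' \near t, phiE k' e t' = g (edge_point e t').
      apply: filterS nt => t' it'; rewrite /g (star_path_edge ec it') /=.
      congr (phiE _ _ _); rewrite -pmulA; congr pmul.
      have -> : pcls (revp (fun r => em e (unit_lerp t' (pos_pt R i) r))) = sg c1 (em e) (pos_pt R i) t'.
        by apply: (sg_rev c1); exact: em_cont.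
      by rewrite sg_mul //; exact: em_cont.
    have h := cvg_trans (near_eq_cvg E) (phiE_cont (z0 := z0) fk' (x := t)).
    rewrite (nbhs_singleton E) in h.
    by move=> O nO; rewrite /nbhs /= sigT_nbhsE /=; exact: h.
  - move=> [ij [ec ip]].
    have np : nbhs p [set p : I * I | pos2_near ij p].
      by apply: open_nbhs_nbhs; split=> //; exact: pos2_near_open.
    pose k' := pmul k (sg c2 (sm s) (pos2_pt R ij) ctr).
    have fk' : pfib x0 (sm s ctr) k'.
      by apply: pfib_mul fk _; rewrite -ec -sm_pos; apply: pfib_sg; exact: sm_cont.
    have E : \forall p' \near p, phiS k' s p' = g (square_point s p').
      apply: filterS np => p' ip'; rewrite /g (star_path_square ec ip') /=.
      congr (phiS _ _ _); rewrite -pmulA; congr pmul.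
      by rewrite (sg_rev c2) ?sg_mul //; exact: sm_cont.
    have h := cvg_trans (near_eq_cvg E) (phiS_cont (z0 := z0) fk' (x := p)).
    rewrite (nbhs_singleton E) in h.
    by move=> O nO; rewrite /nbhs /= sigT_nbhsE /=; exact: h.
move=> a b ab ca; have ca' := (starP c a).1 ca.
rewrite /g -(star_path_attach ab ca'); apply: theta_attach => //.
have fp := pfib_chart (ch := cell_chart R c) ca.
apply: pfib_mul fk _; exists (revp (star_path c a)); rewrite revp0 revp1 star_path0 star_path1 //.
split=> //; apply: revp_cont; rewrite -chart_pathE //; exact: chart_path_cont.
Qed.

End Theta.

(** * From the complex back to the universal cover *)

Section Weights.
Variables (R : realType) (D : token_data) (L : {fset Tok D}) (w : Tok D -> R).

Lemma weights_le1 t : weights L w -> t \in L -> w t <= 1.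
Proof.
move=> [w0 w1] tL; rewrite -w1 (big_fsetD1 t) //= lerDl big_seq.
by apply: sumr_ge0 => u; rewrite !inE => /andP[_ uL]; exact: w0.
Qed.

Lemma weights_pair t u : weights L w -> t \in L -> u \in L -> t != u -> w t + w u <= 1.
Proof.
move=> [w0 w1] tL uL tu; rewrite -w1 (big_fsetD1 t) //= (big_fsetD1 u) /=; last first.
  by rewrite !inE eq_sym tu.
rewrite addrA lerDl big_seq.
by apply: sumr_ge0 => x; rewrite !inE => /and3P[_ _ xL]; exact: w0.
Qed.

Lemma weights_one t u : weights L w -> t \in L -> w t = 1 -> u \in L -> u != t -> w u = 0.
Proof.
move=> wL tL wt uL ut; have [w0 _] := wL; apply/eqP; rewrite eq_le w0 // andbT.
by have := weights_pair wL tL uL; rewrite eq_sym wt => /(_ ut); lra.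
Qed.

Definition supp : Prop := forall t, t \notin L -> w t = 0.

End Weights.

(** * Retraction near a vertex of X *)

Section VertexPart.
Variables (R : realType) (X : VH_complex) (x0 : square_realization R X).
Local Notation I := (unit_interval R).
Local Notation T := (square_realization R X).
Local Notation token := (token X).
Local Notation D := (tdata x0).
Local Notation Z := (simplicial_realization R (token_complex D)).
Variable z0 : Z.
Local Notation half := (clamp 2^-1 : I).
Local Notation c1 := (unit_segments R).
Local Notation ue := (unit_end R).
Local Notation em := (@em R X).
Local Notation K := (set (I -> T)).
Local Notation pt := (@pt R D z0).
Local Notation phiE := (phiE z0).
Implicit Types (v : vertex X) (l : seq token) (L F : {fset token}) (w : token -> R) (k : K).

(* At a vertex v, the edge end with weight w > 1/2, if there is one, pulls the
   point from v to distance 2 w - 1 (in half edges) along the edge. *)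
Fixpoint radP v l w (r : I) : T :=
  match l with
  | [::] => vp R v
  | t :: l' =>
      if t is inl (inr p) then
        if w t <= 2^-1 then radP v l' w r
        else em p.1 (unit_lerp (ue p.2) half (clamp ((2 * w t - 1) * val r)))
      else radP v l' w r
  end.

Lemma radP_end v p l w r : radP v (TN p :: l) w r = if w (TN p) <= 2^-1 then radP v l w r
  else em p.1 (unit_lerp (ue p.2) half (clamp ((2 * w (TN p) - 1) * val r))).
Proof. by []. Qed.

Lemma radP_small v l w r : (forall p, TN p \in l -> w (TN p) <= 2^-1) -> radP v l w r = vp R v.
Proof.
elim: l => [|t l IH] //= h.
have h' : forall p, TN p \in l -> w (TN p) <= 2^-1.
  by move=> p pl; apply: h; rewrite inE pl orbT.
case: t h => [[[v'|e]|p]|s] h; rewrite ?IH //.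
by rewrite h // inE eqxx.
Qed.

Lemma radP_big v l w r p : TN p \in l -> 2^-1 < w (TN p) ->
  (forall q, TN q \in l -> q != p -> w (TN q) <= 2^-1) ->
  radP v l w r = em p.1 (unit_lerp (ue p.2) half (clamp ((2 * w (TN p) - 1) * val r))).
Proof.
move=> + wp; elim: l => [|t l IH] //= pl h.
have h' : forall q, TN q \in l -> q != p -> w (TN q) <= 2^-1.
  by move=> q ql; apply: h; rewrite inE ql orbT.
move: pl; rewrite inE => /orP[/eqP <-|pl]; first by rewrite leNgt wp.
case: t h => [[[v'|e]|q]|s] h; rewrite ?IH //.
have [->|qp] := eqVneq q p; first by rewrite leNgt wp.
by rewrite h // inE eqxx.
Qed.

Lemma radP0 v l w : (forall p, TN p \in l -> endpoint p.1 p.2 = v) -> radP v l w zero = vp R v.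
Proof.
elim: l => [|t l IH] // h.
have {}IH : radP v l w zero = vp R v.
  by apply: IH => p pl; apply: h; rewrite inE pl orbT.
case: t h => [[[v'|e]|p]|s] h //; rewrite radP_end; case: ifP => // _.
rewrite [X in unit_lerp _ _ X]clamp0; last by rewrite val_zero mulr0.
by rewrite unit_lerp0 em_end h // inE eqxx.
Qed.

Lemma radP_cont (S : topologicalType) v l (w : S -> token -> R) : uniq l ->
  (forall t, t \in l -> continuous (fun s => w s t)) ->
  (forall s p q, TN p \in l -> TN q \in l -> p != q -> w s (TN p) + w s (TN q) <= 1) ->
  (forall p, TN p \in l -> endpoint p.1 p.2 = v) ->
  continuous (fun x : S * I => radP v l (w x.1) x.2).
Proof.
elim: l => [|t l IH] /=; first by move=> *; exact: cst_continuous.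
move=> /andP[tl ul] cw w2 lv.
have {}IH : continuous (fun x : S * I => radP v l (w x.1) x.2).
  apply: IH => // [u uL|s p q pl ql|p pl]; first by apply: cw; rewrite inE uL orbT.
    by apply: w2; rewrite inE ?pl ?ql orbT.
  by apply: lv; rewrite inE pl orbT.
case: t tl cw w2 lv => [[[v'|e]|p]|s] tl cw w2 lv //.
have cwp : continuous (fun s => w s (TN p)) by apply: cw; rewrite inE eqxx.
have cp : continuous (fun x : S * I => w x.1 (TN p)) := continuous_compose (@fst_continuous S I) cwp.
apply: (@continuous_glue R _ T (fun x : S * I => w x.1 (TN p)) 2^-1) => //.
- apply: (continuous_compose _ (@em_cont R X p.1)).
  apply: (lerp_comp_cont (c := c1)); [exact: cst_continuous|exact: cst_continuous|].
  apply: (continuous_compose (f := fun x : S * I => (2 * w x.1 (TN p) - 1) * val x.2) _ (@clamp_continuous R)).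
  apply: contM; last exact: (continuous_compose (@snd_continuous _ _) (@val_continuous R)).
  by apply: contB; [apply: contM => //; exact: cst_continuous|exact: cst_continuous].
(* When [w (TN p)] is 1/2, every other end weighs at most 1/2, so both branches stay at [v]. *)
- move=> x xp; rewrite radP_small; last first.
    move=> q ql; have := w2 x.1 q p; rewrite !inE eqxx ql orbT xp.
    have [qp|_] := eqVneq q p; first by rewrite -qp ql in tl.
    by move=> /(_ isT isT isT) h; lra.
  rewrite xp [X in unit_lerp _ _ X]clamp0; last by rewrite (_ : 2 * 2^-1 - 1 = 0) ?mul0r //; lra.
  by rewrite unit_lerp0 em_end lv // inE eqxx.
Qed.

(** The part of a weight above 1/2, rescaled to [[0, 1]]; at most one end has a positive value,
    which is how far [radP] goes along that half edge. *)
Definition pull (w : token -> R) (t : token) : R :=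
  if t is inl (inr _) then Num.max 0 (2 * w t - 1) else 0.

(* The straight line, in the cone with apex v, from the weights w to those of the
   image in the complex of the point reached by [radP]. *)
Definition wP L w (r : I) (t : token) : R :=
  (1 - val r) * w t + val r *
    (if t is inl (inl (inl _)) then 1 - \sum_(u <- L) pull w u else pull w t).

(** The apex is adjoined because [L] need not contain the vertex [v] itself. *)
Definition KP v L k w (r : I) : Z := pt (TV v |` L)%fset k (wP L w r).

Lemma wP_TV L w r v : wP L w r (TV v) = (1 - val r) * w (TV v) + val r * (1 - \sum_(u <- L) pull w u).
Proof. by []. Qed.

Lemma wP_TN L w r p : wP L w r (TN p) = (1 - val r) * w (TN p) + val r * Num.max 0 (2 * w (TN p) - 1).
Proof. by []. Qed.

Lemma pull_bound L w t : weights (D := D) L w -> t \in L -> 0 <= pull w t <= w t.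
Proof.
move=> wL tL; have := weights_le1 wL tL; have := wL.1 t tL.
case: t tL => [[[v'|e]|p]|s] tL w0 w1 /=; rewrite ?w0 ?lexx //.
by rewrite le_max lexx ge_max w0 /=; lra.
Qed.

Lemma pull_supp L w t : supp (D := D) L w -> t \notin L -> pull w t = 0.
Proof.
move=> sw; case: t => [[[v'|e]|p]|s] //= /sw ->; rewrite mulr0 sub0r max_l //; lra.
Qed.

Lemma pull_sum L w : weights (D := D) L w -> 0 <= \sum_(u <- L) pull w u <= 1.
Proof.
move=> wL; apply/andP; split.
  by rewrite big_seq; apply: sumr_ge0 => t tL; have /andP[] := pull_bound wL tL.
rewrite -[X in _ <= X](wL.2) !big_seq.
by apply: ler_sum => t tL; have /andP[] := pull_bound wL tL.
Qed.

Lemma tgood_cone v L : tgood L -> (forall t, t \in L -> at_vertex v t) -> tgood (TV v |` L)%fset.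
Proof.
move=> gL Lv; apply: (@GoodVertex X v).
- by apply/fset0Pn; exists (TV v); rewrite !inE eqxx.
- by move=> t; rewrite !inE => /orP[/eqP->//|]; exact: Lv.
- move=> p q; rewrite !inE /=; case: gL Lv => [e|v' {}L _ _ Lu _|s o] Lv; last first.
  + by move=> /square_toksP[d [b [//]]].
  + exact: Lu.
  + by rewrite !inE.
- by move=> p /fsetP/(_ (TV v)); rewrite !inE eqxx.
Qed.

Lemma cone_at_vertex v L : (forall t, t \in L -> at_vertex v t) ->
  forall t, t \in (TV v |` L)%fset -> at_vertex v t.
Proof. by move=> Lv t; rewrite !inE => /orP[/eqP->//|]; exact: Lv. Qed.

Lemma tfib_at v L k : tgood L -> (forall t, t \in L -> at_vertex v t) -> tfib x0 L k ->
  pfib x0 (vp R v) k.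
Proof.
move=> /tgood_neq0/fset0Pn[t tL] Lv /(_ _ tL); have := Lv _ tL.
by case: t {tL} => [[[v'|e]|p]|s] //= ->.
Qed.

Lemma cone_fib v L k : tgood L -> (forall t, t \in L -> at_vertex v t) -> tfib x0 L k ->
  tfib x0 (TV v |` L)%fset k.
Proof. by move=> gL Lv fL; apply: (vertex_fib (cone_at_vertex Lv)); exact: tfib_at fL. Qed.

Lemma sum_cone v L (f : token -> R) : (TV v \notin L -> f (TV v) = 0) ->
  \sum_(t <- (TV v |` L)%fset) f t = \sum_(t <- L) f t.
Proof.
move=> fv; rewrite -(@big_fset_incl _ _ _ _ L) ?fsubsetU1 // => t.
by rewrite !inE => /orP[/eqP ->|->].
Qed.

Lemma wP_weights v L w r : weights (D := D) L w -> supp (D := D) L w ->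
  (forall t, t \in L -> at_vertex v t) -> weights (D := D) (TV v |` L)%fset (wP L w r).
Proof.
move=> wL sw Lv; have /andP[r0 r1] := unit_intervalP r.
have /andP[s0 s1] := pull_sum wL.
have w0 t : 0 <= w t.
  by have [tL|/sw ->] := boolP (t \in L); [exact: wL.1|].
have p0 t : 0 <= pull w t.
  by have [tL|/(pull_supp sw) ->] := boolP (t \in L); [have /andP[] := pull_bound wL tL|].
split.
  move=> t _; rewrite /wP addr_ge0 // mulr_ge0 // ?subr_ge0 //.
  by case: t => [[[v'|e]|p]|s] //; rewrite subr_ge0.
rewrite big_split /= -!mulr_sumr sum_cone; last by move=> /sw.
rewrite wL.2 (big_fsetD1 (TV v)) ?inE ?eqxx //=.
set S := (X in _ * (_ + X)). 
have -> : S = \sum_(u <- L) pull w u.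
  rewrite /S; transitivity (\sum_(u <- ((TV v |` L) `\ TV v)%fset) pull w u).
    rewrite !big_seq; apply: eq_bigr => t; rewrite !inE => /andP[tv /orP[/eqP tE|/Lv]].
      by rewrite tE eqxx in tv.
    by case: t tv => [[[v'|e]|p]|s] //= tv vE; rewrite vE eqxx in tv.
  apply: big_fset_incl; first by apply/fsubsetP => t; rewrite !inE => /andP[/negbTE ->].
  by move=> t tL; rewrite !inE tL orbT andbT negbK => /eqP ->.
by rewrite subrK !mulr1 subrK.
Qed.

Lemma KP0 v L k w : tgood L -> tfib x0 L k -> (forall t, t \in L -> at_vertex v t) ->
  weights (D := D) L w -> supp (D := D) L w -> KP v L k w zero = pt L k w.
Proof.
move=> gL fL Lv wL sw; rewrite /KP -(@pt_vertex_subset _ _ _ _ v (TV v |` L)%fset L) //.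
- by apply: eq_pt => t _; rewrite /wP val_zero subr0 mul1r mul0r addr0.
- exact: tgood_cone.
- exact: cone_fib.
- exact: cone_at_vertex.
- exact: fsubsetU1.
- exact: tgood_neq0.
- by move=> p E; apply: (@not_good_end X p); rewrite -E.
- exact: wP_weights.
- by move=> t _ tL; rewrite /wP val_zero subr0 mul1r mul0r addr0 sw.
Qed.

Lemma radP_cases v L w r : weights (D := D) L w ->
  (forall p, TN p \in L -> w (TN p) <= 2^-1) \/
  (exists p, [/\ TN p \in L, 2^-1 < w (TN p), forall q, TN q \in L -> q != p -> w (TN q) <= 2^-1 &
     radP v L w r = em p.1 (unit_lerp (ue p.2) half (clamp ((2 * w (TN p) - 1) * val r)))]).
Proof.
move=> wL; have [[p [pL wp]]|h] := pselect (exists p, TN p \in L /\ 2^-1 < w (TN p)).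
  have h q : TN q \in L -> q != p -> w (TN q) <= 2^-1.
    move=> qL qp; have := @weights_pair R D L w (TN q) (TN p) wL qL pL qp; lra.
  by right; exists p; split=> //; apply: radP_big.
left=> p pL; rewrite leNgt; apply/negP => wp; apply: h; by exists p.
Qed.

Lemma pull0 w p : w (TN p) <= 2^-1 -> pull w (TN p) = 0.
Proof. by move=> h /=; rewrite max_l //; lra. Qed.

Lemma pull_sum_small L w : (forall p, TN p \in L -> w (TN p) <= 2^-1) ->
  \sum_(u <- L) pull w u = 0.
Proof.
move=> h; rewrite big_seq big1 // => t tL.
by case: t tL => [[[v'|e]|p]|s] // /h /pull0.
Qed.

Lemma pull_sum_big L w p : TN p \in L -> 2^-1 < w (TN p) ->
  (forall q, TN q \in L -> q != p -> w (TN q) <= 2^-1) ->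
  \sum_(u <- L) pull w u = 2 * w (TN p) - 1.
Proof.
move=> pL wp h; rewrite (big_fsetD1 (TN p)) //= big_seq big1 ?addr0; first by rewrite max_r //; lra.
move=> t; rewrite !inE => /andP[tp tL]; case: t tp tL => [[[v'|e]|q]|s] // tp tL.
by apply: pull0; apply: h => //; apply: contraNneq tp => ->.
Qed.

Lemma val_pull_pt b r : 0 <= r <= 1 ->
  val (unit_lerp (ue b) half (clamp r)) = (1 - r) * b%:R + r * 2^-1.
Proof. by move=> r01; rewrite val_unit_lerp val_clamp // val_end val_half. Qed.

Lemma pull_pt_half b r : 0 <= r <= 1 -> in_half b (unit_lerp (ue b) half (clamp r)).
Proof.
move=> r01; have h := val_pull_pt b r01; move: r01 => /andP[r0 r1].
by rewrite /in_half h; case: (b); rewrite ?mulr1n ?mulr0n; lra.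
Qed.

Lemma udist_pull b r : 0 <= r <= 1 -> udist (unit_lerp (ue b) half (clamp r)) = 1 - r.
Proof.
move=> r01; rewrite /udist (val_pull_pt b r01); move: r01 => /andP[r0 r1].
case: b; rewrite ?mulr1n ?mulr0n.
  by rewrite ger0_norm; lra.
by rewrite ler0_norm; lra.
Qed.

Lemma sg_pull e b (r : R) :
  pcls (fun t : I => em e (unit_lerp (ue b) half (clamp (r * val t)))) =
  sg c1 (em e) (ue b) (unit_lerp (ue b) half (clamp r)).
Proof.
have cu : continuous (fun t : I => unit_lerp (ue b) half (clamp (r * val t))).
  apply: (lerp_comp_cont (c := c1)); [exact: cst_continuous|exact: cst_continuous|].
  apply: (continuous_compose (f := fun t : I => r * val t) _ (@clamp_continuous R)).
  by apply: contM; [exact: cst_continuous|exact: val_continuous].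
rewrite (sgE c1 (@em_cont R X e) cu) val_one mulr1 val_zero mulr0.
by rewrite [X in unit_lerp _ _ X]clamp0 // unit_lerp0.
Qed.

Lemma pmul_const x y k : pfib x y k -> pmul k (pcls (fun _ : I => y)) = k.
Proof. by move=> [f [cf _ <- ->]]; exact: pmulp1. Qed.

(** If no end exceeds 1/2, both sides are the vertex for [v]. Otherwise both lie on the half edge
    that carries the large weight, at the same place because [udist] there is one minus the pull. *)
Lemma KP1 v L k w : tgood L -> tfib x0 L k -> (forall t, t \in L -> at_vertex v t) ->
  weights (D := D) L w -> supp (D := D) L w ->
  KP v L k w one = Theta z0 (radP v L w one) (pmul k (pcls (radP v L w))).
Proof.
move=> gL fL Lv wL sw; have fk := tfib_at gL Lv fL.
have gC := tgood_cone gL Lv; have fC := cone_fib gL Lv fL; have CC := cone_at_vertex Lv.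
have wC := wP_weights one wL sw Lv.
have w1 t : wP L w one t = if t is inl (inl (inl _)) then 1 - \sum_(u <- L) pull w u else pull w t.
  by rewrite /wP val_one subrr mul0r mul1r add0r.
have [h|[p [pL wp h _]]] := @radP_cases v L w one wL.
  have -> : radP v L w = fun=> vp R v by apply/funext => r; exact: radP_small.
  rewrite (pmul_const fk) (@theta_class R X x0 z0 k (vertex_point R v)) //=.
  rewrite /KP -(@pt_vertex_subset _ _ _ _ v _ [fset TV v]%fset _ _ gC fC CC) //.
  - by apply: eq_pt => t; rewrite inE => /eqP ->; rewrite w1 pull_sum_small // subr0.
  - by apply/fsubsetP => t; rewrite !inE => ->.
  - by apply/fset0Pn; exists (TV v); rewrite inE.
  - by move=> p /fsetP/(_ (TV v)); rewrite !inE eqxx.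
  - move=> t tC tv; rewrite w1; move: tC; rewrite !inE in tv *; rewrite (negbTE tv) /= => tL.
    have := Lv _ tL; case: t tv tL => [[[v'|e]|p]|s] //= tv tL vE; first by rewrite vE eqxx in tv.
    exact: pull0 (h _ tL).
set r := 2 * w (TN p) - 1.
have r01 : 0 <= r <= 1.
  by have := weights_le1 wL pL; rewrite /r; lra.
have vE : endpoint p.1 p.2 = v := Lv _ pL.
have -> : radP v L w = fun t => em p.1 (unit_lerp (ue p.2) half (clamp (r * val t))).
  by apply/funext => t; exact: radP_big.
rewrite sg_pull val_one mulr1; set t := unit_lerp _ _ _.
have f1 : pfib x0 (em p.1 (ue p.2)) k by rewrite em_end vE.
have ft : pfib x0 (em p.1 t) (pmul k (sg c1 (em p.1) (ue p.2) t)).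
  by apply: pfib_mul f1 _; apply: pfib_sg; exact: em_cont.
rewrite (@theta_class R X x0 z0 _ (edge_point p.1 t)) //=.
rewrite -pmulA sg_mul; last exact: em_cont.
have fh : pfib x0 (em p.1 half) (pmul k (sg c1 (em p.1) (ue p.2) half)).
  by apply: pfib_mul f1 _; apply: pfib_sg; exact: em_cont.
rewrite (phiE_half z0 fh (pull_pt_half p.2 r01)) /phiEb (sg_id_mul (x0 := x0)) //; last exact: em_cont.
rewrite -surjective_pairing /KP -(@pt_vertex_subset _ _ _ _ v _ (edge_star p) _ _ gC fC CC) //.
- apply: eq_pt => u; rewrite !inE => /orP[]/eqP ->; rewrite w1 /wE udist_pull //.
    by rewrite (@pull_sum_big _ _ p).
  by rewrite /= max_r ?subKr // ; case/andP: r01.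
- by apply/fsubsetP => u; rewrite !inE vE => /orP[]/eqP ->; rewrite ?eqxx // pL orbT.
- by apply/fset0Pn; exists (TN p); rewrite !inE eqxx orbT.
- by move=> q /fsetP/(_ (TV (endpoint p.1 p.2))); rewrite !inE eqxx.
- move=> u uC; rewrite !inE vE negb_or => /andP[uv up]; rewrite w1.
  move: uC; rewrite !inE (negbTE uv) /= => uL.
  have := Lv _ uL; case: u uv up uL => [[[v'|e]|q]|s] //= uv up uL uE; first by rewrite uE eqxx in uv.
  by apply: pull0; apply: h => //; apply: contraNneq up => ->.
Qed.

Lemma radP_sub v L F w : (F `<=` L)%fset -> weights (D := D) L w ->
  (forall t, t \notin F -> w t = 0) -> radP v F w = radP v L w.
Proof.
move=> /fsubsetP FL wL wF; apply/funext => r.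
have [h|[p [pL wp h ->]]] := @radP_cases v L w r wL.
  by rewrite !radP_small // => p /FL; exact: h.
apply: radP_big => //; last by move=> q /FL; exact: h.
by apply: contraTT wp => /wF ->; rewrite -leNgt; lra.
Qed.

(** Tokens of weight zero have pull zero, so they contribute neither to the sum nor to the final
    weights. *)
Lemma KP_sub v L F k w r : tgood L -> tfib x0 L k -> (forall t, t \in L -> at_vertex v t) ->
  (F `<=` L)%fset -> F != fset0 -> weights (D := D) L w ->
  (forall t, t \notin F -> w t = 0) -> KP v F k w r = KP v L k w r.
Proof.
move=> gL fL Lv FL F0 wL wF.
have sL : supp (D := D) L w by move=> t tL; apply: wF; apply: contra tL; exact: (fsubsetP FL).
have gC := tgood_cone gL Lv; have fC := cone_fib gL Lv fL; have CC := cone_at_vertex Lv.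
have wC := wP_weights r wL sL Lv.
have sE : \sum_(u <- F) pull w u = \sum_(u <- L) pull w u.
  by apply: big_fset_incl => // t _ tF; exact: (@pull_supp F).
have -> : KP v F k w r = pt (TV v |` F)%fset k (wP L w r).
  by apply: eq_pt => t _; rewrite /wP sE.
apply: (@pt_vertex_subset _ _ _ _ v _ _ _ _ gC fC CC) => //.
- exact: fsetUS.
- by apply/fset0Pn; exists (TV v); rewrite !inE eqxx.
- by move=> p /fsetP/(_ (TV v)); rewrite !inE eqxx.
- move=> t tC; rewrite !inE negb_or => /andP[tv tF]; rewrite /wP wF // mulr0 add0r.
  move: tC; rewrite !inE (negbTE tv) /= => /Lv.
  by case: t tv tF => [[[v'|e]|p]|s] //= tv tF vE; rewrite ?wF ?mulr0 ?max_l ?mulr0 //; [rewrite vE eqxx in tv|lra].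
Qed.

Lemma radP_one v L w p : weights (D := D) L w -> TN p \in L -> w (TN p) = 1 ->
  radP v L w = fun r => em p.1 (unit_lerp (ue p.2) half r).
Proof.
move=> wL pL wp; apply/funext => r; rewrite (@radP_big _ _ _ _ p) //.
- by rewrite wp (_ : (2 * 1 - 1) * val r = val r) ?clampK //; lra.
- by rewrite wp; lra.
- move=> q qL qp; rewrite (@weights_one R D L w (TN p) (TN q)) //; lra.
Qed.

(** A vertex of the complex that stands for an edge does not move during the homotopy. This is what
    allows different simplices containing it to agree. *)
Lemma KP_end v L k w p r : tgood L -> tfib x0 L k -> (forall t, t \in L -> at_vertex v t) ->
  weights (D := D) L w -> supp (D := D) L w -> TN p \in L -> w (TN p) = 1 ->
  KP v L k w r = pt [fset TE p.1]%fset (pmul k (sg c1 (em p.1) (ue p.2) half)) (fun=> 1).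
Proof.
move=> gL fL Lv wL sw pL wp; apply: pt_vertex_end.
- exact: tgood_cone.
- exact: cone_fib.
- by rewrite !inE pL orbT.
- exact: wP_weights.
- by rewrite wP_TN wp max_r; lra.
Qed.

Lemma KP_cont (S : topologicalType) v L k (w : S -> token -> R) : tgood L -> tfib x0 L k ->
  (forall t, t \in L -> at_vertex v t) -> (forall s, weights (D := D) L (w s)) ->
  (forall s, supp (D := D) L (w s)) -> (forall t, continuous (fun s => w s t)) ->
  continuous (fun x : S * I => KP v L k (w x.1) x.2).
Proof.
move=> gL fL Lv wL sw cw.
have cx t : continuous (fun x : S * I => w x.1 t) := continuous_compose (@fst_continuous S I) (cw t).
have cr : continuous (fun x : S * I => val x.2 : R) := continuous_compose (@snd_continuous S I) (@val_continuous R).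
have cc (r : R) : continuous (fun _ : S * I => r) by exact: cst_continuous.
have cp t : continuous (fun x : S * I => pull (w x.1) t).
  case: t => [[[v'|e]|p]|s] //=; apply: contMax => //; apply: contB => //.
  by apply: contM.
have cs (l : seq token) : continuous (fun x : S * I => \sum_(u <- l) pull (w x.1) u).
  elim: l => [|t l IH].
    by have -> : (fun x : S * I => \sum_(u <- [::]) pull (w x.1) u) = fun=> 0
      by apply/funext => x; rewrite big_nil.
  have -> : (fun x : S * I => \sum_(u <- t :: l) pull (w x.1) u) =
     fun x => pull (w x.1) t + \sum_(u <- l) pull (w x.1) u.
    by apply/funext => x; rewrite big_cons.
  exact: contD.
apply: (@pt_cont R D z0).
- exact: tgood_cone.
- exact: cone_fib.
- by move=> x; exact: wP_weights.
- move=> t _; apply: contD; apply: contM => //; first exact: contB.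
  case: t => [[[v'|e]|p]|s]; [|exact: cp (TE e)|exact: cp (TN p)|exact: cp (inr s)].
  exact: contB.
Qed.

End VertexPart.

Section CornerArithmetic.
Variables (R : realType) (m r : R).
Hypotheses (m01 : 0 <= m <= 1) (r01 : 0 <= r <= 1).
(** On a corner edge with weight [m] on the horizontal side, [Z1] and [Y1] are the distances of [qe]
    from the midlines, and [W] and [U] those of the moving point at time [r]. The inequality
    [1 <= U + W] keeps this point in the corner triangle. *)
Let Z1 : R := Num.min 1 (2 * (1 - m)).
Let Y1 : R := Num.min 1 (2 * m).
Let W : R := (1 - r) * (1 - m) + r * Z1.
Let U : R := (1 - r) * m + r * Y1.

Let ZY : (m <= 2^-1 /\ Z1 = 1 /\ Y1 = 2 * m) \/ (2^-1 <= m /\ Z1 = 2 * (1 - m) /\ Y1 = 1).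
Proof.
case: (leP m 2^-1) => h; [left|right]; split; rewrite ?(ltW h) // /Z1 /Y1.
  by rewrite min_l ?min_r //; lra.
by rewrite min_r ?min_l //; lra.
Qed.

Lemma corner_ends01 : 0 <= Z1 <= 1 /\ 0 <= Y1 <= 1.
Proof. by have m0 := m01; case: ZY => -[h [-> ->]]; split; lra. Qed.

Lemma corner_lerp01 : [/\ 0 <= W <= 1, 0 <= U <= 1 & 1 <= U + W].
Proof.
have m0 := m01; have r0 := r01; have [z y] := corner_ends01; rewrite /U /W; split; [nra|nra|].
by case: ZY => -[h [-> ->]]; nra.
Qed.

Lemma corner_pull :
  Num.max 0 (2 * (1 - m) - 1) = 1 - Y1 /\ Num.max 0 (2 * m - 1) = 1 - Z1.
Proof.
have m0 := m01; case: ZY => -[h [-> ->]]; split.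
- by rewrite max_r; lra.
- by rewrite max_l; lra.
- by rewrite max_l; lra.
- by rewrite max_r; lra.
Qed.

End CornerArithmetic.

(** * Retraction in a square *)

Section SquarePart.
Variables (R : realType) (X : VH_complex) (x0 : square_realization R X).
Local Notation I := (unit_interval R).
Local Notation T := (square_realization R X).
Local Notation token := (token X).
Local Notation D := (tdata x0).
Local Notation Z := (simplicial_realization R (token_complex D)).
Variable z0 : Z.
Local Notation half := (clamp 2^-1 : I).
Local Notation ctr := (half, half).
Local Notation c1 := (unit_segments R).
Local Notation c2 := (square_segments R).
Local Notation ue := (unit_end R).
Local Notation em := (@em R X).
Local Notation sm := (@sm R X).
Local Notation K := (set (I -> T)).
Local Notation pt := (@pt R D z0).
Local Notation phiE := (phiE z0).
Local Notation phiS := (phiS z0).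
Local Notation phiF := (phiF z0).
Local Notation phiM := (phiM z0).
Local Notation phiQ := (phiQ z0).
Implicit Types (s : square X) (w : token -> R) (k : K) (a b c d : bool) (z y : R).

Definition lam s w c : R := w (TS s (vdir s) c).
Definition mu s w c : R := w (TS s (~~ vdir s) c).

(** The point with coordinate [z] when the interval is rescaled to [[-1, 1]]; larger values are cut
    off at the ends. *)
Definition signed_pt z : I := clamp ((1 + z) / 2).

Definition sq_pt s z y : I * I := mkdir (vdir s) (signed_pt z) (signed_pt y).

(* [phiS] maps [qs s w] to the point with weights w; the formula for [qe] is
   chosen to fit [radP] at the corners. *)
Definition qs s w : I * I := sq_pt s (lam s w true - lam s w false) (mu s w true - mu s w false).

Definition qe s w : I * I :=
  sq_pt s ((lam s w true - lam s w false) * Num.min (1 + 2 * (mu s w true + mu s w false)) 2)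
    (2 * (mu s w true - mu s w false)).

Definition radS s w (r : I) : T := sm s (lerp c2 ctr (qe s w) r).
Definition KS k s w (r : I) : Z := phiS k s (lerp c2 (qs s w) (qe s w) r).

Lemma xc_mkdir s (x y : I) : xc s (mkdir (vdir s) x y) = x.
Proof. by rewrite /xc; case: (vdir s). Qed.

Lemma yc_mkdir s (x y : I) : yc s (mkdir (vdir s) x y) = y.
Proof. by rewrite /yc; case: (vdir s). Qed.

Lemma xc_lerp s p q (r : I) : xc s (lerp c2 p q r) = unit_lerp (xc s p) (xc s q) r.
Proof. by rewrite /xc /=; case: (vdir s). Qed.

Lemma yc_lerp s p q (r : I) : yc s (lerp c2 p q r) = unit_lerp (yc s p) (yc s q) r.
Proof. by rewrite /yc /=; case: (vdir s). Qed.

Lemma val_signed_pt z : -1 <= z <= 1 -> val (signed_pt z) = (1 + z) / 2.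
Proof. by move=> z1; rewrite val_clamp //; lra. Qed.

Lemma signed_pt_big b z : 1 <= z -> signed_pt (if b then z else - z) = ue b.
Proof.
by move=> z1; case: b; rewrite /signed_pt; [rewrite clamp1 //|rewrite clamp0 //]; lra.
Qed.

Lemma signed_pt_pull b z : 0 <= z <= 1 ->
  signed_pt (if b then z else - z) = unit_lerp (ue b) half (clamp (1 - z)).
Proof.
move=> z01; apply: val_inj; rewrite val_pull_pt; last lra.
rewrite val_signed_pt; last by case: (b); lra.
by case: b; rewrite ?mulr1n ?mulr0n; lra.
Qed.

Lemma udist_val (t : I) z : val t = (1 + z) / 2 -> udist t = `|z|.
Proof. by move=> h; rewrite /udist h; congr (`| _ |); lra. Qed.

Lemma val_signed_lerp b z y (r : I) : 0 <= z <= 1 -> 0 <= y <= 1 ->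
  val (unit_lerp (signed_pt (if b then z else - z)) (signed_pt (if b then y else - y)) r) =
  (1 + if b then (1 - val r) * z + val r * y else - ((1 - val r) * z + val r * y)) / 2.
Proof.
move=> z01 y01; have sv x : 0 <= x <= 1 -> val (signed_pt (if b then x else - x)) = (1 + if b then x else - x) / 2.
  by move=> x01; apply: val_signed_pt; case: (b); lra.
by rewrite val_unit_lerp !sv //; case: b {sv}; lra.
Qed.

Lemma udist_signed (t : I) b z : 0 <= z -> val t = (1 + if b then z else - z) / 2 -> udist t = z.
Proof. by move=> z_ge0 /udist_val ->; case: b; rewrite ?normrN ger0_norm. Qed.

Lemma in_half_signed (t : I) b z : 0 <= z -> val t = (1 + if b then z else - z) / 2 -> in_half b t.
Proof. by move=> z_ge0; rewrite /in_half => ->; case: b; lra. Qed.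

Lemma sq_weights s o w : weights (D := D) (square_toks s o) w -> supp (D := D) (square_toks s o) w ->
  [/\ forall c, 0 <= lam s w c, forall c, 0 <= mu s w c,
      lam s w true + lam s w false + (mu s w true + mu s w false) = 1 &
      forall c, o != Some c -> mu s w c = 0].
Proof.
move=> [w0 w1] sw.
have w0' t : 0 <= w t by have [|/sw->] := boolP (t \in square_toks s o); [exact: w0|].
have mz c : o != Some c -> mu s w c = 0.
  move=> oc; apply: sw; apply/negP => /square_toksP[d [b [E h]]].
  case: E h => <- <-; rewrite (negbTE oc) orbF; by case: (vdir s).
split=> //; first by move=> c; exact: w0'.
- by move=> c; exact: w0'.
- case: o w0 w1 sw mz => [b|] w0 w1 sw mz.
    rewrite big_square_toks in w1; have := mz (~~ b); rewrite /lam /mu in w1 *.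
    case: b {w0 sw mz} w1 => w1 /(_ isT); rewrite /mu => ->; lra.
  move: w1; rewrite /square_toks fsetU0 big_fset2; last by apply/eqP => -[].
  by rewrite /lam !mz // => <-; lra.
Qed.

(** The path class from the centre to [qe] and the segment by which [theta] returns to the centre
    cancel. *)
Lemma KS1 k s w : pfib x0 (sm s ctr) k ->
  KS k s w one = Theta z0 (radS s w one) (pmul k (pcls (radS s w))).
Proof.
move=> fk; rewrite /KS /radS !lerp1.
rewrite -[pcls _]/(sg c2 (sm s) ctr (qe s w)).
rewrite (@theta_class R X x0 z0 _ (square_point s (qe s w))) /=; last first.
  by apply: pfib_mul fk _; apply: pfib_sg; exact: sm_cont.
by rewrite (sg_id_mul (x0 := x0)) //; exact: sm_cont.
Qed.

(** [qs] inverts the weights [wM] on each half of the diamond. *)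
Lemma KS0 k s o w : pfib x0 (sm s ctr) k -> weights (D := D) (square_toks s o) w ->
  supp (D := D) (square_toks s o) w -> KS k s w zero = pt (square_toks s o) k w.
Proof.
move=> fk wL sw; have [l0 m0 lm mz] := sq_weights wL sw.
have hl0 := l0 true; have hl1 := l0 false; have hm0 := m0 true; have hm1 := m0 false.
rewrite /KS lerp0.
(* Without a horizontal side the point lies on the diagonal, and either half of the diamond
   serves. *)
pose b := if o is Some b then b else false.
have mb : mu s w (~~ b) = 0.
  by apply: mz; rewrite /b; case: (o) => [[]|].
have [u uE] : exists u, u = mu s w b by exists (mu s w b).
have u0 : 0 <= u by rewrite uE.
have muE : mu s w true - mu s w false = if b then u else - u.
  by rewrite uE; case: (b) mb => ->; rewrite ?subr0 ?sub0r.
have lmu : lam s w true + lam s w false + u = 1.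
  by rewrite -lm uE; case: (b) mb => ->; rewrite ?add0r ?addr0.
set z := lam s w true - lam s w false.
pose a := 0 <= z.
have xv : val (xc s (qs s w)) = (1 + z) / 2.
  by rewrite xc_mkdir val_signed_pt // /z; lra.
have yv : val (yc s (qs s w)) = (1 + (if b then u else - u)) / 2.
  by rewrite yc_mkdir muE val_signed_pt //; case: (b); lra.
have ux : udist (xc s (qs s w)) = `|z| by exact: udist_val.
have uy : udist (yc s (qs s w)) = u.
  by rewrite (udist_val yv); case: (b); rewrite ?normrN ger0_norm.
rewrite (@phiS_quarter _ _ _ _ k s a b) //; last first.
  rewrite /in_quarter /in_half xv yv /a; apply/andP; split; last by case: (b); lra.
  by case: (leP 0 z) => h; lra.
have zn : `|z| = if a then z else - z.
  by rewrite /a; case: (leP 0 z) => h; [rewrite ger0_norm|rewrite ler0_norm // ltW].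
have uz : u + `|z| <= 1 by rewrite zn /z; case: (a); lra.
rewrite /phiQ ux uy uz.
have mn : Num.min u (1 - `|z|) = u by apply: min_l; lra.
have E : {in square_toks s (Some b), wM s a u `|z| =1 w}.
  move=> t /square_toksP[d [c [-> h]]] /=; rewrite mn.
  have [dv|dv] := eqVneq d (vdir s).
    rewrite dv zn -[w _]/(lam s w c) /z; case: (a); case: (c) => /=; lra.
  have dE : d = ~~ vdir s by move: dv; case: (d); case: (vdir s).
  by move: h; rewrite (negbTE dv) /= dE => /eqP[<-].
have -> : phiM k s a b u `|z| = pt (square_toks s (Some b)) k w by exact: eq_pt.
have [->//|oN] : o = Some b \/ o = None by rewrite /b; case: (o) => [c|]; [left|right].
rewrite oN in wL mz *; symmetry; apply: pt_square_none => //.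
  have [w0 w1] := wL; split.
    move=> t /square_toksP[d [c [-> _]]]; have [->|dv] := eqVneq d (vdir s).
      exact: l0.
    have -> : d = ~~ vdir s by move: dv; case: (d); case: (vdir s).
    exact: m0.
  rewrite big_square_toks -[X in X + _ + _]/(lam s w false) -[X in _ + X + _]/(lam s w true).
  by rewrite -[X in _ + X]/(mu s w b) -lmu uE; lra.
exact: mz.
Qed.

Lemma em_pull s d b c (r : I) :
  em (side_end s d b c).1 (unit_lerp (ue (side_end s d b c).2) half r) =
  sm s (mkdir d (ue b) (unit_lerp (ue c) half r)).
Proof. by rewrite sm_side unit_flip_lerp unit_flip_end unit_flip_half. Qed.

Lemma sg_pull_side s d b c (r : I) :
  sg c1 (em (side_end s d b c).1) (ue (side_end s d b c).2)
    (unit_lerp (ue (side_end s d b c).2) half r) =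
  sg c2 (sm s) (mkdir d (ue b) (ue c)) (mkdir d (ue b) (unit_lerp (ue c) half r)).
Proof. by rewrite -sg_side unit_flip_lerp unit_flip_end unit_flip_half. Qed.

Section Single.
Variables (s : square X) (o : option bool) (w : token -> R) (d c : bool).
Hypotheses (wL : weights (D := D) (square_toks s o) w) (sw : supp (D := D) (square_toks s o) w).
Hypothesis w1 : w (TS s d c) = 1.

Lemma single_qs : qs s w = mkdir d (ue c) half /\ qe s w = mkdir d (ue c) half.
Proof.
have [l0 m0 lm mz] := sq_weights wL sw.
have hl0 := l0 true; have hl1 := l0 false; have hm0 := m0 true; have hm1 := m0 false.
have h0 : signed_pt 0 = half by congr clamp; lra.
have dE : d = vdir s \/ d = ~~ vdir s by case: (d); case: (vdir s); [left|right|right|left].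
rewrite /qs /qe /sq_pt; have [e|e] := dE; rewrite e.
  have lc : lam s w c = 1 by rewrite /lam -e.
  have ln : lam s w (~~ c) = 0 by case: (c) lc => /= lc; lra.
  have e1 : lam s w true - lam s w false = if c then 1 else - 1.
    by case: (c) lc ln => /= lc ln; lra.
  have mt : mu s w true = 0 by case: (c) lc ln => /= lc ln; lra.
  have mf : mu s w false = 0 by case: (c) lc ln => /= lc ln; lra.
  rewrite e1 mt mf subrr addr0 !mulr0 addr0 h0 min_l ?mulr1; last lra.
  by rewrite signed_pt_big.
have lc : mu s w c = 1 by rewrite /mu -e.
have ln : mu s w (~~ c) = 0 by case: (c) lc => /= lc; lra.
have e1 : mu s w true - mu s w false = if c then 1 else - 1.
  by case: (c) lc ln => /= lc ln; lra.
have e2 : 2 * (if c then 1 else - 1) = if c then 2 else - 2 :> R by case: (c); lra.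
have mt : lam s w true = 0 by case: (c) lc ln => /= lc ln; lra.
have mf : lam s w false = 0 by case: (c) lc ln => /= lc ln; lra.
rewrite e1 mt mf subrr mul0r h0 e2 !signed_pt_big //; last by rewrite ler1n.
by rewrite mkdirC.
Qed.

Lemma KS_single k r : pfib x0 (sm s ctr) k ->
  KS k s w r = pt [fset TE (side s d c).1]%fset
    (pmul k (sg c2 (sm s) ctr (mkdir d (ue c) half))) (fun=> 1).
Proof.
move=> fk; rewrite /KS; have [-> ->] := single_qs; rewrite lerpp phiS_side // unit_flip_half.
have fe : pfib x0 (em (side s d c).1 half) (pmul k (sg c2 (sm s) ctr (mkdir d (ue c) half))).
  by rewrite -sm_side_half; apply: pfib_mul fk _; apply: pfib_sg; exact: sm_cont.
rewrite (@phiE_half _ _ _ _ _ _ false half fe) ?phiEb_half ?val_half //.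
by rewrite /in_half val_half.
Qed.

Lemma radS_single : radS s w = fun r => sm s (lerp c2 ctr (mkdir d (ue c) half) r).
Proof. by rewrite /radS; have [_ ->] := single_qs. Qed.

End Single.

Section Corner.
Variables (s : square X) (a b : bool) (w w' : token -> R) (k : K).
Local Notation L := (square_toks s (Some b)).
Local Notation pv := (side_end s (vdir s) a b).
Local Notation ph := (side_end s (~~ vdir s) b a).
Local Notation F := ([fset TN pv; TN ph]%fset : {fset token}).
Local Notation v := (corner_vertex s a b).
Hypotheses (wL : weights (D := D) L w) (sw : supp (D := D) L w).
Hypotheses (wFw : weights (D := D) F w') (sF : supp (D := D) F w').
Hypotheses (wa : w (TS s (vdir s) (~~ a)) = 0) (wv : w' (TN pv) = w (TS s (vdir s) a))
  (wh : w' (TN ph) = w (TS s (~~ vdir s) b)).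
Hypothesis fk : pfib x0 (sm s ctr) k.
Let m : R := mu s w b.

Lemma corner_coords : [/\ 0 <= m <= 1,
  lam s w true - lam s w false = (if a then 1 - m else - (1 - m)),
  mu s w true - mu s w false = (if b then m else - m) &
  mu s w true + mu s w false = m].
Proof.
have [l0 m0 lm mz] := sq_weights wL sw.
have la : lam s w (~~ a) = 0 by [].
have mb : mu s w (~~ b) = 0 by apply: mz; apply/eqP => -[]; case: (b).
have h1 := l0 true; have h2 := l0 false; have h3 := m0 true; have h4 := m0 false.
by rewrite /m; split; case: (a) la => /= la; case: (b) mb => /= mb; lra.
Qed.

Lemma corner_ends_weights : w' (TN pv) = 1 - m /\ w' (TN ph) = m.
Proof.
have [_ e _ e'] := corner_coords; rewrite wv wh; split=> //.
have la : lam s w (~~ a) = 0 by [].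
by rewrite -[w _]/(lam s w a); case: (a) la e => /= la; lra.
Qed.

Lemma corner_qs : qs s w = sq_pt s (if a then 1 - m else - (1 - m)) (if b then m else - m).
Proof. by rewrite /qs; have [_ -> -> _] := corner_coords. Qed.

Lemma corner_qe : qe s w =
  if m <= 2^-1 then mkdir (vdir s) (ue a) (unit_lerp (ue b) half (clamp (1 - 2 * m)))
  else mkdir (~~ vdir s) (ue b) (unit_lerp (ue a) half (clamp (1 - 2 * (1 - m)))).
Proof.
rewrite /qe; have [/andP[m0 m1] -> -> ->] := corner_coords.
have sgn (q : bool) (x y : R) : (if q then x else - x) * y = if q then x * y else - (x * y).
  by case: q; rewrite ?mulNr.
have sgn2 : 2 * (if b then m else - m) = if b then 2 * m else - (2 * m).
  by case: (b); rewrite ?mulrN.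
rewrite sgn sgn2; case: (leP m 2^-1) => h.
  rewrite /sq_pt signed_pt_big; first by rewrite signed_pt_pull //; lra.
  rewrite min_l; last lra.
  (* Here [(1 - m) * (1 + 2 * m) - 1 = m * (1 - 2 * m)] is nonnegative, so the coordinate is cut off
     at the vertical side. *)
  by nra.
rewrite /sq_pt min_r; last lra.
rewrite (signed_pt_big b); last lra.
rewrite mkdirC mulrC signed_pt_pull //; lra.
Qed.

Lemma corner_qe1 : qe s w = sq_pt s
  (if a then Num.min 1 (2 * (1 - m)) else - Num.min 1 (2 * (1 - m)))
  (if b then Num.min 1 (2 * m) else - Num.min 1 (2 * m)).
Proof.
have [m01 _ _ _] := corner_coords; rewrite corner_qe /sq_pt.
have h0 : clamp 0 = zero :> I by exact: clamp0.
have [h|h|h] := ltgtP m 2^-1.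
- have -> : Num.min 1 (2 * (1 - m)) = 1 by apply: min_l; lra.
  have -> : Num.min 1 (2 * m) = 2 * m by apply: min_r; lra.
  by rewrite signed_pt_big // signed_pt_pull //; lra.
- have -> : Num.min 1 (2 * (1 - m)) = 2 * (1 - m) by apply: min_r; lra.
  have -> : Num.min 1 (2 * m) = 1 by apply: min_l; lra.
  by rewrite mkdirC (signed_pt_big b) // signed_pt_pull //; lra.
- have e : 2 * (1 - m) = 1 by lra.
  have e' : 2 * m = 1 by lra.
  by rewrite e e' minxx !signed_pt_big // subrr h0 unit_lerp0.
Qed.

Lemma corner_fset : (TV v |` F)%fset = corner_toks s a b.
Proof. by rewrite /corner_toks -fsetUA. Qed.

(** The vertex part leaves the corner along the edge whose weight exceeds 1/2, and [qe] lies on that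
    side of the square at the same distance from the corner. If both weights are 1/2, both are at
    the corner. *)
Lemma corner_radP :
  radP v F w' one = sm s (qe s w) /\
  pcls (radP v F w') = sg c2 (sm s) (mkdir (vdir s) (ue a) (ue b)) (qe s w).
Proof.
have [m01 _ _ _] := corner_coords; have [e1 e2] := corner_ends_weights.
have nvh : pv != ph by apply/eqP/side_end_neq.
have inF q : (TN q : token) \in F -> q = pv \/ q = ph.
  by rewrite !inE => /orP[]/eqP/TN_inj ->; [left|right].
have gen p n : (TN p : token) \in F -> w' (TN p) = n -> 2^-1 < n -> n <= 1 ->
   radP v F w' one = em p.1 (unit_lerp (ue p.2) half (clamp (2 * n - 1))) /\
   pcls (radP v F w') = sg c1 (em p.1) (ue p.2) (unit_lerp (ue p.2) half (clamp (2 * n - 1))).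
  move=> pF wp n2 n1; have h q : (TN q : token) \in F -> q != p -> w' (TN q) <= 2^-1.
    move=> qF qp; have := @weights_pair R D F w' (TN q) (TN p) wFw qF pF qp.
    by rewrite wp; lra.
  have -> : radP v F w' = fun r => em p.1 (unit_lerp (ue p.2) half (clamp ((2 * n - 1) * val r))).
    by apply/funext => r; rewrite (@radP_big R X v F w' r p) ?wp.
  by rewrite sg_pull val_one mulr1.
rewrite corner_qe; have [h|h|h] := ltgtP m 2^-1.
- have [] := gen pv (1 - m); rewrite ?e1 //; [by rewrite !inE eqxx|lra|lra|].
  move=> -> ->; rewrite em_pull sg_pull_side.
  by have -> : 2 * (1 - m) - 1 = 1 - 2 * m by lra.
- have [] := gen ph m; rewrite ?e2 //; [by rewrite !inE eqxx orbT|lra|].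
  move=> -> ->; rewrite em_pull sg_pull_side.
  have -> : 2 * m - 1 = 1 - 2 * (1 - m) by lra.
  by rewrite (mkdirC _ (ue a) (ue b)).
- have c0 : clamp (1 - 2 * m) = zero :> I by apply: clamp0; lra.
  have small p : (TN p : token) \in F -> w' (TN p) <= 2^-1.
    by move=> /inF[]->; rewrite ?e1 ?e2; lra.
  rewrite c0 unit_lerp0 sm_side_end sg_id sm_side_end.
  split; first exact: radP_small.
  by congr pcls; apply/funext => r; exact: radP_small.
Qed.

Lemma corner_khat :
  pmul (corner_class k s a b) (pcls (radP v F w')) = pmul k (pcls (radS s w)).
Proof.
have [_ ->] := corner_radP; rewrite -pmulA sg_mul //; exact: sm_cont.
Qed.

Lemma phiQF u z : 0 <= u <= 1 -> 0 <= z <= 1 -> 1 <= u + z -> phiQ k s a b u z = phiF k s a b u z.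
Proof.
move=> u01 z01 uz; rewrite /phiQ; case: ifP => // uz'.
by apply: phiMF => //; lra.
Qed.

(** Both homotopies run in the simplex of the corner, with the same weights, affine in the parameter
    [r]. *)
Lemma corner_KS r : KP z0 v F (corner_class k s a b) w' r = KS k s w r.
Proof.
have [m01 _ _ _] := corner_coords; have [e1 e2] := corner_ends_weights.
have /andP[r0 r1] := unit_intervalP r.
have nvh : (TN pv : token) != TN ph by apply/eqP => /TN_inj/side_end_neq.
have [Z01 Y01] := corner_ends01 m01.
have [W01 U01 UW] := corner_lerp01 m01 (unit_intervalP r).
have [M1 M2] := corner_pull m01.
set Z1 := Num.min 1 (2 * (1 - m)) in Z01 W01 UW M2 *; set Y1 := Num.min 1 (2 * m) in Y01 U01 UW M1 *.
set W := (1 - val r) * (1 - m) + val r * Z1 in W01 UW *; set U := (1 - val r) * m + val r * Y1 in U01 UW *.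
have W0 : 0 <= W by case/andP: W01.
have U0 : 0 <= U by case/andP: U01.
have m01' : 0 <= 1 - m <= 1 by lra.
have xv : val (xc s (lerp c2 (qs s w) (qe s w) r)) = (1 + if a then W else - W) / 2.
  by rewrite xc_lerp corner_qs corner_qe1 !xc_mkdir val_signed_lerp.
have yv : val (yc s (lerp c2 (qs s w) (qe s w) r)) = (1 + if b then U else - U) / 2.
  by rewrite yc_lerp corner_qs corner_qe1 !yc_mkdir val_signed_lerp.
rewrite /KS (@phiS_quarter _ _ _ _ k s a b _ fk); last first.
  by apply/andP; split; [exact: in_half_signed xv|exact: in_half_signed yv].
rewrite (udist_signed W0 xv) (udist_signed U0 yv) (phiQF U01 W01 UW) /KP corner_fset; apply: eq_pt => t.
have mx : Num.max U (1 - W) = U by apply: max_l; rewrite lerBlDr.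
have sE : \sum_(u <- F) pull w' u = (1 - Y1) + (1 - Z1) by rewrite big_fset2 //= e1 e2 M1 M2.
have tv : w' (TV v) = 0 by apply: sF; rewrite !inE.
rewrite !inE => /orP[/orP[]|]/eqP ->.
- by rewrite wP_TV tv sE [wF _ _ _]/= mx /U /W; lra.
- by rewrite wP_TN e1 M1 [wF _ _ _]/= vertical_side eqxx mx /U; lra.
- rewrite wP_TN e2 M2 [wF _ _ _]/= vertical_side (_ : (~~ vdir s == vdir s) = false) /W.
    by lra.
  by case: (vdir s).
Qed.

End Corner.

Lemma signed_cont (S : topologicalType) (f : S -> R) : continuous f ->
  continuous (fun x => signed_pt (f x)).
Proof.
move=> cf; apply: (continuous_compose (f := fun x => (1 + f x) / 2) _ (@clamp_continuous R)).
by apply: cont_half; apply: contD => //; exact: cst_continuous.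
Qed.

Lemma sq_pt_cont (S : topologicalType) s (f g : S -> R) : continuous f -> continuous g ->
  continuous (fun x => sq_pt s (f x) (g x)).
Proof.
move=> /signed_cont cf /signed_cont cg.
by rewrite /sq_pt; case: (vdir s); apply: continuous_pair.
Qed.

Section Continuity.
Variables (S : topologicalType) (s : square X) (w : S -> token -> R).
Hypothesis cw : forall t, continuous (fun x => w x t).

Lemma qs_cont : continuous (fun x => qs s (w x)).
Proof. by apply: sq_pt_cont; apply: contB; exact: cw. Qed.

Lemma qe_cont : continuous (fun x => qe s (w x)).
Proof.
have cc (r : R) : continuous (fun _ : S => r) by exact: cst_continuous.
have cl c : continuous (fun x => lam s (w x) c) by exact: cw.
have cm c : continuous (fun x => mu s (w x) c) by exact: cw.
apply: sq_pt_cont.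
  apply: contM; first exact: contB.
  by apply: contMin => //; apply: contD => //; apply: contM => //; exact: contD.
by apply: contM => //; exact: contB.
Qed.

Lemma KS_cont k : pfib x0 (sm s ctr) k -> continuous (fun x : S * I => KS k s (w x.1) x.2).
Proof.
move=> fk; apply: (continuous_compose _ (phiS_cont (z0 := z0) fk)).
apply: (lerp_comp_cont (c := c2)).
- exact: (continuous_compose (@fst_continuous _ _) qs_cont).
- exact: (continuous_compose (@fst_continuous _ _) qe_cont).
- exact: snd_continuous.
Qed.

Lemma radS_cont : continuous (fun x : S * I => radS s (w x.1) x.2).
Proof.
apply: (continuous_compose _ (@sm_cont R X s)); apply: (lerp_comp_cont (c := c2)).
- exact: cst_continuous.
- exact: (continuous_compose (@fst_continuous _ _) qe_cont).
- exact: snd_continuous.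
Qed.

End Continuity.

End SquarePart.

(** * Compatibility of the vertex and square parts *)

Section Retraction.
Variables (R : realType) (X : VH_complex) (x0 : square_realization R X).
Local Notation I := (unit_interval R).
Local Notation T := (square_realization R X).
Local Notation token := (token X).
Local Notation D := (tdata x0).
Local Notation Y := (token_complex D).
Local Notation Z := (simplicial_realization R Y).
Variable z0 : Z.
Local Notation half := (clamp 2^-1 : I).
Local Notation ctr := (half, half).
Local Notation c1 := (unit_segments R).
Local Notation c2 := (square_segments R).
Local Notation ue := (unit_end R).
Local Notation em := (@em R X).
Local Notation sm := (@sm R X).
Local Notation K := (set (I -> T)).
Local Notation pt := (@pt R D z0).
Implicit Types (L F : {fset token}) (w : token -> R) (k : K).

Definition tok_cell (t : token) : cell X :=
  match t with
  | inl (inl (inl v)) => inl (inl v)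
  | inl (inl (inr e)) => inl (inr e)
  | inl (inr p) => inl (inl (endpoint p.1 p.2))
  | inr (s, _) => inr s
  end.

(** All tokens of a good set have one anchor cell, so the first listed token may be used; [None]
    occurs for the empty set only. *)
Definition fcell L : option (cell X) := omap tok_cell (ohead (enum_fset L)).

Lemma fcellE L t : (forall u, u \in L -> tok_cell u = tok_cell t) -> L != fset0 ->
  fcell L = Some (tok_cell t).
Proof.
move=> h /fset0Pn[u]; rewrite /fcell -[u \in L]/(u \in enum_fset L).
have : {subset enum_fset L <= L} by [].
case: (enum_fset L) => [|x l] //= sub _; rewrite h //; apply: sub; exact: mem_head.
Qed.

Variant cell_spec L : option (cell X) -> Prop :=
| VertexCell v : (forall t, t \in L -> at_vertex v t) -> cell_spec L (Some (inl (inl v)))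
| EdgeCell e : L = [fset TE e]%fset -> cell_spec L (Some (inl (inr e)))
| SquareCell s o : L = square_toks s o -> cell_spec L (Some (inr s)).

Lemma fcell_vertex v L : L != fset0 -> (forall t, t \in L -> at_vertex v t) ->
  fcell L = Some (inl (inl v)).
Proof.
move=> L0 Lv; rewrite (@fcellE L (TV v)) // => t /Lv.
by case: t => [[[v'|e]|p]|s] //= ->.
Qed.

Lemma fcell_edge e : fcell [fset TE e]%fset = Some (inl (inr e)).
Proof.
rewrite (@fcellE _ (TE e)) // => [u|]; first by rewrite inE => /eqP ->.
by apply/fset0Pn; exists (TE e); rewrite inE.
Qed.

Lemma fcell_square s L : L != fset0 -> (forall t, t \in L -> exists d b, t = TS s d b) ->
  fcell L = Some (inr s).
Proof.
by move=> L0 Ls; rewrite (@fcellE L (TS s true true)) // => t /Ls[d [b ->]].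
Qed.

Lemma cellP L : tgood L -> cell_spec L (fcell L).
Proof.
move=> gL; have L0 := tgood_neq0 gL; case: gL L0 => [e|v {}L _ Lv _ _|s o] L0.
- by rewrite fcell_edge; constructor.
- by rewrite (fcell_vertex L0 Lv); constructor.
- rewrite (@fcell_square s) //; first by apply: SquareCell.
  by move=> t /square_toksP[d [b [-> _]]]; exists d, b.
Qed.

Definition radial L w (r : I) : T :=
  match fcell L with
  | Some (inl (inl v)) => radP v L w r
  | Some (inl (inr e)) => em e half
  | Some (inr s) => radS s w r
  | None => x0
  end.

Definition KK L k w (r : I) : Z :=
  match fcell L with
  | Some (inl (inl v)) => KP z0 v L k w r
  | Some (inl (inr e)) => pt L k w
  | Some (inr s) => KS z0 k s w r
  | None => z0
  end.

Definition khatL L k w : K := pmul k (pcls (radial L w)).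

(* The image of a point in X, the class lifting it to the universal cover, and the
   homotopy from the point to its image under both maps. *)
Definition retraction L k w : T * K * (I -> Z) := (radial L w one, khatL L k w, KK L k w).

Lemma weights_single L (t : token) w : weights (D := D) L w -> t \in L ->
  (forall y, y \notin [fset t]%fset -> w y = 0) -> w t = 1.
Proof.
move=> [w0 w1] tL wt; rewrite -w1 (big_fsetD1 t) //= big_seq big1 ?addr0 // => u.
by rewrite !inE => /andP[ut _]; apply: wt; rewrite inE.
Qed.

Lemma id_face F w w' : (forall t, t \in F -> tcv F t = t) ->
  (forall y, y \notin F -> w y = 0) -> {in F, forall y, w' (tcv F y) = w y} ->
  (forall y, y \notin (tcv F @` F)%fset -> w' y = 0) -> (tcv F @` F)%fset = F /\ w' = w.
Proof.
move=> h w0 ww w0'; have FE : (tcv F @` F)%fset = F.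
  by rewrite -[RHS]imfset_id; apply: eq_in_imfset => t tF; exact: h.
split=> //; apply/funext => y; have [yF|yF] := boolP (y \in F).
  by rewrite -[in LHS](h y yF) ww.
by rewrite w0 // w0' // FE.
Qed.

Lemma KK_vertex v L k w : L != fset0 -> (forall t, t \in L -> at_vertex v t) -> KK L k w = KP z0 v L k w.
Proof. by move=> L0 Lv; rewrite /KK (fcell_vertex L0 Lv). Qed.

Lemma radial_vertex v L w : L != fset0 -> (forall t, t \in L -> at_vertex v t) -> radial L w = radP v L w.
Proof. by move=> L0 Lv; rewrite /radial (fcell_vertex L0 Lv). Qed.

(** Seen from any simplex, a vertex of the complex that stands for an edge goes to the midpoint of
    that edge, with a constant homotopy. *)
Lemma retraction_single (t : token) L k w w' : tgood L -> tfib x0 L k -> t \in L -> L != [fset t]%fset ->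
  weights (D := D) L w -> supp (D := D) L w -> w t = 1 -> w' (cv1 t) = 1 -> (forall v, t <> TV v) ->
  retraction [fset cv1 t]%fset (tr1 t k) w' = retraction L k w.
Proof.
move=> gL fL tL Lt wL sw wt w't ntV.
have L0 := tgood_neq0 gL.
have edge e k' : pfib x0 (em e half) k' -> w' (TE e) = 1 ->
    retraction [fset TE e]%fset k' w' = (em e half, k', fun=> pt [fset TE e]%fset k' (fun=> 1)).
  move=> fk w1; rewrite /retraction /khatL /radial /KK fcell_edge (pmul_const fk).
  congr (_, _, _); apply/funext => r; apply: eq_pt => u; by rewrite inE => /eqP ->.
have ft := fL _ tL.
case: (cellP gL) => [v Lv|e LE|s o LE].
- have := Lv _ tL; case: t tL Lt wt w't ntV ft => [[[v'|e]|p]|s] //= tL Lt wt w't ntV ft; first by case: (ntV v').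
  move=> pv.
  have fh : pfib x0 (em p.1 half) (pmul k (sg c1 (em p.1) (ue p.2) half)).
    by apply: pfib_mul ft _; rewrite -em_end; apply: pfib_sg; exact: em_cont.
  rewrite edge // /retraction /khatL (radial_vertex w L0 Lv) (KK_vertex k w L0 Lv).
  rewrite (radP_one _ wL tL wt); congr (_, _, _); first by rewrite unit_lerp1.
  by apply/funext => r; rewrite (KP_end _ _ gL fL Lv wL sw tL wt).
- by move: tL Lt; rewrite LE inE => /eqP ->; rewrite eqxx.
- move: (tL); rewrite {1}LE => /square_toksP[d [c [tE _]]].
  subst t L; rewrite /= in w't *.
  have fh : pfib x0 (em (side s d c).1 half) (pmul k (sg c2 (sm s) ctr (mkdir d (ue c) half))).
    by apply: pfib_mul ft _; rewrite -sm_side_half; apply: pfib_sg; exact: sm_cont.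
  rewrite edge // /retraction /khatL.
  have fs : fcell (square_toks s o) = Some (inr s).
    by apply: fcell_square => // t /square_toksP[d' [b [-> _]]]; exists d', b.
  rewrite /radial /KK fs (radS_single wL sw wt) lerp1 sm_side_half.
  congr (_, _, _); apply/funext => r; by rewrite (KS_single _ wL sw wt).
Qed.

Lemma retraction_corner s a b k w w' (L := square_toks s (Some b))
    (F := [fset TN (side_end s (vdir s) a b); TN (side_end s (~~ vdir s) b a)]%fset) :
  pfib x0 (sm s ctr) k ->
  weights (D := D) L w -> supp (D := D) L w -> weights (D := D) F w' -> supp (D := D) F w' ->
  w (TS s (vdir s) (~~ a)) = 0 -> w' (TN (side_end s (vdir s) a b)) = w (TS s (vdir s) a) ->
  w' (TN (side_end s (~~ vdir s) b a)) = w (TS s (~~ vdir s) b) ->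
  retraction F (corner_class k s a b) w' = retraction L k w.
Proof.
move=> fk wL sw wF sF wa wv wh.
have L0 : L != fset0 by apply: tgood_neq0; constructor.
have fs : fcell L = Some (inr s).
  by apply: fcell_square => // t; rewrite /L => /square_toksP[d [c [-> _]]]; exists d, c.
have Fv t : t \in F -> at_vertex (corner_vertex s a b) t.
  by move=> tF; apply: corner_toks_at; move: tF; rewrite /F !inE => /orP[]/eqP ->; rewrite eqxx ?orbT.
have F0 : F != fset0 by apply/fset0Pn; exists (TN (side_end s (vdir s) a b)); rewrite /F !inE eqxx.
rewrite /retraction /khatL (radial_vertex w' F0 Fv) (KK_vertex _ w' F0 Fv) /radial /KK fs.
have [e1 e2] := corner_radP wL sw wF wa wv wh.
rewrite e1 (corner_khat k wL sw wF wa wv wh); congr (_, _, _).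
  by rewrite /radS lerp1.
by apply/funext => r; apply: corner_KS.
Qed.

(** Faces that keep their anchor only lose tokens of weight zero. The anchor moves for single edge
    ends and sides, and for the corner pairs of a square. *)
Lemma retraction_compat : token_compat (D := D) retraction.
Proof.
move=> L F k w w' gL fL F0 FL wL wF w0 ww w0'; rewrite /= in gL fL F FL F0 wF w0 ww w0' *.
have sL : supp (D := D) L w.
  by move=> t tL; apply: w0; apply: contra tL; exact: (fsubsetP (fproper_sub FL)).
have FLs : (F `<=` L)%fset by exact: fproper_sub.
have sub := fsubsetP FLs; have L0 := tgood_neq0 gL.
have sqL := tgood_squarish gL.
have single t : F = [fset t]%fset -> (forall v, t <> TV v) ->
    retraction (tcv F @` F)%fset (ttr F k) w' = retraction L k w.
  move=> FE nt; have tL : t \in L by apply: sub; rewrite FE inE.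
  have wt : w t = 1 by apply: (weights_single wL tL); rewrite -FE.
  rewrite FE imfset_fset1 tcv1 ttr1; apply: retraction_single => //.
  - by apply/eqP => LE; move: FL; rewrite FE -LE fproperEneq eqxx.
  - by have := ww t; rewrite FE tcv1 => ->; rewrite ?inE.
case: (cellP gL) => [v Lv|e LE|s o LE].
- have Fv t : t \in F -> at_vertex v t by move=> /sub/Lv.
  have [[p FE]|nF] := pselect (exists p, F = [fset TN p]%fset); first exact: (single (TN p)).
  have [_ e2 e3] := vertex_subset_face k Fv F0 (fun p E => nF (ex_intro _ p E)).
  have [E wE] := id_face e3 w0 ww w0'.
  rewrite E e2 wE /retraction /khatL (radial_vertex w F0 Fv) (radial_vertex w L0 Lv).
  rewrite (KK_vertex k w F0 Fv) (KK_vertex k w L0 Lv) (radP_sub v FLs wL w0).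
  by congr (_, _, _); apply/funext => r; apply: KP_sub.
- by have := fproper_ltn_card FL; rewrite LE cardfs1 ltnS leqn0 cardfs_eq0 (negbTE F0).
have sq F' : F' != fset0 -> (F' `<=` L)%fset -> fcell F' = Some (inr s).
  move=> F'0 /fsubsetP F'L; apply: fcell_square => // t /F'L.
  by rewrite LE => /square_toksP[d [b [-> _]]]; exists d, b.
(* The faces of a square simplex that are renamed trivially keep both their anchor and their
   label. *)
have ident : (forall t, t \in F -> tcv F t = t) -> ttr F k = k ->
    retraction (tcv F @` F)%fset (ttr F k) w' = retraction L k w.
  move=> e3 e2; have [E wE] := id_face e3 w0 ww w0'.
  by rewrite E e2 wE /retraction /khatL /radial /KK !sq.
have corner t t' a b : F = [fset t; t']%fset -> corner_pair t t' s (vdir s) a b ->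
    retraction (tcv F @` F)%fset (ttr F k) w' = retraction L k w.
  move=> FE cp; have [E1 E2 tt] := cv2_corner cp.
  have tL : t \in L by apply: sub; rewrite FE !inE eqxx.
  have t'L : t' \in L by apply: sub; rewrite FE !inE eqxx orbT.
  have [tE t'E] := cp.
  have oE : o = Some b.
    move: t'L; rewrite LE t'E => /square_toksP[d [c [E h]]]; case: E h => <- <-.
    by case: (vdir s) => //= /eqP.
  have fk : pfib x0 (sm s ctr) k by have := fL _ tL; rewrite tE.
  have imE : (tcv F @` F)%fset = [fset TN (side_end s (vdir s) a b); TN (side_end s (~~ vdir s) b a)]%fset.
    by rewrite FE imfset_fset2 tcv2 // tcv2r // E1 E2.
  have trE : ttr F k = corner_class k s a b.
    rewrite FE (ttr2 _ sqL tL t'L tt) tE t'E /= (_ : vdir s != ~~ vdir s) //; by case: (vdir s).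
  have c1E : tcv F t = TN (side_end s (vdir s) a b) by rewrite FE tcv2 // E1.
  have c2E : tcv F t' = TN (side_end s (~~ vdir s) b a) by rewrite FE tcv2r // E2.
  rewrite imE in wF w0' *; rewrite trE LE oE; rewrite LE oE in wL sL.
  apply: retraction_corner => //.
  + apply: w0; rewrite FE tE t'E !inE negb_or; apply/andP; split; apply/eqP => -[]; by [case: (a)|case: (vdir s)].
  + by rewrite -c1E ww ?tE // FE !inE tE eqxx.
  + by rewrite -c2E ww ?t'E // FE !inE t'E eqxx orbT.
case: (fset_cases F0) => [[t FE]|[t [t' [tt FE]]]|[t1 [t2 [t3 [h n12 n13 n23]]]]].
- apply: (single t FE) => v tv; have : t \in L by apply: sub; rewrite FE inE.
  by rewrite LE tv => /square_toksP[d [b []]].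
- have tL : t \in L by apply: sub; rewrite FE !inE eqxx.
  have t'L : t' \in L by apply: sub; rewrite FE !inE eqxx orbT.
  have [[s' [d [a [b cp]]]]|[e1 e2]] := pair_cases sqL tL t'L.
    have [tE t'E] := cp; have sE : s' = s.
      by move: (tL); rewrite LE tE => /square_toksP[? [? [[-> _ _] _]]].
    rewrite sE in cp tE t'E; have [dE|dE] : d = vdir s \/ d = ~~ vdir s.
        by case: (d); case: (vdir s); [left|right|right|left].
      by rewrite dE in cp; exact: (corner t t' a b FE cp).
    apply: (corner t' t b a); first by rewrite fsetUC.
    by rewrite /corner_pair tE t'E dE negbK.
  apply: ident => [u|].
    by rewrite FE !inE => /orP[]/eqP ->; rewrite ?tcv2 ?tcv2r.
  rewrite FE (ttr2 _ sqL tL t'L tt).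
  case: t t' e1 {tt FE tL t'L e2} => [[[v|e]|p]|[s1 [d b]]] [[[v'|e']|p']|[s' [d' b']]] //=.
  by case: ifP.
- apply: ident => [u _|]; first exact: (tcv3 _ h).
  exact: (ttr3 _ h).
Qed.

End Retraction.

(** All the paths issue from [y], so the square that they sweep out between [q] and [q'] has a
    constant bottom. *)
Lemma transport_square (R : realType) (T Q : topologicalType) (c : segments R Q)
    (f : Q * unit_interval R -> T) y q q' : continuous f -> (forall u, f (u, zero) = y) ->
  pcls (fun t => f (q', t)) = pmul (pcls (fun t => f (q, t))) (sg c (fun u => f (u, one)) q q').
Proof.
move=> cf f0.
pose F (p : unit_interval R * unit_interval R) := f (lerp c q q' p.1, p.2).
have cF : continuous F.
  apply: (continuous_compose _ cf); apply: continuous_pair; last exact: snd_continuous.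
  exact: (continuous_compose (@fst_continuous _ _) (@seg_cont _ _ c q q')).
have := square_pmul cF; rewrite /F /=.
have -> : (fun t : unit_interval R => f (lerp c q q' t, zero)) = fun=> f (q', zero).
  by apply/funext => t; rewrite !f0.
have cq : continuous (fun t => f (q', t)).
  apply: (continuous_compose (f := fun t : unit_interval R => (q', t)) _ cf).
  by apply: continuous_pair; [exact: cst_continuous|move=> t; exact: cvg_id].
by rewrite lerp1 lerp0 pmul1p.
Qed.

(** * Simple connectedness *)

Section SimplyConnected.
Variables (R : realType) (X : VH_complex) (x0 : square_realization R X).
Local Notation I := (unit_interval R).
Local Notation T := (square_realization R X).
Local Notation token := (token X).
Local Notation D := (tdata x0).
Local Notation Y := (token_complex D).
Local Notation Z := (simplicial_realization R Y).
Variable z0 : Z.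
Local Notation half := (clamp 2^-1 : I).
Local Notation ctr := (half, half).
Local Notation c1 := (unit_segments R).
Local Notation em := (@em R X).
Local Notation sm := (@sm R X).
Local Notation K := (set (I -> T)).
Local Notation pt := (@pt R D z0).
Local Notation radial := (radial x0).
Local Notation KK := (KK z0).
Local Notation retraction := (retraction z0).
Implicit Types (L F : {fset token}) (w : token -> R) (k : K).

(** The radial paths of one simplex all start at its anchor, where the label ends. *)
Lemma radial0 L : tgood L -> exists y : T,
  (forall k, tfib x0 L k -> pfib x0 y k) /\ forall w, radial L w zero = y.
Proof.
move=> gL; rewrite /radial; case: (cellP gL) => [v Lv|e LE|s o LE].
- exists (vp R v); split=> [k fL|w]; first exact: tfib_at fL.
  by apply: radP0 => p /Lv.
- by exists (em e half); split=> // k /(_ (TE e)); rewrite LE inE eqxx; exact.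
- exists (sm s ctr); split=> [k /(_ (TS s (vdir s) true))|w]; last by rewrite /radS lerp0.
  by apply; rewrite LE; apply/square_toksP; exists (vdir s), true; rewrite eqxx.
Qed.

Section Families.
Variables (S : topologicalType) (L : {fset token}) (w : S -> token -> R).
Hypotheses (gL : tgood L) (wL : forall x, weights (D := D) L (w x))
  (sL : forall x, supp (D := D) L (w x)) (cw : forall t, continuous (fun x => w x t)).

Lemma radial_cont : continuous (fun x : S * I => radial L (w x.1) x.2).
Proof.
rewrite /radial; case: (cellP gL) => [v Lv|e LE|s o LE].
- apply: radP_cont => //; last by move=> p /Lv.
  move=> x p q pL qL pq; apply: (@weights_pair R D L (w x) (TN p) (TN q) (wL x) pL qL).
  by apply: contraNneq pq => /TN_inj ->.
- exact: cst_continuous.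
- exact: radS_cont.
Qed.

Lemma KK_cont k : tfib x0 L k -> continuous (fun x : S * I => KK L k (w x.1) x.2).
Proof.
move=> fL; rewrite /KK; case: (cellP gL) => [v Lv|e LE|s o LE].
- exact: KP_cont.
- apply: (@pt_cont R D z0 (S * I)%type L k (fun x : S * I => w x.1)) => // t _.
  exact: (continuous_compose (@fst_continuous S I) (@cw t)).
- apply: KS_cont => //; move: fL => /(_ (TS s (vdir s) true)); apply.
  by rewrite LE; apply/square_toksP; exists (vdir s), true; rewrite eqxx.
Qed.

End Families.

Section Fixed.
Variables (L : {fset token}) (k : K) (w : token -> R).
Hypotheses (gL : tgood L) (fL : tfib x0 L k) (wL : weights (D := D) L w) (sL : supp (D := D) L w).

Lemma KK0 : KK L k w zero = pt L k w.
Proof.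
rewrite /KK; case: (cellP gL) => [v Lv|e LE|s o LE] //; first exact: KP0.
rewrite (@KS0 R X x0 z0 k s o w) -?LE //; move: fL => /(_ (TS s (vdir s) true)); apply.
by rewrite LE; apply/square_toksP; exists (vdir s), true; rewrite eqxx.
Qed.

Lemma KK1 : KK L k w one = Theta z0 (radial L w one) (khatL x0 L k w).
Proof.
rewrite /khatL /radial /KK; case: (cellP gL) => [v Lv|e LE|s o LE]; first exact: KP1.
- have fe : pfib x0 (em e half) k by move: fL => /(_ (TE e)); apply; rewrite LE inE.
  have w1 : w (TE e) = 1.
    by apply: (weights_single wL); [rewrite LE inE|move=> y; rewrite -LE; exact: sL].
  rewrite (pmul_const fe) (@theta_class R X x0 z0 k (edge_point e half)) //=.
  rewrite sg_id (pmul_const fe) (@phiE_half _ _ _ _ _ _ false half fe) ?phiEb_half ?val_half //.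
    by rewrite LE; apply: eq_pt => t; rewrite inE => /eqP ->.
  by rewrite /in_half val_half.
- apply: KS1; move: fL => /(_ (TS s (vdir s) true)); apply.
  by rewrite LE; apply/square_toksP; exists (vdir s), true; rewrite eqxx.
Qed.

Lemma khatL_fib : pfib x0 (radial L w one) (khatL x0 L k w).
Proof.
have [y [fy r0]] := radial0 gL; apply: pfib_mul (fy k fL) _.
exists (radial L w); split=> //.
have := @radial_cont I L (fun=> w) gL (fun=> wL).
have cc t : continuous (fun _ : I => w t) by exact: cst_continuous.
move=> /(_ cc) h; apply: (continuous_compose (f := fun r : I => (zero : I, r)) _ h).
by apply: continuous_pair; [exact: cst_continuous|move=> t; exact: cvg_id].
Qed.

End Fixed.

Let xi (z : Z) : T := (token_fun (D := D) retraction z).1.1.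
Let khat (z : Z) : K := (token_fun (D := D) retraction z).1.2.
Let KZ (z : Z) : I -> Z := (token_fun (D := D) retraction z).2.

Lemma tok_supp (s : tsimplex D) (p : simplex_space R (s : simplex Y)) :
  supp (toks s) (tok_weight p).
Proof. by move=> t; exact: tok_weight_out. Qed.

Lemma compat_comp (A B : Type) (g : A -> B) (G : {fset token} -> K -> (token -> R) -> A) :
  token_compat (D := D) G -> token_compat (D := D) (fun L k w => g (G L k w)).
Proof. by move=> cG L F k w w' *; congr g; exact: cG. Qed.

Lemma radial_one_cont (s : tsimplex D) :
  continuous (fun p : simplex_space R (s : simplex Y) => radial (toks s) (tok_weight p) one).
Proof.
have [gs fs] := tsimplexP s.
have h := @radial_cont _ (toks s)
  (fun p : simplex_space R (s : simplex Y) => tok_weight p) gs (fun p => @tok_weights R D s p)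
  (fun t => @tok_weight_cont R D s t).
apply: (continuous_compose (f := fun p : simplex_space R (s : simplex Y) => (p, one)) _ h).
by apply: continuous_pair; [move=> p; exact: cvg_id|exact: cst_continuous].
Qed.

(** Inside one simplex the label is fixed and only the radial path varies, so [transport_square]
    applies. *)
Lemma khat_transport (s : tsimplex D) (p q : simplex_space R (s : simplex Y)) :
  khatL x0 (toks s) (lab s) (tok_weight q) =
  pmul (khatL x0 (toks s) (lab s) (tok_weight p))
    (sg (simplex_segments R (s : simplex Y)) (fun u => radial (toks s) (tok_weight u) one) p q).
Proof.
have [gs fs] := tsimplexP s; have [y [fy r0]] := radial0 gs.
have h := @radial_cont _ (toks s)
  (fun p : simplex_space R (s : simplex Y) => tok_weight p) gs (fun p => @tok_weights R D s p)
  (fun t => @tok_weight_cont R D s t).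
rewrite /khatL -pmulA; congr pmul.
exact: (@transport_square R T _ (simplex_segments R (s : simplex Y)) _ y p q h (fun u => r0 _)).
Qed.

Lemma xi_cont : continuous xi.
Proof.
apply: (@token_fun_cont R D T (fun L k w => (retraction L k w).1.1)).
  exact: (compat_comp (fun a => a.1.1) (@retraction_compat R X x0 z0)).
exact: radial_one_cont.
Qed.

Lemma khat_fib z : pfib x0 (xi z) (khat z).
Proof.
rewrite /xi /khat /token_fun /token_lift; case: (repr z) => s p /=.
have [gs fs] := tsimplexP (s : tsimplex D).
by apply: khatL_fib => //; exact: tok_weights.
Qed.

Lemma khat_near a z : ch_dom (cell_chart R a) (xi z) -> \forall z' \near z,
  pmul (khat z') (pcls (ch_path (cell_chart R a) (xi z'))) =
  pmul (khat z) (pcls (ch_path (cell_chart R a) (xi z))).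
Proof.
set C := cell_chart R a => dz.
set A := pmul (khat z) _.
(* Membership in the chart belongs to [P], as the continuation to the centre is controlled only
   there. Inside a simplex this condition spreads to nearby points, and [token_fun_open] makes it
   open. *)
pose P (r : T * K * (I -> Z)) := ch_dom C r.1.1 /\ pmul r.1.2 (pcls (ch_path C r.1.1)) = A.
have oP : open [set z | P (token_fun (D := D) retraction z)].
  apply: token_fun_open; first exact: retraction_compat.
  move=> s p [dp Ap]; have := chart_near (simplex_segments R (s : simplex Y)) (@radial_one_cont s) dp.
  apply: filterS => q [dq hq]; split=> //=.
  by rewrite (khat_transport p q) -pmulA hq.
have Pz : P (token_fun (D := D) retraction z) by [].
have := open_nbhs_nbhs (conj oP Pz); apply: filterS => z' [_ h]; exact: h.
Qed.

Lemma KZ_cont (g : I -> Z) : continuous g -> continuous (fun p : I * I => KZ (g p.1) p.2).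
Proof.
apply: (@token_homotopy R D (fun L k w => (retraction L k w).2)).
  exact: (compat_comp (fun a => a.2) (@retraction_compat R X x0 z0)).
move=> s /=; have [gs fs] := tsimplexP s.
exact: (@KK_cont _ (toks s)
  (fun p : simplex_space R (s : simplex Y) => tok_weight p) gs (fun p => @tok_weights R D s p)
  (fun p => @tok_supp s p) (fun t => @tok_weight_cont R D s t)).
Qed.

Lemma KZ0 z : KZ z zero = z.
Proof.
rewrite -[RHS]glued_class_repr /KZ /token_fun /token_lift; case: (repr z) => s p /=.
have [gs fs] := tsimplexP (s : tsimplex D).
rewrite KK0 //; [|exact: tok_weights|exact: tok_supp].
by rewrite -pt_repr.
Qed.

Lemma KZ1 z : KZ z one = Theta z0 (xi z) (khat z).
Proof.
rewrite /KZ /xi /khat /token_fun /token_lift; case: (repr z) => s p /=.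
have [gs fs] := tsimplexP (s : tsimplex D).
by apply: KK1 => //; [exact: tok_weights|exact: tok_supp].
Qed.

Lemma token_complex_path (z z' : Z) : inhabited {path I from z to z'}.
Proof.
exact: (dominated_path (@cell_chart_cover R X) (@Theta_cont R X x0 z0) khat_fib KZ_cont KZ0 KZ1).
Qed.

Lemma token_complex_simply_connected : simply_connected R Z.
Proof.
exact: (dominated_simply_connected (@cell_chart_cover R X) (@Theta_cont R X x0 z0) xi_cont khat_fib
  khat_near KZ_cont KZ0 KZ1).
Qed.

End SimplyConnected.

Lemma set_type_compact (U : topologicalType) (A : set U) :
  compact A -> compact [set: set_type A].
Proof.
move=> cA F PF _.
have GA : (fmap (val : set_type A -> U) F) A.
  by apply: (@filterE _ F) => x; exact: (set_mem (valP x)).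
have [a [Aa cl]] := cA _ (fmap_proper_filter _ PF) GA.
exists (exist (fun x => x \in A) a (mem_set Aa)); split=> // B C FB.
rewrite nbhsE => -[O [[O' oO' OE] Oa] OC].
have FB' : (fmap (val : set_type A -> U) F) (val @` B).
  by apply: (@filterS _ F _ B) => // x Bx; exists x.
have O'a : O' a by move: Oa; rewrite -OE.
have [y [[b Bb <-] O'b]] := cl _ _ FB' (open_nbhs_nbhs (conj oO' O'a)).
by exists b; split=> //; apply: OC; rewrite -OE.
Qed.

(** * The action of the fundamental group *)

Section SimplexCompact.
Variables (R : realType) (A : finType).
Local Notation W := {ptws A -> R}.

Lemma ptws_eval_cont (x : A) : continuous (fun w : W => w x : R).
Proof. exact: (@proj_continuous A (fun=> R) x). Qed.

(** A closed subset of a cube, which is compact by Tychonoff's theorem. *)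
Lemma std_simplex_compact : compact (@std_simplex R A).
Proof.
have cs (l : seq A) : continuous (fun w : W => \sum_(x <- l) w x).
  elim: l => [|x l IH].
    have -> : (fun w : W => \sum_(x <- [::]) w x) = fun=> 0 by apply/funext => w; rewrite big_nil.
    exact: cst_continuous.
  have -> : (fun w : W => \sum_(x <- x :: l) w x) = fun w => w x + \sum_(x <- l) w x.
    by apply/funext => w; rewrite big_cons.
  by apply: contD => //; exact: ptws_eval_cont.
have c1 : closed [set w : W | \sum_x w x = 1].
  have := cs (index_enum A) => /continuous_closedP/(_ [set 1]); apply; exact: closed_eq.
have c0 : closed [set w : W | forall x, 0 <= w x].
  have -> : [set w : W | forall x, 0 <= w x] = \bigcap_(x in [set: A]) [set w : W | 0 <= w x].
    by apply/seteqP; split=> w h x; [move=> _; exact: h|exact: (h x Logic.I)].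
  apply: closed_bigI => x _.
  have := @ptws_eval_cont x => /continuous_closedP/(_ [set r | 0 <= r]); apply; exact: closed_ge.
apply: (@subclosed_compact _ _ [set w : W | forall x, `[0, 1]%classic (w x)]).
- exact: closedI.
- apply: (@tychonoff A (fun=> R) (fun=> `[0, 1]%classic)) => x; exact: segment_compact.
- move=> w [w0 w1] x /=; rewrite in_itv /= w0 -w1 (bigD1 x) //= lerDl.
  by apply: sumr_ge0 => y _.
Qed.

End SimplexCompact.

Lemma simplex_space_compact (R : realType) (Y : simplicial_complex) (s : simplex Y) :
  compact [set: simplex_space R s].
Proof. by apply: set_type_compact; exact: std_simplex_compact. Qed.

Lemma path_connected_space (R : realType) (Z : topologicalType) :
  (forall z z' : Z, inhabited {path unit_interval R from z to z'}) -> connected [set: Z].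
Proof.
move=> h; have [[z _]|n] := pselect ([set: Z] !=set0); last first.
  have -> : [set: Z] = set0 by apply/seteqP; split=> // z _; case: n; exists z.
  exact: connected0.
pose A (g : {z' & {path unit_interval R from z to z'}}) := projT2 g @` [set: unit_interval R].
have -> : [set: Z] = \bigcup_(g in setT) A g.
  apply/seteqP; split=> // z' _; have [g] := h z z'.
  by exists (existT _ z' g) => //; exists one => //; exact: path_one.
apply: bigcup_connected; first by exists z => -[z' g] _; exists zero => //; exact: path_zero.
move=> [z' g] _; apply: connected_continuous_connected; first exact: unit_connected.
by apply: continuous_subspaceT; exact: cts_fun.
Qed.

(** * Free and transitive action of loops on classes of paths *)

Section LoopAction.
Variables (R : realType) (T : topologicalType) (x0 : T).
Local Notation I := (unit_interval R).
Local Notation G := (pi1 R x0).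
Implicit Types (g h : G) (k : set (I -> T)).

Definition gcls g : set (I -> T) := pcls (repr g : I -> T).

Lemma gcls_loop (f : {path I from x0 to x0}) : gcls (loop_class f) = pcls f.
Proof. by apply: pclsE; apply: phmt_of_path; exact: repr_loop_class. Qed.

Lemma gcls_fib g : pfib x0 x0 (gcls g).
Proof.
by exists (repr g); split; [exact: cts_fun|exact: path_zero|exact: path_one|].
Qed.

Lemma gclsM g h : gcls (g * h)%g = pmul (gcls g) (gcls h).
Proof.
rewrite -[(g * h)%g]/(pi1_mul g h) /pi1_mul gcls_loop /gcls pmul_cls //; try exact: cts_fun.
by rewrite path_one path_zero.
Qed.

Lemma gcls1_mul y k : pfib x0 y k -> pmul (gcls 1%g) k = k.
Proof.
move=> [f [cf f0 f1 ->]]; rewrite -[1%g]/(pi1_one R x0) /pi1_one gcls_loop.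
by rewrite -[RHS]pmul1p // f0.
Qed.

Lemma gcls_inj g h : gcls g = gcls h -> g = h.
Proof.
move=> E; rewrite -[g]loop_class_repr -[h]loop_class_repr; apply/loop_classP/path_of_phmt.
by apply: pcls_inj => //; exact: cts_fun.
Qed.

Lemma gcls_cancel g y k y' k' : pfib x0 y k -> pfib x0 y' k' ->
  pmul (gcls g) k = pmul (gcls g) k' -> k = k'.
Proof.
move=> fk fk' /(congr1 (pmul (gcls g^-1%g))).
by rewrite !pmulA -gclsM mulVg (gcls1_mul fk) (gcls1_mul fk').
Qed.

(** Cancelling the path [f] leaves an equality of classes of loops. *)
Lemma gcls_free g h y k : pfib x0 y k -> pmul (gcls g) k = pmul (gcls h) k -> g = h.
Proof.
move=> [f [cf f0 f1 ->]] E; apply: gcls_inj.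
exact: (pfib_mulK (gcls_fib g) (gcls_fib h) cf f0).
Qed.

(** The loop runs out along the second path and back along the first. *)
Lemma gcls_trans y k k' : pfib x0 y k -> pfib x0 y k' -> exists g, pmul (gcls g) k = k'.
Proof.
move=> [f [cf f0 f1 ->]] [h [ch h0 h1 ->]].
have hf : h one = revp f zero by rewrite revp0 h1.
have cr := revp_cont cf.
have cc : continuous (pconc h (revp f)) by exact: pconc_cont.
have c0 : pconc h (revp f) zero = x0 by rewrite pconc0.
have c1 : pconc h (revp f) one = x0 by rewrite pconc1 revp1.
exists (loop_class (mk_path cc c0 c1)); rewrite gcls_loop /= -pmul_cls // -pmulA pmulVp //.
by rewrite f1 -h1 pmulp1.
Qed.

End LoopAction.

Section Action.
Variables (R : realType) (X : VH_complex) (x0 : square_realization R X).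
Local Notation I := (unit_interval R).
Local Notation T := (square_realization R X).
Local Notation token := (token X).
Local Notation D := (tdata x0).
Local Notation Y := (token_complex D).
Local Notation Z := (simplicial_realization R Y).
Local Notation G := (pi1 R x0).
Local Notation K := (set (I -> T)).
Implicit Types (g h : G) (s t : tsimplex D) (k A : K) (F L : {fset token}).

(** Loops multiply labels on the left and transports on the right, so [pmulA] makes the action
    commute with passing to faces. *)
Lemma ttr_mul F A k : ttr F (pmul A k) = pmul A (ttr F k).
Proof.
have tr1m (t : token) : tr1 t (pmul A k) = pmul A (tr1 t k).
  by case: t => [[[v|e]|p]|[s [d b]]] //=; rewrite pmulA.
rewrite /ttr; case: (enum_fset F) => [|t [|t' [|t'' l]]] //.
by case: t t' => [[[v|e]|p]|[s [d b]]] [[[v'|e']|p']|[s' [d' b']]] //=; case: ifP; rewrite ?pmulA.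
Qed.

Lemma lab_fib s : exists y, pfib x0 y (lab s).
Proof.
have [gs fs] := tsimplexP s; have /fset0Pn[t ts] := good_neq0 gs.
by exists (anchor R t); exact: fs.
Qed.

Lemma shift_subproof g s : tgood (toks s) /\ tfib x0 (toks s) (pmul (gcls g) (lab s)).
Proof.
have [gs fs] := tsimplexP s; split=> // t ts.
by apply: pfib_mul (gcls_fib g) _; exact: fs.
Qed.

Definition tshift g s : tsimplex D := mksim (D := D) (shift_subproof g s).

Lemma lab_shift g s : lab (tshift g s) = pmul (gcls g) (lab s).
Proof. by []. Qed.

Lemma shiftM g h s : tshift (g * h)%g s = tshift g (tshift h s).
Proof. by apply: tsimplex_eq => //; rewrite !lab_shift gclsM pmulA. Qed.

Lemma shift1 s : tshift 1%g s = s.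
Proof. by apply: tsimplex_eq => //; have [y fy] := lab_fib s; rewrite lab_shift (gcls1_mul fy). Qed.

Lemma shift_bij g : bijective (tshift g).
Proof. by exists (tshift g^-1%g) => s; rewrite -shiftM ?mulVg ?mulgV shift1. Qed.

(** The shift changes only the label, and [tverts] depends only on the tokens, so the identity is
    well typed. *)
Definition shift_vert g s (x : tverts s) : tverts (tshift g s) := x.

Lemma shift_vert_bij g s : bijective (@shift_vert g s).
Proof. by exists (fun x => x). Qed.

Lemma shift_attach g s t (f : {ffun tverts s -> tverts t})
    (f' : {ffun tverts (tshift g s) -> tverts (tshift g t)}) :
  (forall x, f' (shift_vert g x) = shift_vert g (f x)) -> (tattach f <-> tattach f').
Proof.
move=> ff; split=> -[F [F0 Ft sF lF fP]]; exists F; split=> //.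
- by rewrite !lab_shift lF -ttr_mul.
- by move=> x; rewrite (ff x); exact: fP.
- have [y fy] := lab_fib s; have [gt ft] := tsimplexP t.
  have /fset0Pn[u uF] := F0.
  have fu := tfib_face gt Ft F0 ft (in_imfset imfset_key (tcv F) uF).
  apply: (gcls_cancel (g := g) fy fu); rewrite -[LHS]/(lab (tshift g s)) lF lab_shift.
  exact: ttr_mul.
- by move=> x; have := fP (shift_vert g x); rewrite ff.
Qed.

Definition shift_aut g : simplicial_aut Y :=
  @SimplicialAut Y (tshift g) (@shift_vert g) (shift_bij g) (@shift_vert_bij g) (@shift_attach g).

Lemma vertex_eq (s t : tsimplex D) (x : tverts s) (y : tverts t) : s = t -> val x = val y ->
  existT (fun s : simplex Y => verts s : Type) s x = existT (fun s : simplex Y => verts s : Type) t y.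
Proof. by move=> st; subst t => xy; congr existT; exact: val_inj. Qed.

Lemma shift_act1 p : aut_vertex_map (shift_aut 1%g) p = p.
Proof. by case: p => s x; apply: vertex_eq => //; exact: shift1. Qed.

Lemma shift_actM g h p : aut_vertex_map (shift_aut (g * h)%g) p =
  aut_vertex_map (shift_aut g) (aut_vertex_map (shift_aut h) p).
Proof. by case: p => s x; apply: vertex_eq => //; exact: shiftM. Qed.

Definition shift_action : simplicial_action G Y :=
  @SimplicialAction G Y shift_aut shift_act1 shift_actM.

End Action.

(** * Properness and cocompactness *)

Section Geometry.
Variables (R : realType) (X : VH_complex) (x0 : square_realization R X).
Local Notation I := (unit_interval R).
Local Notation T := (square_realization R X).
Local Notation token := (token X).
Local Notation D := (tdata x0).
Local Notation Y := (token_complex D).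
Local Notation Z := (simplicial_realization R Y).
Local Notation cls := (glued_class (@simplicial_attach R Y)).
Local Notation G := (pi1 R x0).
Local Notation K := (set (I -> T)).
Local Notation half := (clamp 2^-1 : I).
Implicit Types (g h : G) (s : tsimplex D) (k : K) (F L : {fset token}).

Lemma token_realization_neq0 : [set: Z] !=set0.
Proof.
have [c cx] := cell_chart_cover x0.
have fk : pfib x0 (cell_ctr R c) (pcls (ch_path (cell_chart R c) x0)) := pfib_chart cx.
have mk (L : {fset token}) k (t : token) : tgood L -> tfib x0 L k -> t \in L -> [set: Z] !=set0.
  move=> gL fL tL; have hw : weights (R := R) (D := D) L (fun u : token => (u == t)%:R).
    split=> [u _|]; first by rewrite ler0n.
    rewrite (big_fsetD1 t) //= eqxx big_seq big1 ?addr0 // => u.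
    by rewrite !inE => /andP[/negbTE ->].
  have h : @good D L /\ @fib D L k by [].
  by exists (cls (simplex_point (@spt R D (mksim h) _ hw))).
case: c fk {cx} => [[v|e]|s] fk.
- apply: (mk [fset TV v]%fset _ (TV v) _ _ (fset11 _)) => [|t]; last by rewrite inE => /eqP ->; exact: fk.
  apply: (@GoodVertex X v).
  + by apply/fset0Pn; exists (TV v); rewrite inE.
  + by move=> t; rewrite inE => /eqP ->.
  + by move=> p p'; rewrite inE.
  + by move=> p /fsetP/(_ (TV v)); rewrite !inE eqxx.
- apply: (mk [fset TE e]%fset _ (TE e) _ _ (fset11 _)) => [|t]; last by rewrite inE => /eqP ->; exact: fk.
  by constructor.
- apply: (mk (square_toks s None) _ (TS s (vdir s) true)); first by constructor.
    by move=> t /square_toksP[d [b [-> _]]]; exact: fk.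
  by apply/square_toksP; exists (vdir s), true; rewrite eqxx.
Qed.

(* The vertices of the smallest face containing the point, as pairs (token, label). *)
Definition carrier L k (w : token -> R) : set (token * K) :=
  [set u | exists t, [/\ t \in L, 0 < w t & u = (cv1 t, tr1 t k)]].

(** By [tcv_tcv] and [ttr_ttr] a vertex gets the same final name and label from the face as from the
    simplex; tokens of positive weight lie in the face. *)
Lemma carrier_compat : token_compat (D := D) carrier.
Proof.
move=> L F k w w' gL fL F0 FL wL wF w0 ww w0'; rewrite /= in gL fL F FL F0 wF w0 ww w0' *.
have E t : t \in F -> (cv1 (tcv F t), tr1 (tcv F t) (ttr F k)) = (cv1 t, tr1 t k).
  move=> tF; have tF' : ([fset t] `<=` F)%fset by rewrite fsub1set.
  have t0 : [fset t]%fset != fset0 by apply/fset0Pn; exists t; rewrite inE.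
  have := tcv_tcv gL FL tF' t0 (fset11 t); rewrite imfset_fset1 !tcv1 => ->.
  by have := ttr_ttr gL FL tF' t0 fL; rewrite imfset_fset1 !ttr1 => ->.
apply/seteqP; split=> u [t [tL wt ->]].
  move/imfsetP: tL wt => [y /= yF ->] wt; exists y; rewrite E // -ww //.
  by split=> //; exact: (fsubsetP (fproper_sub FL)).
have tF : t \in F by apply: contraTT wt => /w0 ->; rewrite ltxx.
by exists (tcv F t); rewrite E // ww // in_imfset.
Qed.

(** The open star of the vertex of the complex given by the token and label [u]. *)
Definition ystar (u : token * K) : set Z := [set z | token_fun (D := D) carrier z u].

Lemma ystar_open u : open (ystar u).
Proof.
apply: (@token_fun_open R D _ carrier (fun A => A u) carrier_compat) => s p [t [ts wt uE]].
have := open_nbhs_nbhs (conj (@open_gt R 0) wt).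
move=> /(@tok_weight_cont R D s t p) h.
have h' : \forall q \near p, 0 < @tok_weight R D s q t by exact: h.
by near=> q; exists t; split=> //; near: q.
Unshelve. all: by end_near.
Qed.

Lemma ystar_cover z : exists u, ystar u z.
Proof.
rewrite /ystar /= /token_fun /token_lift; case: (repr z) => s p /=.
have [w0 w1] := @tok_weights R D s p.
have [t [ts wt]] : exists t, t \in toks (s : tsimplex D) /\ 0 < tok_weight p t.
  apply: contrapT => n; have := oner_neq0 R; rewrite -w1 big_seq big1 ?eqxx // => t ts.
  apply/eqP; rewrite eq_le w0 // andbT leNgt; apply/negP => wt; by apply: n; exists t.
by exists (cv1 t, tr1 t (lab (s : tsimplex D))); exists t.
Qed.

Lemma shift_weight g s (p : simplex_space R (s : simplex Y)) :
  @tok_weight R D (tshift g s) (affine_map (@shift_vert R X x0 g s) p) = tok_weight p.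
Proof.
apply/funext => t; have [ts|ts] := boolP (t \in toks s); last first.
  by rewrite (tok_weight_out p ts) (@tok_weight_out R D (tshift g s)).
rewrite -[t in RHS]/(val ([` ts]%fset : tverts s)) tok_weightE.
rewrite -[t in LHS]/(val ([` ts]%fset : tverts (tshift g s))) tok_weightE /= /affine_ext.
by rewrite (big_pred1 ([` ts]%fset : tverts s)).
Qed.

Local Notation act g := (@aut_realization R Y (shift_aut g)).

Lemma ystar_act g z u : ystar u z -> ystar (u.1, pmul (gcls g) u.2) (act g z).
Proof.
rewrite /ystar /= /aut_realization (token_fun_class _ carrier_compat).
rewrite {1}/token_fun; case: (repr z) => s p [t [ts wt ->]]; exists t.
by rewrite /= shift_weight; split=> //; congr (_, _); rewrite lab_shift; case: t {ts wt} => [[[v|e]|q]|[s' [d b]]] //=; rewrite pmulA.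
Qed.

Hypothesis cT : compact [set: T].

Lemma tokens_finite : finite_set [set: token].
Proof.
pose f (a : cell X * (bool * (bool * bool))) : token :=
  match a with
  | (inl (inl v), _) => TV v
  | (inl (inr e), (true, _)) => TE e
  | (inl (inr e), (false, (b, _))) => TN (e, b)
  | (inr s, (_, (d, b))) => TS s d b
  end.
have -> : [set: token] = f @` ([set: cell X] `*` [set: bool * (bool * bool)]).
  apply/seteqP; split=> // t _; case: t => [[[v|e]|[e b]]|[s [d b]]].
  - by exists (inl (inl v), (true, (true, true))).
  - by exists (inl (inr e), (true, (true, true))).
  - by exists (inl (inr e), (false, (b, true))).
  - by exists (inr s, (true, (d, b))).
apply: finite_image; apply: finite_setX; first exact: (cells_finite cT).
exact: finite_finset.
Qed.

Lemma finite_subsingleton (A : choiceType) (S : set A) : (forall a b, S a -> S b -> a = b) ->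
  finite_set S.
Proof.
move=> h; have [[a Sa]|n] := pselect (S !=set0).
  by apply: (@sub_finite_set _ _ [set a]) => // b Sb; exact: h.
by apply: (@sub_finite_set _ _ set0) => // b Sb; case: n; exists b.
Qed.

Lemma tr1_inj (t : token) k k' : pfib x0 (anchor R t) k -> pfib x0 (anchor R t) k' ->
  tr1 t k = tr1 t k' -> k = k'.
Proof.
move=> fk fk'; have [f [cf f0 f1 fE]] := tr1_path fk; rewrite !fE //.
exact: pfib_mulK fk fk' cf f0.
Qed.

Lemma tr1_fib (t : token) k : pfib x0 (anchor R t) k -> pfib x0 (anchor R (cv1 t)) (tr1 t k).
Proof.
move=> fk; have [f [cf f0 f1 fE]] := tr1_path fk; rewrite fE //.
by apply: pfib_mul fk _; exists f.
Qed.

(** A compact set is covered by finitely many vertex stars. If [g] moves a point of the star of [u]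
    into the star of [u'], then [g u] and [u'] lie in one simplex, and their tokens there leave at
    most one possibility for [g]. *)
Lemma shift_proper : proper_action R (shift_action x0).
Proof.
move=> C cC; have [|z _|N cov] := @compact_fin_cover Z C _ ystar cC; [exact: ystar_open|exact: ystar_cover|].
(* An index records the two stars and the tokens [t], [t'] that name [g u] and [u'] in the common
   simplex, whose label is [k]. *)
pose S (i : (token * K) * (token * K) * (token * token)) := [set g : G | exists L k,
  [/\ tfib x0 L k, i.2.1 \in L, i.2.2 \in L, i.1.2 = (cv1 i.2.2, tr1 i.2.2 k) &
      (exists y, pfib x0 y i.1.1.2) /\ (i.1.1.1, pmul (gcls g) i.1.1.2) = (cv1 i.2.1, tr1 i.2.1 k)]].
apply: (@sub_finite_set _ _ (\bigcup_(i in ([set` N] `*` [set` N]) `*` [set: token * token]) S i)).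
  move=> g [_ [[z Cz <-] Cgz]] /=.
  have [u uN zu] := cov z Cz; have [u' u'N gzu'] := cov _ Cgz.
  have gzu := ystar_act g zu.
  have [y fy] : exists y, pfib x0 y u.2.
    move: zu; rewrite /ystar /= /token_fun /token_lift; case: (repr z) => s p [t [ts _ ->]] /=.
    have [gs fs] := tsimplexP (s : tsimplex D).
    by exists (anchor R (cv1 t)); apply: tr1_fib; exact: fs.
  move: gzu gzu'; rewrite /ystar /= /token_fun /token_lift.
  case: (repr _) => s p /= [t [ts _ tE]] [t' [t's _ t'E]].
  have [gs fs] := tsimplexP (s : tsimplex D).
  exists ((u, u'), (t, t')) => //; exists (toks (s : tsimplex D)), (lab (s : tsimplex D)).
  by split=> //; split=> //; exists y.
apply: bigcup_finite; first by apply: finite_setX; [exact: finite_setX|rewrite -setXTT; apply: finite_setX; exact: tokens_finite].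
move=> [[u u'] [t t']] _; apply: finite_subsingleton => g h.
move=> [L [k [fL tL t'L /= uE' [[y fy] uE]]]] [L' [k' [fL' tL' t'L' /= vE' [_ vE]]]].
(* The label of the common simplex is determined by that of its vertex [u']; freeness then
   determines [g]. *)
have kk : k = k'.
  apply: (@tr1_inj t'); [exact: fL|exact: fL'|].
  by move: uE' vE' => -> [].
apply: (gcls_free fy); case: uE => _ ->; case: vE => _ ->; by rewrite kk.
Qed.

(** There are finitely many token sets, and loops act transitively on the labels of each, so one
    closed simplex for each token set suffices. *)
Lemma shift_cocompact : cocompact_action R (shift_action x0).
Proof.
have [F0 F0E] : exists F0 : {fset token}, forall t, t \in F0.
  have /finite_fsetP[F0 E] := tokens_finite; exists F0 => t.
  by have : [set: token] t by []; rewrite E.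
pose B (L : {fset token}) : set Z :=
  match pselect (exists s : tsimplex D, toks s = L) with
  | left h => (fun p : simplex_space R (projT1 (cid h) : simplex Y) => cls (simplex_point p)) @` setT
  | right _ => set0
  end.
exists (\big[setU/set0]_(L <- fpowerset F0) B L).
  apply: bigsetU_compact => L _; rewrite /B; case: pselect => [h|_]; last exact: compact0.
  apply: continuous_compact; last exact: simplex_space_compact.
  apply: continuous_subspaceT.
  apply: (continuous_compose _ (@glued_class_continuous _ _)).
  exact: (@existT_continuous _ (@simplex_space R Y) (projT1 (cid h))).
apply/seteqP; split=> // z _; rewrite -[z]glued_class_repr; case: (repr z) => s p.
have LF : toks (s : tsimplex D) \in fpowerset F0.
  by rewrite fpowersetE; apply/fsubsetP => t _; exact: F0E.
pose h : exists s' : tsimplex D, toks s' = toks (s : tsimplex D) := ex_intro _ s erefl.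
have [s' s'E BE] : exists2 s' : tsimplex D, toks s' = toks (s : tsimplex D) &
    forall p : simplex_space R (s' : simplex Y), B (toks (s : tsimplex D)) (cls (simplex_point p)).
  rewrite /B; case: pselect => [h'|/(_ h)] //; exists (projT1 (cid h')); first exact: (projT2 (cid h')).
  by move=> q; exists q.
have [gs fs] := tsimplexP (s : tsimplex D); have [gs' fs'] := tsimplexP s'.
have /fset0Pn[t ts] := good_neq0 gs.
have fk := fs _ ts; have fk' : pfib x0 (anchor R t) (lab s') by apply: fs'; rewrite s'E.
(* The chosen simplex [s'] has the tokens of [s] and differs from it only by its label, which a loop
   corrects. *)
have [g gE] := gcls_trans fk' fk.
have E : tshift g s' = s by apply: tsimplex_eq.
exists g => //; move: p LF BE; rewrite -E => p LF BE.
exists (cls (simplex_point (p : simplex_space R (s' : simplex Y)))).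
  by rewrite -bigcup_seq; exists (toks s') => //; exact: BE.
rewrite aut_realizationE /aut_point /=; congr (cls (simplex_point _)).
apply: val_inj; apply/funext => x; rewrite /= /affine_ext.
exact: (big_pred1 (x : tverts s')).
Qed.

End Geometry.

Theorem theorem1p6 (R : realType) (X : VH_complex)
    (x0 : square_realization R X) :
  compact [set: square_realization R X] ->
  connected [set: square_realization R X] ->
  nonpositively_curved X ->
  systolic_group R (pi1 R x0).
Proof.
move=> cX _ npc; exists (token_complex (tdata x0)); last first.
  by exists (shift_action x0); split; [exact: shift_proper|exact: shift_cocompact].
have [z0 _] := token_realization_neq0 x0; split.
- by exists z0.
- exact: path_connected_space (token_complex_path z0).
- exact: token_complex_simply_connected.
- exact: token_complex_6_large.
Qed.
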